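(* Let $h>0$ and, for each $N\in\mathbb N$, let $M^{[N,h]}$ be the Markov-modulated Ornstein-Uhlenbeck process obtained under the scaling $Q\mapsto NQ$, $\boldsymbol\alpha\mapsto N^h\boldsymbol\alpha$, $\boldsymbol\sigma\mapsto N^{h/2}\boldsymbol\sigma$ (with $\boldsymbol\gamma$ unscaled), i.e. the solution of $$\mathrm dM^{[N,h]}(t)=(N^h\boldsymbol\alpha-\boldsymbol\gamma M^{[N,h]}(t))^{\rm T}\boldsymbol Z^{[N]}(t)\,\mathrm dt+N^{h/2}\boldsymbol\sigma^{\rm T}\boldsymbol Z^{[N]}(t)\,\mathrm dB(t),\qquad M^{[N,h]}(0)=m_0,$$ where $m_0\in\mathbb R$ is a constant not depending on $N$. Put $\beta:=\max\{h/2,h-1/2\}$, $\varrho(t):=\frac{\alpha_\infty}{\gamma_\infty}(1-e^{-\gamma_\infty t})$, $\hat M^{[N,h]}(t):=N^{-\beta}(M^{[N,h]}(t)-N^h\varrho(t))$, and $$V(t):=\int_0^t(\boldsymbol\alpha-\boldsymbol\gamma\varrho(s))^{\rm T}\left(\mathrm{diag}\{\boldsymbol\pi\}D+D^{\rm T}\mathrm{diag}\{\boldsymbol\pi\}\right)(\boldsymbol\alpha-\boldsymbol\gamma\varrho(s))\,\mathrm ds .$$ Then, as $N\to\infty$, $\hat M^{[N,h]}$ converges weakly (at the process level) to the process $\mathscr M_2$ with $\mathscr M_2(0)=0$ defined by the following stochastic differential equation, with $B$ a standard Brownian motion: (i) if $0<h<1$: $\ \mathrm d\mathscr M_2(t)=-\gamma_\infty\mathscr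 M_2(t)\,\mathrm dt+\sigma_\infty\,\mathrm dB(t)$; (ii) if $h=1$: $\ \mathrm d\mathscr M_2(t)=-\gamma_\infty\mathscr M_2(t)\,\mathrm dt+\sqrt{\sigma_\infty^2+V'(t)}\,\mathrm dB(t)$; (iii) if $h>1$: $\ \mathrm d\mathscr M_2(t)=-\gamma_\infty\mathscr M_2(t)\,\mathrm dt+\sqrt{V'(t)}\,\mathrm dB(t)$.
   Context: $X$ is a continuous-time Markov chain on $\{1,\dots,d\}$ with generator $Q$ having a unique invariant distribution $\boldsymbol\pi$ (column vector, $\boldsymbol\pi^{\rm T}Q=\boldsymbol 0^{\rm T}$, $\mathbf 1^{\rm T}\boldsymbol\pi=1$). $D:=(\mathbf 1\boldsymbol\pi^{\rm T}-Q)^{-1}-\mathbf 1\boldsymbol\pi^{\rm T}$ is the deviation matrix of $Q$; equivalently $D=\int_0^\infty(e^{Qt}-\mathbf 1\boldsymbol\pi^{\rm T})\,\mathrm dt$. The parameter vectors are $\boldsymbol\alpha,\boldsymbol\gamma,\boldsymbol\sigma\in\mathbb R^d$ with $\gamma_i>0$ for all $i$; $\boldsymbol\sigma^2:=(\sigma_1^2,\dots,\sigma_d^2)^{\rm T}$. The time-averaged parameters are $\alpha_\infty:=\boldsymbol\pi^{\rm T}\boldsymbol\alpha$, $\gamma_\infty:=\boldsymbol\pi^{\rm T}\boldsymbol\gamma$, $\sigma_\infty^2:=\boldsymbol\pi^{\rm T}\boldsymbol\sigma^2$ ($\sigma_\infty\ge0$). $\boldsymbol Z^{[N]}(t)\in\{0,1\}^d$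 is the indicator vector of the sped-up chain $X^{[N]}$ (equivalently $X^{[N]}(t)=X(Nt)$), which has generator $NQ$ and initial law not depending on $N$: $Z^{[N]}_i(t)=1$ if $X^{[N]}(t)=i$ and $0$ otherwise. In the equation for $M^{[N,h]}$, $B$ is a standard Brownian motion independent of the chain. Weak convergence at the process level means convergence in distribution in the space of continuous paths on $[0,\infty)$ with the topology of uniform convergence on compacts. *)

(* Defs.v *)
From HB Require Import structures.
From mathcomp Require Import all_boot all_order all_algebra.
From mathcomp Require Import all_classical all_reals all_analysis.

Set Implicit Arguments.
Unset Strict Implicit.
Unset Printing Implicit Defensive.

Import Order.TTheory GRing.Theory Num.Theory.
Import numFieldNormedType.Exports.

Local Open Scope classical_set_scope.
Local Open Scope ring_scope.

Section FiniteGenerators.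
Context {R : realType} {d : nat}.
Implicit Types (Q A : 'M[R]_d) (p : 'cV[R]_d).

Definition dotv (u v : 'cV[R]_d) : R := (u^T *m v) 0 0.

Definition ones : 'cV[R]_d := const_mx 1.

Definition is_generator Q : Prop :=
  (forall i j, i != j -> 0 <= Q i j) /\ (forall i, \sum_j Q i j = 0).

Definition invariant_distribution Q p : Prop :=
  [/\ forall i, 0 <= p i 0, dotv ones p = 1 & p^T *m Q = 0].

Definition unique_invariant_distribution Q p : Prop :=
  invariant_distribution Q p /\
  forall p', invariant_distribution Q p' -> p' = p.

Definition deviation_matrix Q p : 'M[R]_d :=
  invmx (ones *m p^T - Q) - ones *m p^T.

Definition expmx A : 'M[R]_d :=
  \matrix_(i, j) limn (series (fun k => (A ^+ k) i j / k`!%:R)).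

End FiniteGenerators.

Section Processes.
Context {R : realType} {dO : measure_display} {Om : measurableType dO}.
Variable P : probability Om R.

(* Processes are indexed by all of R, but only times t >= 0 are ever used. *)

Definition filtration (F : R -> set (set Om)) : Prop :=
  [/\ forall t : R, 0 <= t -> sigma_algebra setT (F t),
      forall t : R, 0 <= t -> F t `<=` measurable &
      forall s t : R, 0 <= s -> s <= t -> F s `<=` F t].

Definition sigma_process {S : Type} (G : set (set S)) (Y : R -> Om -> S) :
    set (set Om) :=
  <<s \bigcup_(t in `[0, +oo[) preimage_set_system setT (Y t) G >>.

Definition adapted {S : Type} (G : set (set S)) (F : R -> set (set Om))
    (Y : R -> Om -> S) : Prop :=
  forall t : R, 0 <= t -> preimage_set_system setT (Y t) G `<=` F t.

Definition independent_processes {S1 S2 : Type}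
    (G1 : set (set S1)) (Y1 : R -> Om -> S1)
    (G2 : set (set S2)) (Y2 : R -> Om -> S2) : Prop :=
  forall E1 E2, sigma_process G1 Y1 E1 -> sigma_process G2 Y2 E2 ->
    P (E1 `&` E2) = (P E1 * P E2)%E.

Definition borelR : set (set R) := @measurable _ (measurableTypeR R).

Definition continuous_paths (Y : R -> Om -> R) : Prop :=
  forall w, {within `[0, +oo[, continuous (fun t => Y t w)}.

Definition brownian_motion (F : R -> set (set Om)) (B : R -> Om -> R) : Prop :=
  [/\ adapted borelR F B, continuous_paths B,
      {ae P, forall w, B 0 w = 0} &
      forall s t : R, 0 <= s -> s < t -> forall A, borelR A ->
        let E := [set w | A (B t w - B s w)] in
        P E = normal_prob 0 (Num.sqrt (t - s)) A /\
        forall G, F s G -> P (G `&` E) = (P G * P E)%E].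

Definition cadlag_states {d : nat} (x : R -> 'I_d) : Prop :=
  (forall t : R, 0 <= t -> \forall s \near t^'+, x s = x t) /\
  (forall t : R, 0 < t -> exists i, \forall s \near t^'-, x s = i).

(* The Markov property is the elementary one, conditioning on finitely many
   past times, with the conditional probability multiplied out. *)
Definition markov_chain {d : nat} (Q : 'M[R]_d) (p0 : 'cV[R]_d)
    (X : R -> Om -> 'I_d) : Prop :=
  [/\ forall (t : R) i, 0 <= t -> measurable (X t @^-1` [set i]),
      forall w, cadlag_states (fun t => X t w),
      forall i, P (X 0 @^-1` [set i]) = (p0 i 0)%:E &
      forall (n : nat) (t : nat -> R) (x : nat -> 'I_d),
        0 <= t 0%N -> (forall k, (k <= n)%N -> t k <= t k.+1) ->
        P [set w | forall k, (k <= n.+1)%N -> X (t k) w = x k] =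
        (P [set w | forall k, (k <= n)%N -> X (t k) w = x k] *
         (expmx ((t n.+1 - t n) *: Q) (x n) (x n.+1))%:E)%E].

(* The simple process sum_k xi_k 1_(t_k, t_(k+1)] on [0, T]. *)
Record simple_process (F : R -> set (set Om)) (T : R) := SimpleProcess {
  sp_size : nat;
  sp_time : nat -> R;
  sp_coef : nat -> Om -> R;
  sp_time_ge0 : 0 <= sp_time 0%N;
  sp_time_homo : forall k, (k < sp_size)%N -> sp_time k <= sp_time k.+1;
  sp_time_le : sp_time sp_size <= T;
  sp_coef_measurable : forall k, (k < sp_size)%N ->
    preimage_set_system setT (sp_coef k) borelR `<=` F (sp_time k);
  sp_coef_bounded : forall k, (k < sp_size)%N ->
    exists K, forall w, `|sp_coef k w| <= K }.

Definition sp_value F T (H : simple_process F T) (s : R) (w : Om) : R :=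
  \sum_(k < sp_size H)
    sp_coef H k w * (sp_time H k < s <= sp_time H k.+1)%R%:R.

Definition sp_integral F T (H : simple_process F T) (B : R -> Om -> R)
    (w : Om) : R :=
  \sum_(k < sp_size H)
    sp_coef H k w * (B (sp_time H k.+1) w - B (sp_time H k) w).

(* J is (a version of) the Ito integral of c over [0, T] with respect to the
   F-Brownian motion B, for c square integrable on [0, T] x Om: the L^2 limit
   of integrals of simple processes approximating c in L^2. *)
Definition ito_integral (F : R -> set (set Om)) (B : R -> Om -> R)
    (c : R -> Om -> R) (T : R) (J : Om -> R) : Prop :=
  measurable_fun setT J /\
  exists H : nat -> simple_process F T,
    ((\int[P]_w \int[lebesgue_measure]_(s in `[0%R, T])
       ((sp_value (H n) s w - c s w) ^+ 2)%:E)%E @[n --> \oo] --> 0%E) /\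
    ((\int[P]_w ((sp_integral (H n) B w - J w) ^+ 2)%:E)%E
       @[n --> \oo] --> 0%E).

(* dM(t) = b(t, w, M(t)) dt + c(t, w) dB(t), M(0) = m0. *)
Definition sde_solution (F : R -> set (set Om)) (B : R -> Om -> R)
    (b : R -> Om -> R -> R) (c : R -> Om -> R) (m0 : R) (M : R -> Om -> R) :
    Prop :=
  [/\ adapted borelR F M, continuous_paths M,
      {ae P, forall w, M 0 w = m0} &
      forall t : R, 0 <= t -> exists2 J, ito_integral F B c t J &
        {ae P, forall w,
          M t w = m0 + \int[lebesgue_measure]_(s in `[0, t]) b s w (M s w)
                  + J w}].

End Processes.

(* C[0, oo) with the topology of uniform convergence on compacts: all functions
   R -> R under uniform convergence on the compact subsets of [0, oo), which
   ignores negative times, restricted to those continuous on [0, oo). *)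
Notation path_space R :=
  {family compactly_in (`[0%R, +oo[%classic : set R), R -> R}.

Definition continuous_path_set (R : realType) : set (path_space R) :=
  [set x : R -> R | {within `[0, +oo[, continuous x}].

Definition cvg_in_law_paths (R : realType)
    (dO : nat -> measure_display) (Om : forall N, measurableType (dO N))
    (P : forall N, probability (Om N) R) (Y : forall N, R -> Om N -> R)
    (dO' : measure_display) (Om' : measurableType dO')
    (P' : probability Om' R) (Y' : R -> Om' -> R) : Prop :=
  forall Phi : path_space R -> R,
    {within @continuous_path_set R, continuous Phi} ->
    (exists K, forall x, continuous_path_set x -> `|Phi x| <= K) ->
    ('E_(P N)[fun w => Phi (fun t => Y N t w)])%E @[N --> \oo] -->
      ('E_P'[fun w => Phi (fun t => Y' t w)])%E.

Section ModulatedOU.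
Context {R : realType} {d : nat}.
Implicit Types (p alpha gamma sigma : 'cV[R]_d) (Q : 'M[R]_d).

Definition state_indicator (i : 'I_d) : 'cV[R]_d := delta_mx i 0.

Definition mmou_drift {Om : Type} (X : R -> Om -> 'I_d) alpha gamma
    (t : R) (w : Om) (m : R) : R :=
  dotv (alpha - m *: gamma) (state_indicator (X t w)).

Definition mmou_diffusion {Om : Type} (X : R -> Om -> 'I_d) sigma
    (t : R) (w : Om) : R :=
  dotv sigma (state_indicator (X t w)).

Definition mmou {dO} {Om : measurableType dO} (P : probability Om R)
    (F : R -> set (set Om)) (B : R -> Om -> R) (X : R -> Om -> 'I_d)
    alpha gamma sigma (m0 : R) (M : R -> Om -> R) : Prop :=
  sde_solution P F B (mmou_drift X alpha gamma) (mmou_diffusion X sigma) m0 M.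

Definition sigma_infty p sigma : R :=
  Num.sqrt (dotv p (map_mx (fun x => x ^+ 2) sigma)).

Definition varrho p alpha gamma (t : R) : R :=
  dotv p alpha / dotv p gamma * (1 - expR (- dotv p gamma * t)).

(* As the integration set `[0, t] is empty for t < 0, the two-sided derivative
   of Vfun may fail to exist at t = 0; it is the integrand at every t > 0. *)
Definition Vfun Q p alpha gamma (t : R) : R :=
  \int[lebesgue_measure]_(s in `[0, t])
    (let f := alpha - varrho p alpha gamma s *: gamma in
     let D := deviation_matrix Q p in
     dotv f ((diag_mx p^T *m D + D^T *m diag_mx p^T) *m f)).

Definition beta_exponent (h : R) : R := Num.max (h / 2) (h - 2^-1).

End ModulatedOU.

(* Main.v *)
Require Import Defs.
From HB Require Import structures.
From mathcomp Require Import all_boot all_order all_algebra.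
From mathcomp Require Import all_classical all_reals all_analysis.
From mathcomp Require Import measurable_realfun.
From mathcomp Require Import ring lra.

(* Proof idea. With f_s = alpha - gamma rho(s), the centred process y = Mhat
   satisfies y(t) = c_N + U(t) - int_0^t gamma_X y ds, where
   U(t) = N^(h - beta) int_0^t (f_s(X) - pi.f_s) ds + N^(-beta) J(t), J being
   the Ito integral of N^(h/2) sigma_X, and c_N = N^(-beta) m0 tends to 0.
   Replacing gamma_X by gamma_infty costs an error that vanishes uniformly in
   probability (Gronwall, and averaging of gamma_X over short blocks); then
   y + gamma_infty int y is a perturbation of U, and y is recovered from it by a
   continuous (Volterra) map.  So it suffices that U converges in law to the
   Gaussian martingale with variance rate r(t) = a v(t) + b sigma_infty^2, where
   v(t) = 2 pi.(f_t D f_t) = V'(t) and (a, b) = (0, 1), (1, 1), (1, 0) according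
   to h < 1, h = 1, h > 1.
   On a fine grid the Poisson equation Q (D f) = pi.f - f turns U, up to small
   boundary terms, into a discrete martingale whose conditional variances average
   to r.  Lindeberg's replacement trick then gives the limits of increments
   conditionally on the past, hence of finite-dimensional laws; fourth moments
   and dyadic chaining reduce path functionals to finitely many grid values.
   Tightness theorems are avoided: a bounded continuous functional is the
   increasing limit of its Lipschitz inf-convolutions. *)

Set Implicit Arguments.
Unset Strict Implicit.
Unset Printing Implicit Defensive.

Import Order.TTheory GRing.Theory Num.Theory.
Import numFieldNormedType.Exports.

Local Open Scope classical_set_scope.
Local Open Scope ring_scope.

(** * Expectations and sub-sigma-algebras *)

Section Expectation.
Context d (T : measurableType d) (R : realType) (P : probability T R).
Implicit Types f g : T -> R.

(** The data give the Ito integral only at fixed times and up to null sets, and the Taylor constant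
    of [expmx] at a given [N] grows with [N]. So the noise is defined pathwise from the continuous
    solution ([driving]), the integral is consulted at grid points only, and for each [N] the grid
    level is chosen after all constants ([approximable]); what must stay uniform in [N] is expressed
    through the scales [lam ^+ 2 * nu] and [kap ^+ 2], both at most 1. The Markov property concerns
    the chain's own past, while the filtration may be larger: the sigma-algebra [past] reconciles
    the two. Prelimit and limit laws are not compared with each other directly: block increments of
    both are compared with the same iterated Rademacher average, a number that depends on the
    limiting rate function but not on [N]. Square roots of rates enter only through squared
    differences, so rates may vanish. Path tails must hold on all time scales at once, although the
    martingale approximation is informative only on intervals longer than about [1 / N]; shorter
    ones get a separate deterministic bound on the drift. *)

Definition intg f : Prop := P.-integrable setT (EFin \o f).
Definition Ex f : R := \int[P]_w f w.

Lemma intg_meas f : intg f -> measurable_fun setT f.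
Proof. by move=> /integrableP[/measurable_EFinP]. Qed.

Lemma intg_bd f K : measurable_fun setT f -> (forall w, `|f w| <= K) -> intg f.
Proof.
move=> mf fK; apply: measurable_bounded_integrable => //.
  by rewrite (le_lt_trans (probability_le1 _ _))// ltry.
exists K; split; first exact: num_real.
by move=> M KM w _ /=; rewrite (le_trans (fK w))// ltW.
Qed.

Lemma intg_cst (k : R) : intg (fun=> k).
Proof. exact: (@intg_bd _ `|k|). Qed.

Lemma intgD f g : intg f -> intg g -> intg (fun w => f w + g w).
Proof.
move=> hf hg; have := integrableD measurableT hf hg.
by apply: eq_integrable => // w _.
Qed.

Lemma intgZ k f : intg f -> intg (fun w => k * f w).
Proof.
move=> hf; have := integrableZl measurableT k hf.
by apply: eq_integrable => // w _.
Qed.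

Lemma intgN f : intg f -> intg (fun w => - f w).
Proof.
move=> /(intgZ (-1)).
by apply: eq_integrable => // w _; rewrite /= mulN1r.
Qed.

Lemma intgB f g : intg f -> intg g -> intg (fun w => f w - g w).
Proof. by move=> hf hg; apply: intgD => //; exact: intgN. Qed.

Lemma intg_sum (I : Type) (s : seq I) (p : pred I) (F : I -> T -> R) :
  (forall i, intg (F i)) -> intg (fun w => \sum_(i <- s | p i) F i w).
Proof.
move=> h; elim: s => [|i s ih].
  by apply: (@eq_integrable _ _ _ _ _ _ (EFin \o (fun=> 0))) (intg_cst 0) => // w _ /=; rewrite big_nil.
have : intg (fun w => (if p i then F i w else 0) + \sum_(j <- s | p j) F j w).
  by apply: intgD => //; case: (p i) => //; exact: intg_cst.
apply: eq_integrable => // w _ /=; rewrite big_cons; case: (p i) => //.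
by rewrite add0r.
Qed.

Lemma intg_le f g : measurable_fun setT f -> intg g ->
  (forall w, `|f w| <= g w) -> intg f.
Proof.
move=> mf ig fg; apply: (le_integrable measurableT _ _ ig).
  exact/measurable_EFinP.
by move=> w _ /=; rewrite lee_fin (le_trans (fg w))// ler_norm.
Qed.

Lemma intg_abs f : intg f -> intg (fun w => `|f w|).
Proof.
move=> hf; apply: (@intg_le _ (fun w => `|f w|)).
- by apply: measurableT_comp => //; exact: intg_meas.
- exact: integrable_norm.
- by move=> w; rewrite normr_id.
Qed.

Lemma intg_eq f g : (forall w, f w = g w) -> intg f -> intg g.
Proof. by move=> fg; apply: eq_integrable => // w _ /=; rewrite fg. Qed.

Lemma intg_mulbd f g K : measurable_fun setT f -> (forall w, `|f w| <= K) ->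
  intg g -> intg (fun w => f w * g w).
Proof.
move=> mf fK ig; have mg := intg_meas ig.
apply: (@intg_le _ (fun w => K * `|g w|)).
- exact: measurable_funM.
- by apply: intgZ; exact: intg_abs.
- by move=> w; rewrite normrM ler_wpM2r.
Qed.

Lemma Ex_eq f g : (forall w, f w = g w) -> Ex f = Ex g.
Proof. by move=> fg; apply: eq_Rintegral => w _; exact: fg. Qed.

Lemma ExE f : intg f -> (Ex f)%:E = (\int[P]_w (f w)%:E)%E.
Proof. by move=> hf; rewrite /Ex /Rintegral fineK//; exact: integrable_fin_num. Qed.

Lemma Ex_cst (k : R) : Ex (fun=> k) = k.
Proof. transitivity (fine (k%:E * 1)%E); last by rewrite mule1.
by rewrite /Ex /Rintegral; congr fine; rewrite integral_cst//; congr (_ * _)%E; exact: probability_setT. Qed.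

Lemma ExD f g : intg f -> intg g -> Ex (fun w => f w + g w) = Ex f + Ex g.
Proof. by move=> *; exact: RintegralD. Qed.

Lemma ExB f g : intg f -> intg g -> Ex (fun w => f w - g w) = Ex f - Ex g.
Proof. by move=> *; exact: RintegralB. Qed.

Lemma ExZ k f : intg f -> Ex (fun w => k * f w) = k * Ex f.
Proof. by move=> *; exact: RintegralZl. Qed.

Lemma ExN f : intg f -> Ex (fun w => - f w) = - Ex f.
Proof.
by move=> hf; rewrite -mulN1r -ExZ//; apply: Ex_eq => w; rewrite mulN1r.
Qed.

Lemma Ex_sum (I : Type) (s : seq I) (p : pred I) (F : I -> T -> R) :
  (forall i, intg (F i)) ->
  Ex (fun w => \sum_(i <- s | p i) F i w) = \sum_(i <- s | p i) Ex (F i).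
Proof.
move=> h; elim: s => [|i s ih].
  by rewrite big_nil -[RHS](Ex_cst 0); apply: Ex_eq => w; rewrite big_nil.
rewrite big_cons -ih; case: ifPn => pi.
  rewrite -ExD//; last exact: intg_sum.
  by apply: Ex_eq => w; rewrite big_cons pi.
by apply: Ex_eq => w; rewrite big_cons (negbTE pi).
Qed.

Lemma Ex_le f g : intg f -> intg g -> (forall w, f w <= g w) -> Ex f <= Ex g.
Proof. by move=> *; exact: le_Rintegral. Qed.

Lemma Ex_ge0 f : (forall w, 0 <= f w) -> 0 <= Ex f.
Proof. by move=> f0; exact: Rintegral_ge0. Qed.

Lemma Ex_abs f : intg f -> `|Ex f| <= Ex (fun w => `|f w|).
Proof. by move=> *; exact: le_normr_Rintegral. Qed.

Lemma Ex_absle f g : intg f -> intg g -> (forall w, `|f w| <= g w) ->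
  `|Ex f| <= Ex g.
Proof.
move=> hf hg fg; apply: le_trans (Ex_abs hf) _.
by apply: Ex_le => //; exact: intg_abs.
Qed.

Lemma Ex_bd f K : intg f -> (forall w, `|f w| <= K) -> `|Ex f| <= K.
Proof.
by move=> hf fK; rewrite -(Ex_cst K); apply: Ex_absle => //; exact: intg_cst.
Qed.

(** The fourth power is the working integrability class: it is closed under sums, and products of up
    to four of its members are integrable ([intg_prod4]), which the expansion of the fourth moment
    of a martingale needs. *)
Definition L4 f := measurable_fun setT f /\ intg (fun w => f w ^+ 4).

Lemma L4_bd f K : measurable_fun setT f -> (forall w, `|f w| <= K) -> L4 f.
Proof.
move=> mf fK; split => //; apply: (@intg_bd _ (K ^+ 4)).
  exact: measurable_funX.
by move=> w; rewrite normrX lerXn2r// nnegrE// (le_trans _ (fK w)).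
Qed.

Lemma L4_cst k : L4 (fun=> k).
Proof. exact: (@L4_bd _ `|k|). Qed.

Lemma L4D f g : L4 f -> L4 g -> L4 (fun w => f w + g w).
Proof.
move=> [mf hf] [mg hg]; split; first exact: measurable_funD.
apply: (@intg_le _ (fun w => 8 * f w ^+ 4 + 8 * g w ^+ 4)).
- by apply: measurable_funX; exact: measurable_funD.
- by apply: intgD; exact: intgZ.
- move=> w; rewrite ger0_norm ?exprn_even_ge0//.
  (* [(x + y)^4 <= 8 x^4 + 8 y^4] is convexity; the squares below are the hints from which [nra]
     assembles it. *)
  move: (f w) (g w) => x y.
  have h1 := sqr_ge0 (x ^+ 2 - y ^+ 2); have h2 := sqr_ge0 (x * (x - y)).
  have h3 := sqr_ge0 (y * (x - y)); have h4 := sqr_ge0 ((x - y) ^+2).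
  nra.
Qed.

Lemma L4_mulbd f g K : measurable_fun setT f -> (forall w, `|f w| <= K) ->
  L4 g -> L4 (fun w => f w * g w).
Proof.
move=> mf fK [mg hg]; split; first exact: measurable_funM.
have h : intg (fun w => f w ^+ 4 * g w ^+ 4).
  apply: (@intg_mulbd _ _ (K ^+ 4)) => //; first exact: measurable_funX.
  by move=> w; rewrite normrX lerXn2r// nnegrE// (le_trans _ (fK w)).
by apply: intg_eq h => w; rewrite exprMn.
Qed.

Lemma L4Z k f : L4 f -> L4 (fun w => k * f w).
Proof. by apply: (@L4_mulbd _ _ `|k|). Qed.

Lemma L4_eq f g : (forall w, f w = g w) -> L4 f -> L4 g.
Proof. by move=> /funext ->. Qed.

Lemma L4_sum (I : Type) (s : seq I) (p : pred I) (F : I -> T -> R) :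
  (forall i, L4 (F i)) -> L4 (fun w => \sum_(i <- s | p i) F i w).
Proof.
move=> h; elim: s => [|i s ih].
  by apply: L4_eq (L4_cst 0) => w; rewrite big_nil.
have : L4 (fun w => (if p i then F i w else 0) + \sum_(j <- s | p j) F j w).
  by apply: L4D => //; case: (p i) => //; exact: L4_cst.
apply: L4_eq => w; rewrite big_cons; case: (p i) => //.
by rewrite add0r.
Qed.

Lemma intg_prod4 f1 f2 f3 f4 : L4 f1 -> L4 f2 -> L4 f3 -> L4 f4 ->
  intg (fun w => f1 w * f2 w * f3 w * f4 w).
Proof.
move=> [m1 h1] [m2 h2] [m3 h3] [m4 h4].
apply: (@intg_le _ (fun w => f1 w ^+ 4 + f2 w ^+ 4 + f3 w ^+ 4 + f4 w ^+ 4)).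
- by repeat apply: measurable_funM.
- by repeat apply: intgD.
move=> w; move: (f1 w) (f2 w) (f3 w) (f4 w) => a b c e.
have amgm (x y : R) : `|x * y| <= 2^-1 * (x ^+ 2 + y ^+ 2).
  rewrite ler_norml; have := sqr_ge0 (x - y); have := sqr_ge0 (x + y); nra.
have q (x y : R) : (x * y) ^+ 2 <= 2^-1 * (x ^+ 4 + y ^+ 4).
  have := sqr_ge0 (x ^+ 2 - y ^+ 2); nra.
rewrite -mulrA; apply: le_trans (amgm _ _) _.
have := q a b; have := q c e.
have := exprn_even_ge0 a (isT : ~~ odd 4); have := exprn_even_ge0 b (isT : ~~ odd 4).
have := exprn_even_ge0 c (isT : ~~ odd 4); have := exprn_even_ge0 e (isT : ~~ odd 4).
lra.
Qed.

Lemma L4_prod3 f1 f2 f3 : L4 f1 -> L4 f2 -> L4 f3 ->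
  intg (fun w => f1 w * f2 w * f3 w).
Proof.
move=> h1 h2 h3; have := intg_prod4 h1 h2 h3 (L4_cst 1).
by apply: intg_eq => w; rewrite mulr1.
Qed.

Lemma L4_prod2 f1 f2 : L4 f1 -> L4 f2 -> intg (fun w => f1 w * f2 w).
Proof.
move=> h1 h2; have := L4_prod3 h1 h2 (L4_cst 1).
by apply: intg_eq => w; rewrite mulr1.
Qed.

Lemma L4_intg f : L4 f -> intg f.
Proof.
move=> h1; have := L4_prod2 h1 (L4_cst 1).
by apply: intg_eq => w; rewrite mulr1.
Qed.

Lemma L4_intg2 f : L4 f -> intg (fun w => f w ^+ 2).
Proof. by move=> h; apply: intg_eq (L4_prod2 h h) => w; rewrite expr2. Qed.

Lemma L4_intg3 f : L4 f -> intg (fun w => f w ^+ 3).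
Proof. by move=> h; apply: intg_eq (L4_prod3 h h h) => w; ring. Qed.

Lemma Ex_markov4 f (c : R) : 0 < c -> L4 f ->
  (P [set w | (c <= `|f w|)%R] <= (c ^- 4 * Ex (fun w => f w ^+ 4))%:E)%E.
Proof.
move=> c0 [mf hf].
have mA : measurable [set w | c <= `|f w|].
  rewrite (_ : [set w | _] = (fun w => c <= `|f w|) @^-1` [set true])//.
  rewrite -[X in measurable X]setTI.
  apply: (measurable_fun_ler _ _) => //.
  by apply: measurableT_comp.
have i1 : intg (\1_[set w | c <= `|f w|]).
  by apply: (@intg_bd _ 1) => [|w]; [exact: measurable_indic|
    rewrite indicE; case: (_ \in _); rewrite ?normr1 ?normr0].
have -> : P [set w | (c <= `|f w|)%R] = (Ex \1_[set w | c <= `|f w|])%:E.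
  by rewrite ExE// integral_indic// setIT.
rewrite lee_fin -ExZ//.
apply: Ex_le => //; first exact: intgZ.
move=> w; rewrite indicE; have f0 := exprn_even_ge0 (f w) (isT : ~~ odd 4).
case: (boolP (w \in _)) => [|_] /=.
  rewrite inE /= => cf; rewrite mulrC ler_pdivlMr ?exprn_gt0// mul1r.
  by rewrite -[X in _ <= X]ger0_norm// normrX lerXn2r// nnegrE ltW.
by rewrite mulr_ge0// invr_ge0 exprn_ge0// ltW.
Qed.

End Expectation.

(** * Measurability with respect to a sub-sigma-algebra *)

Section SubSigmaAlgebra.
Context d (T : measurableType d) (R : realType).
Implicit Types (A B : set (set T)) (f g : T -> R).

(** Phrased through the generated sigma-algebra type, so that closure lemmas for measurable
    functions apply to any [A]; for a sigma-algebra [A] it is the preimage condition of [smeasP]. *)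
Definition smeas A f := @measurable_fun _ _ (g_sigma_algebraType A)
  (measurableTypeR R) setT f.

Lemma smeasP A f : sigma_algebra setT A ->
  smeas A f <-> forall E, borelR E -> A (f @^-1` E).
Proof.
move=> sA; rewrite /smeas /measurable_fun /=.
have -> : (measurable : set (set (g_sigma_algebraType A))) = A.
  exact: measurable_g_measurableTypeE.
split=> [h E mE|h _ E mE]; last by rewrite setTI; exact: h.
have AT : A setT by case: sA => A0 /(_ _ A0); rewrite setDE setC0 setIT.
by have := h AT E mE; rewrite setTI.
Qed.

Lemma smeas_sub A B f : A `<=` B -> smeas A f -> smeas B f.
Proof.
by move=> AB h mT E mE; apply: (sub_sigma_algebra2 AB); exact: h.
Qed.

Lemma smeas_meas A f : A `<=` measurable -> smeas A f -> measurable_fun setT f.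
Proof.
move=> Am h _ E mE.
have : <<s A >> `<=` @measurable _ T.
  by apply: smallest_sub => //; exact: sigma_algebra_measurable.
by apply; exact: h.
Qed.

End SubSigmaAlgebra.

Lemma maxBE (R : realType) (x : R) : x = Num.max x 0 - Num.max (- x) 0.
Proof. by case: (lerP x 0); case: (lerP (- x) 0) => ? ?; lra. Qed.

(** * From identities on events to identities with weights; independence *)

Section Transfer.
Context d (T : measurableType d) (R : realType) (P : probability T R).
Implicit Types (H f g : T -> R).
Local Notation Ex := (Ex P).
Local Notation intg := (intg P).

Lemma layer_cake (x : R) : 0 <= x ->
  (\int[lebesgue_measure]_(t in `[0%R, +oo[) ((t < x)%R%:R%:E : \bar R) = x%:E)%E.
Proof.
move=> x0.
transitivity (\int[lebesgue_measure]_(t in `[0%R, +oo[) ((\1_`[0%R, x[%classic t)%:E : \bar R))%E.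
  apply: eq_integral => t; rewrite inE/= in_itv/= andbT => t0.
  by rewrite indicE mem_setE in_itv/= t0.
rewrite integral_indic//= setIidl.
  rewrite lebesgue_measure_itv/= lte_fin.
  case: ltP => [//|xle]; first by rewrite oppr0 adde0.
  by congr EFin; apply/eqP; rewrite eq_le x0 xle.
by move=> t /=; rewrite !in_itv/= andbT => /andP[].
Qed.

(** [H] is the integral over [t >= 0] of the indicators of [t < H]; Tonelli then exchanges [t] and
    the measure. Any identity for the level sets of [H] becomes one for [H] itself. *)
Lemma layer_integral d' (T' : measurableType d')
    (mu : {sigma_finite_measure set T' -> \bar R}) (H h : T' -> R) :
  measurable_fun setT H -> measurable_fun setT h ->
  (forall w, 0 <= H w) -> (forall w, 0 <= h w) ->
  (\int[mu]_w (H w * h w)%:E = \int[lebesgue_measure]_t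
     ((0 <= t)%R%:R%:E * \int[mu]_w (h w * (t < H w)%R%:R)%:E))%E.
Proof.
move=> mH mh H0 h0.
transitivity (\int[mu]_w \int[lebesgue_measure]_t
    ((0 <= t)%R%:R * (h w * (t < H w)%R%:R))%:E)%E.
  apply: eq_integral => w _.
  rewrite mulrC EFinM -[in LHS](layer_cake (H0 w)).
  rewrite -ge0_integralZl//.
  - rewrite integral_mkcond; apply: eq_integral => t _.
    rewrite patchE mem_setE in_itv/= andbT; case: (0 <= t).
      by rewrite mul1r EFinM.
    by rewrite mul0r.
  - apply/measurable_EFinP; apply: measurable_funTS.
    apply: (@measurableT_comp _ _ _ _ _ _ (fun b : bool => b%:R : R)) => //.
    exact: measurable_fun_ltr.
  - by rewrite lee_fin.
have m2 : measurable_fun setT (fun z : T' * measurableTypeR R =>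
    ((0 <= z.2)%R%:R * (h z.1 * (z.2 < H z.1)%R%:R))%:E : \bar R).
  apply/measurable_EFinP; apply: measurable_funM.
    apply: (@measurableT_comp _ _ _ _ _ _ (fun b : bool => b%:R : R)) => //.
    by apply: measurable_fun_ler => //; exact: measurable_snd.
  apply: measurable_funM.
    by apply: measurableT_comp => //; exact: measurable_fst.
  apply: (@measurableT_comp _ _ _ _ _ _ (fun b : bool => b%:R : R)) => //.
  apply: measurable_fun_ltr; first exact: measurable_snd.
  by apply: measurableT_comp => //; exact: measurable_fst.
have := @fubini_tonelli _ _ T' (measurableTypeR R) R mu lebesgue_measure _ m2.
rewrite /fubini_F /fubini_G /= => ->; last first.
  by move=> z; rewrite lee_fin !mulr_ge0.
apply: eq_integral => t _; rewrite -ge0_integralZl//.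
- by apply/measurable_EFinP; apply: measurable_funM => //;
  apply: (@measurableT_comp _ _ _ _ _ _ (fun b : bool => b%:R : R)) => //;
  apply: measurable_fun_ltr.
- by move=> w _; rewrite lee_fin mulr_ge0.
Qed.

Lemma ge0_integral_transfer H f g : measurable_fun setT H ->
  measurable_fun setT f -> measurable_fun setT g ->
  (forall w, 0 <= H w) -> (forall w, 0 <= f w) -> (forall w, 0 <= g w) ->
  (forall t, \int[P]_w (f w * (t < H w)%R%:R)%:E =
             \int[P]_w (g w * (t < H w)%R%:R)%:E)%E ->
  (\int[P]_w (H w * f w)%:E = \int[P]_w (H w * g w)%:E)%E.
Proof.
move=> mH mf mg H0 f0 g0 fg.
rewrite (layer_integral P mH mf H0 f0) (layer_integral P mH mg H0 g0).
by apply: eq_integral => t _; rewrite fg.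
Qed.

(** Plays the part of conditional expectations: level sets of an [A]-measurable weight lie in [A],
    so the layer formula lifts an identity on events of [A] to nonnegative weights, and positive and
    negative parts give signed ones. *)
Lemma Ex_transfer A H f g : sigma_algebra setT A -> A `<=` measurable ->
  smeas A H -> (forall w, 0 <= f w) -> (forall w, 0 <= g w) ->
  intg f -> intg g -> intg (fun w => H w * f w) -> intg (fun w => H w * g w) ->
  (forall G, A G -> Ex (fun w => \1_G w * f w) = Ex (fun w => \1_G w * g w)) ->
  Ex (fun w => H w * f w) = Ex (fun w => H w * g w).
Proof.
move=> sA Am AH f0 g0 jf jg iHf iHg hG.
have mH := smeas_meas Am AH.
have ind (t : R) (K : T -> R) (mK : smeas A K) : A [set w | (t < K w)%R].
  have := (smeasP _ sA).1 mK `]t, +oo[%classic (measurable_itv _).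
  by rewrite (_ : K @^-1` _ = [set w | t < K w])//; apply/seteqP; split => w /=;
    rewrite in_itv/= andbT.
have pos K : smeas A K -> (forall w, 0 <= K w) ->
   intg (fun w => K w * f w) -> intg (fun w => K w * g w) ->
   Ex (fun w => K w * f w) = Ex (fun w => K w * g w).
  move=> mK K0 i1 i2; apply: EFin_inj; rewrite !ExE//.
  apply: ge0_integral_transfer => //; [exact: smeas_meas mK|exact: intg_meas jf
    |exact: intg_meas jg|].
  move=> t; have AG := ind t K mK.
  have mG := Am _ AG.
  have bdi : forall w, `|\1_[set w | (t < K w)%R] w : R| <= 1.
    by move=> w; rewrite indicE; case: (_ \in _); rewrite ?normr1 ?normr0.
  have : (Ex (fun w => \1_[set w | (t < K w)%R] w * f w))%:E =
         (Ex (fun w => \1_[set w | (t < K w)%R] w * g w))%:E by rewrite hG.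
  rewrite !ExE; [|by apply: intg_mulbd bdi _ => //; exact: measurable_indic..].
  have e (h : T -> R) w : (\1_[set w | (t < K w)%R] w * h w)%:E =
      (h w * (t < K w)%R%:R)%:E.
    by rewrite indicE mem_setE /= mulrC.
  by under eq_integral do rewrite e; under [in RHS]eq_integral do rewrite e.
pose Hp w := Num.max (H w) 0; pose Hn w := Num.max (- H w) 0.
have mHp : smeas A Hp.
  by apply: (@measurable_maxr _ (g_sigma_algebraType A)).
have mHn : smeas A Hn.
  apply: (@measurable_maxr _ (g_sigma_algebraType A)) => //.
  exact: (@measurable_funN _ (g_sigma_algebraType A)).
have HE w : H w = Hp w - Hn w.
  exact: maxBE.
have Hp0 w : 0 <= Hp w by rewrite le_max lexx orbT.
have Hn0 w : 0 <= Hn w by rewrite le_max lexx orbT.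
have bp w : Hp w <= `|H w| by rewrite ge_max ler_norm normr_ge0.
have bn w : Hn w <= `|H w| by rewrite ge_max -normrN ler_norm normr_ge0.
have ii K h : smeas A K -> (forall w, 0 <= K w) -> (forall w, K w <= `|H w|) ->
   (forall w, 0 <= h w) -> intg h -> intg (fun w => H w * h w) ->
   intg (fun w => K w * h w).
  move=> mK K0 KH h0 ih iHh; apply: (@intg_le _ _ _ _ _ (fun w => `|H w * h w|)).
  - by apply: measurable_funM; [exact: smeas_meas mK|exact: intg_meas ih].
  - exact: intg_abs.
  - by move=> w; rewrite !normrM (ger0_norm (K0 w)) ler_wpM2r.
have split h : (forall w, 0 <= h w) -> intg h -> intg (fun w => H w * h w) ->
   Ex (fun w => H w * h w) = Ex (fun w => Hp w * h w) - Ex (fun w => Hn w * h w).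
  move=> h0 ih iHh; rewrite -ExB; [|exact: ii..].
  by apply: Ex_eq => w; rewrite -mulrBl -HE.
by rewrite !split// !pos//; exact: ii.
Qed.

Lemma Ex_indic (G : set T) : measurable G -> (Ex \1_G)%:E = P G.
Proof.
move=> mG; rewrite ExE ?integral_indic ?setIT//.
apply: (@intg_bd _ _ _ _ _ 1) => [|w]; first exact: measurable_indic.
by rewrite indicE; case: (_ \in _); rewrite ?normr1 ?normr0.
Qed.

Lemma indic_le1 (G : set T) w : `|\1_G w : R| <= 1.
Proof. by rewrite indicE; case: (_ \in _); rewrite ?normr1 ?normr0. Qed.

Lemma intg_indicM (G : set T) f : measurable G -> intg f ->
  intg (fun w => \1_G w * f w).
Proof. by move=> mG; apply: intg_mulbd (indic_le1 G) => //; exact: measurable_indic. Qed.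

(** Two transfers: for a fixed event [G] of [A], from events of [Z] to functions of [Z] ([stepa]);
    then, for each part of [Z], from events [G] to the weight [H] ([stepb]). *)
Lemma Ex_indep A H Z : sigma_algebra setT A -> A `<=` measurable ->
  (forall G E, A G -> borelR E -> P (G `&` Z @^-1` E) = (P G * P (Z @^-1` E))%E) ->
  smeas A H -> intg H -> intg Z -> intg (fun w => H w * Z w) ->
  Ex (fun w => H w * Z w) = Ex H * Ex Z.
Proof.
move=> sA Am ind AH iH iZ iHZ.
have mH := intg_meas iH; have mZ := intg_meas iZ.
pose AZ := preimage_set_system setT Z (@borelR R).
have sAZ : sigma_algebra setT AZ.
  apply: sigma_algebra_preimage; exact: sigma_algebra_measurable.
have AZm : AZ `<=` measurable.
  by move=> _ [E mE <-]; exact: mZ.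
have stepa K : smeas AZ K -> intg K -> forall G, A G ->
    Ex (fun w => \1_G w * K w) = Ex \1_G * Ex K.
  move=> mK iK G AG; have mG := Am _ AG.
  transitivity (Ex (fun w => K w * Ex \1_G)).
    transitivity (Ex (fun w => K w * \1_G w)).
      by apply: Ex_eq => w; rewrite mulrC.
    have i1 : intg (\1_G).
      by apply: (@intg_bd _ _ _ _ _ 1 _ (indic_le1 G)); exact: measurable_indic.
    apply: (Ex_transfer sAZ AZm mK) => //.
    - by move=> w; exact: Ex_ge0.
    - exact: intg_cst.
    - by apply: intg_eq (intg_indicM mG iK) => w; rewrite mulrC.
    - by apply: intg_eq (intgZ (Ex \1_G) iK) => w; rewrite mulrC.
    move=> _ [E mE <-]; rewrite setTI.
    have mZE : measurable (Z @^-1` E) by rewrite -[X in measurable X]setTI; exact: mZ.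
    transitivity (Ex (\1_(G `&` Z @^-1` E))).
      by apply: Ex_eq => w; rewrite indicI mulrC.
    apply: EFin_inj; rewrite Ex_indic//; last exact: measurableI.
    rewrite ind// -!Ex_indic// -EFinM; congr EFin.
    rewrite -ExZ; last first.
      by apply: (@intg_bd _ _ _ _ _ 1 _ (indic_le1 _)); exact: measurable_indic.
    by apply: Ex_eq => w; rewrite mulrC.
  by rewrite -ExZ//; apply: Ex_eq => w; rewrite mulrC.
pose Zp w := Num.max (Z w) 0; pose Zn w := Num.max (- Z w) 0.
have mZ' : smeas AZ Z.
  by apply/smeasP => // E mE; exists E => //; rewrite setTI.
have mZp : smeas AZ Zp by apply: (@measurable_maxr _ (g_sigma_algebraType AZ)).
have mZn : smeas AZ Zn.
  apply: (@measurable_maxr _ (g_sigma_algebraType AZ)) => //.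
  exact: (@measurable_funN _ (g_sigma_algebraType AZ)).
have ZE w : Z w = Zp w - Zn w.
  exact: maxBE.
have Zp0 w : 0 <= Zp w by rewrite le_max lexx orbT.
have Zn0 w : 0 <= Zn w by rewrite le_max lexx orbT.
have bp w : Zp w <= `|Z w| by rewrite ge_max ler_norm normr_ge0.
have bn w : Zn w <= `|Z w| by rewrite ge_max -normrN ler_norm normr_ge0.
have ii K : smeas AZ K -> (forall w, 0 <= K w) -> (forall w, K w <= `|Z w|) ->
   intg K /\ intg (fun w => H w * K w).
  move=> mK K0 KZ; have mK' := smeas_meas AZm mK; split.
    apply: (@intg_le _ _ _ _ _ (fun w => `|Z w|)) => //; first exact: intg_abs.
    by move=> w; rewrite (ger0_norm (K0 w)).
  apply: (@intg_le _ _ _ _ _ (fun w => `|H w * Z w|)).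
  - exact: measurable_funM.
  - exact: intg_abs.
  - by move=> w; rewrite !normrM (ger0_norm (K0 w)) ler_wpM2l.
have stepb K : smeas AZ K -> (forall w, 0 <= K w) -> (forall w, K w <= `|Z w|) ->
   Ex (fun w => H w * K w) = Ex H * Ex K.
  move=> mK K0 KZ; have [iK iHK] := ii K mK K0 KZ.
  have eK0 : 0 <= Ex K by exact: Ex_ge0.
  rewrite mulrC -ExZ//.
  transitivity (Ex (fun w => H w * Ex K)); last by apply: Ex_eq => w; rewrite mulrC.
  apply: (Ex_transfer sA Am AH) => //.
  - exact: intg_cst.
  - by apply: intg_eq (intgZ (Ex K) iH) => w; rewrite mulrC.
  move=> G AG; rewrite (stepa K)// mulrC -ExZ; first by apply: Ex_eq => w; rewrite mulrC.
  apply: (@intg_bd _ _ _ _ _ 1 _ (indic_le1 _)); exact: measurable_indic (Am _ AG).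
have [ip ihp] := ii Zp mZp Zp0 bp; have [iN ihn] := ii Zn mZn Zn0 bn.
transitivity (Ex (fun w => H w * Zp w) - Ex (fun w => H w * Zn w)).
  by rewrite -ExB//; apply: Ex_eq => w; rewrite -mulrBr -ZE.
rewrite !stepb// -mulrBr; congr (_ * _).
by rewrite -ExB//; apply: Ex_eq => w; rewrite -ZE.
Qed.

End Transfer.

(** * Gaussian moments *)

Section FTC.
Context {R : realType}.
Local Notation mu := (@lebesgue_measure R).

Lemma continuous_intg_itv (f : R -> R) (a b : R) :
  {within `[a, b], continuous f} -> mu.-integrable `[a, b] (EFin \o f).
Proof. by move=> cf; apply: continuous_compact_integrable => //; exact: segment_compact. Qed.

Lemma is_derive_continuous (F f : R -> R) :
  (forall x : R, is_derive x (1 : R) F (f x)) -> continuous F.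
Proof.
by move=> dF x; apply/differentiable_continuous/derivable1_diffP; case: (dF x).
Qed.

Lemma FTC_is_derive (F f : R -> R) (a b : R) : a < b ->
  (forall x : R, is_derive x (1 : R) F (f x)) -> continuous f ->
  (\int[mu]_(x in `[a, b]) (f x)%:E = (F b)%:E - (F a)%:E)%E.
Proof.
move=> ab dF cf; have cF := is_derive_continuous dF.
apply: continuous_FTC2 => //.
- by apply: continuous_subspaceT.
- split; first by move=> x _; case: (dF x).
  + exact/cvg_at_right_filter/cF.
  + exact/cvg_at_left_filter/cF.
- by move=> x _; rewrite derive1E; case: (dF x).
Qed.

Lemma FTC_Rintegral (F f : R -> R) (a b : R) : a <= b ->
  (forall x : R, is_derive x (1 : R) F (f x)) -> continuous f ->
  \int[mu]_(x in `[a, b]) f x = F b - F a.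
Proof.
rewrite le_eqVlt => /predU1P[->|ab] dF cf.
  by rewrite subrr set_itv1 Rintegral_set1.
by rewrite /Rintegral (FTC_is_derive ab dF cf).
Qed.

End FTC.

Section GaussianMoments.
Context {R : realType} (s : R) (s0 : 0 < s).
Local Notation mu := (@lebesgue_measure R).
Local Notation phi := (normal_pdf 0 s).

Lemma normal_pdf_is_derive (x : R) : is_derive x 1 phi (- x / s ^+ 2 * phi x).
Proof.
have sn0 : s != 0 by rewrite gt_eqF.
rewrite normal_pdfE// /normal_fun.
have eE (y : R) : - (y - 0) ^+ 2 / (s ^+ 2 *+ 2) = (- (s ^+ 2 *+ 2)^-1) * y ^+ 2.
  by rewrite subr0 !mulNr; congr (- _); rewrite mulrC.
have -> : (fun y : R => normal_peak s * expR (- (y - 0) ^+ 2 / (s ^+ 2 *+ 2))) =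
  (fun y : R => normal_peak s * expR ((- (s ^+ 2 *+ 2)^-1) * y ^+ 2)).
  by apply/funext => y; rewrite eE.
rewrite eE; apply: is_derive_eq.
rewrite /GRing.scale/= !mulr1; set e := expR _.
by rewrite -mulr_natr; field.
Qed.

Lemma normal_pdf_even (x : R) : phi (- x) = phi x.
Proof.
by rewrite normal_pdfE ?gt_eqF// /normal_fun !subr0 sqrrN.
Qed.

Let cphi : continuous phi.
Proof. by apply: continuous_normal_pdf; rewrite gt_eqF. Qed.

(** With [y = x^2 / (2 s^2)], squaring [exp (y/2) >= y/2] gives [exp y >= y^2 / 4], and
    [16 s^4 (y^2 / 4) = x^4]. *)
Lemma normal_pdf_decay (x : R) : 0 < x -> x ^+ 4 * phi x <= 16 * s ^+ 4 * normal_peak s.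
Proof.
move=> x0; have sn0 : s != 0 by rewrite gt_eqF.
rewrite normal_pdfE// /normal_fun subr0 mulNr expRN.
set y := x ^+ 2 / _.
have y0 : 0 < y by rewrite divr_gt0 ?exprn_gt0// mulr2n addr_gt0// exprn_gt0.
have ey : y ^+ 2 / 4 <= expR y.
  have -> : expR y = expR (y / 2) ^+ 2 by rewrite expr2 -expRD; congr expR; field.
  rewrite (_ : _ / 4 = (y / 2) ^+ 2); last by field.
  have h0 : 0 <= y / 2 by rewrite divr_ge0// ltW.
  have h1 : y / 2 <= expR (y / 2) by have := expR_ge1Dx (y / 2); lra.
  by rewrite lerXn2r// nnegrE expR_ge0.
rewrite mulrCA [leRHS]mulrC ler_wpM2l ?normal_peak_ge0//.
rewrite ler_pdivrMr ?expR_gt0//.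
apply: le_trans (_ : 16 * s ^+ 4 * (y ^+ 2 / 4) <= _).
  by rewrite le_eqVlt; apply/orP; left; apply/eqP; rewrite /y -mulr_natr; field.
by rewrite ler_wpM2l// mulr_ge0// exprn_ge0// ltW.
Qed.

Let I (n : nat) : set R := `[- n.+1%:R, n.+1%:R]%classic.

Let bigsym : \bigcup_n I n = [set: R].
Proof.
apply/seteqP; split => // x _; exists (Num.truncn `|x|) => //=.
by rewrite /I/= in_itv/= -ler_norml ltW// truncnS_gt.
Qed.

Let cvg_int (f : R -> R) : continuous f -> (forall x, 0 <= f x) ->
  (\int[mu]_(x in I n) (f x)%:E)%E @[n --> \oo] -->
  (\int[mu]_x (f x)%:E)%E.
Proof.
move=> cf f0; rewrite -bigsym; apply: ge0_nondecreasing_set_cvg_integral.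
- move=> m n mn; apply/subsetPset => x; rewrite /I/= !in_itv/= => /andP[h1 h2].
  rewrite (le_trans _ h1) ?(le_trans h2)// ?lerN2 ler_nat//.
- by move=> n; exact: measurable_itv.
- by move=> n; apply/measurable_EFinP; apply: measurable_funTS;
    exact: continuous_measurable_fun.
- by move=> n x _; rewrite lee_fin.
Qed.

(** Integration by parts with [phi' = - x phi / s^2], on [[-(n+1), n+1]]. Even powers make both
    integrands nonnegative, so the truncated integrals converge monotonically, and [k <= 3] lets the
    fourth-power decay kill the boundary term. *)
Lemma normal_moment_step (k : nat) (c : R) : (k <= 3)%N -> ~~ odd k.+1 ->
  ((\int[mu]_x (x ^+ k.-1 * phi x)%:E)%E = c%:E) ->
  ((\int[mu]_x (x ^+ k.+1 * phi x)%:E)%E = (k%:R * s ^+ 2 * c)%:E).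
Proof.
move=> k3 ko hc.
have sn0 : s != 0 by rewrite gt_eqF.
have k0 : (0 < k)%N by move: ko; case: k {k3 hc}.
have ko' : ~~ odd k.-1 by move: ko; rewrite -(prednK k0) /= negbK.
have p0 x : 0 <= phi x by exact: normal_pdf_ge0.
have cX m : continuous (fun x : R => x ^+ m * phi x).
  by move=> x; apply: cvgM; [exact: exprn_continuous|exact: cphi].
have ev0 m (x : R) : ~~ odd m -> 0 <= x ^+ m * phi x.
  by move=> om; rewrite mulr_ge0// exprn_even_ge0.
have h1 := cvg_int (cX k.+1) (fun x => ev0 k.+1 x ko).
have h2 := cvg_int (cX k.-1) (fun x => ev0 k.-1 x ko').
(* Boundary term: [- s^2 x^k phi] takes opposite values at the two ends because [k] is odd and [phi]
   even, hence the factor 2. *)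
pose b n : R := - 2 * s ^+ 2 * (n.+1%:R ^+ k * phi n.+1%:R).
have id n : (\int[mu]_(x in I n) (x ^+ k.+1 * phi x)%:E =
   (b n)%:E + (k%:R * s ^+ 2)%:E *
   \int[mu]_(x in I n) (x ^+ k.-1 * phi x)%:E)%E.
  have ii m : mu.-integrable (I n) (EFin \o (fun x : R => x ^+ m * phi x)).
    by apply: continuous_intg_itv; exact: continuous_subspaceT.
  have ab : - n.+1%:R < n.+1%:R :> R by rewrite gtrN.
  rewrite -integralZl; [|exact: measurable_itv|exact: ii].
  have dF (x : R) : is_derive x (1 : R) (fun x => - s ^+ 2 * (x ^+ k * phi x))
      (x ^+ k.+1 * phi x - k%:R * s ^+ 2 * (x ^+ k.-1 * phi x)).
    have dphi := normal_pdf_is_derive x.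
    have dX : is_derive x (1 : R) (fun y : R => y ^+ k) (k%:R * x ^+ k.-1).
      have := @is_deriveX R R id k x 1 1 (is_derive_id x 1).
      by rewrite exprfctE /GRing.scale/= mulr1.
    by apply: is_derive_eq; rewrite /GRing.scale/= (exprS x k); field.
  have cF : continuous (fun x : R => x ^+ k.+1 * phi x - k%:R * s ^+ 2 * (x ^+ k.-1 * phi x)).
    move=> x; apply: cvgB; first exact: cX.
    by apply: cvgMr; exact: cX.
  have : (\int[mu]_(x in I n)
     (x ^+ k.+1 * phi x - k%:R * s ^+ 2 * (x ^+ k.-1 * phi x))%:E = (b n)%:E)%E.
    rewrite (FTC_is_derive ab dF cF).
    rewrite -EFinB; congr EFin; rewrite normal_pdf_even exprNn.
    rewrite -signr_odd (_ : odd k) /b; last by move: ko; rewrite /= negbK.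
    by rewrite expr1; ring.
  under [X in X = _ -> _]eq_integral do rewrite EFinB (EFinM (k%:R * s ^+ 2)).
  have mI : (@measurable _ (measurableTypeR R)) (I n) by exact: measurable_itv.
  have iZ := integrableZl mI (k%:R * s ^+ 2) (ii k.-1).
  rewrite integralB; [|exact: mI|exact: ii|exact: iZ].
  move=> <-; rewrite subeK//.
  by apply: integrable_fin_num iZ.
apply: (cvg_unique _ h1) => //=.
under eq_fun do rewrite id.
rewrite -(add0e (_ * c)%:E).
apply: cvgeD => //; last first.
  rewrite (EFinM _ c) -hc; apply: cvgeZl => //.
apply: cvg_EFin; first exact: nearW.
suff : b @ \oo --> (0 : R) by [].
rewrite -(mulr0 (- 2 * s ^+ 2)); apply: cvgMr.
apply: (@squeeze_cvgr _ _ _ _ (fun=> 0) (fun n => 16 * s ^+ 4 * normal_peak s * n.+1%:R^-1)).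
- apply: nearW => n; rewrite mulr_ge0 ?exprn_ge0//=.
  rewrite ler_pdivlMr// mulrC mulrA -exprS.
  apply: le_trans (normal_pdf_decay (_ : 0 < n.+1%:R)) => //.
  by rewrite ler_wpM2r// ler_weXn2l// ler1n.
- exact: cvg_cst.
- rewrite -[X in _ --> X](mulr0 (16 * s ^+ 4 * normal_peak s)); apply: cvgMr.
  exact: cvg_harmonic.
Qed.

Context d (T : measurableType d) (P : probability T R) (Z : T -> R).
Hypothesis mZ : measurable_fun setT Z.
Hypothesis lawZ : forall E, borelR E -> P (Z @^-1` E) = normal_prob 0 s E.

(** The layer formula on both sides: the law of [Z] is consulted only on the sets [t < H]. *)
Lemma gauss_integral (H : R -> R) : measurable_fun setT H -> (forall x, 0 <= H x) ->
  (\int[P]_w (H (Z w))%:E = \int[mu]_x (H x * phi x)%:E)%E.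
Proof.
move=> mH H0.
transitivity (\int[P]_w (H (Z w) * 1)%:E)%E.
  by apply: eq_integral => w _; rewrite mulr1.
rewrite (layer_integral P (measurableT_comp mH mZ) (measurable_cst (1 : R)) (fun w => H0 (Z w)) (fun=> ler01)).
rewrite (layer_integral mu mH (measurable_normal_pdf 0 s) H0 (@normal_pdf_ge0 _ 0 s)).
apply: eq_integral => t _; congr (_ * _)%E.
have mE : measurable [set x : R | t < H x].
  rewrite -[X in measurable X]setTI.
  by apply: (measurable_fun_ltr (measurable_cst t) mH).
transitivity (P (Z @^-1` [set x | t < H x])).
  rewrite -[X in P X]setIT -integral_indic//; last first.
    by rewrite -[X in measurable X]setTI; exact: mZ.
  apply: eq_integral => w _; rewrite mul1r indicE.
  by rewrite (_ : (w \in Z @^-1` _) = (t < H (Z w)))// mem_setE.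
rewrite lawZ// /normal_prob integral_mkcond; apply: eq_integral => x _.
rewrite patchE (_ : (x \in [set x0 : R | t < H x0]) = (t < H x)); last first.
  by apply/idP/idP; rewrite inE.
by case: (t < H x); rewrite ?mulr1 ?mulr0.
Qed.

Lemma gauss_moments : [/\ L4 P Z, Ex P Z = 0, Ex P (fun w => Z w ^+ 2) = s ^+ 2
  & Ex P (fun w => Z w ^+ 4) = 3 * s ^+ 4].
Proof.
have sn0 : s != 0 by rewrite gt_eqF.
have m0 : (\int[mu]_x (x ^+ 0 * phi x)%:E = 1%:E)%E.
  by under eq_integral do rewrite expr0 mul1r; exact: integral_normal_pdf.
have m2 := @normal_moment_step 1 1 isT isT m0.
have m4 := @normal_moment_step 3 _ isT isT m2.
have e2 : (\int[P]_w (Z w ^+ 2)%:E = (s ^+ 2)%:E)%E.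
  rewrite (@gauss_integral (fun x => x ^+ 2))//; last by move=> x; exact: sqr_ge0.
  by rewrite m2 mul1r mulr1.
have e4 : (\int[P]_w (Z w ^+ 4)%:E = (3 * s ^+ 4)%:E)%E.
  rewrite (@gauss_integral (fun x => x ^+ 4))//; last by move=> x; rewrite exprn_even_ge0.
  by rewrite m4; congr EFin; ring.
have L : L4 P Z.
  split => //; apply/integrableP; split.
    by apply/measurable_EFinP; exact: measurable_funX.
  under eq_integral do rewrite /= ger0_norm ?exprn_even_ge0//.
  by rewrite e4 ltry.
split => //.
(* Zero mean: the integrals of the positive and negative parts agree, by the reflection [x -> - x],
   which preserves Lebesgue measure and the density. *)
- have mm : measurable_fun setT (fun x : R => Num.max x 0) by exact: measurable_maxr.
  have mn : measurable_fun setT (fun x : R => Num.max (- x) 0) by exact: measurable_maxr.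
  have iZ := L4_intg L.
  have ip : intg P (fun w => Num.max (Z w) 0).
    apply: (@intg_le _ _ _ _ _ (fun w => `|Z w|)); last 1 first.
    - by move=> w; rewrite ger0_norm ?le_max ?lexx ?orbT// ge_max ler_norm normr_ge0.
    - exact: measurableT_comp mm mZ.
    - exact: intg_abs.
  have iN : intg P (fun w => Num.max (- Z w) 0).
    apply: (@intg_le _ _ _ _ _ (fun w => `|Z w|)); last 1 first.
    - by move=> w; rewrite ger0_norm ?le_max ?lexx ?orbT// ge_max -normrN ler_norm normr_ge0.
    - exact: measurableT_comp mn mZ.
    - exact: intg_abs.
  rewrite (@Ex_eq _ _ _ P _ (fun w => Num.max (Z w) 0 - Num.max (- Z w) 0)); last first.
    by move=> w; exact: maxBE.
  rewrite ExB//; apply/eqP; rewrite subr_eq0; apply/eqP/EFin_inj.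
  rewrite !ExE// (@gauss_integral (fun x => Num.max x 0))//; last first.
    by move=> x; rewrite le_max lexx orbT.
  rewrite (@gauss_integral (fun x => Num.max (- x) 0))//; last first.
    by move=> x; rewrite le_max lexx orbT.
  pose g (x : R) : \bar R := (Num.max x 0 * phi x)%:E.
  change (\int[mu]_x g x = \int[mu]_x (Num.max (- x) 0 * phi x)%:E)%E.
  transitivity (\int[mu]_x g (- x)%R)%E; last first.
    by apply: eq_integral => x _; rewrite /g normal_pdf_even.
  have mg : measurable_fun setT g.
    apply/measurable_EFinP; apply: measurable_funM => //; exact: measurable_normal_pdf.
  transitivity (\int[pushforward mu (-%R : _ -> measurableTypeR R)]_x g x)%E.
    by apply: eq_measure_integral => //= A mA _; exact/esym/lebesgue_measureN.
  rewrite ge0_integral_pushforward//= => x _; rewrite lee_fin mulr_ge0 ?le_max ?lexx ?orbT//; exact: normal_pdf_ge0.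
- by apply: EFin_inj; rewrite ExE//; exact: L4_intg2.
- by apply: EFin_inj; rewrite ExE//; case: L.
Qed.

End GaussianMoments.

(** * Generator and deviation matrix *)

Section GeneratorAlgebra.
Context {R : realType} {d : nat}.
Implicit Types (Q A : 'M[R]_d) (p : 'cV[R]_d) (f g : 'I_d -> R).

Definition mop A f (i : 'I_d) : R := \sum_j A i j * f j.
Definition pav p f : R := \sum_i p i 0 * f i.
(** For a generator this is [Q f^2 - 2 f Q f] ([carre_du_champE]), twice the usual square-field
    operator: the rate at which the martingale part of [f] along the chain gains conditional
    variance. *)
Definition carre_du_champ Q f (i : 'I_d) : R := \sum_j Q i j * (f j - f i) ^+ 2.

Lemma invariant_distributionP Q p : invariant_distribution Q p <->
  [/\ forall i, 0 <= p i 0, \sum_i p i 0 = 1 &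
      forall j, \sum_i p i 0 * Q i j = 0].
Proof.
have e1 : dotv ones p = \sum_i p i 0.
  by rewrite /dotv mxE; apply: eq_bigr => i _; rewrite !mxE mul1r.
have e2 j : (p^T *m Q) 0 j = \sum_i p i 0 * Q i j.
  by rewrite mxE; apply: eq_bigr => i _; rewrite !mxE.
split=> [[h1 h2 h3]|[h1 h2 h3]]; split => //.
- by rewrite -e1.
- by move=> j; rewrite -e2 h3 mxE.
- by rewrite e1.
- by apply/rowP => j; rewrite e2 h3 mxE.
Qed.

(** Nonnegative off-diagonal entries and the triangle inequality make every entry of [|v| Q]
    nonnegative; zero row sums make these entries add up to 0. *)
Lemma generator_kernel_abs Q (v : 'I_d -> R) : is_generator Q ->
  (forall j, \sum_i v i * Q i j = 0) -> forall j, \sum_i `|v i| * Q i j = 0.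
Proof.
move=> [Qoff Qrow] vQ.
have Qd j : Q j j <= 0.
  have := Qrow j; rewrite (bigD1 j)//= => /eqP; rewrite addr_eq0 => /eqP ->.
  by rewrite oppr_le0 sumr_ge0// => i ij; rewrite Qoff// eq_sym.
have ge0 j : 0 <= \sum_i `|v i| * Q i j.
  rewrite (bigD1 j)//=.
  have := vQ j; rewrite (bigD1 j)//= => /eqP; rewrite addr_eq0 => /eqP e.
  have -> : `|v j| * Q j j = - `|v j * Q j j| by rewrite normrM (ler0_norm (Qd j)) mulrN opprK.
  rewrite e normrN addrC subr_ge0; apply: le_trans (ler_norm_sum _ _ _) _.
  by apply: ler_sum => i ij; rewrite normrM (ger0_norm (Qoff _ _ ij)).
have s0 : \sum_j \sum_i `|v i| * Q i j = 0.
  rewrite exchange_big/= big1// => i _.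
  by rewrite -mulr_sumr Qrow mulr0.
move=> j; apply/eqP; move/eqP: s0; rewrite psumr_eq0//.
by move/allP => /(_ j); rewrite mem_index_enum => /(_ isT).
Qed.

(** A left null vector [v] has total mass 0 (multiply by [ones]), hence [v Q = 0]. Then [|v|] and
    [|v| + v] are nonnegative null vectors of [Q] with the same mass, both equal to that mass times
    [p] by uniqueness, so [v = 0]. *)
Lemma deviation_unit Q p : is_generator Q -> unique_invariant_distribution Q p ->
  ones *m p^T - Q \in unitmx.
Proof.
move=> gQ [/invariant_distributionP[p0 p1 pQ] uni].
rewrite unitmxE unitfE; apply/negP => /det0P[v v0 vA].
have e j : (\sum_i v 0 i) * p j 0 = \sum_i v 0 i * Q i j.
  have := congr1 (fun M : 'rV_d => M 0 j) vA.
  rewrite mulmxBr mulmxA !mxE => /eqP; rewrite subr_eq0 => /eqP <-.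
  rewrite big_ord1 !mxE; congr (_ * _).
  by apply: eq_bigr => i _; rewrite !mxE mulr1.
have sv : \sum_i v 0 i = 0.
  have : \sum_j (\sum_i v 0 i) * p j 0 = \sum_j \sum_i v 0 i * Q i j.
    by apply: eq_bigr => j _; exact: e.
  rewrite -mulr_sumr p1 mulr1 => ->; rewrite exchange_big/= big1// => i _.
  by rewrite -mulr_sumr gQ.2 mulr0.
have vQ j : \sum_i v 0 i * Q i j = 0 by rewrite -e sv mul0r.
have uQ := generator_kernel_abs gQ vQ.
pose s := \sum_i `|v 0 i|.
have s0 : 0 < s.
  rewrite lt_neqAle sumr_ge0// andbT eq_sym; apply: contra v0.
  rewrite psumr_eq0// => /allP h; apply/eqP/rowP => j; rewrite mxE.
  by have := h j; rewrite mem_index_enum => /(_ isT); rewrite normr_eq0 => /eqP.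
have norm (u : 'I_d -> R) : (forall i, 0 <= u i) -> \sum_i u i = s ->
   (forall j, \sum_i u i * Q i j = 0) -> forall i, u i = s * p i 0.
  move=> u0 us uQ0 i.
  have /uni <- : invariant_distribution Q (\col_i (u i / s)).
    apply/invariant_distributionP; split.
    - by move=> k; rewrite mxE divr_ge0// ltW.
    - under eq_bigr do rewrite mxE.
      by rewrite -mulr_suml us divff// gt_eqF.
    - move=> j; under eq_bigr do rewrite mxE mulrAC.
      by rewrite -mulr_suml uQ0 mul0r.
  by rewrite mxE mulrC divfK// gt_eqF.
have u1 := norm _ (fun i => normr_ge0 (v 0 i)) erefl uQ.
have u2 : forall i, `|v 0 i| + v 0 i = s * p i 0.
  apply: norm.
  - by move=> i; rewrite -lerBlDr sub0r -normrN ler_norm.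
  - by rewrite big_split/= sv addr0.
  - move=> j; under eq_bigr do rewrite mulrDl.
    by rewrite big_split/= uQ vQ addr0.
move/negP: v0; apply; apply/eqP/rowP => i; rewrite mxE.
by have := u2 i; rewrite -u1; lra.
Qed.

Section Poisson.
Variables (Q : 'M[R]_d) (p : 'cV[R]_d).
Hypotheses (gQ : is_generator Q) (up : unique_invariant_distribution Q p).
Local Notation D := (deviation_matrix Q p).
Let ip : invariant_distribution Q p := up.1.


Let pT1 : p^T *m ones = 1%:M.
Proof.
have /invariant_distributionP[_ h _] := ip.
apply/matrixP => i j; rewrite !ord1 !mxE/= -h.
by apply: eq_bigr => k _; rewrite !mxE mulr1.
Qed.

Let Q1 : Q *m ones = 0.
Proof.
apply/matrixP => i j; rewrite !mxE -[RHS](gQ.2 i).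
by apply: eq_bigr => k _; rewrite !mxE mulr1.
Qed.

Let A := ones *m p^T - Q.
Let uA : A \in unitmx. Proof. exact: deviation_unit. Qed.

Let pTA : p^T *m invmx A = p^T.
Proof.
have [_ _ pQ] := ip.
have e : p^T *m A = p^T by rewrite mulmxBr mulmxA pT1 mul1mx pQ subr0.
by rewrite -[in LHS]e -mulmxA mulmxV// mulmx1.
Qed.

Let QD : Q *m D = ones *m p^T - 1%:M.
Proof.
rewrite /deviation_matrix -/A mulmxBr mulmxA Q1 mul0mx subr0.
have -> : Q = ones *m p^T - A by rewrite /A opprB addrC subrK.
by rewrite mulmxBl mulmxV// -mulmxA pTA.
Qed.

Let mopE B f i : mop B f i = (B *m \col_j f j) i 0.
Proof. by rewrite mxE; apply: eq_bigr => j _; rewrite mxE. Qed.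

Let mop_col B f : \col_j mop B f j = B *m \col_j f j.
Proof. by apply/colP => i; rewrite mxE mopE. Qed.

Let pavE f : pav p f = (p^T *m \col_j f j) 0 0.
Proof. by rewrite mxE; apply: eq_bigr => j _; rewrite !mxE. Qed.

(** In matrix form [Q D = ones p^T - I], since [Q] kills [ones] and the inverse of [ones p^T - Q]
    fixes [p^T] on the left. This is what turns time integrals along the chain into martingales. *)
Lemma poisson_equation f i : mop Q (mop D f) i = pav p f - f i.
Proof.
rewrite mopE mop_col mulmxA QD mulmxBl mul1mx -mulmxA.
rewrite [p^T *m _]mx11_scalar -pavE mul_mx_scalar !mxE mulr1.
by [].
Qed.

Lemma pav_deviation f : pav p (mop D f) = 0.
Proof.
rewrite pavE mop_col mulmxA /deviation_matrix -/A mulmxBr pTA mulmxA pT1 mul1mx.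
by rewrite subrr mul0mx mxE.
Qed.

Lemma pav_mopQ f : pav p (mop Q f) = 0.
Proof.
have [_ _ pQ] := ip.
by rewrite pavE mop_col mulmxA pQ mul0mx mxE.
Qed.

(** Expand the squares: [Q g^2] has zero [p]-average by invariance, the Poisson equation replaces
    [Q g], and [g = D f] has [p]-average 0. This identifies the variance rate of the chain
    martingale with the integrand of [Vfun]. *)
Lemma pav_carre_du_champ f :
  pav p (carre_du_champ Q (mop D f)) = 2 * pav p (fun i => f i * mop D f i).
Proof.
set g := mop D f.
have e i : carre_du_champ Q g i = mop Q (fun j => g j ^+ 2) i - 2 * g i * (pav p f - f i).
  rewrite -poisson_equation -/g /carre_du_champ /mop mulr_sumr -sumrB.
  transitivity (\sum_j (Q i j * g j ^+ 2 - 2 * g i * (Q i j * g j)) + g i ^+ 2 * \sum_j Q i j).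
    by rewrite [g i ^+ 2 * _]mulr_sumr -[RHS]big_split; apply: eq_bigr => j _; rewrite /=; ring.
  by rewrite gQ.2 mulr0 addr0.
(* An opaque name for the average of [f], so that unfolding [pav] below leaves it alone. *)
have [c cE] : {c | c = pav p f} by exists (pav p f).
transitivity (pav p (mop Q (fun j => g j ^+ 2)) - 2 * c * pav p g + 2 * pav p (fun i => f i * g i)).
  clearbody g; rewrite -cE in e; rewrite /pav !mulr_sumr -sumrB -big_split/=; apply: eq_bigr => i _.
  by rewrite e; ring.
by rewrite pav_mopQ pav_deviation mulr0 subr0 add0r.
Qed.

Lemma carre_du_champ_ge0 f i : 0 <= carre_du_champ Q f i.
Proof.
apply: sumr_ge0 => j _; have [->|ji] := eqVneq j i.
  by rewrite subrr expr0n/= mulr0.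
by rewrite mulr_ge0 ?sqr_ge0// gQ.1// eq_sym.
Qed.

Lemma pav_ge0 f : (forall i, 0 <= f i) -> 0 <= pav p f.
Proof.
have [h _ _] := ip.
by move=> f0; apply: sumr_ge0 => i _; rewrite mulr_ge0.
Qed.

Lemma pav_le f K : (forall i, `|f i| <= K) -> `|pav p f| <= K.
Proof.
have /invariant_distributionP[p0 s1 _] := ip.
move=> fK; apply: le_trans (ler_norm_sum _ _ _) _.
rewrite -[leRHS]mul1r -s1 mulr_suml; apply: ler_sum => i _.
by rewrite normrM (ger0_norm (p0 i)) ler_wpM2l.
Qed.

End Poisson.

Lemma mop_le B f K : (forall i, `|f i| <= K) ->
  forall i, `|mop B f i| <= (\sum_i \sum_j `|B i j|) * K.
Proof.
move=> fK i; apply: le_trans (ler_norm_sum _ _ _) _.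
have K0 : 0 <= K by exact: le_trans (normr_ge0 _) (fK i).
apply: (@le_trans _ _ ((\sum_j `|B i j|) * K)).
  by rewrite mulr_suml; apply: ler_sum => j _; rewrite normrM ler_wpM2l.
rewrite ler_wpM2r//; rewrite [leRHS](bigD1 i)//= lerDl.
by apply: sumr_ge0 => k _; apply: sumr_ge0.
Qed.

(** Entries of the powers of [B] are dominated by powers of [r], the sum of all absolute entries, so
    the series is dominated by that of [exp r]; for [0 <= t <= 1] and [k >= 2] the factor [t^k] is
    at most [t^2]. This gives [C = exp r]. *)
Lemma expmx_taylor (B : 'M[R]_d) : exists2 C, 0 <= C & forall (t : R), 0 <= t -> t <= 1 ->
  forall i j, `|expmx (t *: B) i j - ((i == j)%:R + t * B i j)| <= C * t ^+ 2.
Proof.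
pose r := \sum_i \sum_j `|B i j|.
have r0 : 0 <= r by apply: sumr_ge0 => i _; apply: sumr_ge0.
have row k : forall i, \sum_j `|(B ^+ k) i j| <= r ^+ k.
  elim: k => [|k ih] i.
    rewrite expr0 (bigD1 i)//= expr0 mxE eqxx normr1 big1 ?addr0// => j ji.
    by rewrite mxE eq_sym (negbTE ji) normr0.
  have e j : (B ^+ k.+1) i j = \sum_l B i l * (B ^+ k) l j by rewrite exprS mxE.
  apply: (@le_trans _ _ (\sum_j \sum_l `|B i l| * `|(B ^+ k) l j|)).
    apply: ler_sum => j _; rewrite e; apply: le_trans (ler_norm_sum _ _ _) _.
    by apply: ler_sum => l _; rewrite normrM.
  rewrite exchange_big/= exprS /r mulr_suml.
  rewrite [leRHS](bigD1 i)//= -[leLHS]addr0; apply: lerD.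
    rewrite mulr_suml; apply: ler_sum => l _; rewrite -mulr_sumr.
    by rewrite ler_wpM2l.
  apply: sumr_ge0 => l _; rewrite mulr_ge0 ?exprn_ge0// sumr_ge0//.
have ent k i j : `|(B ^+ k) i j| <= r ^+ k.
  apply: le_trans (row k i); rewrite [leRHS](bigD1 j)//= lerDl.
  exact: sumr_ge0.
have scal (t : R) k i j : ((t *: B) ^+ k) i j = t ^+ k * (B ^+ k) i j.
  elim: k i j => [|k ih] i j; first by rewrite !expr0 mul1r.
  have e2 (K L : 'M[R]_d) : (K * L) i j = \sum_l K i l * L l j by rewrite mxE.
  rewrite exprS e2 (exprS B) e2 mulr_sumr.
  by apply: eq_bigr => l _; rewrite ih mxE exprS; ring.
have rc : cvgn (series (exp_coeff r)) by exact: is_cvg_series_exp_coeff.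
have part n : series (exp_coeff r) n <= expR r.
  rewrite /expR /=; apply: nondecreasing_cvgn_le => //.
  by apply/nondecreasing_series => k _; rewrite /exp_coeff divr_ge0// exprn_ge0.
exists (expR r); first exact: expR_ge0.
move=> t t0 t1 i j.
pose u k := ((t *: B) ^+ k) i j / k`!%:R.
have uk k : `|u k| <= exp_coeff r k.
  rewrite /u scal normrM normrM normrX (ger0_norm t0).
  rewrite [`|_^-1|]ger0_norm ?invr_ge0// /exp_coeff/= ler_wpM2r ?invr_ge0//.
  rewrite -[leRHS]mul1r; apply: ler_pM => //; first exact: exprn_ge0.
  exact: exprn_ile1.
have uk2 k : (2 <= k)%N -> `|u k| <= t ^+ 2 * exp_coeff r k.
  move=> k2; rewrite /u scal normrM normrM normrX (ger0_norm t0).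
  rewrite [`|_^-1|]ger0_norm ?invr_ge0// /exp_coeff/= mulrA ler_wpM2r ?invr_ge0//.
  apply: ler_pM => //; first exact: exprn_ge0.
  by rewrite -(subnK k2) addnC exprD ler_piMr ?exprn_ge0// exprn_ile1.
have cu : cvgn (series u).
  apply: normed_cvg; apply: (series_le_cvg _ _ uk) => // k.
  by rewrite /exp_coeff divr_ge0// exprn_ge0.
have bd n : `|series u n.+2 - (u 0%N + u 1%N)| <= expR r * t ^+ 2.
  have -> : series u n.+2 - (u 0%N + u 1%N) = \sum_(0 <= k < n) u k.+2.
    rewrite /series/= big_nat_recl// big_nat_recl//; clearbody u; ring.
  apply: le_trans (ler_norm_sum _ _ _) _.
  apply: (@le_trans _ _ (\sum_(0 <= k < n) t ^+ 2 * exp_coeff r k.+2)).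
    by apply: ler_sum => k _; exact: uk2.
  rewrite -mulr_sumr mulrC ler_wpM2r ?sqr_ge0//; apply: le_trans (part n.+2).
  rewrite /series/= [leRHS]big_nat_recl// big_nat_recl// addrA lerDr.
  by rewrite addr_ge0// /exp_coeff divr_ge0// exprn_ge0.
have e0 : u 0%N + u 1%N = (i == j)%:R + t * B i j.
  by rewrite /u !scal !expr1 !expr0 (_ : 0`! = 1)%N// (_ : 1`! = 1)%N// !divr1 mul1r mxE.
rewrite mxE -/u -e0.
have cu2 : (fun n => `|series u n.+2 - (u 0%N + u 1%N)|) @ \oo --> `|limn (series u) - (u 0%N + u 1%N)|.
  apply: cvg_norm; apply: cvgB; last exact: cvg_cst.
  have h : series u (n + 2)%N @[n --> \oo] --> limn (series u) by rewrite cvg_shiftn.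
  by under eq_fun do rewrite -addn2.
rewrite -(cvg_lim _ cu2)//; apply: limr_le; first by apply: cvgP cu2.
exact: nearW.
Qed.

End GeneratorAlgebra.

(** * Lindeberg replacement *)

Section Lindeberg.
Context {R : realType}.
Implicit Types (x y z u v M : R) (f : R -> R).

(** The class [C^{2,1}] stated as a global third-order Taylor bound, with [f1] and [f2] in the role
    of the derivatives. In this form it passes, with the same [M], to averages of translates
    ([C21_rad]). *)
Definition C21 M f f1 f2 : Prop :=
  [/\ measurable_fun setT f, measurable_fun setT f1, measurable_fun setT f2,
   forall x, [/\ `|f x| <= M, `|f1 x| <= M & `|f2 x| <= M] &
   forall x u, `|f (x + u) - f x - f1 x * u - 2^-1 * f2 x * u ^+ 2| <= M * `|u| ^+ 3].

Definition rad v f x := 2^-1 * (f (x + Num.sqrt v) + f (x - Num.sqrt v)).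

Lemma measurable_rad v f : measurable_fun setT f -> measurable_fun setT (rad v f).
Proof.
move=> mf; apply: measurable_funM => //; apply: measurable_funD.
- by apply: measurableT_comp => //; apply: measurable_funD.
- by apply: measurableT_comp => //; apply: measurable_funD.
Qed.

Lemma C21_ge0 M f f1 f2 : C21 M f f1 f2 -> 0 <= M.
Proof. by move=> [_ _ _ /(_ 0)[h _ _] _]; exact: le_trans h. Qed.

Lemma C21_rad v M f f1 f2 : C21 M f f1 f2 -> C21 M (rad v f) (rad v f1) (rad v f2).
Proof.
move=> [mf mf1 mf2 bd ty]; set q := Num.sqrt v.
have half g x : (forall y, `|g y| <= M) -> `|rad v g x| <= M.
  move=> h; have := h (x + q); have := h (x - q).
  rewrite /rad -/q !ler_norml => /andP[a b] /andP[c e]; apply/andP; split; lra.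
split; [exact: measurable_rad..| |].
- by move=> x; split; apply: half => y; have [] := bd y.
move=> x u; rewrite /rad -/q.
have := ty (x + q) u; have := ty (x - q) u.
rewrite (addrAC x q u) (addrAC x (- q) u) !ler_norml => /andP[a b] /andP[c e].
by apply/andP; split; lra.
Qed.

(** The first-order terms at [+ sqrt v] and [- sqrt v] cancel, and the second-order ones add up to
    [f2 x * v / 2]. *)
Lemma rad_taylor v M f f1 f2 x : 0 <= v -> C21 M f f1 f2 ->
  `|rad v f x - f x - 2^-1 * f2 x * v| <= M * Num.sqrt v ^+ 3.
Proof.
move=> v0 [_ _ _ _ ty]; have := ty x (Num.sqrt v); have := ty x (- Num.sqrt v).
rewrite normrN (ger0_norm (sqrtr_ge0 v)) sqrrN sqr_sqrtr// /rad.
rewrite !ler_norml => /andP[a b] /andP[c e]; apply/andP; split; lra.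
Qed.

Definition rads := foldr rad.

Lemma C21_rads M f f1 f2 (vs : seq R) : C21 M f f1 f2 ->
  exists g1 g2, C21 M (rads f vs) g1 g2.
Proof.
move=> h; elim: vs => [|v vs [g1 [g2 ih]]]; first by exists f1, f2.
by exists (rad v g1), (rad v g2); exact: C21_rad.
Qed.

Section Step.
Context d (T : measurableType d) (P : probability T R).
Local Notation Ex := (Ex P).

(* Rademacher steps with the right variances serve as the reference law: any
   increments whose conditional mean vanishes, with conditional variance near v
   and small third moments, may be exchanged for them against C^{2,1} functions. *)
Definition block_increment (A : set (set T)) (D : T -> R) (v e : R) : Prop :=
  [/\ L4 P D, 0 <= v,
      forall eta (K : R), smeas A eta -> (forall w, `|eta w| <= K) ->
        Ex (fun w => eta w * D w) = 0,
      forall eta (K : R), smeas A eta -> (forall w, `|eta w| <= K) ->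
        `|Ex (fun w => eta w * D w ^+ 2) - v * Ex eta| <= K * e &
      Ex (fun w => `|D w| ^+ 3) <= e /\ Num.sqrt v ^+ 3 <= e].

Lemma smeas_comp A f Z : measurable_fun setT f -> smeas A Z ->
  smeas A (fun w : T => f (Z w)).
Proof. by move=> mf mZ; exact: (measurableT_comp mf mZ). Qed.

(** Both sides are expanded to second order at [Z]. The remainders are the third moment of [D], the
    cube of [sqrt v], and half the conditional variance mismatch; each contributes at most
    [K * M * e]. *)
Lemma rad_exchange A (D : T -> R) v e M f f1 f2 (eta : T -> R) (K : R) Z :
  A `<=` measurable -> block_increment A D v e -> C21 M f f1 f2 ->
  smeas A eta -> (forall w, `|eta w| <= K) -> smeas A Z ->
  `|Ex (fun w => eta w * f (Z w + D w)) - Ex (fun w => eta w * rad v f (Z w))|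
    <= 3 * K * M * e.
Proof.
move=> Am [L v0 b1 b2 [b3 b3']] cf Aeta etaK AZ.
have M0 := C21_ge0 cf; have [mf mf1 mf2 bd ty] := cf.
have K0 : 0 <= K.
  by apply: le_trans (etaK point).
have mD : measurable_fun setT D by case: L.
have meta := smeas_meas Am Aeta; have mZ := smeas_meas Am AZ.
have iD := L4_intg L; have iD2 := L4_intg2 L.
have iD3 : intg P (fun w => `|D w| ^+ 3).
  apply: intg_eq (intg_abs (L4_intg3 L)) => w; exact: normrX.
have bdm (g : R -> R) : measurable_fun setT g -> (forall x, `|g x| <= M) ->
    smeas A (fun w => eta w * g (Z w)) /\ forall w, `|eta w * g (Z w)| <= K * M.
  move=> mg gM; split.
    apply: (@measurable_funM _ (g_sigma_algebraType A)) => //; exact: smeas_comp.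
  by move=> w; rewrite normrM ler_pM.
have [m1 k1] := bdm f1 mf1 (fun x => let: And3 _ h _ := bd x in h).
have [m2 k2] := bdm f2 mf2 (fun x => let: And3 _ _ h := bd x in h).
have [m0 k0] := bdm f mf (fun x => let: And3 h _ _ := bd x in h).
have [rf _ _ rbd _] := C21_rad v cf.
have [mr kr] := bdm (rad v f) rf (fun x => let: And3 h _ _ := rbd x in h).
have ibd (g : T -> R) : smeas A g -> (forall w, `|g w| <= K * M) -> intg P g.
  by move=> mg gk; apply: intg_bd gk; exact: smeas_meas mg.
have i0 := ibd _ m0 k0; have i1 := ibd _ m1 k1; have i2 := ibd _ m2 k2; have ir := ibd _ mr kr.
have i1D : intg P (fun w => eta w * f1 (Z w) * D w).
  by apply: intg_mulbd k1 iD; exact: smeas_meas m1.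
have i2D : intg P (fun w => eta w * f2 (Z w) * D w ^+ 2).
  by apply: intg_mulbd k2 iD2; exact: smeas_meas m2.
have iS : intg P (fun w => eta w * f (Z w + D w)).
  apply: (@intg_bd _ _ _ _ _ (K * M)).
    by apply: measurable_funM => //; apply: measurableT_comp => //; exact: measurable_funD.
  by move=> w; rewrite normrM ler_pM//; have [] := bd (Z w + D w).
have e1 : Ex (fun w => eta w * f1 (Z w) * D w) = 0 by exact: b1 m1 k1.
have e2 := b2 _ _ m2 k2.
pose r1 w := eta w * f (Z w + D w) - eta w * f (Z w) - eta w * f1 (Z w) * D w
    - 2^-1 * (eta w * f2 (Z w) * D w ^+ 2).
have ir1 : intg P r1.
  by apply: intgB; [apply: intgB; [exact: intgB|]|exact: intgZ].
have h1 : `|Ex r1| <= K * M * e.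
  apply: (@le_trans _ _ (Ex (fun w => K * M * `|D w| ^+ 3))).
    apply: Ex_absle => //; first exact: intgZ.
    move=> w; have -> : r1 w = eta w * (f (Z w + D w) - f (Z w) - f1 (Z w) * D w - 2^-1 * f2 (Z w) * D w ^+ 2).
      by rewrite /r1; ring.
    by rewrite normrM -[leRHS]mulrA ler_pM.
  by rewrite ExZ// ler_wpM2l// mulr_ge0.
have E1 : Ex r1 = Ex (fun w => eta w * f (Z w + D w)) - Ex (fun w => eta w * f (Z w))
   - 2^-1 * Ex (fun w => eta w * f2 (Z w) * D w ^+ 2).
  rewrite /r1 !ExB//; [|exact: intgB|by apply: intgB => //; exact: intgB|exact: intgZ].
  by rewrite ExZ// e1 subr0.
pose r2 w := eta w * rad v f (Z w) - eta w * f (Z w) - 2^-1 * v * (eta w * f2 (Z w)).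
have ir2 : intg P r2 by apply: intgB; [exact: intgB|exact: intgZ].
have h2 : `|Ex r2| <= K * M * e.
  apply: (@le_trans _ _ (Ex (fun w => K * (M * e)))).
    apply: Ex_absle => //; first exact: intg_cst.
    move=> w; have -> : r2 w = eta w * (rad v f (Z w) - f (Z w) - 2^-1 * f2 (Z w) * v).
      by rewrite /r2; ring.
    rewrite normrM ler_pM//; apply: le_trans (rad_taylor (Z w) v0 cf) _.
    by rewrite ler_wpM2l.
  by rewrite Ex_cst mulrA.
have E2 : Ex r2 = Ex (fun w => eta w * rad v f (Z w)) - Ex (fun w => eta w * f (Z w))
   - 2^-1 * v * Ex (fun w => eta w * f2 (Z w)).
  by rewrite /r2 !ExB//; [rewrite ExZ|exact: intgB|exact: intgZ].
have -> : Ex (fun w => eta w * f (Z w + D w)) - Ex (fun w => eta w * rad v f (Z w)) =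
  Ex r1 - Ex r2 + 2^-1 * (Ex (fun w => eta w * f2 (Z w) * D w ^+ 2) - v * Ex (fun w => eta w * f2 (Z w))).
  by rewrite E1 E2; ring.
apply: le_trans (ler_normD _ _) _; apply: le_trans (lerD (ler_normB _ _) (lexx _)) _.
rewrite normrM ger0_norm//.
have h0 := le_trans (normr_ge0 _) h1.
lra.
Qed.

(** Later increments are exchanged first, the first one being absorbed into the start [Z]; it is
    then exchanged in turn, against the function already averaged over the others, which lies in the
    same class with the same [M]. *)
Lemma lindeberg (n : nat) (A : nat -> set (set T)) (D : nat -> T -> R)
    (v : nat -> R) e M f f1 f2 (eta : T -> R) (K : R) Z :
  (forall i, A i `<=` measurable) -> (forall i, A i `<=` A i.+1) ->
  (forall i, (i < n)%N -> block_increment (A i) (D i) (v i) e) ->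
  (forall i, (i < n)%N -> smeas (A i.+1) (D i)) ->
  C21 M f f1 f2 ->
  smeas (A 0%N) eta -> (forall w, `|eta w| <= K) -> smeas (A 0%N) Z ->
  `|Ex (fun w => eta w * f (Z w + \sum_(i < n) D i w))
   - Ex (fun w => eta w * rads f [seq v i | i <- iota 0 n] (Z w))|
    <= n%:R * (3 * K * M * e).
Proof.
move=> Am + + + cf + etaK; elim: n A D v Z Am => [|n ih] A D v Z Am Amono bi AD Aeta AZ.
  rewrite mul0r /=; under Ex_eq do rewrite big_ord0 addr0.
  by rewrite subrr normr0.
have AZ' : smeas (A 1%N) (fun w => Z w + D 0%N w).
  apply: (@measurable_funD _ (g_sigma_algebraType (A 1%N))); last exact: AD.
  exact: smeas_sub AZ.
have Aeta' : smeas (A 1%N) eta by exact: smeas_sub Aeta.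
have := ih (fun i => A i.+1) (fun i => D i.+1) (fun i => v i.+1) _ (fun i => Am i.+1)
  (fun i => Amono i.+1) (fun i h => bi i.+1 h) (fun i h => AD i.+1 h) Aeta' AZ'.
have [g1 [g2 cg]] := C21_rads [seq v i.+1 | i <- iota 0 n] cf.
have := rad_exchange (Am 0%N) (bi 0%N isT) cg Aeta etaK AZ.
have -> : [seq v i | i <- iota 0 n.+1] = v 0%N :: [seq v i.+1 | i <- iota 0 n].
  rewrite /= -[1%N]addn0 iotaDl -map_comp; congr cons; exact: eq_map.
rewrite (@Ex_eq _ _ _ P (fun w => eta w * f (Z w + \sum_(i < n.+1) D i w))
  (fun w => eta w * f (Z w + D 0%N w + \sum_(i < n) D i.+1 w))); last first.
  by move=> w; rewrite big_ord_recl addrA.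
move=> h1 h2; rewrite -natr1 mulrDl mul1r.
apply: le_trans (lerD h2 h1); apply: le_trans (ler_normD _ _).
by rewrite addrA subrK.
Qed.

End Step.
End Lindeberg.

(** * Finite-dimensional laws *)

Section Spline.
Context {R : realType}.
Implicit Types (x y z u v M : R) (f : R -> R).

Definition tpow (n : nat) z : R := Num.max z 0 ^+ n.

(** The cubic B-spline with knots 0, 1, 2, 3, 4, as a fourth difference of truncated cubes; [bspl1]
    and [bspl2] are its derivatives, and [smooth_step] is the sum of its translates by 0, 1, 2, and
    so on, rising from 0 to 1 on [[0, 3]]. *)
Definition bspl z : R := 6^-1 *
  (tpow 3 z - 4 * tpow 3 (z - 1) + 6 * tpow 3 (z - 2) - 4 * tpow 3 (z - 3) + tpow 3 (z - 4)).
Definition bspl1 z : R := 2^-1 *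
  (tpow 2 z - 4 * tpow 2 (z - 1) + 6 * tpow 2 (z - 2) - 4 * tpow 2 (z - 3) + tpow 2 (z - 4)).
Definition bspl2 z : R :=
  tpow 1 z - 4 * tpow 1 (z - 1) + 6 * tpow 1 (z - 2) - 4 * tpow 1 (z - 3) + tpow 1 (z - 4).
Definition smooth_step z : R := 6^-1 *
  (tpow 3 z - 3 * tpow 3 (z - 1) + 3 * tpow 3 (z - 2) - tpow 3 (z - 3)).

Lemma tpow_pos n z : 0 <= z -> tpow n z = z ^+ n.
Proof. by move=> z0; rewrite /tpow max_l. Qed.

Lemma tpow_neg n z : (0 < n)%N -> z <= 0 -> tpow n z = 0.
Proof. by move=> n0 z0; rewrite /tpow max_r// expr0n gtn_eqF. Qed.

Lemma tpow3_taylor z u :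
  `|tpow 3 (z + u) - tpow 3 z - 3 * tpow 2 z * u - 3 * tpow 1 z * u ^+ 2| <= `|u| ^+ 3.
Proof.
have [z0|z0] := lerP 0 z; have [zu|zu] := lerP 0 (z + u).
- rewrite !tpow_pos// -normrX.
  by rewrite (_ : _ - _ = u ^+ 3)//; ring.
- rewrite (tpow_neg _ (ltW zu))// !tpow_pos//.
  have u0 : u < 0 by lra.
  rewrite (ler0_norm (ltW u0)) ler_norml.
  have e : 0 - z ^+ 3 - 3 * z ^+ 2 * u - 3 * z ^+ 1 * u ^+ 2 = u ^+ 3 - (z + u) ^+ 3 by ring.
  rewrite e; have h1 : (- (z + u)) ^+ 3 <= (- u) ^+ 3.
    by rewrite lerXn2r// ?nnegrE; lra.
  have h2 : 0 <= (- (z + u)) ^+ 3 by rewrite exprn_ge0//; lra.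
  have e1 : (- (z + u)) ^+ 3 = - (z + u) ^+ 3 by ring.
  have e2 : (- u) ^+ 3 = - u ^+ 3 by ring.
  rewrite e1 e2 in h1 h2 *; apply/andP; split; lra.
- rewrite (tpow_pos _ zu) !(tpow_neg _ (ltW z0))//.
  have u0 : 0 < u by lra.
  rewrite (ger0_norm (ltW u0)) !mulr0 !mul0r !subr0 ger0_norm ?exprn_ge0//.
  by rewrite lerXn2r// ?nnegrE; lra.
- rewrite (tpow_neg _ (ltW zu))// !(tpow_neg _ (ltW z0))//.
  by rewrite !mulr0 !mul0r !subr0 normr0 exprn_ge0.
Qed.

(** The coefficients of the five truncated cubes add up to [16 / 6] in absolute value, below 3. *)
Lemma bspl_taylor z u :
  `|bspl (z + u) - bspl z - bspl1 z * u - 2^-1 * bspl2 z * u ^+ 2| <= 3 * `|u| ^+ 3.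
Proof.
have h0 := tpow3_taylor z u; have h1 := tpow3_taylor (z - 1) u.
have h2 := tpow3_taylor (z - 2) u; have h3 := tpow3_taylor (z - 3) u.
have h4 := tpow3_taylor (z - 4) u.
rewrite !(addrAC _ _ u) in h1 h2 h3 h4.
move: h0 h1 h2 h3 h4; rewrite /bspl /bspl1 /bspl2 !ler_norml.
set w := `|u| ^+ 3.
move: (tpow 3 (z + u)) (tpow 3 (z + u - 1)) (tpow 3 (z + u - 2)) (tpow 3 (z + u - 3)) (tpow 3 (z + u - 4)).
have w0 : 0 <= w by exact: exprn_ge0.
move=> a0 a1 a2 a3 a4 /andP[? ?] /andP[? ?] /andP[? ?] /andP[? ?] /andP[? ?].
apply/andP; split; lra.
Qed.

Lemma bspl_out z : 4 <= z \/ z <= 0 -> [/\ bspl z = 0, bspl1 z = 0 & bspl2 z = 0].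
Proof.
move=> [h|h].
  rewrite /bspl /bspl1 /bspl2 !tpow_pos; try lra.
  by split; ring.
rewrite /bspl /bspl1 /bspl2 !tpow_neg//; try lra.
by split; ring.
Qed.

Lemma bspl_bound z : [/\ `|bspl z| <= 256, `|bspl1 z| <= 256 & `|bspl2 z| <= 256].
Proof.
have [h|h] := lerP 4 z.
  by have [-> -> ->] := bspl_out (or_introl h); rewrite normr0; split; exact: ler0n.
have [h'|h'] := lerP z 0.
  by have [-> -> ->] := bspl_out (or_intror h'); rewrite normr0; split; exact: ler0n.
have b y : y <= 4 -> [/\ 0 <= tpow 3 y <= 64, 0 <= tpow 2 y <= 16 & 0 <= tpow 1 y <= 4].
  move=> y4; have y0 : 0 <= Num.max y 0 by rewrite le_max lexx orbT.
  have y1 : Num.max y 0 <= 4 by rewrite ge_max y4 ler0n.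
  rewrite /tpow; split; rewrite exprn_ge0//=.
  - by have := lerXn2r 3 y0 (le_trans y0 y1) y1; lra.
  - by have := lerXn2r 2 y0 (le_trans y0 y1) y1; lra.
rewrite /bspl /bspl1 /bspl2.
have h0 : z <= 4 by lra.
have h1 : z - 1 <= 4 by lra.
have h2 : z - 2 <= 4 by lra.
have h3 : z - 3 <= 4 by lra.
have h4 : z - 4 <= 4 by lra.
move: (b _ h0) (b _ h1) (b _ h2) (b _ h3) (b _ h4).
move=> [/andP[? ?] /andP[? ?] /andP[? ?]] [/andP[? ?] /andP[? ?] /andP[? ?]]
  [/andP[? ?] /andP[? ?] /andP[? ?]] [/andP[? ?] /andP[? ?] /andP[? ?]]
  [/andP[? ?] /andP[? ?] /andP[? ?]].
by split; rewrite ler_norml; apply/andP; split; lra.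
Qed.

Lemma bspl_ge0 z : 0 <= bspl z.
Proof.
have [h|h] := lerP 4 z.
  by have [-> _ _] := bspl_out (or_introl h).
have [h'|h'] := lerP z 0.
  by have [-> _ _] := bspl_out (or_intror h').
rewrite /bspl mulr_ge0// (@tpow_neg 3 (z - 4))//; last by lra.
rewrite (@tpow_pos 3 z); last by lra.
have [h1|h1] := lerP z 1.
  rewrite !tpow_neg//; try lra.
  by rewrite !mulr0 !subr0 !addr0 exprn_ge0// ltW.
rewrite (@tpow_pos 3 (z - 1)); last by lra.
have [h2|h2] := lerP z 2.
  rewrite !tpow_neg//; try lra.
  set t := z - 1; have -> : z = 1 + t by rewrite /t; ring.
  have t0 : 0 <= t by rewrite /t; lra.
  have t1 : t <= 1 by rewrite /t; lra.
  have -> : (1 + t) ^+ 3 - 4 * t ^+ 3 + 6 * 0 - 4 * 0 + 0 = 1 + 3 * t + 3 * t ^+ 2 * (1 - t) by ring.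
  by rewrite !addr_ge0// ?mulr_ge0// ?sqr_ge0//; lra.
rewrite (@tpow_pos 3 (z - 2)); last by lra.
have [h3|h3] := lerP z 3.
  rewrite !tpow_neg//; try lra.
  set t := 3 - z; have -> : z = 3 - t by rewrite /t; ring.
  have t0 : 0 <= t by rewrite /t; lra.
  have t1 : t <= 1 by rewrite /t; lra.
  have -> : (3 - t) ^+ 3 - 4 * (3 - t - 1) ^+ 3 + 6 * (3 - t - 2) ^+ 3 - 4 * 0 + 0 =
    1 + 3 * t + 3 * t ^+ 2 * (1 - t) by ring.
  by rewrite !addr_ge0// ?mulr_ge0// ?sqr_ge0//; lra.
rewrite (@tpow_pos 3 (z - 3)); last by lra.
have -> : z ^+ 3 - 4 * (z - 1) ^+ 3 + 6 * (z - 2) ^+ 3 - 4 * (z - 3) ^+ 3 + 0 = (4 - z) ^+ 3 by ring.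
by rewrite exprn_ge0//; lra.
Qed.

Lemma bspl_step z : bspl z = smooth_step z - smooth_step (z - 1).
Proof.
rewrite /bspl /smooth_step.
have -> : z - 1 - 1 = z - 2 by ring.
have -> : z - 1 - 2 = z - 3 by ring.
have -> : z - 1 - 3 = z - 4 by ring.
by ring.
Qed.

Lemma smooth_step0 z : z <= 0 -> smooth_step z = 0.
Proof. by move=> h; rewrite /smooth_step !tpow_neg//; try lra; ring. Qed.

Lemma smooth_step1 z : 3 <= z -> smooth_step z = 1.
Proof. by move=> h; rewrite /smooth_step !tpow_pos; try lra; field. Qed.

Lemma sum_bspl n y : \sum_(i < n) bspl (y - i%:R) = smooth_step y - smooth_step (y - n%:R).
Proof.
elim: n => [|n ih]; first by rewrite big_ord0 subr0 subrr.
rewrite big_ord_recr/= ih bspl_step.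
have -> : y - n.+1%:R = y - n%:R - 1 by rewrite -natr1; ring.
by ring.
Qed.

(** Enough translates of the nonnegative [bspl] telescope to [smooth_step y] alone, the other end
    being 0 at a nonpositive argument. The upper bound below uses the same sum, started where the
    step has reached 1. *)
Lemma smooth_step_ge0 y : 0 <= smooth_step y.
Proof.
pose n := (Num.truncn `|y|).+1.
have yn : y - n%:R <= 0.
  by rewrite subr_le0 (le_trans (ler_norm _))// ltW// truncnS_gt.
have := sum_bspl n y; rewrite (smooth_step0 yn) subr0 => <-.
by apply: sumr_ge0 => i _; exact: bspl_ge0.
Qed.

Lemma smooth_step_le1 y : smooth_step y <= 1.
Proof.
pose n := (Num.truncn `|3 - y|).+1.
have yn : 3 <= y + n%:R.
  have : 3 - y <= n%:R by rewrite (le_trans (ler_norm _))// ltW// truncnS_gt.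
  by rewrite lerBlDl.
have := sum_bspl n (y + n%:R); rewrite (smooth_step1 yn) addrK => h.
by rewrite -subr_ge0 -h; apply: sumr_ge0 => i _; exact: bspl_ge0.
Qed.

Lemma measurable_tpow n z : measurable_fun setT (fun x : R => tpow n (x - z)).
Proof.
apply: measurable_funX; apply: measurable_maxr => //.
exact: measurable_funB.
Qed.

Lemma measurable_bspl : [/\ measurable_fun setT bspl, measurable_fun setT bspl1
  & measurable_fun setT bspl2].
Proof.
have m0 n : measurable_fun setT (fun x : R => tpow n x).
  by apply: measurable_funX; exact: measurable_maxr.
have mk n (c k : R) : measurable_fun setT (fun z : R => c * tpow n (z - k)).
  by apply: measurable_funM => //; exact: measurable_tpow.
have key n : measurable_fun setT (fun z : R => tpow n z - 4 * tpow n (z - 1)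
    + 6 * tpow n (z - 2) - 4 * tpow n (z - 3) + tpow n (z - 4)).
  apply: measurable_funD; last exact: measurable_tpow.
  apply: measurable_funB; last exact: mk.
  apply: measurable_funD; last exact: mk.
  by apply: measurable_funB; [exact: m0|exact: mk].
by split; [apply: measurable_funM|apply: measurable_funM|]; rewrite //; exact: key.
Qed.

Lemma C21_bspl (e c : R) : 0 < e -> exists M f1 f2, C21 M (fun z => bspl (z / e - c)) f1 f2.
Proof.
move=> e0.
exists (256 * (1 + e^-1 + e^-1 ^+ 2 + e^-1 ^+ 3)), (fun z => e^-1 * bspl1 (z / e - c)),
  (fun z => e^-1 ^+ 2 * bspl2 (z / e - c)).
have [m m1 m2] := measurable_bspl.
have i0 : 0 <= e^-1 by rewrite invr_ge0 ltW.
have i2 : 0 <= e^-1 ^+ 2 by exact: exprn_ge0.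
have i3 : 0 <= e^-1 ^+ 3 by exact: exprn_ge0.
have ms : measurable_fun setT (fun z : R => z / e - c).
  by apply: measurable_funB => //; exact: measurable_funM.
split.
- by apply: measurableT_comp.
- by apply: measurable_funM => //; apply: measurableT_comp.
- by apply: measurable_funM => //; apply: measurableT_comp.
- move=> z; have [a a1 a2] := bspl_bound (z / e - c); split.
  + by apply: (le_trans a); lra.
  + rewrite normrM (ger0_norm i0); have := ler_wpM2l i0 a1; lra.
  + rewrite normrM (ger0_norm i2); have := ler_wpM2l i2 a2; lra.
- move=> z u; have := bspl_taylor (z / e - c) (u / e).
  have -> : (z + u) / e - c = z / e - c + u / e by rewrite mulrDl; ring.
  rewrite normrM (ger0_norm i0) [(`|u| / e) ^+ 3]exprMn => h.
  have -> : e^-1 * bspl1 (z / e - c) * u = bspl1 (z / e - c) * (u / e) by ring.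
  have -> : 2^-1 * (e^-1 ^+ 2 * bspl2 (z / e - c)) * u ^+ 2 = 2^-1 * bspl2 (z / e - c) * (u / e) ^+ 2.
    by rewrite exprMn; ring.
  apply: (le_trans h); have u3 : 0 <= `|u| ^+ 3 by exact: exprn_ge0.
  have a1 := mulr_ge0 u3 i0; have a2 := mulr_ge0 u3 i2; have a3 := mulr_ge0 u3 i3.
  lra.
Qed.

End Spline.

(** * B-spline quasi-interpolation in one coordinate of a Lipschitz function *)

Section SplineApproximation.
Context {R : realType}.
Implicit Types (phi : (nat -> R) -> R) (x y : nat -> R).

Definition upd x (j : nat) (t : R) : nat -> R := fun k => if k == j then t else x k.

Definition coord_lipschitz (j : nat) (L : R) phi : Prop :=
  forall x y, `|phi x - phi y| <= L * \sum_(i < j) `|x i - y i|.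

Lemma coord_lipschitz_upd j (L t : R) phi : coord_lipschitz j.+1 L phi ->
  coord_lipschitz j L (fun x => phi (upd x j t)).
Proof.
move=> h x y; apply: le_trans (h _ _) _; rewrite big_ord_recr/= /upd eqxx subrr normr0 addr0.
rewrite le_eqVlt; apply/orP; left; apply/eqP; congr (_ * _).
by apply: eq_bigr => i _; rewrite ltn_eqF.
Qed.

(* Quasi-interpolation by cubic B-splines: a Lipschitz function of coordinate j
   becomes a finite combination of C^{2,1} test functions of that coordinate. *)
Definition spline_approx phi (j I n : nat) (e : R) x : R :=
  \sum_(i < n) phi (upd x j ((i%:R - I%:R) * e)) * bspl (x j / e - (i%:R - I%:R)).

(** Splines active at [x j] have nodes within [4 e] of it, which gives the Lipschitz error [4 L e].
    The splines can sum to less than 1 only when [|x j| > (I - 3) e], and then the quotient of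
    squares exceeds 1. *)
Lemma spline_approxP phi j I (e L K0 : R) x : 0 < e -> 0 <= L ->
  coord_lipschitz j.+1 L phi -> (forall x, `|phi x| <= K0) -> (3 < I)%N ->
  `|phi x - spline_approx phi j I (2 * I) e x|
    <= 4 * L * e + K0 * (x j ^+ 2 / ((I%:R - 3) * e) ^+ 2).
Proof.
move=> e0 L0 hL hK I3.
have K00 : 0 <= K0 by exact: le_trans (hK x).
pose b (i : 'I_(2 * I)) := bspl (x j / e - (i%:R - I%:R)).
have sb : \sum_i b i = smooth_step (x j / e + I%:R) - smooth_step (x j / e - I%:R).
  transitivity (\sum_(i < 2 * I) bspl (x j / e + I%:R - i%:R)).
    by apply: eq_bigr => i _; rewrite /b opprB addrA.
  rewrite sum_bspl; congr (_ - smooth_step _).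
  by rewrite natrM; ring.
have b0 i : 0 <= b i by exact: bspl_ge0.
have sb1 : \sum_i b i <= 1.
  by rewrite sb; have := smooth_step_ge0 (x j / e - I%:R); have := smooth_step_le1 (x j / e + I%:R); lra.
have -> : phi x - spline_approx phi j I (2 * I) e x =
   \sum_(i < 2 * I) (phi x - phi (upd x j ((i%:R - I%:R) * e))) * b i + phi x * (1 - \sum_i b i).
  under [X in _ = X + _]eq_bigr do rewrite mulrBl.
  by rewrite sumrB -mulr_sumr /spline_approx; ring.
apply: le_trans (ler_normD _ _) _; apply: lerD.
  apply: le_trans (ler_norm_sum _ _ _) _.
  apply: (@le_trans _ _ (\sum_i 4 * L * e * b i)); last first.
    by rewrite -mulr_sumr ler_piMr// !mulr_ge0// ltW.
  apply: ler_sum => i _; rewrite normrM (ger0_norm (b0 i)).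
  have [h|h] := lerP 4 (x j / e - (i%:R - I%:R)).
    by rewrite /b; have [-> _ _] := bspl_out (or_introl h); rewrite !mulr0.
  have [h'|h'] := lerP (x j / e - (i%:R - I%:R)) 0.
    by rewrite /b; have [-> _ _] := bspl_out (or_intror h'); rewrite !mulr0.
  rewrite ler_wpM2r//; apply: le_trans (hL _ _) _.
  rewrite big_ord_recr/= big1 ?add0r; last first.
    by move=> k _; rewrite /upd ltn_eqF// subrr normr0.
  rewrite /upd eqxx (mulrC 4) -mulrA ler_wpM2l//.
  have -> : x j - (i%:R - I%:R) * e = (x j / e - (i%:R - I%:R)) * e.
    by rewrite [RHS]mulrBl divfK// gt_eqF.
  rewrite normrM (gtr0_norm e0) ler_wpM2r ?(ltW e0)//.
  by rewrite ger0_norm ltW.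
rewrite normrM ler_pM//.
rewrite ger0_norm ?subr_ge0//.
have I30 : 0 < I%:R - 3 :> R by rewrite subr_gt0 ltr_nat.
have [h|h] := lerP `|x j / e| (I%:R - 3).
  move: h; rewrite ler_norml => /andP[h1 h2].
  rewrite sb smooth_step1; last by lra.
  rewrite smooth_step0; last by lra.
  by rewrite subr0 subrr mulr_ge0// ?sqr_ge0// invr_ge0 sqr_ge0.
apply: (@le_trans _ _ 1); first by rewrite gerBl sumr_ge0.
rewrite ler_pdivlMr ?exprn_gt0// ?mulr_gt0// mul1r.
rewrite -[leRHS]ger0_norm ?sqr_ge0// normrX lerXn2r// ?nnegrE ?mulr_ge0// ?(ltW e0) ?(ltW I30)//.
by rewrite -ler_pdivlMr// -(gtr0_norm e0) -normfV -normrM ltW.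
Qed.

(** Induction on the number of coordinates: a spline approximation separates the last coordinate
    from Lipschitz functions of the others, and the approximations converge pointwise. *)
Lemma measurable_coord_lipschitz d (T : measurableType d) (Y : nat -> T -> R)
    phi j (L K0 : R) : 0 <= L -> coord_lipschitz j L phi -> (forall x, `|phi x| <= K0) ->
  (forall i, (i < j)%N -> measurable_fun setT (Y i)) ->
  measurable_fun setT (fun w => phi (fun i => Y i w)).
Proof.
move=> L0; elim: j phi => [|j ih] phi hL hK mY.
  have e x : phi x = phi (fun=> 0).
    by apply/eqP; rewrite -subr_eq0 -normr_le0 (le_trans (hL _ _))// big_ord0 mulr0.
  by under eq_fun do rewrite e; exact: measurable_cst.
(* The mesh [1 / (n+1)] tends to 0 while the covered range [(I n - 3) * e n = n + 1] grows. *)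
pose e (n : nat) : R := n.+1%:R^-1; pose I (n : nat) := (n.+1 * n.+1 + 3)%N.
apply: (@measurable_fun_cvg _ _ _ setT (fun n w => spline_approx phi j (I n) (2 * I n) (e n) (fun i => Y i w))) => //.
  move=> n; rewrite /spline_approx; apply: measurable_sum => i.
  apply: measurable_funM.
    apply: (ih (fun x => phi (upd x j ((i%:R - (I n)%:R) * e n)))) => //.
    - exact: coord_lipschitz_upd.
    - by move=> k kj; apply: mY; exact: ltnW.
  have [m _ _] := @measurable_bspl R.
  apply: measurableT_comp => //; apply: measurable_funB => //.
  by apply: measurable_funM => //; exact: mY.
move=> w _; apply/cvgrPdist_le => eps eps0.
pose x := fun i => Y i w.
have K00 : 0 <= K0 by exact: le_trans (hK x).
pose C := 4 * L + K0 * x j ^+ 2.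
have C0 : 0 <= C by apply: addr_ge0; apply: mulr_ge0 => //; exact: sqr_ge0.
near=> n.
have n0 : 0 < n.+1%:R :> R by [].
apply: (@le_trans _ _ (C * n.+1%:R^-1)).
  apply: le_trans (spline_approxP x _ L0 hL hK _) _; rewrite ?invr_gt0//.
    by rewrite /I addnS ltnS addn2 !ltnS.
  rewrite [leRHS]mulrDl; apply: lerD => //; rewrite -[leRHS]mulrA.
  apply: ler_wpM2l => //; apply: ler_wpM2l; first exact: sqr_ge0.
  have -> : ((I n)%:R - 3) * e n = n.+1%:R :> R.
    by rewrite /I /e natrD natrM addrK mulfK.
  rewrite lef_pV2 ?posrE ?exprn_gt0//.
  by rewrite expr2 ler_peMl// ler1n.
rewrite ler_pdivrMr// mulrC -ler_pdivrMr//.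
rewrite (le_trans (ler_norm _))// ltW//.
have : (Num.truncn `|C / eps| <= n)%N by near: n; exact: nbhs_infty_ge.
move=> h; apply: lt_le_trans (truncnS_gt _) _.
by rewrite ler_nat ltnS.
Unshelve. all: by end_near. Qed.

End SplineApproximation.

(** * Joint laws of increments that are asymptotically independent of their past *)

Section FiniteDimensional.
Context {R : realType}.
Context (dO : nat -> measure_display) (Om : forall N, measurableType (dO N)).
Context (P : forall N, probability (Om N) R) (Y : forall N, nat -> Om N -> R).
Context (A : forall N, nat -> set (set (Om N))).
Context d' (Om' : measurableType d') (P' : probability Om' R) (Y' : nat -> Om' -> R).
Context (A' : nat -> set (set Om')).

Hypothesis Am : forall N j, @A N j `<=` measurable.
Hypothesis Am' : forall j, A' j `<=` measurable.

(* Both families are asymptotically independent of their past against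
   C^{2,1} test functions, with the same constant c. *)
Definition same_increment (j : nat) : Prop :=
  forall M f f1 f2, @C21 R M f f1 f2 -> forall e : R, 0 < e ->
  exists c : R, (exists N0 : nat, forall N, (N0 <= N)%N ->
     forall eta (K : R), smeas (@A N j) eta -> (forall w, `|eta w| <= K) ->
     `|Ex (P N) (fun w => eta w * f (@Y N j w)) - c * Ex (P N) eta| <= K * e) /\
   (forall eta (K : R), smeas (A' j) eta -> (forall w, `|eta w| <= K) ->
     `|Ex P' (fun w => eta w * f (Y' j w)) - c * Ex P' eta| <= K * e).

(** Induction on the number of increments: splines split off the last one, leaving products of a
    bounded function of the past and a test function of the last increment. [same_increment]
    replaces the latter by one constant for both laws, and the past is settled by induction. Second
    moments control the tail of the spline error. *)
Lemma fdd_convergence (m : nat) (V : R) (N1 : nat) :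
  (forall N i j, (N1 <= N)%N -> (i < j)%N -> (j <= m)%N -> smeas (@A N j) (@Y N i)) ->
  (forall i j, (i < j)%N -> (j <= m)%N -> smeas (A' j) (Y' i)) ->
  (forall N j, (N1 <= N)%N -> (j < m)%N -> intg (P N) (fun w => @Y N j w ^+ 2) /\ Ex (P N) (fun w => @Y N j w ^+ 2) <= V) ->
  (forall j, (j < m)%N -> intg P' (fun w => Y' j w ^+ 2) /\ Ex P' (fun w => Y' j w ^+ 2) <= V) ->
  (forall j, (j < m)%N -> same_increment j) ->
  forall (phi : (nat -> R) -> R) (L K0 : R), 0 <= L -> coord_lipschitz m L phi ->
  (forall x, `|phi x| <= K0) ->
  forall e : R, 0 < e -> exists N0, forall N, (N0 <= N)%N ->
    `|Ex (P N) (fun w => phi (fun i => @Y N i w)) - Ex P' (fun w => phi (fun i => Y' i w))| <= e.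
Proof.
elim: m => [|m ih] mY mY' LY LY' inc phi L K0 L0 hL hK e e0.
  exists 0%N => N _.
  have cst x : phi x = phi (fun=> 0).
    by apply/eqP; rewrite -subr_eq0 -normr_le0 (le_trans (hL _ _))// big_ord0 mulr0.
  have -> : Ex (P N) (fun w => phi (fun i => @Y N i w)) = phi (fun=> 0).
    by rewrite -[RHS](Ex_cst (P N)); apply: Ex_eq => w; exact: cst.
  have -> : Ex P' (fun w => phi (fun i => Y' i w)) = phi (fun=> 0).
    by rewrite -[RHS](Ex_cst P'); apply: Ex_eq => w; exact: cst.
  by rewrite subrr normr0 ltW.
have K00 : 0 <= K0 by exact: le_trans (hK (fun=> 0)).
have V0 : 0 <= V.
  by have [_] := LY' m (ltnSn m); apply: le_trans; apply: Ex_ge0 => w; exact: sqr_ge0.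
(* The mesh [a] keeps the Lipschitz error below [e / 6]; the range, through [q], makes the
   coefficient of the square at most [e / (6 (V + 1))], so that its expectation is at most [e / 6]
   too. *)
pose a : R := e / (6 * (4 * L + 1)).
have L1 : 0 < 4 * L + 1 by rewrite ltr_wpDl// mulr_ge0.
have V1 : 0 < V + 1 by rewrite ltr_wpDl.
have a0 : 0 < a by rewrite divr_gt0// mulr_gt0.
pose q := (Num.truncn (6 * K0 * (V + 1) / (a ^+ 2 * e))).+1.
have q1 : 1 <= q%:R :> R by rewrite ler1n.
have qb : 6 * K0 * (V + 1) <= q%:R * (a ^+ 2 * e).
  rewrite -ler_pdivrMr; last by rewrite mulr_gt0// exprn_gt0.
  exact/ltW/truncnS_gt.
pose I : nat := (q + 3)%N.
have I3 : (3 < I)%N by rewrite /I /q addSn ltnS leq_addl.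
pose n := (2 * I)%N.
have n0 : 0 < n%:R :> R by rewrite ltr0n /n muln_gt0/= (leq_trans _ I3).
have err x : `|phi x - spline_approx phi m I n a x| <= e / 6 + e / (6 * (V + 1)) * x m ^+ 2.
  apply: le_trans (spline_approxP x a0 L0 hL hK I3) _.
  apply: lerD.
    rewrite /a mulrA ler_pdivrMr ?mulr_gt0//.
    have -> : e / 6 * (6 * (4 * L + 1)) = 4 * L * e + e by field.
    by rewrite lerDl ltW.
  rewrite mulrCA mulrC ler_wpM2r ?sqr_ge0//.
  have -> : I%:R - 3 = q%:R :> R by rewrite /I natrD addrK.
  have qa : 0 < (q%:R * a) ^+ 2 by rewrite exprn_gt0// mulr_gt0// (lt_le_trans ltr01).
  rewrite ler_pdivrMr// mulrAC ler_pdivlMr ?mulr_gt0//.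
  have -> : K0 * (6 * (V + 1)) = 6 * K0 * (V + 1) by ring.
  apply: le_trans qb _.
  have -> : e * (q%:R * a) ^+ 2 = q%:R * (q%:R * (a ^+ 2 * e)) by ring.
  rewrite ler_wpM2l// ler_peMl// mulr_ge0// ?sqr_ge0// ltW//.
have Errb d0 (T : measurableType d0) (Q : probability T R) (Z : nat -> T -> R) :
    (forall i, (i < m.+1)%N -> measurable_fun setT (Z i)) ->
    intg Q (fun w => Z m w ^+ 2) -> Ex Q (fun w => Z m w ^+ 2) <= V ->
    [/\ intg Q (fun w => phi (fun i => Z i w)),
      intg Q (fun w => spline_approx phi m I n a (fun i => Z i w)),
      Ex Q (fun w => spline_approx phi m I n a (fun i => Z i w)) =
        \sum_(i < n) Ex Q (fun w => phi (upd (fun k => Z k w) m ((i%:R - I%:R) * a))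
          * bspl (Z m w / a - (i%:R - I%:R))) &
      `|Ex Q (fun w => phi (fun i => Z i w)) -
        Ex Q (fun w => spline_approx phi m I n a (fun i => Z i w))| <= e / 3].
  move=> mZ LZ VZ.
  have mph := measurable_coord_lipschitz L0 hL hK mZ.
  have i1 : intg Q (fun w => phi (fun i => Z i w)).
    by apply: intg_bd mph _ => w; exact: hK.
  have it (i : 'I_n) : intg Q (fun w => phi (upd (fun k => Z k w) m ((i%:R - I%:R) * a))
          * bspl (Z m w / a - (i%:R - I%:R))).
    apply: (@intg_mulbd _ _ _ _ _ _ K0).
    - apply: (@measurable_coord_lipschitz _ _ _ _ (fun x => phi (upd x m ((i%:R - I%:R) * a))) m L K0) => //.
        exact: coord_lipschitz_upd.
      by move=> k km; apply: mZ; exact: ltnW.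
    - by move=> w; exact: hK.
    apply: (@intg_bd _ _ _ _ _ 256).
      have [mb _ _] := @measurable_bspl R.
      apply: measurableT_comp => //; apply: measurable_funB => //.
      by apply: measurable_funM => //; exact: mZ.
    by move=> w; have [] := bspl_bound (Z m w / a - (i%:R - I%:R)).
  have i2 : intg Q (fun w => spline_approx phi m I n a (fun i => Z i w)) by exact: intg_sum.
  split => //; first exact: Ex_sum.
  rewrite -ExB//.
  have iZ2 := LZ.
  apply: (@le_trans _ _ (Ex Q (fun w => e / 6 + e / (6 * (V + 1)) * Z m w ^+ 2))).
    apply: Ex_absle; [exact: intgB| |by move=> w; exact: err].
    by apply: intgD; [exact: intg_cst|exact: intgZ].
  rewrite ExD; [|exact: intg_cst|exact: intgZ].
  rewrite Ex_cst ExZ//.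
  have : e / (6 * (V + 1)) * Ex Q (fun w => Z m w ^+ 2) <= e / (6 * (V + 1)) * (V + 1).
    by rewrite ler_wpM2l ?divr_ge0 ?mulr_ge0 ?(ltW e0) ?(ltW V1)// (le_trans VZ)// lerDl.
  have -> : e / (6 * (V + 1)) * (V + 1) = e / 6 by field; rewrite gt_eqF.
  lra.
have term (i : nat) : exists N0, forall N, (N0 <= N)%N -> (N1 <= N)%N ->
    `|Ex (P N) (fun w => phi (upd (fun k => @Y N k w) m ((i%:R - I%:R) * a)) * bspl (@Y N m w / a - (i%:R - I%:R)))
     - Ex P' (fun w => phi (upd (fun k => Y' k w) m ((i%:R - I%:R) * a)) * bspl (Y' m w / a - (i%:R - I%:R)))|
    <= e / (3 * n%:R).
  set t := (i%:R - I%:R) * a; set c0 := i%:R - I%:R.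
  have [Mb [b1 [b2 cb]]] := C21_bspl c0 a0.
  have K1 : 0 < K0 + 1 by rewrite ltr_wpDl.
  pose s := e / (12 * n%:R * (K0 + 1)).
  have s0 : 0 < s by rewrite divr_gt0// !mulr_gt0.
  have [c [[N2 hN] h']] := inc m (ltnSn m) _ _ _ _ cb s s0.
  pose s2 := e / (6 * n%:R * (`|c| + 1)).
  have c1 : 0 < `|c| + 1 by rewrite ltr_wpDl.
  have s20 : 0 < s2 by rewrite divr_gt0// !mulr_gt0.
  have lm : coord_lipschitz m L (fun x => phi (upd x m t)) by exact: coord_lipschitz_upd.
  have [N3 hN3] := ih (fun N i j h1 h2 h3 => mY N i j h1 h2 (leqW h3))
     (fun i j h1 h2 => mY' i j h1 (leqW h2))
     (fun N j h1 h2 => LY N j h1 (leqW h2)) (fun j h => LY' j (leqW h))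
     (fun j h => inc j (leqW h)) (fun x => phi (upd x m t)) L K0 L0 lm (fun x => hK _) s2 s20.
  exists (maxn N2 N3) => N; rewrite geq_max => /andP[h2 h3] h1.
  have Y1 : smeas (@A N m) (fun w => phi (upd (fun k => @Y N k w) m t)).
    apply: (@measurable_coord_lipschitz _ _ (g_sigma_algebraType (@A N m)) _ (fun x => phi (upd x m t)) m L K0) => //.
    by move=> k km; exact: mY.
  have Y1' : smeas (A' m) (fun w => phi (upd (fun k => Y' k w) m t)).
    apply: (@measurable_coord_lipschitz _ _ (g_sigma_algebraType (A' m)) _ (fun x => phi (upd x m t)) m L K0) => //.
    by move=> k km; exact: mY'.
  have g1 := hN N h2 _ K0 Y1 (fun w => hK _).
  have g2 := h' _ K0 Y1' (fun w => hK _).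
  have g3 := hN3 N h3.
  set E1 := Ex (P N) _ in g1 *; set E2 := Ex P' _ in g2 *.
  set F1 := Ex (P N) _ in g1 g3; set F2 := Ex P' _ in g2 g3.
  have -> : E1 - E2 = (E1 - c * F1) - (E2 - c * F2) + c * (F1 - F2) by ring.
  apply: le_trans (ler_normD _ _) _; apply: le_trans (lerD (ler_normB _ _) (lexx _)) _.
  have k1 : K0 * s <= e / (12 * n%:R).
    rewrite /s mulrA ler_pdivrMr ?mulr_gt0//.
    have -> : e / (12 * n%:R) * (12 * n%:R * (K0 + 1)) = K0 * e + e by field; rewrite gt_eqF.
    by rewrite lerDl ltW.
  have k2 : `|c * (F1 - F2)| <= e / (6 * n%:R).
    rewrite normrM; apply: (@le_trans _ _ (`|c| * s2)); first by rewrite ler_wpM2l.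
    rewrite /s2 mulrA ler_pdivrMr ?mulr_gt0//.
    have -> : e / (6 * n%:R) * (6 * n%:R * (`|c| + 1)) = `|c| * e + e by field; rewrite gt_eqF.
    by rewrite lerDl ltW.
  have -> : e / (3 * n%:R) = e / (12 * n%:R) + e / (12 * n%:R) + e / (6 * n%:R).
    by field; rewrite gt_eqF.
  apply: lerD => //; apply: lerD; exact: le_trans k1.
have [N0 hN0] := choice term.
exists (maxn N1 (\max_(i < n) N0 i)) => N; rewrite geq_max => /andP[h1 h2].
have [LN VN] := LY N m h1 (ltnSn m); have [L' V'] := LY' m (ltnSn m).
have mYN i : (i < m.+1)%N -> measurable_fun setT (@Y N i).
  by move=> im; apply: smeas_meas (Am (j := m.+1)) _; exact: mY.
have mYN' i : (i < m.+1)%N -> measurable_fun setT (Y' i).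
  by move=> im; apply: smeas_meas (Am' (j := m.+1)) _; exact: mY'.
have [i1 i2 s1 b1] := Errb _ _ _ _ mYN LN VN.
have [i1' i2' s1' b1'] := Errb _ _ _ _ mYN' L' V'.
have mid : `|Ex (P N) (fun w => spline_approx phi m I n a (fun i => @Y N i w)) -
   Ex P' (fun w => spline_approx phi m I n a (fun i => Y' i w))| <= e / 3.
  rewrite s1 s1' -sumrB; apply: le_trans (ler_norm_sum _ _ _) _.
  apply: (@le_trans _ _ (\sum_(i < n) e / (3 * n%:R))).
    apply: ler_sum => i _; apply: hN0 => //.
    exact: leq_trans (leq_bigmax i) h2.
  rewrite sumr_const card_ord -mulr_natr le_eqVlt; apply/orP; left; apply/eqP.
  by field; rewrite gt_eqF.
move: b1 b1' mid.
rewrite !ler_norml => /andP[? ?] /andP[? ?] /andP[? ?]; apply/andP; split; lra.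
Qed.
End FiniteDimensional.

(** * Functionals of continuous paths *)

Section Paths.
Context {R : realType}.
Implicit Types (x y z : R -> R) (s t e : R).

Definition cpath x : Prop := {within `[0, +oo[, continuous x}.

Lemma cpathP x : cpath x <-> forall t, 0 <= t -> forall e, 0 < e ->
  exists2 r : R, 0 < r & forall s, 0 <= s -> `|s - t| < r -> `|x s - x t| <= e.
Proof.
have inA t : (`[0, +oo[%classic : set R) t = (0 <= t) by rewrite /= in_itv/= andbT.
split=> [cx t t0 e e0|h].
  have /(_ t) := cx; rewrite /continuous_at => cxt.
  have {cxt} : x @ within `[0, +oo[ (nbhs t) --> x t.
    by rewrite nbhs_subspace_in ?inA.
  move=> /cvgrPdist_le/(_ _ e0); rewrite near_withinE => /nbhs_ballP[r /= r0 hr].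
  exists r => // s s0 st; rewrite distrC; apply: hr; last by rewrite in_itv/= andbT.
  by rewrite /ball/= distrC.
rewrite /cpath continuous_subspace_in => t; rewrite inE inA => t0.
apply/cvgrPdist_le => e e0.
have [r r0 hr] := h _ t0 _ e0.
rewrite -nbhs_subspace_in ?inA// near_withinE.
apply/nbhs_ballP; exists r => //= s; rewrite /ball/= in_itv/= andbT => st s0.
by rewrite distrC; apply: hr; rewrite // distrC.
Qed.

(** Freezing a path at time 0 makes it continuous on the whole line; the pattern [x (Num.max t 0)]
    recurs wherever a function of all real times is wanted. *)
Lemma cpath_ext x : cpath x -> continuous (fun t => x (Num.max t 0)).
Proof.
move=> /cpathP cx t; apply/cvgrPdist_le => e e0.
have t0 : 0 <= Num.max t 0 by rewrite le_max lexx orbT.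
have [r r0 hr] := cx _ t0 _ e0.
apply/nbhs_ballP; exists r => //= s; rewrite /ball/= => st.
rewrite distrC; apply: hr; first by rewrite le_max lexx orbT.
apply: le_lt_trans st; rewrite distrC.
have h1 := ler_norm (t - s); have h2 := ler_norm (s - t).
rewrite distrC in h2; rewrite ler_norml.
by case: (lerP t 0); case: (lerP s 0) => ? ?; apply/andP; split; have := normr_ge0 (t - s); lra.
Qed.

Lemma continuous_cpath (f : R -> R) x : continuous f -> (forall t, 0 <= t -> x t = f t) -> cpath x.
Proof.
move=> cf xf; apply/cpathP => t t0 e e0.
have /cvgrPdist_le/(_ _ e0)/nbhs_ballP[r /= r0 hr] := cf t.
exists r => // s s0 st; rewrite !xf// distrC; apply: hr.
by rewrite /ball/= distrC.
Qed.

Lemma cpath_unif x T e : cpath x -> 0 < e ->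
  exists2 r : R, 0 < r & forall s t, 0 <= s <= T -> 0 <= t <= T -> `|s - t| < r -> `|x s - x t| <= e.
Proof.
move=> cx e0; pose f t := x (Num.max t 0); have cf := cpath_ext cx.
have /compact_near_coveringP nc := @segment_compact R 0 T.
have := nc _ (0^'+) (fun (r s : R) => forall t, `|s - t| < r -> `|f s - f t| <= e) _ _.
case.
  move=> s _; have e2 : 0 < e / 2 by rewrite divr_gt0.
  have /cvgrPdist_le/(_ _ e2)/nbhs_ballP[r /= r0 hr] := cf s.
  exists (ball s (r / 2), [set q | q < r / 2]) => /=.
    split; first by apply: nbhsx_ballx; rewrite divr_gt0.
    by apply: nbhs_right_lt; rewrite divr_gt0.
  move=> [s' q] [/= ss qr] t st.
  have h1 := hr s' ; have h2 := hr t.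
  have b1 : ball s r s' by rewrite /ball/=; rewrite /ball/= in ss; lra.
  have b2 : ball s r t.
    rewrite /ball/= in ss *; have -> : s - t = (s - s') + (s' - t) by ring.
    by apply: le_lt_trans (ler_normD _ _) _; lra.
  have := h1 b1; have := h2 b2; rewrite -/(f _) => a b.
  have -> : f s' - f t = (f s - f t) - (f s - f s') by ring.
  by apply: le_trans (ler_normB _ _) _; rewrite /f in a b *; lra.
move=> r /= r0 hr.
have h : [set` `[0, T]] `<=` [set s | forall t, `|s - t| < r / 2 -> `|f s - f t| <= e].
  apply: hr; last by rewrite divr_gt0.
  by rewrite /ball/= sub0r normrN gtr0_norm; lra.
exists (r / 2); first by rewrite divr_gt0.
move=> s t /andP[s0 sT] /andP[t0 tT] st.
have := h s; rewrite /= in_itv/= s0 sT => /(_ isT t st).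
by rewrite /f !max_l.
Qed.

(* Metrizes uniform convergence on the compact subsets of [0, oo). *)
Definition ucdist x y : R :=
  sup [set Num.min `|x t - y t| (1 + t)^-1 | t in [set t | 0 <= t]].

Let S x y := [set Num.min `|x t - y t| (1 + t)^-1 | t in [set t | 0 <= t]].

Let inv_le1 t : 0 <= t -> (1 + t)^-1 <= 1.
Proof. by move=> t0; rewrite invf_le1 ?lerDl// ltr_wpDr. Qed.

Let S_sup x y : has_sup (S x y).
Proof.
split; first by exists (Num.min `|x 0 - y 0| (1 + 0)^-1); exists 0 => //=.
by exists 1 => _ [t /= t0 <-]; rewrite ge_min inv_le1 ?orbT.
Qed.

Lemma ucdist_ub x y t : 0 <= t -> Num.min `|x t - y t| (1 + t)^-1 <= ucdist x y.
Proof. by move=> t0; apply: (sup_upper_bound (S_sup x y)); exists t. Qed.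

Lemma ucdist_le x y e : (forall t, 0 <= t -> Num.min `|x t - y t| (1 + t)^-1 <= e) ->
  ucdist x y <= e.
Proof.
move=> h; apply: ge_sup; first by case: (S_sup x y).
by move=> _ [t /= t0 <-]; exact: h.
Qed.

Lemma ucdist_ge0 x y : 0 <= ucdist x y.
Proof.
apply: le_trans (@ucdist_ub x y 0 (lexx _)).
by rewrite le_min normr_ge0 addr0 invr1 ler01.
Qed.

Lemma ucdist_le1 x y : ucdist x y <= 1.
Proof. by apply: ucdist_le => t t0; rewrite ge_min inv_le1 ?orbT. Qed.

Lemma ucdistC x y : ucdist x y = ucdist y x.
Proof.
by rewrite /ucdist; congr sup; apply/seteqP; split => _ [t /= t0 <-]; exists t => //;
  rewrite distrC.
Qed.

Lemma ucdistxx x : ucdist x x = 0.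
Proof.
apply/eqP; rewrite eq_le ucdist_ge0 andbT; apply: ucdist_le => t t0.
by rewrite subrr normr0 ge_min lexx.
Qed.

Lemma ucdist_triangle y x z : ucdist x z <= ucdist x y + ucdist y z.
Proof.
apply: ucdist_le => t t0.
apply: le_trans (lerD (ucdist_ub x y t0) (ucdist_ub y z t0)).
have i0 : 0 <= (1 + t)^-1 by rewrite invr_ge0 addr_ge0.
have : `|x t - z t| <= `|x t - y t| + `|y t - z t|.
  have -> : x t - z t = (x t - y t) + (y t - z t) by ring.
  exact: ler_normD.
move: (`|x t - y t|) (`|y t - z t|) (`|x t - z t|) ((1 + t)^-1) i0 (normr_ge0 (x t - y t)) (normr_ge0 (y t - z t)).
move=> a b c q q0 a0 b0 cab.
rewrite ge_min; case: (lerP a q); case: (lerP b q) => ? ?; apply/orP.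
- by left.
- by right; lra.
- by right; lra.
- by right; lra.
Qed.

Lemma ucdist_le_on x y T e : 0 <= T -> (forall t, 0 <= t <= T -> `|x t - y t| <= e) ->
  ucdist x y <= Num.max e (1 + T)^-1.
Proof.
move=> T0 h; apply: ucdist_le => t t0; rewrite le_max !ge_min.
have [tT|Tt] := lerP t T; first by rewrite h ?t0.
by apply/orP; right; apply/orP; right; rewrite lef_pV2 ?posrE ?ltr_wpDr// lerD2l ltW.
Qed.

(** Pointwise epsilon form of continuity for uniform convergence on compacts, tested on continuous
    paths; the arguments that follow use the topology in this form only. *)
Definition uccont (Th : (R -> R) -> R) : Prop := forall x, cpath x -> forall e, 0 < e ->
  exists T r : R, [/\ 0 <= T, 0 < r & forall y, cpath y ->
    (forall t, 0 <= t <= T -> `|x t - y t| <= r) -> `|Th x - Th y| <= e].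

(** The sets [B n] of continuous paths within [1 / (n+1)] of [x] on [[0, n]] generate a filter
    converging to [x], because a compact subset of the half-line is bounded; continuity of [Phi] is
    then read along that filter. *)
Lemma continuous_uccont (Phi : path_space R -> R) :
  {within @continuous_path_set R, continuous Phi} -> uccont Phi.
Proof.
move=> cPhi x cx e e0.
pose B (n : nat) : set (path_space R) :=
  [set y : R -> R | cpath y /\ forall t, 0 <= t <= n%:R -> `|x t - y t| <= n.+1%:R^-1].
pose F : set_system (path_space R) := filter_from setT B.
have FF : ProperFilter F.
  apply: filter_from_proper; last first.
    move=> n _; exists x; split => // t _; by rewrite subrr normr0.
  apply: filter_from_filter; first by exists 0%N.
  move=> i j _ _; exists (maxn i j) => // y [cy hy]; split; split => // t /andP[t0 ti].
    apply: le_trans (hy t _) _; first by rewrite t0 (le_trans ti)// ler_nat leq_maxl.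
    by rewrite lef_pV2 ?posrE// ler_nat ltnS leq_maxl.
  apply: le_trans (hy t _) _; first by rewrite t0 (le_trans ti)// ler_nat leq_maxr.
  by rewrite lef_pV2 ?posrE// ler_nat ltnS leq_maxr.
have Fx : F --> (x : path_space R).
  apply/fam_cvgP => K [K0 cK] U /uniform_nbhs [E [entE EU]].
  have [r /= r0 rE] : exists2 r : R, 0 < r & [set xy : R * R | ball xy.1 r xy.2] `<=` E.
    by move: entE; rewrite -entourage_ballE => -[r r0 rE]; exists r.
  have [M [_ hM]] := compact_bounded cK.
  have KM t : K t -> t <= `|M| + 1.
    move=> Kt; apply: le_trans (ler_norm t) _; apply: hM => //.
    by rewrite ltr_pwDr// ler_norm.
  pose n := (maxn (Num.truncn (`|M| + 1)) (Num.truncn r^-1)).+1.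
  exists n => // y [cy hy]; apply: EU => t Kt; apply: rE; rewrite /ball/=.
  have t0 : 0 <= t by have := K0 _ Kt; rewrite /= in_itv/= andbT.
  apply: le_lt_trans (hy t _) _.
    rewrite t0/= (le_trans (KM _ Kt))// ltW// (lt_le_trans (truncnS_gt _))//.
    by rewrite ler_nat /n ltnS leq_maxl.
  rewrite invf_plt ?posrE//; apply: lt_le_trans (truncnS_gt _) _.
  by rewrite ler_nat /n ltnS leqW// leq_maxr.
have := cPhi x; rewrite /continuous_at => cPx.
have {cPx} : Phi @ within (@continuous_path_set R) (nbhs (x : path_space R)) --> Phi x.
  by rewrite nbhs_subspace_in.
move=> /cvgrPdist_le/(_ _ e0); rewrite near_withinE => /Fx [n _ hn].
exists n%:R, n.+1%:R^-1; split; [exact: ler0n|by rewrite invr_gt0|].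
move=> y cy hy; apply: hn => //.
Qed.

Section InfConvolution.
Variables (Th : (R -> R) -> R) (K : R).
Hypothesis ThK : forall x, cpath x -> `|Th x| <= K.

(* k-Lipschitz for ucdist, and increasing to Th on continuous paths. *)
Definition infc (k : R) x : R := inf [set Th y + k * ucdist x y | y in cpath].

Let C0 : cpath (fun=> 0).
Proof. by apply: (@continuous_cpath (fun=> 0)) => // t; exact: cvg_cst. Qed.

Let K0 : 0 <= K.
Proof. exact: le_trans (ThK C0). Qed.

Let I_lb k x y : 0 <= k -> cpath y -> - K <= Th y + k * ucdist x y.
Proof.
move=> k0 cy; have := ThK cy; rewrite ler_norml => /andP[h _].
by have := mulr_ge0 k0 (ucdist_ge0 x y); lra.
Qed.

Let I_inf k x : 0 <= k -> has_inf [set Th y + k * ucdist x y | y in cpath].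
Proof.
move=> k0; split; first by exists (Th (fun=> 0) + k * ucdist x (fun=> 0)), (fun=> 0).
by exists (- K) => _ [y cy <-]; exact: I_lb.
Qed.

Lemma infc_lb k x y : 0 <= k -> cpath y -> infc k x <= Th y + k * ucdist x y.
Proof. by move=> k0 cy; apply: (inf_lbound (proj2 (I_inf x k0))); exists y. Qed.

Lemma infc_ge k x c : (forall y, cpath y -> c <= Th y + k * ucdist x y) -> c <= infc k x.
Proof.
move=> h; apply: lb_le_inf; first by exists (Th (fun=> 0) + k * ucdist x (fun=> 0)), (fun=> 0).
by move=> _ [y cy <-]; exact: h.
Qed.

Lemma infc_le k x : 0 <= k -> cpath x -> infc k x <= Th x.
Proof. by move=> k0 cx; have := infc_lb x k0 cx; rewrite ucdistxx mulr0 addr0. Qed.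

Lemma infc_bound k x : 0 <= k -> `|infc k x| <= K + k.
Proof.
move=> k0; rewrite ler_norml; apply/andP; split.
  apply: (@le_trans _ _ (- K)); first by rewrite opprD gerDl oppr_le0.
  by apply: infc_ge => y cy; exact: I_lb.
apply: le_trans (infc_lb x k0 C0) _; apply: lerD.
  exact: le_trans (ler_norm _) (ThK C0).
by rewrite ler_piMr// ucdist_le1.
Qed.

Lemma infc_lip k x z : 0 <= k -> `|infc k x - infc k z| <= k * ucdist x z.
Proof.
have h a b : 0 <= k -> infc k a <= infc k b + k * ucdist a b.
  move=> k0; rewrite -lerBlDr; apply: infc_ge => y cy; rewrite lerBlDr -addrA -mulrDr.
  apply: le_trans (infc_lb a k0 cy) _; rewrite lerD2l ler_wpM2l//.
  by rewrite addrC; exact: ucdist_triangle.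
move=> k0; rewrite ler_norml; have := h x z k0; have := h z x k0; rewrite ucdistC.
by move=> ? ?; apply/andP; split; lra.
Qed.

Lemma infc_lower x e : uccont Th -> cpath x -> 0 < e ->
  exists k0 : R, 0 <= k0 /\ forall k, k0 <= k -> Th x - e <= infc k x.
Proof.
move=> uTh cx e0; have [T [r [T0 r0 h]]] := uTh x cx e e0.
(* If [ucdist x y < q] then [|x - y| <= r] on [[0, T]], the weights there being at least
   [1 / (1 + T)]; otherwise the penalty [k * q] is at least [2 K], the largest possible gap. *)
pose q := Num.min r (1 + T)^-1.
have q0 : 0 < q by rewrite lt_min r0 invr_gt0 ltr_pwDl.
exists (2 * K / q); split; first by rewrite divr_ge0 ?mulr_ge0// ltW.
move=> k hk; apply: infc_ge => y cy.
have k0 : 0 <= k by apply: le_trans hk; rewrite divr_ge0 ?mulr_ge0// ltW.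
have [dq|dq] := ltrP (ucdist x y) q.
  have := h y cy; have k1 := mulr_ge0 k0 (ucdist_ge0 x y).
  suff hh : forall t, 0 <= t <= T -> `|x t - y t| <= r.
    by move=> /(_ hh); rewrite ler_norml => /andP[? ?]; lra.
  move=> t /andP[t0 tT]; have := le_lt_trans (ucdist_ub x y t0) dq.
  rewrite /q !lt_min !gt_min => /andP[hr hT].
  have i1 : (1 + T)^-1 <= (1 + t)^-1 by rewrite lef_pV2 ?posrE ?ltr_pwDl// lerD2l.
  case/orP: hT => [hT|]; last by rewrite ltNge i1.
  case/orP: hr => [/ltW//|hr].
  have : ucdist x y < q by []; rewrite /q lt_min => /andP[h1 h2].
  have := ucdist_ub x y t0; rewrite ge_min => /orP[h3|h3].
    by apply: ltW; exact: le_lt_trans h1.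
  by move: (le_lt_trans h3 h2); rewrite ltNge i1.
have h1 : 2 * K <= k * ucdist x y.
  rewrite ler_pdivrMr// in hk; apply: le_trans hk _; rewrite ler_wpM2l//.
have := ThK cy; have := ThK cx; rewrite !ler_norml => /andP[? ?] /andP[? ?]; lra.
Qed.

End InfConvolution.
End Paths.

(** * Bounded convergence and comparison of expectations off a small event *)

Section BoundedConvergence.
Context d (T : measurableType d) (R : realType) (P : probability T R).

Lemma Ex_bounded_cvg (f : nat -> T -> R) (g : T -> R) (K : R) :
  (forall n, measurable_fun setT (f n)) -> (forall n w, `|f n w| <= K) ->
  (forall w, f ^~ w @ \oo --> g w) ->
  [/\ measurable_fun setT g, (forall w, `|g w| <= K) &
      (fun n => Ex P (f n)) @ \oo --> Ex P g].
Proof.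
move=> mf fK fg.
have mg : measurable_fun setT g by apply: (@measurable_fun_cvg _ _ _ setT f).
have gK w : `|g w| <= K.
  have h : `|f n w| @[n --> \oo] --> `|g w| by apply: cvg_norm; exact: fg.
  rewrite -(cvg_lim _ h)//.
  by apply: limr_le; [exact: cvgP h|exact: nearW].
split => //.
have [] := @dominated_convergence _ T R P setT measurableT (fun n => EFin \o f n)
  (EFin \o g) (EFin \o (fun=> K)).
- by move=> n; exact/measurable_EFinP.
- exact/measurable_EFinP.
- by apply: aeW => w _; apply: cvg_EFin; [exact: nearW|exact: fg].
- exact: intg_cst.
- by apply: aeW => w n _; rewrite /= lee_fin.
by move=> ig _ h; apply: fine_cvg; rewrite -ExE in h.
Qed.

Lemma Ex_ae_eq (f g : T -> R) : measurable_fun setT f -> measurable_fun setT g ->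
  {ae P, forall w, f w = g w} -> Ex P f = Ex P g.
Proof.
move=> mf mg fg; rewrite /Ex /Rintegral; congr fine.
apply: ae_eq_integral => //; [exact/measurable_EFinP|exact/measurable_EFinP|].
by apply: filterS fg => w -> .
Qed.

Lemma Ex_close (f g : T -> R) (B : set T) (a c K : R) : 0 <= a -> 0 <= K ->
  measurable B -> (P B <= c%:E)%E -> intg P f -> intg P g ->
  (forall w, `|f w - g w| <= K) -> (forall w, ~ B w -> `|f w - g w| <= a) ->
  `|Ex P f - Ex P g| <= a + K * c.
Proof.
move=> a0 K0 mB PB jf jg fK fa; rewrite -ExB//.
have iB : intg P (\1_B : T -> R).
  by apply: (@intg_bd _ _ _ _ _ 1) => [|w]; [exact: measurable_indic|exact: indic_le1].
apply: (@le_trans _ _ (Ex P (fun w => a + K * \1_B w))).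
  apply: Ex_absle; [exact: intgB| |].
    by apply: intgD; [exact: intg_cst|exact: intgZ].
  move=> w; rewrite indicE; case: (boolP (w \in B)) => wB.
    by rewrite mulr1 ler_wpDl.
  by rewrite mulr0 addr0; apply: fa; rewrite notin_setE in wB.
rewrite ExD; [|exact: intg_cst|exact: intgZ].
rewrite Ex_cst ExZ// lerD2l ler_wpM2l// -lee_fin Ex_indic//.
Qed.

End BoundedConvergence.

(** * Dyadic step paths, and the lower half of weak convergence *)

Section StepPaths.
Context {R : realType}.

Let chain_lower (e x y z u v w : R) : y <= x -> `|y - z| <= e / 4 -> `|z - u| <= e / 4 ->
  `|v - u| <= e / 4 -> `|w - v| <= e / 4 -> w - e <= x.
Proof.
rewrite !ler_norml => h0 /andP[a1 a2] /andP[b1 b2] /andP[c1 c2] /andP[d1 d2].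
lra.
Qed.

Definition grid (l i : nat) : R := i%:R / 2 ^+ l.
(** The grid index is capped at [l * 2 ^ l]: level [l] follows the path up to time [l] and freezes
    it there, so mesh and horizon improve together. *)
Definition stepv (l : nat) (v : nat -> R) (t : R) : R :=
  v (minn (Num.truncn (t * 2 ^+ l)) (l * 2 ^ l)).
Definition psum (v : nat -> R) (i : nat) : R := \sum_(k < i) v k.

Lemma stepv_cvg (x : R -> R) (e : R) : cpath x -> 0 < e ->
  exists l0 : nat, forall l, (l0 <= l)%N -> ucdist x (stepv l (fun i => x (grid l i))) <= e.
Proof.
(* Beyond [T = 1 / e] the metric charges at most [1 / (1 + T) <= e]. *)
move=> cx e0; pose T : R := e^-1.
have T0 : 0 < T by rewrite invr_gt0.
have [r r0 hr] := cpath_unif T cx e0.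
exists (maxn (Num.truncn T).+1 (Num.truncn r^-1).+1) => l; rewrite geq_max => /andP[h1 h2].
have lT : T <= l%:R by apply: ltW; apply: lt_le_trans (truncnS_gt _) _; rewrite ler_nat.
have p0 : 0 < 2 ^+ l :> R by exact: exprn_gt0.
have lr : (2 ^+ l)^-1 < r.
  rewrite invf_plt ?posrE//; apply: lt_le_trans (truncnS_gt _) _.
  rewrite -natrX ler_nat; apply: leq_trans h2 _; exact/ltnW/ltn_expl.
apply: le_trans (ucdist_le_on (e := e) (ltW T0) _) _; last first.
  have T1 : 0 < 1 + T by rewrite addr_gt0.
  by rewrite ge_max lexx/= invf_ple ?posrE// -/T lerDr.
move=> t /andP[t0 tT]; rewrite /stepv.
set i := Num.truncn _.
have ti0 : 0 <= t * 2 ^+ l by rewrite mulr_ge0// ltW.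
have /andP[i1 i2] := truncn_itv ti0; rewrite -/i in i1 i2.
have il : (i <= l * 2 ^ l)%N.
  rewrite -(ler_nat R) (le_trans i1)// natrM natrX ler_wpM2r ?(ltW p0)//.
  exact: le_trans lT.
rewrite (minn_idPl il).
have g1 : grid l i <= t by rewrite /grid ler_pdivrMr.
have g0 : 0 <= grid l i by rewrite /grid divr_ge0// ltW.
apply: hr; rewrite ?t0 ?tT ?g0 ?(le_trans g1)//.
rewrite ger0_norm ?subr_ge0//; apply: lt_trans lr.
have : t < i.+1%:R / 2 ^+ l by rewrite ltr_pdivlMr.
by rewrite -natr1 mulrDl mul1r -/(grid l i); lra.
Qed.

Lemma stepv_dist l (v v' : nat -> R) :
  ucdist (stepv l v) (stepv l v') <= \sum_(i < (l * 2 ^ l).+1) `|v i - v' i|.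
Proof.
apply: ucdist_le => t t0; rewrite ge_min; apply/orP; left; rewrite /stepv.
set i := minn _ _; have il : (i < (l * 2 ^ l).+1)%N by rewrite ltnS geq_minr.
rewrite [leRHS](bigD1 (Ordinal il))//= lerDl; exact: sumr_ge0.
Qed.

Lemma psum_dist m (v v' : nat -> R) i : (i <= m)%N ->
  `|psum v i - psum v' i| <= \sum_(k < m) `|v k - v' k|.
Proof.
move=> im; rewrite /psum -sumrB; apply: le_trans (ler_norm_sum _ _ _) _.
rewrite -(subnKC im) big_split_ord/= lerDl; exact: sumr_ge0.
Qed.

Lemma stepv_psum_dist l (v v' : nat -> R) :
  ucdist (stepv l (psum v)) (stepv l (psum v')) <= \sum_(i < l * 2 ^ l) `|v i - v' i|.
Proof.
apply: ucdist_le => t t0; rewrite ge_min; apply/orP; left; rewrite /stepv.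
by apply: psum_dist; exact: geq_minr.
Qed.

Section Functional.
Variables (Th : (R -> R) -> R) (K : R).
Hypothesis ThK : forall x, cpath x -> `|Th x| <= K.
Hypothesis uTh : uccont Th.

Let K0 : 0 <= K.
Proof.
apply: le_trans (ThK (_ : cpath (fun=> 0))) => //.
by apply: (@continuous_cpath _ (fun=> 0)) => // t; exact: cvg_cst.
Qed.

Section Measurability.
Context d (T : measurableType d) (P : probability T R) (W : R -> T -> R).
Hypothesis cW : forall w : T, cpath (W ^~ w).
Hypothesis mW : forall t : R, 0 <= t -> measurable_fun setT (W t).

Let grid0 l i : 0 <= grid l i.
Proof. by rewrite /grid divr_ge0// exprn_ge0. Qed.

Lemma measurable_infc_step (k : R) l : 0 <= k ->
  measurable_fun setT (fun w => infc Th k (stepv l (fun i => W (grid l i) w))).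
Proof.
move=> k0.
apply: (@measurable_coord_lipschitz _ _ _ (fun i => W (grid l i))
  (fun v => infc Th k (stepv l v)) (l * 2 ^ l).+1 k (K + k)) => //.
- move=> v v'; apply: le_trans (infc_lip ThK _ _ k0) _.
  by rewrite ler_wpM2l// stepv_dist.
- by move=> v; exact: infc_bound.
- by move=> i _; exact: mW.
Qed.

Lemma infc_step_cvg (k : R) w : 0 <= k ->
  (fun l => infc Th k (stepv l (fun i => W (grid l i) w))) @ \oo --> infc Th k (W ^~ w).
Proof.
move=> k0; apply/cvgrPdist_le => e e0.
have k1 : 0 < k + 1 by rewrite ltr_wpDl.
have [l0 hl] := stepv_cvg (@cW w) (divr_gt0 e0 k1).
exists l0 => // l /= ll; apply: le_trans (infc_lip ThK _ _ k0) _.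
apply: le_trans (ler_wpM2l k0 (hl _ ll)) _.
by rewrite mulrCA ler_piMr ?(ltW e0)// ler_pdivrMr// mul1r lerDl.
Qed.

Lemma Ex_infc_step (k : R) : 0 <= k ->
  [/\ measurable_fun setT (fun w => infc Th k (W ^~ w)),
      intg P (fun w => infc Th k (W ^~ w)) &
      (fun l => Ex P (fun w => infc Th k (stepv l (fun i => W (grid l i) w)))) @ \oo
        --> Ex P (fun w => infc Th k (W ^~ w))].
Proof.
move=> k0.
have [m b c] := @Ex_bounded_cvg _ T R P
  (fun l w => infc Th k (stepv l (fun i => W (grid l i) w)))
  (fun w => infc Th k (W ^~ w)) (K + k) (fun l => measurable_infc_step l k0)
  (fun l w => infc_bound ThK _ k0) (fun w => @infc_step_cvg k w k0).
by split => //; exact: intg_bd b.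
Qed.

Let infn (n : nat) w : infc Th n%:R (W ^~ w) <= Th (W ^~ w) /\ `|infc Th n%:R (W ^~ w)| <= K.
Proof.
have h := infc_le ThK (ler0n R n) (@cW w); split => //.
rewrite ler_norml; apply/andP; split; last first.
  by apply: le_trans h _; exact: le_trans (ler_norm _) (ThK (@cW w)).
apply: infc_ge => y cy; have := ThK cy; rewrite ler_norml => /andP[a _].
by apply: le_trans a _; rewrite lerDl mulr_ge0// ucdist_ge0.
Qed.

(** Measurability comes out of the approximation: [Th] along the paths is a pointwise limit of
    inf-convolutions, themselves limits of Lipschitz functions of finitely many grid values. *)
Lemma Ex_infc_cvg :
  [/\ measurable_fun setT (fun w => Th (W ^~ w)),
      intg P (fun w => Th (W ^~ w)) &
      (fun n => Ex P (fun w => infc Th n%:R (W ^~ w))) @ \oo --> Ex P (fun w => Th (W ^~ w))].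
Proof.
have cv w : (fun n => infc Th n%:R (W ^~ w)) @ \oo --> Th (W ^~ w).
  apply/cvgrPdist_le => e e0; have [k0 [k00 hk]] := infc_lower ThK uTh (@cW w) e0.
  exists (Num.truncn k0).+1 => // n /= kn; have [h _] := infn n w.
  rewrite ger0_norm ?subr_ge0// lerBlDr addrC -lerBlDr; apply: hk.
  by apply: ltW; apply: lt_le_trans (truncnS_gt _) _; rewrite ler_nat.
have mm (n : nat) : measurable_fun setT (fun w => infc Th n%:R (W ^~ w)).
  by have [] := Ex_infc_step (ler0n R n).
have [m b c] := @Ex_bounded_cvg _ T R P _ _ K mm (fun n w => (infn n w).2) cv.
by split => //; exact: intg_bd b.
Qed.

End Measurability.

Section WeakConvergence.
Context (dO : nat -> measure_display) (Om : forall N, measurableType (dO N)).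
Context (P : forall N, probability (Om N) R) (W : forall N, R -> Om N -> R).
Context d' (Om' : measurableType d') (P' : probability Om' R) (W' : R -> Om' -> R).
Variable G : forall N, nat -> nat -> Om N -> R.

Hypothesis cW : forall N (w : Om N), (0 < N)%N -> cpath (fun t => @W N t w).
Hypothesis mW : forall N (t : R), (0 < N)%N -> 0 <= t -> measurable_fun setT (@W N t).
Hypothesis cW' : forall w, cpath (fun t => W' t w).
Hypothesis mW' : forall t : R, 0 <= t -> measurable_fun setT (W' t).
Hypothesis W'0 : {ae P', forall w, W' 0 w = 0}.
Hypothesis mG : forall l, exists N1 : nat, forall N i, (N1 <= N)%N -> (i < l * 2 ^ l)%N ->
  measurable_fun setT (@G N l i).
Hypothesis fdd : forall l (phi : (nat -> R) -> R) (L M : R), 0 <= L ->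
  coord_lipschitz (l * 2 ^ l) L phi -> (forall x, `|phi x| <= M) ->
  forall e : R, 0 < e -> exists N0 : nat, forall N, (N0 <= N)%N ->
    `|Ex (P N) (fun w => phi (fun i => @G N l i w)) -
      Ex P' (fun w => phi (fun i => W' (grid l i.+1) w - W' (grid l i) w))| <= e.
Hypothesis close : forall (e T : R), 0 < e -> 0 <= T ->
  exists l0 : nat, forall l, (l0 <= l)%N -> exists N0 : nat, forall N, (N0 <= N)%N ->
  exists B : set (Om N), [/\ measurable B, (P N B <= e%:E)%E &
    forall w, ~ B w -> forall t, 0 <= t <= T ->
      `|@W N t w - stepv l (psum (fun i => @G N l i w)) t| <= e].

Let grid0 l i : 0 <= grid l i :> R.
Proof. by rewrite /grid divr_ge0// exprn_ge0. Qed.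

(** One direction is proved, where it helps that the inf-convolution lies below [Th] for every [N];
    the other follows by applying this to [- Th]. The degree [k] and the level [l] are fixed before
    [N] is taken large. *)
Lemma weak_lower (e : R) : 0 < e -> exists N0 : nat, forall N, (N0 <= N)%N ->
  Ex P' (fun w => Th (fun t => W' t w)) - e <= Ex (P N) (fun w => Th (fun t => @W N t w)).
Proof.
move=> e0; pose e4 := e / 4; have e40 : 0 < e4 by rewrite divr_gt0.
have [_ _ /cvgrPdist_le/(_ _ e40)[n _ hn]] := Ex_infc_cvg P' cW' mW'.
have {hn} := hn n (leqnn n); rewrite /=; set k : R := n%:R => hn.
have k0 : 0 <= k by exact: ler0n.
have [_ _ /cvgrPdist_le/(_ _ e40)[l1 _ hl1]] := Ex_infc_step P' cW' mW' k0.
(* On the good event the two values differ by at most [k * a]; on the bad one, of probability at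
   most [a], by at most [2 (K + k)]. This [q] makes the total at most [e / 4]. *)
pose q := 3 * k + 2 * K + 1.
have q0 : 0 < q by rewrite ltr_wpDl// addr_ge0// mulr_ge0.
pose a := e4 / q; have a0 : 0 < a by rewrite divr_gt0.
have ai : 0 <= a^-1 by rewrite invr_ge0 ltW.
have [l0 hl0] := close a0 ai.
pose l := maxn l0 l1.
have [N2 hN2] := hl0 l (leq_maxl _ _).
pose phi v := infc Th k (stepv l (psum v)).
have phiL : coord_lipschitz (l * 2 ^ l) k phi.
  move=> v v'; apply: le_trans (infc_lip ThK _ _ k0) _.
  by rewrite ler_wpM2l// stepv_psum_dist.
have phiK v : `|phi v| <= K + k by exact: infc_bound.
have [N3 hN3] := fdd k0 phiL phiK e40.
have [N4 hN4] := mG l.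
exists (maxn (maxn N2 N3) (maxn N4 1)) => N.
rewrite !geq_max => /andP[/andP[NN2 NN3] /andP[NN4 NN1]].
have [B [mB PB hB]] := hN2 N NN2.
have [_ iTh _] := Ex_infc_cvg (P N) (fun w => @cW N w NN1) (fun t => @mW N t NN1).
have [_ iIn _] := Ex_infc_step (P N) (fun w => @cW N w NN1) (fun t => @mW N t NN1) k0.
have iphi : intg (P N) (fun w => phi (fun i => @G N l i w)).
  apply: (@intg_bd _ _ _ _ _ (K + k)) => [|w]; last exact: phiK.
  by apply: (measurable_coord_lipschitz k0 phiL phiK) => i il; exact: hN4.
have s1 : Ex (P N) (fun w => infc Th k (fun t => @W N t w)) <= Ex (P N) (fun w => Th (fun t => @W N t w)).
  by apply: Ex_le => // w; apply: (infc_le ThK k0); exact: cW.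
have s2 : `|Ex (P N) (fun w => infc Th k (fun t => @W N t w)) - Ex (P N) (fun w => phi (fun i => @G N l i w))| <= e4.
  have ka : 0 <= k * a by rewrite mulr_ge0// ltW.
  apply: le_trans (Ex_close (a := k * a) (K := 2 * (K + k)) (B := B) (c := a) _ _ mB PB iIn iphi _ _) _ => //.
  - by rewrite mulr_ge0// addr_ge0.
  - move=> w; apply: le_trans (ler_normB _ _) _.
    have := infc_bound ThK (fun t => @W N t w) k0.
    by have := phiK (fun i => @G N l i w); lra.
  - move=> w Bw; apply: le_trans (infc_lip ThK _ _ k0) _; rewrite ler_wpM2l//.
    apply: le_trans (ucdist_le_on ai (hB w Bw)) _.
    have T1 : 0 < 1 + a^-1 by rewrite ltr_pwDl.
    by rewrite ge_max lexx/= invf_ple ?posrE// lerDr.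
  - have -> : e4 = a * q by rewrite /a divfK// gt_eqF.
    by rewrite /q; lra.
have s3 := hN3 N NN3.
(* Increments sum to grid values because the limit path starts at 0 almost surely. *)
have s4 : Ex P' (fun w => phi (fun i => W' (grid l i.+1) w - W' (grid l i) w)) =
    Ex P' (fun w => infc Th k (stepv l (fun i => W' (grid l i) w))).
  apply: Ex_ae_eq.
  - apply: (measurable_coord_lipschitz k0 phiL phiK) => i il.
    by apply: measurable_funB; exact: mW'.
  - exact: measurable_infc_step.
  apply: filterS W'0 => w w0; rewrite /phi; congr infc; apply/funext => t; rewrite /stepv.
  move: (minn _ _) => m; rewrite /psum; elim: m => [|m ih].
    by rewrite big_ord0 /grid mul0r w0.
  by rewrite big_ord_recr/= ih; ring.
have s5 := hl1 l (leq_maxr _ _).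
rewrite s4 in s3.
exact: (chain_lower s1 s2 s3 s5 hn).
Qed.

End WeakConvergence.
End Functional.
End StepPaths.

(** * Dyadic chaining *)

Section UnionBounds.
Context d (T : measurableType d) (R : realType) (P : probability T R).

Lemma prob_bigcup_le (A : nat -> set T) (a : nat -> R) (c : R) :
  (forall i, measurable (A i)) -> (forall i, (P (A i) <= (a i)%:E)%E) ->
  (forall n, \sum_(i < n) a i <= c) -> (P (\bigcup_n A n) <= c%:E)%E.
Proof.
move=> mA PA ac; apply: le_trans (generalized_Boole_inequality P mA (bigcupT_measurable _ mA)) _.
apply: lime_le.
  by apply: is_cvg_nneseries => n _ _; exact: measure_ge0.
apply: nearW => n; apply: (@le_trans _ _ (\sum_(0 <= i < n) (a i)%:E)%E).
  by apply: lee_sum => i _; exact: PA.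
by rewrite sumEFin lee_fin big_mkord.
Qed.

Lemma prob_bigcup_lt (n : nat) (A : nat -> set T) (a c : R) :
  (forall i, (i < n)%N -> measurable (A i)) ->
  (forall i, (i < n)%N -> (P (A i) <= a%:E)%E) -> n%:R * a <= c ->
  (P (\bigcup_(i < n) A i) <= c%:E)%E.
Proof.
move=> mA PA ac; rewrite bigcup_mkord.
apply: le_trans (Boole_inequality P mA) _.
apply: (@le_trans _ _ (\sum_(i < n) a%:E)%E).
  by apply: lee_sum => i _; exact: PA.
by rewrite sumEFin lee_fin sumr_const card_ord -mulr_natl.
Qed.

Lemma prob_setU_le (A B : set T) (a b : R) : measurable A -> measurable B ->
  (P A <= a%:E)%E -> (P B <= b%:E)%E -> (P (A `|` B) <= (a + b)%:E)%E.
Proof.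
move=> mA mB PA PB; rewrite EFinD.
exact: le_trans (measureU2 P mA mB) (leeD PA PB).
Qed.

Lemma prob_le (A B : set T) (c : R) : measurable A -> measurable B -> A `<=` B ->
  (P B <= c%:E)%E -> (P A <= c%:E)%E.
Proof. by move=> mA mB AB; apply: le_trans; exact: le_measure (mem_set mA) (mem_set mB) AB. Qed.

End UnionBounds.

Section DyadicPaths.
Context {R : realType}.
Implicit Types (x : R -> R).

Lemma grid_trunc (l : nat) (t : R) : 0 <= t ->
  grid l (Num.truncn (t * 2 ^+ l)) <= t < grid l (Num.truncn (t * 2 ^+ l)).+1.
Proof.
move=> t0; have p0 : 0 < 2 ^+ l :> R by exact: exprn_gt0.
have /truncn_itv : 0 <= t * 2 ^+ l by rewrite mulr_ge0// ltW.
by rewrite /grid ler_pdivrMr// ltr_pdivlMr.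
Qed.

Lemma grid_trunc_succ (k : nat) (t : R) : 0 <= t ->
  let i := Num.truncn (t * 2 ^+ k) in
  Num.truncn (t * 2 ^+ k.+1) = i.*2 \/ Num.truncn (t * 2 ^+ k.+1) = i.*2.+1.
Proof.
move=> t0 i; have p0 : 0 < 2 ^+ k :> R by exact: exprn_gt0.
have h0 : 0 <= t * 2 ^+ k by rewrite mulr_ge0// ltW.
have /andP[a b] := truncn_itv h0; rewrite -/i in a b.
have e : t * 2 ^+ k.+1 = 2 * (t * 2 ^+ k) by rewrite exprS; ring.
case: (ltP (2 * (t * 2 ^+ k)) i.*2.+1%:R) => h; [left|right].
  by apply: truncn_def; rewrite e h andbT -muln2 natrM mulrC ler_pM2l.
apply: truncn_def; rewrite e h /=.
by rewrite -doubleS -muln2 natrM [ltRHS]mulrC ltr_pM2l.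
Qed.

Lemma grid_double k i : grid k.+1 i.*2 = grid k i :> R.
Proof.
rewrite /grid -muln2 natrM exprS invfM mulrA; congr (_ / _).
by rewrite mulfK// pnatr_eq0.
Qed.

(** The dyadic floor of [t] moves by at most one grid step from each level to the next, so the
    increments telescope to a geometric series with sum [b / (1 - b) = 9] times [b^l], for
    [b = 9/10]; path continuity passes to [t] itself. *)
Lemma dyadic_path_modulus x (a : R) (l T : nat) : cpath x -> 0 <= a ->
  (forall k i, (l <= k)%N -> (i < T * 2 ^ k)%N -> `|x (grid k i.+1) - x (grid k i)| <= a * (9 / 10) ^+ k) ->
  forall t : R, 0 <= t -> t <= T%:R ->
  `|x t - x (grid l (Num.truncn (t * 2 ^+ l)))| <= 9 * a * (9 / 10) ^+ l.
Proof.
move=> cx a0 hx t t0; set b : R := 9 / 10.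
have b0 : 0 <= b by rewrite divr_ge0.
(* The endpoint [T] is a grid point at every level. It is set apart because the increment to the
   right of it is not covered by the bound. *)
rewrite le_eqVlt => /orP[/eqP ->|tT].
  have -> : T%:R * 2 ^+ l = (T * 2 ^ l)%:R :> R by rewrite natrM natrX.
  rewrite natrK /grid natrM natrX mulfK ?expf_neq0// subrr normr0.
  by rewrite !mulr_ge0// exprn_ge0.
pose tk k := grid k (Num.truncn (t * 2 ^+ k)) : R.
have step k : (l <= k)%N -> `|x (tk k.+1) - x (tk k)| <= a * b ^+ k.+1.
  move=> lk; rewrite /tk.
  have [->|e] := grid_trunc_succ k t0.
    by rewrite grid_double subrr normr0 mulr_ge0// exprn_ge0.
  rewrite e -(grid_double k); apply: hx; first exact: leqW.
  rewrite -(ltr_nat R) natrM natrX; apply: (@lt_le_trans _ _ (t * 2 ^+ k.+1)); last first.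
    by rewrite ler_wpM2r ?exprn_ge0// ltW.
  apply: (@lt_le_trans _ _ (Num.truncn (t * 2 ^+ k.+1))%:R); first by rewrite e ltr_nat.
  by rewrite truncn_le mulr_ge0// exprn_ge0.
have tele m : `|x (tk (l + m)%N) - x (tk l)| <= 9 * a * b ^+ l - 9 * a * b ^+ (l + m).
  elim: m => [|m ih]; first by rewrite addn0 !subrr normr0.
  have -> : x (tk (l + m.+1)%N) - x (tk l) =
    (x (tk (l + m).+1) - x (tk (l + m)%N)) + (x (tk (l + m)%N) - x (tk l)) by rewrite addnS; ring.
  apply: le_trans (ler_normD _ _) _; apply: le_trans (lerD (step _ (leq_addr _ _)) ih) _.
  rewrite addnS exprS /b; lra.
apply/ler_addgt0Pl => e e0.
have [r r0 hr] := (cpathP x).1 cx t t0 e e0.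
pose m := (Num.truncn r^-1).+1.
have p0 : 0 < 2 ^+ (l + m) :> R by exact: exprn_gt0.
have pm : (2 ^+ (l + m))^-1 < r.
  rewrite invf_plt ?posrE//; apply: lt_le_trans (truncnS_gt _) _.
  by rewrite -natrX ler_nat; apply: leq_trans (leq_addl l m) _; exact/ltnW/ltn_expl.
have /andP[g1 g2] := grid_trunc (l + m) t0; rewrite -/(tk _) in g1.
have := hr (tk (l + m)%N).
have -> : 0 <= tk (l + m)%N by rewrite /tk /grid divr_ge0// ltW.
have -> : `|tk (l + m)%N - t| < r.
  rewrite distrC ger0_norm ?subr_ge0//; apply: lt_trans pm.
  by move: g2; rewrite {1}/grid -natr1 mulrDl mul1r -/(grid _ _) -/(tk _); lra.
move=> /(_ isT isT); have := tele m.
have : 0 <= 9 * a * b ^+ (l + m) by rewrite !mulr_ge0// exprn_ge0.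
have -> : x t - x (grid l (Num.truncn (t * 2 ^+ l))) =
  (x (tk (l + m)%N) - x (tk l)) - (x (tk (l + m)%N) - x t) by rewrite /tk; ring.
move=> h1 h2 h3; apply: le_trans (ler_normB _ _) _; lra.
Qed.

End DyadicPaths.

Section Chaining.
Context d (T : measurableType d) (R : realType) (P : probability T R).

(** Kolmogorov's argument. The union bound at level [k] is [K H / a^4] times [(1 / (2 b^4))^k] with
    [b = 9/10]; since [1 / (2 b^4) < 4/5], the sum over levels from [l] on is at most [5 (4/5)^l]
    times that constant. *)
Lemma chaining (U : R -> T -> R) (K : R) (H : nat) :
  0 <= K -> (forall w, cpath (U ^~ w)) ->
  (forall t : R, 0 <= t -> measurable_fun setT (U t)) ->
  (forall k i (c : R), (i < H * 2 ^ k)%N -> 0 < c ->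
    (P [set w | (c <= `|U (grid k i.+1) w - U (grid k i) w|)%R] <= (K * 4 ^- k / c ^+ 4)%:E)%E) ->
  forall (a : R) (l : nat), 0 < a ->
  exists B : set T, [/\ measurable B,
    (P B <= (5 * K * H%:R / a ^+ 4 * (4 / 5) ^+ l)%:E)%E &
    forall w, ~ B w ->
    (forall i, (i < H * 2 ^ l)%N -> `|U (grid l i.+1) w - U (grid l i) w| <= a * (9 / 10) ^+ l) /\
    forall t : R, 0 <= t -> t <= H%:R ->
      `|U t w - U (grid l (Num.truncn (t * 2 ^+ l))) w| <= 9 * a * (9 / 10) ^+ l].
Proof.
move=> K0 cU mU tail a l a0; set b : R := 9 / 10.
have b0 : 0 < b by rewrite divr_gt0.
pose E k i := [set w | (a * b ^+ k <= `|U (grid k i.+1) w - U (grid k i) w|)%R].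
have g0 k i : 0 <= grid k i :> R by rewrite /grid divr_ge0// exprn_ge0.
have mE k i : measurable (E k i).
  rewrite -[X in measurable X]setTI; apply: measurable_fun_le => //.
  apply: measurableT_comp => //; apply: measurable_funB; exact: mU.
pose A k := \bigcup_(i < H * 2 ^ (l + k)) E (l + k)%N i.
have mA k : measurable (A k) by rewrite /A; exact: bigcup_measurable.
pose x : R := 4 / 5.
pose c0 := K * H%:R / a ^+ 4 * x ^+ l.
have c00 : 0 <= c0 by rewrite /c0 !mulr_ge0// ?invr_ge0 ?exprn_ge0 ?divr_ge0// ltW.
exists (\bigcup_k A k); split.
- exact: bigcupT_measurable.
- apply: (@prob_bigcup_le _ _ _ P A (fun k => c0 * x ^+ k)) => // [k|n]; last first.
    rewrite -mulr_sumr.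
    have -> : 5 * K * H%:R / a ^+ 4 * x ^+ l = c0 * 5 by rewrite /c0; ring.
    rewrite ler_wpM2l//.
    suff -> : \sum_(i < n) x ^+ i = 5 - 5 * x ^+ n.
      by rewrite lerBlDr lerDl mulr_ge0// exprn_ge0// divr_ge0.
    elim: n => [|n ih]; first by rewrite big_ord0 expr0; ring.
    by rewrite big_ord_recr/= ih exprS /x; field.
  apply: (@prob_bigcup_lt _ _ _ P _ _ (K * 4 ^- (l + k) / (a * b ^+ (l + k)) ^+ 4)) => [i _|i iH|].
  + exact: mE.
  + by apply: tail => //; rewrite mulr_gt0// exprn_gt0.
  rewrite /c0 natrM natrX.
  set j := (l + k)%N.
  have -> : K * H%:R / a ^+ 4 * x ^+ l * x ^+ k = K * H%:R / a ^+ 4 * x ^+ j.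
    by rewrite /j exprD; ring.
  have -> : H%:R * 2 ^+ j * (K * 4 ^- j / (a * b ^+ j) ^+ 4) =
    K * H%:R / a ^+ 4 * (2 ^+ j * 4 ^- j / (b ^+ j) ^+ 4).
    by rewrite exprMn; field; rewrite ?expf_neq0 ?gt_eqF.
  rewrite ler_wpM2l ?mulr_ge0 ?invr_ge0 ?exprn_ge0 ?(ltW a0)//.
  have -> : 2 ^+ j * 4 ^- j / (b ^+ j) ^+ 4 = (2 / 4 / b ^+ 4) ^+ j.
    have -> : (b ^+ j) ^+ 4 = (b ^+ 4) ^+ j by rewrite -!exprM mulnC.
    by rewrite -(expr_div_n 2 4) -expr_div_n.
  rewrite lerXn2r ?nnegrE ?mulr_ge0 ?invr_ge0 ?exprn_ge0 ?(ltW b0)//.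
  rewrite /x /b; lra.
move=> w Bw.
have hE k i : (l <= k)%N -> (i < H * 2 ^ k)%N -> `|U (grid k i.+1) w - U (grid k i) w| <= a * b ^+ k.
  move=> lk iH; rewrite leNgt; apply/negP => h; apply: Bw; exists (k - l)%N => //.
  by rewrite /A subnKC//; exists i => //; exact: ltW.
split=> [i iH|t t0 tH]; first exact: hE.
by apply: (@dyadic_path_modulus _ (U ^~ w) a l H) => //; exact: ltW.
Qed.

End Chaining.

(** * Discrete martingales *)

Section DiscreteMartingale.
Context d (T : measurableType d) (R : realType) (P : probability T R).
Local Notation Ex := (Ex P).
Local Notation intg := (intg P).

(** Conditional moments are stated by duality against [A k]-measurable weights. The weights are
    integrable rather than bounded because the fourth-moment bound uses powers of earlier block sums
    as weights. [q] is the conditional variance per unit time. *)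
Record martingale_increments (A : nat -> set (set T)) (s q : nat -> T -> R)
    (tau C v4 : R) : Prop := MartingaleIncrements {
  mi_sigma : forall k, sigma_algebra setT (A k);
  mi_meas : forall k, A k `<=` measurable;
  mi_incr : forall k, A k `<=` A k.+1;
  mi_smeas : forall k, smeas (A k.+1) (s k);
  mi_L4 : forall k, L4 P (s k);
  mi_fourth : forall k, Ex (fun w => s k w ^+ 4) <= v4 * tau;
  mi_centered : forall k H, smeas (A k) H -> intg H -> intg (fun w => H w * s k w) ->
    Ex (fun w => H w * s k w) = 0;
  mi_rate_smeas : forall k, smeas (A k) (q k);
  mi_rate_le : forall k w, `|q k w| <= C;
  mi_square : forall k H, smeas (A k) H -> intg H -> intg (fun w => H w * s k w ^+ 2) ->
    Ex (fun w => H w * s k w ^+ 2) = tau * Ex (fun w => H w * q k w) }.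

Definition block (s : nat -> T -> R) (a b : nat) (w : T) : R := \sum_(a <= k < b) s k w.

Variables (A : nat -> set (set T)) (s q : nat -> T -> R) (tau C v4 : R).
Hypothesis mi : martingale_increments A s q tau C v4.
Hypotheses (tau0 : 0 <= tau) (v40 : 0 <= v4).

Let C0 : 0 <= C.
Proof. exact: le_trans (mi_rate_le mi 0%N point). Qed.

Let mA k : A k `<=` measurable.
Proof. by move=> G; apply: (mi_meas mi). Qed.

Let mi_smeas_meas k (f : T -> R) : smeas (A k) f -> measurable_fun setT f.
Proof. exact: smeas_meas (@mA k). Qed.

Lemma mi_mono a b : (a <= b)%N -> A a `<=` A b.
Proof.
move=> /subnK <-; elim: (b - a)%N => // n ih G /ih; exact: (mi_incr mi).
Qed.

Lemma block_recr a n w : block s a (a + n.+1) w = block s a (a + n) w + s (a + n)%N w.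
Proof. by rewrite /block addnS big_nat_recr//= leq_addr. Qed.

Lemma block0 a w : block s a a w = 0.
Proof. by rewrite /block big_geq. Qed.

Lemma smeas_block a b : (a <= b)%N -> smeas (A b) (block s a b).
Proof.
move=> /subnKC <-; elim: (b - a)%N => [|n ih].
  rewrite addn0; rewrite (_ : block s a a = fun=> 0); first exact: measurable_cst.
  by apply/funext => w; rewrite block0.
rewrite (_ : block s a _ = fun w => block s a (a + n) w + s (a + n)%N w); last first.
  by apply/funext => w; rewrite block_recr.
apply: (@measurable_funD _ (g_sigma_algebraType (A (a + n.+1)%N))).
  by apply: smeas_sub ih; apply: mi_mono; rewrite leq_add2l.
by rewrite addnS; exact: (mi_smeas mi).
Qed.

Lemma L4_block a b : L4 P (block s a b).
Proof. by apply: L4_sum => k; exact: (mi_L4 mi). Qed.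

Let bd_intg a (eta : T -> R) (K : R) : smeas (A a) eta -> (forall w, `|eta w| <= K) -> intg eta.
Proof. by move=> /mi_smeas_meas m b; exact: intg_bd m b. Qed.

Let bd_intgM a (eta f : T -> R) (K : R) : smeas (A a) eta -> (forall w, `|eta w| <= K) -> intg f ->
  intg (fun w => eta w * f w).
Proof. by move=> /mi_smeas_meas m b; exact: intg_mulbd m b. Qed.

Lemma block_centered a b (eta : T -> R) (K : R) : smeas (A a) eta -> (forall w, `|eta w| <= K) ->
  Ex (fun w => eta w * block s a b w) = 0.
Proof.
move=> me bd; have is' k : intg (fun w => eta w * s k w).
  by apply: (bd_intgM me bd); exact: L4_intg (mi_L4 mi k).
rewrite (@Ex_eq _ _ _ _ _ (fun w => \sum_(k <- index_iota a b) eta w * s k w)); last first.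
  by move=> w; rewrite /block mulr_sumr.
rewrite Ex_sum// big_nat big1// => k /andP[ak kb]; apply: (mi_centered mi) => //.
  by apply: smeas_sub me; exact: mi_mono.
exact: bd_intg me bd.
Qed.

Lemma block_square a n (eta : T -> R) (K : R) : smeas (A a) eta -> (forall w, `|eta w| <= K) ->
  Ex (fun w => eta w * block s a (a + n) w ^+ 2) =
  tau * \sum_(a <= k < a + n) Ex (fun w => eta w * q k w).
Proof.
move=> me bd; elim: n => [|n ih].
  rewrite addn0 big_geq// mulr0 -[RHS](Ex_cst P); apply: Ex_eq => w.
  by rewrite block0 expr0n/= mulr0.
set D := block s a (a + n).
have LD : L4 P D by exact: L4_block.
have Ls := mi_L4 mi (a + n)%N.
have me' : smeas (A (a + n)%N) eta by apply: smeas_sub me; apply: mi_mono; exact: leq_addr.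
have mD : smeas (A (a + n)%N) D by apply: smeas_block; exact: leq_addr.
have i1 : intg (fun w => eta w * D w ^+ 2) by apply: (bd_intgM me bd); exact: L4_intg2.
have iD : intg (fun w => eta w * D w) by apply: (bd_intgM me bd); exact: L4_intg.
have i2 : intg (fun w => eta w * D w * s (a + n)%N w).
  apply: (@intg_eq _ _ _ _ (fun w => eta w * (D w * s (a + n)%N w))); first by move=> w; rewrite mulrA.
  by apply: (bd_intgM me bd); exact: L4_prod2.
have i3 : intg (fun w => eta w * s (a + n)%N w ^+ 2).
  by apply: (bd_intgM me bd); exact: L4_intg2.
rewrite (@Ex_eq _ _ _ _ _ (fun w => eta w * D w ^+ 2 + (2 * (eta w * D w * s (a + n)%N w) +
  eta w * s (a + n)%N w ^+ 2))); last by move=> w; rewrite block_recr -/D; ring.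
rewrite ExD//; last by apply: intgD => //; exact: intgZ.
rewrite ExD//; last exact: intgZ.
rewrite ExZ// ih (mi_centered mi)//; last first.
  exact: (@measurable_funM _ (g_sigma_algebraType (A (a + n)%N))).
rewrite (mi_square mi)//; last exact: bd_intg me bd.
by rewrite addnS big_nat_recr ?leq_addr//= mulr0 add0r mulrDr.
Qed.

Lemma block_square_le a n : Ex (fun w => block s a (a + n) w ^+ 2) <= C * (tau * n%:R).
Proof.
have m1 : smeas (A a) (fun=> 1 : R) by exact: measurable_cst.
have b1 (w : T) : `|1 : R| <= 1 by rewrite normr1.
have := block_square n m1 b1.
rewrite (@Ex_eq _ _ _ _ _ (fun w => block s a (a + n) w ^+ 2)); last by move=> w; rewrite mul1r.
move=> ->; rewrite mulrCA ler_wpM2l//.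
apply: (@le_trans _ _ (\sum_(a <= k < a + n) C)); last by rewrite sumr_const_nat addKn mulr_natr.
apply: ler_sum => k _; apply: le_trans (ler_norm _) _; apply: Ex_bd.
  by apply: (@bd_intg k _ C) => [|w]; rewrite ?mul1r; [under eq_fun do rewrite mul1r; exact: (mi_rate_smeas mi)|exact: (mi_rate_le mi)].
by move=> w; rewrite mul1r; exact: (mi_rate_le mi).
Qed.

(** The term cubic in the new increment is absorbed by [(D + s)^4 <= D^4 + 4 D^3 s + 8 D^2 s^2 + 3
    s^4], the gap being [2 s^2 (D - s)^2]. The term [D^3 s] is centred, and the mean of [D^2 s^2] is
    at most [C^2 tau^2 n], whose sum over [n] gives the square. *)
Lemma block_fourth_le a n : Ex (fun w => block s a (a + n) w ^+ 4) <=
  4 * C ^+ 2 * (tau * n%:R) ^+ 2 + 3 * v4 * (tau * n%:R).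
Proof.
elim: n => [|n ih].
  rewrite addn0 (@Ex_eq _ _ _ _ _ (fun=> 0)); last by move=> w; rewrite block0 expr0n.
  by rewrite Ex_cst !mulr0 expr0n/= mulr0 add0r.
set D := block s a (a + n) in ih *; set k := (a + n)%N.
have LD : L4 P D by exact: L4_block.
have Ls := mi_L4 mi k.
have mD : smeas (A k) D by apply: smeas_block; exact: leq_addr.
have mM (f g : T -> R) : smeas (A k) f -> smeas (A k) g -> smeas (A k) (fun w => f w * g w).
  exact: (@measurable_funM _ (g_sigma_algebraType (A k))).
have i4 : intg (fun w => D w ^+ 4) by case: LD.
have j4 : intg (fun w => s k w ^+ 4) by case: Ls.
have i31 : intg (fun w => D w * D w * D w * s k w) by exact: intg_prod4.
have i3 : intg (fun w => D w * D w * D w) by exact: L4_prod3.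
have i22 : intg (fun w => D w * D w * s k w ^+ 2).
  apply: (@intg_eq _ _ _ _ (fun w => D w * D w * s k w * s k w)); last exact: intg_prod4.
  by move=> w; ring.
have i2 : intg (fun w => D w * D w) by exact: L4_prod2.
have iq : intg (fun w => q k w * (D w * D w)).
  apply: (intg_mulbd _ (mi_rate_le mi k)) => //.
  by apply: (@mi_smeas_meas k); apply: (mi_rate_smeas mi).
apply: (@le_trans _ _ (Ex (fun w => D w ^+ 4 + (4 * (D w * D w * D w * s k w) +
   (8 * (D w * D w * s k w ^+ 2) + 3 * s k w ^+ 4))))).
  apply: Ex_le.
  - by have [] := L4_block a (a + n.+1).
  - by apply: intgD => //; apply: intgD; [exact: intgZ|apply: intgD; exact: intgZ].
  move=> w; rewrite block_recr -/D -/k -subr_ge0.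
  rewrite (_ : _ - _ = 2 * (s k w * (D w - s k w)) ^+ 2); last by ring.
  by rewrite mulr_ge0// sqr_ge0.
rewrite ExD//; last by apply: intgD; [exact: intgZ|apply: intgD; exact: intgZ].
rewrite ExD; [|exact: intgZ|by apply: intgD; exact: intgZ].
rewrite ExD; [|exact: intgZ|exact: intgZ].
have mDD : smeas (A k) (fun w => D w * D w) by exact: mM.
have mDDD : smeas (A k) (fun w => D w * D w * D w) by exact: mM.
rewrite (ExZ _ i31) (ExZ _ i22) (ExZ _ j4).
rewrite (mi_centered mi mDDD i3 i31) (mi_square mi mDD i2 i22).
have sq : Ex (fun w => D w * D w * q k w) <= C * (C * (tau * n%:R)).
  apply: (@le_trans _ _ (C * Ex (fun w => D w ^+ 2))); last first.
    by rewrite ler_wpM2l//; exact: block_square_le.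
  rewrite -ExZ; last exact: L4_intg2.
  apply: Ex_le.
  - by apply: intg_eq iq => w; rewrite mulrC.
  - by apply: intgZ; exact: L4_intg2.
  move=> w; rewrite mulrC expr2 ler_wpM2r//; first by rewrite -expr2 sqr_ge0.
  exact: le_trans (ler_norm _) (mi_rate_le mi k w).
have := mi_fourth mi k.
have h1 : tau * Ex (fun w => D w * D w * q k w) <= tau * (C * (C * (tau * n%:R))).
  by rewrite ler_wpM2l.
have t2 : 0 <= 4 * C ^+ 2 * tau ^+ 2 by rewrite !mulr_ge0// sqr_ge0.
have -> : n.+1%:R = n%:R + 1 :> R by rewrite -natr1.
move: ih h1 t2.
set E1 := Ex _; set E2 := Ex _; set E3 := Ex _ => {}ih {}h1 {}t2 h2.
have -> : 4 * C ^+ 2 * (tau * (n%:R + 1)) ^+ 2 + 3 * v4 * (tau * (n%:R + 1)) =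
  (4 * C ^+ 2 * (tau * n%:R) ^+ 2 + 3 * v4 * (tau * n%:R)) + (8 * (tau * (C * (C * (tau * n%:R)))) +
   3 * (v4 * tau)) + 4 * C ^+ 2 * tau ^+ 2 by ring.
lra.
Qed.

(** The third moment is interpolated between the second and the fourth; [v4 <= t] makes the latter
    of order [t^2], so that everything is of order [t sqrt t]. *)
Lemma martingale_block_increment a n (v e : R) (t := tau * n%:R) :
  0 < t -> 1 <= C -> v4 <= t -> 0 <= v -> v <= C * t ->
  (4 * C ^+ 2 + C + 3) * (t * Num.sqrt t) <= e ->
  (forall (eta : T -> R) (K : R), smeas (A a) eta -> (forall w, `|eta w| <= K) ->
    `|tau * \sum_(a <= k < a + n) Ex (fun w => eta w * q k w) - v * Ex eta| <= K * e) ->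
  block_increment P (A a) (block s a (a + n)) v e.
Proof.
move=> t0 C1 v4t v0 vC te var.
have r0 : 0 < Num.sqrt t by rewrite sqrtr_gt0.
have rt : Num.sqrt t ^+ 2 = t by rewrite sqr_sqrtr// ltW.
have tr0 : 0 <= t * Num.sqrt t by rewrite mulr_ge0// ltW.
have LD := L4_block a (a + n).
split => //.
- by move=> eta K me bd; exact: block_centered bd.
- by move=> eta K me bd; rewrite (block_square n me bd); exact: var.
split.
  have [mD i4] := LD; have i2 := L4_intg2 LD.
  set D := block s a (a + n) in mD i4 i2 *.
  (* Arithmetic-geometric mean: [2 |D|^3 <= sqrt t D^2 + D^4 / sqrt t]. *)
  apply: (@le_trans _ _ (Ex (fun w => 2^-1 * Num.sqrt t * D w ^+ 2 + (2 * Num.sqrt t)^-1 * D w ^+ 4))).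
    apply: Ex_le.
    - apply: (@intg_eq _ _ _ _ (fun w => `|D w ^+ 3|)); first by move=> w; rewrite normrX.
      by apply: intg_abs; exact: L4_intg3.
    - by apply: intgD; exact: intgZ.
    move=> w; rewrite -(@ler_pM2l _ (2 * Num.sqrt t)) ?mulr_gt0//.
    have -> : D w ^+ 2 = `|D w| ^+ 2 by rewrite real_normK ?num_real.
    have -> : D w ^+ 4 = `|D w| ^+ 4.
      rewrite (_ : `|D w| ^+ 4 = (`|D w| ^+ 2) ^+ 2); last by rewrite -exprM.
      by rewrite real_normK ?num_real// -exprM.
    set x := `|D w|; rewrite -subr_ge0.
    have -> : 2 * Num.sqrt t * (2^-1 * Num.sqrt t * x ^+ 2 + (2 * Num.sqrt t)^-1 * x ^+ 4) -
      2 * Num.sqrt t * x ^+ 3 = x ^+ 2 * (Num.sqrt t - x) ^+ 2 by field; rewrite gt_eqF.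
    by rewrite mulr_ge0// sqr_ge0.
  rewrite ExD; [|exact: intgZ|exact: intgZ].
  rewrite !ExZ//.
  have e2 := block_square_le a n; have e4 := block_fourth_le a n.
  rewrite -/t -/D in e2 e4.
  have b2 : 2^-1 * Num.sqrt t * Ex (fun w => D w ^+ 2) <= 2^-1 * Num.sqrt t * (C * t).
    by rewrite ler_wpM2l// mulr_ge0// ltW.
  have b4 : (2 * Num.sqrt t)^-1 * Ex (fun w => D w ^+ 4) <= (2 * Num.sqrt t)^-1 * (4 * C ^+ 2 * t ^+ 2 + 3 * t * t).
    rewrite ler_wpM2l ?invr_ge0 ?mulr_ge0 ?(ltW r0)//; apply: le_trans e4 _.
    by rewrite lerD2l ler_wpM2r ?(ltW t0)// ler_wpM2l.
  apply: le_trans (lerD b2 b4) _; apply: le_trans te.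
  have -> : 2^-1 * Num.sqrt t * (C * t) + (2 * Num.sqrt t)^-1 * (4 * C ^+ 2 * t ^+ 2 + 3 * t * t) =
    (2^-1 * C + 2 * C ^+ 2 + 3 / 2) * (t * Num.sqrt t).
    have E (x y : R) : 0 < x -> x ^+ 2 = y -> 2^-1 * x * (C * y) + (2 * x)^-1 * (4 * C ^+ 2 * y ^+ 2 + 3 * y * y) =
      (2^-1 * C + 2 * C ^+ 2 + 3 / 2) * (y * x) by move=> x0 <-; field; rewrite gt_eqF.
    exact: E.
  rewrite ler_wpM2r//; have : 0 <= C ^+ 2 by exact: sqr_ge0.
  lra.
apply: le_trans te.
have sv : Num.sqrt v <= C * Num.sqrt t.
  rewrite -(ler_pXn2r (_ : 0 < 2)%N) ?nnegrE ?sqrtr_ge0 ?mulr_ge0 ?(ltW r0)//.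
  rewrite sqr_sqrtr// exprMn rt; apply: le_trans vC _.
  by rewrite expr2 -mulrA ler_peMl// mulr_ge0// ltW.
have -> : Num.sqrt v ^+ 3 = v * Num.sqrt v by rewrite exprS sqr_sqrtr// mulrC.
apply: (@le_trans _ _ (C * t * (C * Num.sqrt t))); first by rewrite ler_pM// sqrtr_ge0.
have -> : C * t * (C * Num.sqrt t) = C ^+ 2 * (t * Num.sqrt t) by ring.
rewrite ler_wpM2r//; have : 0 <= C ^+ 2 by exact: sqr_ge0.
lra.
Qed.

Lemma block_tail a n (c : R) : 0 < c ->
  (P [set w | (c <= `|block s a (a + n) w|)%R] <=
    (c ^- 4 * (4 * C ^+ 2 * (tau * n%:R) ^+ 2 + 3 * v4 * (tau * n%:R)))%:E)%E.
Proof.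
move=> c0; apply: le_trans (Ex_markov4 c0 (L4_block a (a + n))) _.
rewrite lee_fin ler_wpM2l ?invr_ge0 ?exprn_ge0 ?(ltW c0)//; exact: block_fourth_le.
Qed.

End DiscreteMartingale.

(** * Conditioning on the past *)

Section PiLambda.
Context d (T : measurableType d) (R : realType) (P : probability T R).

Lemma indic_bigcup_cvg (F : nat -> set T) w : (forall m n, (m <= n)%N -> F m `<=` F n) ->
  (fun n => \1_(F n) w : R) @ \oo --> (\1_(\bigcup_n F n) w : R).
Proof.
move=> ndF; case: (pselect ((\bigcup_n F n) w)) => [[n0 _ Fw]|nw].
  apply: cvg_near_cst; exists n0 => // n /= n0n.
  rewrite !indicE !mem_set//; first by exists n0.
  exact: ndF Fw.
rewrite [X in _ --> X]indicE memNset//.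
apply: cvg_near_cst; apply: nearW => n; rewrite indicE memNset// => Fw.
by apply: nw; exists n.
Qed.

Lemma Ex_pi_lambda (G : set (set T)) (f g : T -> R) (K : R) :
  setI_closed G -> G setT -> G `<=` measurable ->
  measurable_fun setT f -> measurable_fun setT g ->
  (forall w, `|f w| <= K) -> (forall w, `|g w| <= K) ->
  (forall E, G E -> Ex P (fun w => \1_E w * f w) = Ex P (fun w => \1_E w * g w)) ->
  forall E, <<s G >> E -> Ex P (fun w => \1_E w * f w) = Ex P (fun w => \1_E w * g w).
Proof.
move=> GI GT Gm mf mg fK gK GE.
pose H := [set E | measurable E /\ Ex P (fun w => \1_E w * f w) = Ex P (fun w => \1_E w * g w)].
have jf := intg_bd P mf fK; have jg := intg_bd P mg gK.
suff : <<s G >> `<=` H by move=> h E /h [].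
apply: (lambda_system_subset GI) => //; last by move=> E GE'; split; [exact: Gm|exact: GE].
split.
- by move=> A _ w.
- by split; [exact: measurableT|exact: GE].
- move=> A B BA [mA hA] [mB hB]; split; first exact: measurableD.
  have D w : \1_(A `\` B) w = \1_A w - \1_B w :> R.
    rewrite !indicE; case: (boolP (w \in B)) => wB.
      have wA : w \in A by rewrite inE; apply: BA; rewrite inE in wB.
      by rewrite wA subrr memNset// => -[_]; rewrite inE in wB.
    rewrite subr0; congr (_%:R); rewrite notin_setE in wB.
    case: (pselect (A w)) => wA; first by rewrite !mem_set.
    by rewrite !memNset// => -[].
  have E h : intg P h -> Ex P (fun w => \1_(A `\` B) w * h w) =
      Ex P (fun w => \1_A w * h w) - Ex P (fun w => \1_B w * h w).
    move=> ih; rewrite -ExB; try exact: intg_indicM.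
    by apply: Ex_eq => w; rewrite D mulrBl.
  by rewrite !E// hA hB.
- move=> F ndF hF.
  have mF n : measurable (F n) by have [] := hF n.
  split; first exact: bigcupT_measurable.
  have nd m n : (m <= n)%N -> F m `<=` F n by move=> mn; apply/subsetPset/ndF.
  have C (h : T -> R) (mh : measurable_fun setT h) (hK : forall w, `|h w| <= K) :
      (fun n => Ex P (fun w => \1_(F n) w * h w)) @ \oo -->
      Ex P (fun w => \1_(\bigcup_n F n) w * h w).
    have [] // := @Ex_bounded_cvg _ T R P (fun n w => \1_(F n) w * h w)
      (fun w => \1_(\bigcup_n F n) w * h w) K.
    - by move=> n; apply: measurable_funM => //; exact: measurable_indic.
    - move=> n w; rewrite normrM -[leRHS]mul1r ler_pM//; exact: indic_le1.
    - by move=> w; apply: cvgMl; exact: indic_bigcup_cvg.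
  have E : (fun n => Ex P (fun w => \1_(F n) w * f w)) = (fun n => Ex P (fun w => \1_(F n) w * g w)).
    by apply/funext => n; have [] := hF n.
  have cf := C f mf fK; rewrite E in cf.
  exact: (cvg_unique _ cf (C g mg gK)).
Qed.

End PiLambda.

Lemma sigma_algebraI (T : Type) (A B : set (set T)) :
  sigma_algebra setT A -> sigma_algebra setT B -> sigma_algebra setT (A `&` B).
Proof.
move=> [A0 AC AU] [B0 BC BU]; split.
- by [].
- by move=> X [? ?]; split; [exact: AC|exact: BC].
- by move=> X hX; split; [apply: AU => n; have [] := hX n|apply: BU => n; have [] := hX n].
Qed.

Section MarkovPast.
Context {R : realType} {d : nat} {dO : measure_display} {Om : measurableType dO}.
Variables (P : probability Om R) (F : R -> set (set Om)) (B : R -> Om -> R).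
Variables (X : R -> Om -> 'I_d) (A : 'M[R]_d) (p0 : 'cV[R]_d) (tau : R).
Hypothesis fF : filtration F.
Hypothesis bB : brownian_motion P F B.
Hypothesis cX : markov_chain P A p0 X.
Hypothesis aX : adapted setT F X.
Hypothesis iXB : independent_processes P setT X borelR B.
Hypothesis tau0 : 0 < tau.

Local Notation Y k := (X (k%:R * tau)).
Let t0 k : 0 <= k%:R * tau. Proof. by rewrite mulr_ge0// ltW. Qed.

Definition grid_path (k : nat) (w : Om) : {ffun 'I_k.+1 -> 'I_d} := [ffun i : 'I_k.+1 => Y i w].

Definition past_rectangles (k : nat) : set (set Om) :=
  [set G | exists S E, sigma_process borelR B E /\ G = (grid_path k @^-1` S) `&` E].

(* Conditioning on the chain at grid times and on the whole Brownian path,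
   inside F: the first makes the chain step, the second makes the Brownian
   increment, independent of the past. *)
Definition past (k : nat) : set (set Om) := F (k%:R * tau) `&` <<s past_rectangles k >>.

Let mX t i : 0 <= t -> measurable (X t @^-1` [set i]).
Proof. by case: cX => h _ _ _; exact: h. Qed.

Lemma measurable_comp_finite (I : finType) (Z : Om -> I) (G : set (set Om)) (S : set I) :
  sigma_algebra setT G -> (forall i, G (Z @^-1` [set i])) -> G (Z @^-1` S).
Proof.
(* The finite union over values is written as a countable one through [unpickle], padded with empty
   sets, to match the axiom of sigma-algebras. *)
move=> sG GZ; have -> : Z @^-1` S = \bigcup_n
    (if unpickle n is Some i then if i \in S then Z @^-1` [set i] else set0 else set0).
  apply/seteqP; split=> [w Sw|w [n _]].
    by exists (pickle (Z w)) => //; rewrite pickleK mem_set.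
  case: unpickle => // i; case: ifPn => //; rewrite inE => Si /= ->; exact: Si.
have [G0 _ GU] := sG; apply: GU => n.
by case: unpickle => // i; case: ifPn => //.
Qed.

Lemma grid_path_measurable k S : measurable (grid_path k @^-1` S).
Proof.
apply: measurable_comp_finite; first exact: sigma_algebra_measurable.
move=> x; have -> : grid_path k @^-1` [set x] = \big[setI/setT]_(i < k.+1) (Y i @^-1` [set x (inord i)]).
  rewrite -(bigcap_mkord _ (fun i => Y i @^-1` [set x (inord i)])); apply/seteqP; split=> [w /= <- i /= ik|w /= h].
    by rewrite /= ffunE inordK.
  by apply/ffunP => i; rewrite ffunE; have := h i (ltn_ord i); rewrite /= inord_val.
by apply: bigsetI_measurable => i _; exact: mX.
Qed.

Let sBm : sigma_process borelR B `<=` measurable.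
Proof.
apply: smallest_sub; first exact: sigma_algebra_measurable.
move=> E [t /=]; rewrite in_itv/= andbT => t0' tE.
have [_ + _] := fF; apply; first exact: t0'.
by have [aB _ _ _] := bB; exact: aB t0' _ tE.
Qed.

Let rect_meas k : past_rectangles k `<=` measurable.
Proof.
move=> G [S [E [sE ->]]]; apply: measurableI; [exact: grid_path_measurable|exact: sBm].
Qed.

Let rectI k : setI_closed (past_rectangles k).
Proof.
move=> G1 G2 [S1 [E1 [sE1 ->]]] [S2 [E2 [sE2 ->]]]; exists (S1 `&` S2), (E1 `&` E2).
split; last by rewrite preimage_setI setIACA.
have [s0 sC sU] : sigma_algebra setT (sigma_process borelR B) by exact: smallest_sigma_algebra.
have cI : setI_closed (sigma_process borelR B).
  by have [] := (sigma_algebraP (fun _ _ => subsetT _)).1 (And3 s0 sC sU) => //.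
exact: cI.
Qed.


Let rectT k : past_rectangles k setT.
Proof.
exists setT, setT; split; last by rewrite preimage_setT setIT.
by have [] := (sigma_algebraP (fun _ _ => subsetT _)).1 (smallest_sigma_algebra setT
  (\bigcup_(t in `[0, +oo[) preimage_set_system setT (B t) borelR)).
Qed.

Lemma past_sigma k : sigma_algebra setT (past k).
Proof.
apply: sigma_algebraI; last exact: smallest_sigma_algebra.
by have [h _ _] := fF; exact: h.
Qed.

Lemma rectangles_measurable k : <<s past_rectangles k >> `<=` measurable.
Proof. by apply: smallest_sub; [exact: sigma_algebra_measurable|exact: rect_meas]. Qed.

Lemma past_measurable k : past k `<=` measurable.
Proof. by move=> G [_]; exact: rectangles_measurable. Qed.

Lemma past_mono k : past k `<=` past k.+1.
Proof.
have [_ _ Fm] := fF.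
move=> G [FG rG]; split.
  by apply: Fm FG => //; rewrite ler_wpM2r ?(ltW tau0)// ler_nat.
apply: sub_sigma_algebra2 rG => _ [S [E [sE ->]]].
exists [set x | S [ffun i : 'I_k.+1 => x (widen_ord (leqnSn _) i)]], E; split => //.
congr (_ `&` _); apply/seteqP; split => w /= => [Sw|].
  by rewrite (_ : [ffun _ => _] = grid_path k w)//; apply/ffunP => i; rewrite !ffunE.
by rewrite (_ : [ffun _ => _] = grid_path k w)//; apply/ffunP => i; rewrite !ffunE.
Qed.

Lemma chain_event_past k j i : (j <= k)%N -> past k (Y j @^-1` [set i]).
Proof.
move=> jk; split.
  have [_ _ Fm] := fF; have le : j%:R * tau <= k%:R * tau.
    by rewrite ler_wpM2r ?(ltW tau0)// ler_nat.
  apply: (Fm _ _ (t0 j) le); apply: aX => //.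
  by exists [set i] => //; rewrite setTI.
apply: sub_sigma_algebra; exists [set x | x (inord j) = i], setT; split.
  by have [_ [S [E [sE ET]]]] := (rectT k, rectT k); have [] := (sigma_algebraP (fun _ _ => subsetT _)).1
   (smallest_sigma_algebra setT (\bigcup_(t in `[0, +oo[) preimage_set_system setT (B t) borelR)).
by rewrite setIT; apply/seteqP; split => w /=; rewrite ffunE inordK.
Qed.

Lemma chain_past (u : 'I_d -> R) j k : (j <= k)%N -> smeas (past k) (fun w => u (Y j w)).
Proof.
move=> jk; apply/smeasP; first exact: past_sigma.
move=> E _; rewrite (_ : _ @^-1` E = Y j @^-1` (u @^-1` E))//.
apply: measurable_comp_finite; first exact: past_sigma.
by move=> i; exact: chain_event_past.
Qed.

Let sX_event t i : 0 <= t -> sigma_process setT X (X t @^-1` [set i]).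
Proof.
move=> t0'; apply: sub_sigma_algebra; exists t; first by rewrite /= in_itv/= t0'.
by exists [set i] => //; rewrite setTI.
Qed.

Let sXI : setI_closed (sigma_process setT X).
Proof. by have [] := (sigma_algebraP (fun _ _ => subsetT _)).1 (smallest_sigma_algebra setT
  (\bigcup_(t in `[0, +oo[) preimage_set_system setT (X t) setT)). Qed.

Let sX_path k x : sigma_process setT X (grid_path k @^-1` [set x]).
Proof.
have -> : grid_path k @^-1` [set x] = \big[setI/setT]_(i < k.+1) (Y i @^-1` [set x (inord i)]).
  rewrite -(bigcap_mkord _ (fun i => Y i @^-1` [set x (inord i)])); apply/seteqP; split=> [w /= <- i /= ik|w /= h].
    by rewrite /= ffunE inordK.
  by apply/ffunP => i; rewrite ffunE; have := h i (ltn_ord i); rewrite /= inord_val.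
apply: big_ind => [|G1 G2 h1 h2|i _].
- by have [] := (sigma_algebraP (fun _ _ => subsetT _)).1 (smallest_sigma_algebra setT
   (\bigcup_(t in `[0, +oo[) preimage_set_system setT (X t) setT)).
- exact: sXI.
- exact: sX_event.
Qed.

Local Notation pK := (expmx (tau *: A)).

Let markov_path k (x : {ffun 'I_k.+1 -> 'I_d}) j :
  P (grid_path k @^-1` [set x] `&` (Y k.+1 @^-1` [set j])) =
  (P (grid_path k @^-1` [set x]) * (pK (x ord_max) j)%:E)%E.
Proof.
pose x' n := if n == k.+1 then j else x (inord n).
have [_ _ _ mk] := cX.
have := mk k (fun n => n%:R * tau) x' _ _.
have -> : k.+1%:R * tau - k%:R * tau = tau by rewrite -natr1; ring.
have e1 : x' k = x ord_max.
  rewrite /x' ltn_eqF//; congr (x _); apply: val_inj; rewrite /= inordK//.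
have e2 : x' k.+1 = j by rewrite /x' eqxx.
have e3 : [set w | forall n, (n <= k)%N -> Y n w = x' n] = grid_path k @^-1` [set x].
  apply/seteqP; split => w /= h.
    apply/ffunP => i; have ik := ltn_ord i; rewrite ffunE (h i); last by rewrite -ltnS.
    by rewrite /x' ltn_eqF// inord_val.
  move=> n nk; rewrite /x' ltn_eqF; last by rewrite ltnS.
  by rewrite -h ffunE inordK.
have e4 : [set w | forall n, (n <= k.+1)%N -> Y n w = x' n] =
    grid_path k @^-1` [set x] `&` (Y k.+1 @^-1` [set j]).
  rewrite -e3; apply/seteqP; split => w /= h.
    by split; [move=> n nk; apply: h; exact: leqW|rewrite h].
  move=> n; rewrite leq_eqVlt ltnS => /orP[/eqP ->|]; last exact: h.1.
  by rewrite h.2 e2.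
rewrite e1 e2 e3 e4; apply; first exact: t0.
by move=> n _; rewrite ler_wpM2r ?(ltW tau0)// ler_nat.
Qed.

Let indicI (G1 G2 : set Om) w : \1_(G1 `&` G2) w = \1_G1 w * \1_G2 w :> R.
Proof. by rewrite indicI. Qed.

Let pK_bound : exists2 C : R, 0 <= C & forall i j, `|pK i j| <= C.
Proof.
exists (\sum_i \sum_j `|pK i j|); first by apply: sumr_ge0 => i _; exact: sumr_ge0.
move=> i j; rewrite (bigD1 i)//= (bigD1 j)//= -addrA lerDl.
by apply: addr_ge0; [exact: sumr_ge0|apply: sumr_ge0 => ? _; exact: sumr_ge0].
Qed.

(** It suffices to test rectangles, a pi-system. There the chain event splits into single grid
    paths; independence factors out the Brownian event, and the Markov property is applied to each
    path. *)
Lemma chain_step_event k j E : <<s past_rectangles k >> E ->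
  Ex P (fun w => \1_E w * \1_(Y k.+1 @^-1` [set j]) w) = Ex P (fun w => \1_E w * pK (Y k w) j).
Proof.
have [C C0 hC] := pK_bound.
have mY (u : 'I_d -> R) n : measurable_fun setT (fun w => u (Y n w)).
  by apply: smeas_meas (@past_measurable n) _; exact: chain_past.
move: E; apply: (@Ex_pi_lambda _ _ _ _ _ _ _ (1 + C)).
- exact: rectI.
- exact: rectT.
- exact: rect_meas.
- by apply: measurable_indic; exact: mX.
- exact: (mY (fun i => pK i j)).
- by move=> w; apply: le_trans (indic_le1 _ _ _) _; rewrite lerDl.
- by move=> w; apply: le_trans (hC _ _) _; rewrite lerDr.
move=> _ [S [E [sE ->]]].
have mE := sBm sE.
have mC x : measurable (grid_path k @^-1` [set x] `&` E).
  by apply: measurableI => //; exact: grid_path_measurable.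
have mj := mX j (t0 k.+1).
have dec (h : Om -> R) w : \1_(grid_path k @^-1` S `&` E) w * h w =
    \sum_(x : {ffun 'I_k.+1 -> 'I_d}) (x \in S)%:R * (\1_(grid_path k @^-1` [set x] `&` E) w * h w).
  rewrite (bigD1 (grid_path k w))//= big1 ?addr0 => [|x xw].
    rewrite !indicI mulrA; congr (_ * _); rewrite mulrA; congr (_ * _).
    have -> : \1_(grid_path k @^-1` [set grid_path k w]) w = 1 :> R by rewrite indicE mem_set.
    rewrite mulr1 indicE; case: (pselect (S (grid_path k w))) => Sw; first by rewrite !mem_set.
    by rewrite !memNset.
  have x0 : \1_(grid_path k @^-1` [set x]) w = 0 :> R.
    by rewrite indicE memNset//= => e; rewrite e eqxx in xw.
  by rewrite indicI x0 !mul0r mulr0.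
have ih (h : Om -> R) (K : R) : measurable_fun setT h -> (forall w, `|h w| <= K) ->
    Ex P (fun w => \1_(grid_path k @^-1` S `&` E) w * h w) =
    \sum_(x : {ffun 'I_k.+1 -> 'I_d}) (x \in S)%:R * Ex P (fun w => \1_(grid_path k @^-1` [set x] `&` E) w * h w).
  move=> mh hK; have jh x : intg P (fun w => \1_(grid_path k @^-1` [set x] `&` E) w * h w).
    by apply: intg_indicM => //; exact: intg_bd hK.
  under Ex_eq do rewrite dec.
  by rewrite Ex_sum => [|x]; [apply: eq_bigr => x _; rewrite ExZ|exact: intgZ].
rewrite (ih _ 1); [|exact: measurable_indic|exact: indic_le1].
rewrite (ih _ C); [|exact: (mY (fun i => pK i j))|by []].
apply: eq_bigr => x _; congr (_ * _).
rewrite (@Ex_eq _ _ _ _ _ (\1_((grid_path k @^-1` [set x] `&` (Y k.+1 @^-1` [set j])) `&` E))); last first.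
  by move=> w; rewrite -indicI; congr (\1_ _ w); rewrite setIAC.
rewrite [RHS](@Ex_eq _ _ _ _ _ (fun w => pK (x ord_max) j * \1_(grid_path k @^-1` [set x] `&` E) w)); last first.
  move=> w; rewrite mulrC [in LHS]indicE [in RHS]indicE.
  case: (boolP (w \in _)) => [|_]; last by rewrite !mulr0.
  by rewrite inE => -[/= <- _]; rewrite ffunE.
have imC x' : intg P (\1_(grid_path k @^-1` [set x'] `&` E) : Om -> R).
  by apply: (@intg_bd _ _ _ _ _ 1); [exact: measurable_indic|exact: indic_le1].
rewrite ExZ//; apply: EFin_inj; rewrite EFinM !Ex_indic//; last first.
  apply: measurableI => //; apply: measurableI => //; exact: grid_path_measurable.
rewrite (iXB _ sE) ?markov_path; last by apply: sXI; [exact: sX_path|exact: sX_event].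
rewrite (iXB _ sE); last exact: sX_path.
by rewrite [RHS]muleC -!muleA; congr (_ * _)%E; rewrite muleC.
Qed.

Lemma chain_step k (u : 'I_d -> R) H : smeas <<s past_rectangles k >> H -> intg P H ->
  Ex P (fun w => H w * u (Y k.+1 w)) = Ex P (fun w => H w * mop pK u (Y k w)).
Proof.
move=> mH iH; have [C C0 hC] := pK_bound.
have sk : sigma_algebra setT <<s past_rectangles k >> by exact: smallest_sigma_algebra.
have mY (v : 'I_d -> R) n : measurable_fun setT (fun w => v (Y n w)).
  by apply: smeas_meas (@past_measurable n) _; exact: chain_past.
have iM (h : Om -> R) (K : R) : measurable_fun setT h -> (forall w, `|h w| <= K) ->
    intg P (fun w => H w * h w).
  by move=> mh hK; apply: intg_eq (intg_mulbd mh hK iH) => w; rewrite mulrC.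
have mj j : measurable_fun setT (\1_(Y k.+1 @^-1` [set j]) : Om -> R).
  by apply: measurable_indic; exact: mX.
have mp j : measurable_fun setT (fun w => pK (Y k w) j) by exact: (mY (fun i => pK i j)).
have bp j w : `|pK (Y k w) j| <= C by exact: hC.
have bj j w : `|\1_(Y k.+1 @^-1` [set j]) w : R| <= 1 by exact: indic_le1.
have one j : Ex P (fun w => H w * \1_(Y k.+1 @^-1` [set j]) w) = Ex P (fun w => H w * pK (Y k w) j).
  have ij := intg_bd P (mj j) (bj j); have ip := intg_bd P (mp j) (bp j).
  have iHj := iM _ _ (mj j) (bj j); have iHp := iM _ _ (mp j) (bp j).
  have iHC : intg P (fun w => H w * C) by apply: intg_eq (intgZ C iH) => w; rewrite mulrC.
  (* Adding [C] makes both functions nonnegative, as [Ex_transfer] requires; it cancels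
     afterwards. *)
  have : Ex P (fun w => H w * (\1_(Y k.+1 @^-1` [set j]) w + C)) = Ex P (fun w => H w * (pK (Y k w) j + C)).
    apply: (Ex_transfer sk (@rectangles_measurable k)) => //.
    - by move=> w; rewrite addr_ge0// indicE.
    - by move=> w; rewrite -lerBlDr sub0r; have := hC (Y k w) j; rewrite ler_norml => /andP[].
    - by apply: intgD => //; exact: intg_cst.
    - by apply: intgD => //; exact: intg_cst.
    - by apply: intg_eq (intgD iHj iHC) => w; rewrite mulrDr.
    - by apply: intg_eq (intgD iHp iHC) => w; rewrite mulrDr.
    move=> G sG; have mG := rectangles_measurable sG.
    have iG : intg P (fun w => \1_G w * C) by apply: intg_indicM => //; exact: intg_cst.
    under Ex_eq do rewrite mulrDr; under [RHS]Ex_eq do rewrite mulrDr.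
    rewrite !ExD//; try exact: intg_indicM.
    by rewrite chain_step_event.
  under Ex_eq do rewrite mulrDr; under [RHS]Ex_eq do rewrite mulrDr.
  by rewrite !ExD// => /addIr.
rewrite (@Ex_eq _ _ _ _ _ (fun w => \sum_j u j * (H w * \1_(Y k.+1 @^-1` [set j]) w))); last first.
  move=> w; rewrite (bigD1 (Y k.+1 w))//= big1 ?addr0 => [|j jn].
    by rewrite indicE mem_set// mulr1 mulrC.
  by rewrite indicE memNset ?mulr0// => /= e; rewrite e eqxx in jn.
rewrite [RHS](@Ex_eq _ _ _ _ _ (fun w => \sum_j u j * (H w * pK (Y k w) j))); last first.
  by move=> w; rewrite /mop mulr_sumr; apply: eq_bigr => j _; ring.
rewrite !Ex_sum => [|j|j].
- by apply: eq_bigr => j _; rewrite !ExZ ?one//; [exact: iM (bp j)|exact: iM (bj j)].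
- by apply: intgZ; exact: iM (bp j).
- by apply: intgZ; exact: iM (bj j).
Qed.

End MarkovPast.

(** * Brownian increments, and the martingale differences of a modulated model *)

Section BrownianIncrements.
Context {R : realType} {dO : measure_display} {Om : measurableType dO}.
Variables (P : probability Om R) (F : R -> set (set Om)) (B : R -> Om -> R).
Hypothesis fF : filtration F.
Hypothesis bB : brownian_motion P F B.

Lemma filtration_sigma (t : R) : 0 <= t -> sigma_algebra setT (F t).
Proof. by case: fF => h _ _; exact: h. Qed.

Lemma filtration_measurable (t : R) : 0 <= t -> F t `<=` measurable.
Proof. by case: fF => _ h _; exact: h. Qed.

Lemma filtration_mono (s t : R) : 0 <= s -> s <= t -> F s `<=` F t.
Proof. by case: fF => _ _ h; exact: h. Qed.

Lemma adapted_smeas (Y : R -> Om -> R) (t : R) : adapted borelR F Y -> 0 <= t -> smeas (F t) (Y t).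
Proof.
move=> aY t0; apply/smeasP; first exact: filtration_sigma.
by move=> E bE; apply: aY => //; exists E => //; rewrite setTI.
Qed.

Lemma smeas_brownian (t : R) : 0 <= t -> smeas (F t) (B t).
Proof. by apply: adapted_smeas; case: bB. Qed.

Lemma measurable_brownian (t : R) : 0 <= t -> measurable_fun setT (B t).
Proof. by move=> t0; apply: smeas_meas (filtration_measurable t0) _; exact: smeas_brownian. Qed.

Section Increment.
Variables (s t : R).
Hypotheses (s0 : 0 <= s) (st : s < t).
Let b (w : Om) : R := B t w - B s w.

Let t0 : 0 <= t. Proof. exact: le_trans (ltW st). Qed.

Let mb : measurable_fun setT b.
Proof. by apply: measurable_funB; exact: measurable_brownian. Qed.

Let lawb E : borelR E -> P (b @^-1` E) = normal_prob 0 (Num.sqrt (t - s)) E.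
Proof. by case: bB => _ _ _ h bE; have [] := h s t s0 st E bE. Qed.

Lemma smeas_brownian_increment : smeas (F t) b.
Proof.
apply: (@measurable_funB _ (g_sigma_algebraType (F t))); first exact: smeas_brownian.
by apply: smeas_sub (smeas_brownian s0); exact: filtration_mono (ltW st).
Qed.

Lemma brownian_moments : [/\ L4 P b, Ex P b = 0, Ex P (fun w => b w ^+ 2) = t - s &
  Ex P (fun w => b w ^+ 4) = 3 * (t - s) ^+ 2].
Proof.
have d0 : 0 < t - s by rewrite subr_gt0.
have r0 : 0 < Num.sqrt (t - s) by rewrite sqrtr_gt0.
have [? ? h2 h4] := gauss_moments r0 mb lawb.
have r2 : Num.sqrt (t - s) ^+ 2 = t - s by rewrite sqr_sqrtr// ltW.
split => //; first by rewrite h2.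
have e4 : Num.sqrt (t - s) ^+ 4 = (Num.sqrt (t - s) ^+ 2) ^+ 2 by rewrite -exprM.
by rewrite h4 e4 r2.
Qed.

Lemma brownian_indep (psi : R -> R) (H : Om -> R) : measurable_fun setT psi ->
  smeas (F s) H -> intg P H -> intg P (fun w => psi (b w)) -> intg P (fun w => H w * psi (b w)) ->
  Ex P (fun w => H w * psi (b w)) = Ex P H * Ex P (fun w => psi (b w)).
Proof.
move=> mpsi mH iH ib iHb; apply: (Ex_indep (filtration_sigma s0) (filtration_measurable s0)) => //.
move=> G E FG bE; have bE' : borelR (psi @^-1` E) by rewrite -[X in borelR X]setTI; exact: mpsi.
have [_ _ _ h] := bB; have [_ h2] := h s t s0 st _ bE'.
exact: h2.
Qed.

Lemma brownian_centered (H : Om -> R) : smeas (F s) H -> intg P H -> intg P (fun w => H w * b w) ->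
  Ex P (fun w => H w * b w) = 0.
Proof.
have [Lb b1 _ _] := brownian_moments.
move=> mH iH iHb; rewrite (brownian_indep (psi := id))//; last exact: L4_intg Lb.
by rewrite b1 mulr0.
Qed.

Lemma brownian_square (H : Om -> R) : smeas (F s) H -> intg P H -> intg P (fun w => H w * b w ^+ 2) ->
  Ex P (fun w => H w * b w ^+ 2) = (t - s) * Ex P H.
Proof.
have [Lb _ b2 _] := brownian_moments.
move=> mH iH iHb; rewrite (brownian_indep (psi := fun x => x ^+ 2))//; last exact: L4_intg2 Lb.
by rewrite b2 mulrC.
Qed.

End Increment.

Section DeterministicIntegrand.
Variables (tau : R) (c : nat -> R) (C : R).
Hypotheses (tau0 : 0 < tau) (cC : forall k, c k ^+ 2 <= C).
Let t0 k : 0 <= k%:R * tau. Proof. by rewrite mulr_ge0// ltW. Qed.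
Let tS k : k%:R * tau < k.+1%:R * tau. Proof. by rewrite ltr_pM2r// ltr_nat. Qed.
Let tD k : k.+1%:R * tau - k%:R * tau = tau. Proof. by rewrite -natr1; ring. Qed.

(** The grid version of the limit noise: the conditional variance is deterministic, and the fourth
    moment of a step is [3 c^4 tau^2]. *)
Lemma deterministic_martingale : martingale_increments P (fun k => F (k%:R * tau))
  (fun k w => c k * (B (k.+1%:R * tau) w - B (k%:R * tau) w)) (fun k _ => c k ^+ 2)
  tau C (3 * C ^+ 2 * tau).
Proof.
have C0 : 0 <= C by exact: le_trans (sqr_ge0 _) (cC 0%N).
split.
- by move=> k; exact: filtration_sigma.
- by move=> k; exact: filtration_measurable.
- by move=> k; apply: filtration_mono => //; exact: ltW.
- move=> k; apply: (@measurable_funM _ (g_sigma_algebraType (F (k.+1%:R * tau)))).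
    exact: measurable_cst.
  exact: smeas_brownian_increment.
- by move=> k; have [Lb _ _ _] := brownian_moments (t0 k) (tS k); exact: L4Z.
- move=> k; have [Lb _ _ b4] := brownian_moments (t0 k) (tS k).
  under Ex_eq do rewrite exprMn; rewrite ExZ; last by case: Lb.
  rewrite b4 tD (_ : c k ^+ 4 = (c k ^+ 2) ^+ 2); last by rewrite -exprM.
  have : (c k ^+ 2) ^+ 2 <= C ^+ 2 by rewrite lerXn2r ?nnegrE ?sqr_ge0.
  rewrite -subr_ge0 => h; rewrite -subr_ge0.
  have -> : 3 * C ^+ 2 * tau * tau - (c k ^+ 2) ^+ 2 * (3 * tau ^+ 2) =
    (C ^+ 2 - (c k ^+ 2) ^+ 2) * (3 * tau ^+ 2) by ring.
  by rewrite mulr_ge0// mulr_ge0// sqr_ge0.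
- move=> k H mH iH iHs.
  rewrite (@Ex_eq _ _ _ _ _ (fun w => (H w * c k) * (B (k.+1%:R * tau) w - B (k%:R * tau) w))); last first.
    by move=> w; rewrite mulrA.
  apply: brownian_centered => //.
  + by apply: (@measurable_funM _ (g_sigma_algebraType (F (k%:R * tau)))) => //; exact: measurable_cst.
  + by apply: intg_eq (intgZ (c k) iH) => w; rewrite mulrC.
  by apply: intg_eq iHs => w; rewrite mulrA.
- by move=> k; exact: measurable_cst.
- by move=> k w; rewrite ger0_norm ?sqr_ge0.
- move=> k H mH iH iHs.
  rewrite (@Ex_eq _ _ _ _ _ (fun w => (H w * c k ^+ 2) * (B (k.+1%:R * tau) w - B (k%:R * tau) w) ^+ 2)); last first.
    by move=> w; rewrite exprMn mulrA.
  rewrite brownian_square ?tD//.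
  + by apply: (@measurable_funM _ (g_sigma_algebraType (F (k%:R * tau)))) => //; exact: measurable_cst.
  + by apply: intg_eq (intgZ (c k ^+ 2) iH) => w; rewrite mulrC.
  by apply: intg_eq iHs => w; rewrite exprMn mulrA.
Qed.

End DeterministicIntegrand.

Section ModulatedIncrements.
Context {d : nat}.
Variables (X : R -> Om -> 'I_d) (A : 'M[R]_d) (p0 : 'cV[R]_d) (tau : R).
Hypothesis cX : markov_chain P A p0 X.
Hypothesis aX : adapted setT F X.
Hypothesis iXB : independent_processes P setT X borelR B.
Hypothesis tau0 : 0 < tau.
Variables (lam kap : R) (g : nat -> 'I_d -> R) (u : 'I_d -> R).
Variables (Mm C1 C2 : R).
Local Notation Y k := (X (k%:R * tau)).
Local Notation pK := (expmx (tau *: A)).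
Local Notation A_ := (past F B X tau).

(** A Doob martingale difference for the chain on the grid, with conditional variance
    [chain_variance]. In use [g k] is the Poisson corrector at time [k * tau] and [u] the
    volatility. *)
Definition chain_increment (k : nat) (w : Om) : R := lam * (g k (Y k.+1 w) - mop pK (g k) (Y k w)).
Definition brownian_part (k : nat) (w : Om) : R := kap * u (Y k w) * (B (k.+1%:R * tau) w - B (k%:R * tau) w).
Definition chain_variance (k : nat) (i : 'I_d) : R :=
  lam ^+ 2 * (mop pK (fun j => g k j ^+ 2) i - mop pK (g k) i ^+ 2).

Hypothesis mM : forall k w, `|chain_increment k w| <= Mm.
Hypothesis vC : forall k i, `|chain_variance k i| <= C1 * tau.
Hypothesis uC : forall i, (kap * u i) ^+ 2 <= C2.

Let t0 k : 0 <= k%:R * tau. Proof. by rewrite mulr_ge0// ltW. Qed.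
Let tS k : k%:R * tau < k.+1%:R * tau. Proof. by rewrite ltr_pM2r// ltr_nat. Qed.
Let tD k : k.+1%:R * tau - k%:R * tau = tau. Proof. by rewrite -natr1; ring. Qed.
Let b k (w : Om) : R := B (k.+1%:R * tau) w - B (k%:R * tau) w.

Let sM G (f h : Om -> R) : smeas G f -> smeas G h -> smeas G (fun w => f w * h w).
Proof. exact: (@measurable_funM _ (g_sigma_algebraType G)). Qed.
Let sD G (f h : Om -> R) : smeas G f -> smeas G h -> smeas G (fun w => f w + h w).
Proof. exact: (@measurable_funD _ (g_sigma_algebraType G)). Qed.

Let pastF k : A_ k `<=` F (k%:R * tau). Proof. by move=> G []. Qed.
Let pastR k : A_ k `<=` <<s past_rectangles B X tau k >>. Proof. by move=> G []. Qed.

Let uY j k (h : 'I_d -> R) : (j <= k)%N -> smeas (A_ k) (fun w => h (Y j w)).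
Proof. by move=> jk; exact: (chain_past fF aX tau0). Qed.

Let mY k (h : 'I_d -> R) : measurable_fun setT (fun w => h (Y k w)).
Proof. by apply: smeas_meas (@past_measurable _ _ _ _ _ _ _ _ _ _ _ fF bB cX tau0 k) _; exact: uY. Qed.

Let brownian_rect (t : R) k E : 0 <= t -> borelR E -> past_rectangles B X tau k (B t @^-1` E).
Proof.
move=> ht bE; exists setT, (B t @^-1` E); split; last by rewrite preimage_setT setTI.
apply: sub_sigma_algebra; exists t; first by rewrite /= in_itv/= ht.
by exists E => //; rewrite setTI.
Qed.

Let smeas_b_rect j k : smeas <<s past_rectangles B X tau k >> (b j).
Proof.
have h t : 0 <= t -> smeas <<s past_rectangles B X tau k >> (B t).
  move=> ht; apply/smeasP; first exact: smallest_sigma_algebra.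
  by move=> E bE; apply: sub_sigma_algebra; exact: brownian_rect.
by apply: (@measurable_funB _ (g_sigma_algebraType _)); exact: h.
Qed.

Let smeas_b k : smeas (A_ k.+1) (b k).
Proof.
apply/smeasP; first exact: (past_sigma B X fF tau0).
move=> E bE; split.
  by have /smeasP := smeas_brownian_increment (t0 k) (tS k); apply => //; exact: filtration_sigma.
by have /smeasP := @smeas_b_rect k k.+1; apply => //; exact: smallest_sigma_algebra.
Qed.

Let smeas_m k : smeas (A_ k.+1) (chain_increment k).
Proof.
apply: sM; first exact: measurable_cst.
apply: (@measurable_funB _ (g_sigma_algebraType _)); first exact: uY.
by apply: (@uY k _ (mop pK (g k))); exact: leqnSn.
Qed.

Let meas_m k : measurable_fun setT (chain_increment k).
Proof. by apply: smeas_meas (@past_measurable _ _ _ _ _ _ _ _ _ _ _ fF bB cX tau0 k.+1) _; exact: smeas_m. Qed.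

Let meas_cst k : measurable_fun setT (fun w => kap * u (Y k w)).
Proof. exact: (@mY k (fun i => kap * u i)). Qed.

Let C20 : 0 <= C2.
Proof. exact: le_trans (sqr_ge0 _) (uC (Y 0%N point)). Qed.

Let cbd i : `|kap * u i| <= C2 + 1.
Proof.
rewrite -(ler_pXn2r (_ : 0 < 2)%N) ?nnegrE ?addr_ge0// real_normK ?num_real//.
by apply: le_trans (uC i) _; have := sqr_ge0 C2; have := C20; rewrite sqrrD1; lra.
Qed.

Let L4_brownian k : L4 P (brownian_part k).
Proof.
have [Lb _ _ _] := brownian_moments (t0 k) (tS k).
by apply: (L4_mulbd (meas_cst k) (K := C2 + 1)) => // w; exact: cbd.
Qed.

Let L4_chain k : L4 P (chain_increment k).
Proof. exact: L4_bd (meas_m k) (mM k). Qed.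

(** The weight may depend on the whole Brownian path, later times included: [past_rectangles]
    contains that path, and the chain step is centred given it. *)
Let chain_centered k H : smeas <<s past_rectangles B X tau k >> H -> intg P H ->
  Ex P (fun w => H w * chain_increment k w) = 0.
Proof.
move=> mH iH.
have bdY n (h : 'I_d -> R) : exists K : R, forall w, `|h (Y n w)| <= K.
  exists (\sum_i `|h i|) => w; rewrite (bigD1 (Y n w))//= lerDl; exact: sumr_ge0.
have iY n (h : 'I_d -> R) : intg P (fun w => H w * h (Y n w)).
  have [K hK] := bdY n h; apply: intg_eq (intg_mulbd (mY n h) hK iH) => w; exact: mulrC.
rewrite (@Ex_eq _ _ _ _ _ (fun w => lam * (H w * g k (Y k.+1 w) - H w * mop pK (g k) (Y k w)))).
  rewrite ExZ; last exact: intgB (iY _ _) (iY _ _).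
  rewrite (ExB (iY _ _) (iY _ (mop pK (g k)))).
  by rewrite (chain_step fF bB cX aX iXB tau0)// subrr mulr0.
by move=> w; rewrite /chain_increment; ring.
Qed.

Let chain_square k H : smeas <<s past_rectangles B X tau k >> H -> intg P H ->
  Ex P (fun w => H w * chain_increment k w ^+ 2) = Ex P (fun w => H w * chain_variance k (Y k w)).
Proof.
move=> mH iH.
have bdY n (h : 'I_d -> R) : exists K : R, forall w, `|h (Y n w)| <= K.
  exists (\sum_i `|h i|) => w; rewrite (bigD1 (Y n w))//= lerDl; exact: sumr_ge0.
have iY n (h : 'I_d -> R) (H' : Om -> R) : intg P H' -> intg P (fun w => H' w * h (Y n w)).
  move=> iH'; have [K hK] := bdY n h; apply: intg_eq (intg_mulbd (mY n h) hK iH') => w; exact: mulrC.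
pose H1 w := H w * mop pK (g k) (Y k w).
have i1 : intg P H1 by exact: (iY k (mop pK (g k))).
have m1 : smeas <<s past_rectangles B X tau k >> H1.
  apply: sM => //; apply: smeas_sub (@pastR k) _; exact: (@uY k k (mop pK (g k))).
have j1 := iY k.+1 (fun j => g k j ^+ 2) _ iH.
have j2 := iY k.+1 (g k) _ i1.
have j3 := iY k (mop pK (g k)) _ i1.
have j4 := iY k (mop pK (fun j => g k j ^+ 2)) _ iH.
rewrite (@Ex_eq _ _ _ _ _ (fun w => lam ^+ 2 * ((H w * g k (Y k.+1 w) ^+ 2 - 2 * (H1 w * g k (Y k.+1 w))) +
  H1 w * mop pK (g k) (Y k w)))); last by move=> w; rewrite /chain_increment /H1; ring.
rewrite ExZ; last by apply: intgD => //; apply: intgB => //; exact: intgZ.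
rewrite ExD//; last by apply: intgB => //; exact: intgZ.
rewrite ExB//; last exact: intgZ.
rewrite (ExZ 2 j2) (chain_step fF bB cX aX iXB tau0 (fun j => g k j ^+ 2) mH iH).
rewrite (chain_step fF bB cX aX iXB tau0 (g k) m1 i1).
rewrite [RHS](@Ex_eq _ _ _ _ _ (fun w => lam ^+ 2 *
  (H w * mop pK (fun j => g k j ^+ 2) (Y k w) - H1 w * mop pK (g k) (Y k w)))); last first.
  by move=> w; rewrite /chain_variance /H1; ring.
rewrite ExZ; last exact: intgB.
by rewrite ExB//; ring.
Qed.

Definition modulated_rate (k : nat) (w : Om) : R :=
  chain_variance k (Y k w) / tau + (kap * u (Y k w)) ^+ 2.

(** From [y = (x + y) - x]: integrability of [h (x + y)^2] and [h x^2] gives that of [h y^2], which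
    separates the Brownian part of a weighted square from the chain part. *)
Let young (h x y : R) : `|h * y ^+ 2| <= 2 * `|h * (x + y) ^+ 2| + 2 * `|h * x ^+ 2|.
Proof.
rewrite !(normrM h) (ger0_norm (sqr_ge0 y)) (ger0_norm (sqr_ge0 x)) (ger0_norm (sqr_ge0 (x + y))) -subr_ge0.
rewrite (_ : _ - _ = `|h| * (2 * x + y) ^+ 2); last by ring.
by rewrite mulr_ge0// sqr_ge0.
Qed.

Let young1 (h y : R) : `|h * y| <= `|h| + `|h * y ^+ 2|.
Proof.
rewrite !(normrM h) (ger0_norm (sqr_ge0 y)) -{2}(mulr1 `|h|) -mulrDr ler_wpM2l//.
rewrite -[y ^+ 2]real_normK ?num_real//; have := sqr_ge0 (`|y| - 1); have := normr_ge0 y.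
by rewrite sqrrB1; lra.
Qed.

Lemma modulated_martingale : martingale_increments P A_
  (fun k w => chain_increment k w + brownian_part k w) modulated_rate tau (C1 + C2)
  (8 * (Mm ^+ 2 * C1 + 3 * C2 ^+ 2 * tau)).
Proof.
have pm k : A_ k `<=` measurable by exact: (past_measurable fF bB cX tau0).
have sc k (G : set (set Om)) : A_ k `<=` G -> smeas G (fun w => kap * u (Y k w)).
  by move=> h; apply: smeas_sub h _; exact: (@uY k k (fun i => kap * u i)).
split.
- by move=> k; exact: (past_sigma B X fF tau0).
- exact: pm.
- by move=> k; exact: (past_mono fF tau0).
- move=> k; apply: sD; first exact: smeas_m.
  by apply: sM; [apply: sc; exact: (past_mono fF tau0)|exact: smeas_b].
- by move=> k; apply: L4D.
- move=> k; have [_ Lc] := L4_chain k; have [_ Lb] := L4_brownian k.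
  have [Lb0 _ _ b4] := brownian_moments (t0 k) (tS k).
  apply: (@le_trans _ _ (Ex P (fun w => 8 * (chain_increment k w ^+ 4 + brownian_part k w ^+ 4)))).
    apply: Ex_le; [by have [] := L4D (L4_chain k) (L4_brownian k)|by apply: intgZ; exact: intgD|].
    move=> w; set x := chain_increment k w; set y := brownian_part k w; rewrite -subr_ge0.
    have -> : 8 * (x ^+ 4 + y ^+ 4) - (x + y) ^+ 4 =
      (x - y) ^+ 2 * (7 * x ^+ 2 + 10 * x * y + 7 * y ^+ 2) by ring.
    rewrite mulr_ge0 ?sqr_ge0//.
    rewrite (_ : _ + _ = 5 * (x + y) ^+ 2 + 2 * x ^+ 2 + 2 * y ^+ 2); last by ring.
    by rewrite !addr_ge0// mulr_ge0// sqr_ge0.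
  rewrite ExZ; last exact: intgD.
  rewrite ExD// -mulrA ler_wpM2l//.
  have m1 : smeas <<s past_rectangles B X tau k >> (fun=> 1 : R) by exact: measurable_cst.
  have i1 : intg P (fun=> 1 : R) by exact: intg_cst.
  have iv : intg P (fun w => chain_variance k (Y k w)).
    by apply: (@intg_bd _ _ _ _ _ (C1 * tau)); [exact: (@mY k (chain_variance k))|move=> w; exact: vC].
  have sq := chain_square m1 i1.
  rewrite (@Ex_eq _ _ _ _ _ (fun w => chain_increment k w ^+ 2)) in sq; last by move=> w; rewrite mul1r.
  rewrite [RHS](@Ex_eq _ _ _ _ _ (fun w => chain_variance k (Y k w))) in sq; last by move=> w; rewrite mul1r.
  rewrite [leRHS]mulrDl; apply: lerD.
    (* Two of the four factors are bounded by [Mm]; the other two leave the conditional variance, of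
       order [tau]. *)
    apply: (@le_trans _ _ (Ex P (fun w => Mm ^+ 2 * chain_increment k w ^+ 2))).
      apply: Ex_le => //; first by apply: intgZ; exact: L4_intg2.
      move=> w; rewrite (_ : _ ^+ 4 = chain_increment k w ^+ 2 * chain_increment k w ^+ 2); last by rewrite -exprD.
      rewrite ler_wpM2r ?sqr_ge0// -[leLHS]real_normK ?num_real// lerXn2r ?nnegrE//.
      exact: le_trans (mM k w).
    rewrite ExZ; last exact: L4_intg2.
    rewrite -mulrA ler_wpM2l ?sqr_ge0// sq; apply: le_trans (ler_norm _) _.
    by apply: Ex_bd => // w; exact: vC.
  apply: (@le_trans _ _ (Ex P (fun w => C2 ^+ 2 * b k w ^+ 4))).
    apply: Ex_le => //; first by apply: intgZ; case: Lb0.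
    move=> w; rewrite /brownian_part exprMn ler_wpM2r//.
      by rewrite (_ : _ ^+ 4 = (b k w ^+ 2) ^+ 2) ?sqr_ge0// -exprM.
    rewrite (_ : _ ^+ 4 = ((kap * u (Y k w)) ^+ 2) ^+ 2); last by rewrite -exprM.
    by rewrite lerXn2r ?nnegrE ?sqr_ge0.
  rewrite ExZ; last by case: Lb0.
  by rewrite b4 tD le_eqVlt; apply/orP; left; apply/eqP; ring.
- move=> k H mH iH iHs.
  have iHm : intg P (fun w => H w * chain_increment k w).
    by apply: intg_eq (intg_mulbd (meas_m k) (mM k) iH) => w; exact: mulrC.
  have iHb : intg P (fun w => H w * (kap * u (Y k w)) * b k w).
    by apply: intg_eq (intgB iHs iHm) => w; rewrite /brownian_part -/(b k w); ring.
  rewrite (@Ex_eq _ _ _ _ _ (fun w => H w * chain_increment k w + H w * (kap * u (Y k w)) * b k w)); last first.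
    by move=> w; rewrite /brownian_part -/(b k w); ring.
  rewrite ExD// chain_centered//; last exact: smeas_sub (@pastR k) mH.
  rewrite (brownian_centered (t0 k) (tS k))// ?addr0//.
    by apply: sM; [exact: smeas_sub (@pastF k) mH|exact: sc].
  by apply: intg_eq (intg_mulbd (meas_cst k) (fun w => cbd (Y k w)) iH) => w; exact: mulrC.
- by move=> k; exact: (@uY k k (fun i => chain_variance k i / tau + (kap * u i) ^+ 2)).
- move=> k w; apply: le_trans (ler_normD _ _) _; apply: lerD; last by rewrite ger0_norm ?sqr_ge0.
  by rewrite normrM normfV (gtr0_norm tau0) ler_pdivrMr.
- move=> k H mH iH iHs.
  set c := fun w => kap * u (Y k w).
  set m := chain_increment k in iHs *.
  have mHm : measurable_fun setT H by exact: smeas_meas (pm k) mH.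
  have mbk : measurable_fun setT (b k).
    by apply: measurable_funB; exact: measurable_brownian.
  have mm : measurable_fun setT m by exact: meas_m.
  have mc : measurable_fun setT c by exact: meas_cst.
  have iHm2 : intg P (fun w => H w * m w ^+ 2).
    apply: (@intg_eq _ _ _ _ (fun w => m w ^+ 2 * H w)); first by move=> w; exact: mulrC.
    apply: (@intg_mulbd _ _ _ _ _ _ (Mm ^+ 2)) => //; first exact: measurable_funX.
    move=> w; rewrite normrX lerXn2r ?nnegrE//; last exact: mM.
    exact: le_trans (mM k w).
  have iHcb2 : intg P (fun w => H w * c w ^+ 2 * b k w ^+ 2).
    apply: (@intg_le _ _ _ _ _ (fun w => 2 * `|H w * (m w + brownian_part k w) ^+ 2| + 2 * `|H w * m w ^+ 2|)).
    - by apply: measurable_funM; [apply: measurable_funM => //; exact: measurable_funX|exact: measurable_funX].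
    - by apply: intgD; apply: intgZ; exact: intg_abs.
    by move=> w; have := young (H w) (m w) (c w * b k w); rewrite exprMn mulrA.
  have iHcb : intg P (fun w => H w * c w * b k w).
    apply: (@intg_le _ _ _ _ _ (fun w => `|H w| + `|H w * c w ^+ 2 * b k w ^+ 2|)).
    - by apply: measurable_funM => //; exact: measurable_funM.
    - by apply: intgD; exact: intg_abs.
    by move=> w; have := young1 (H w) (c w * b k w); rewrite exprMn !mulrA.
  have iHcbm : intg P (fun w => H w * c w * b k w * m w).
    by apply: intg_eq (intg_mulbd mm (mM k) iHcb) => w; exact: mulrC.
  have sH : smeas <<s past_rectangles B X tau k >> H by exact: smeas_sub (@pastR k) mH.
  rewrite (@Ex_eq _ _ _ _ _ (fun w => (H w * m w ^+ 2 + 2 * (H w * c w * b k w * m w)) +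
    H w * c w ^+ 2 * b k w ^+ 2)); last first.
    by move=> w; rewrite /brownian_part -/(b k w) -/(c w); ring.
  rewrite ExD//; last by apply: intgD => //; exact: intgZ.
  rewrite ExD//; last exact: intgZ.
  (* The cross term vanishes: the Brownian increment is measurable for the rectangles, hence part of
     the weight, and the chain increment is centred given them. *)
  rewrite (ExZ 2 iHcbm) chain_centered//; last first.
    by apply: sM; [apply: sM => //; exact: sc (@pastR k)|exact: smeas_b_rect].
  rewrite mulr0 addr0 chain_square//.
  have iHc2 : intg P (fun w => H w * c w ^+ 2).
    apply: (@intg_eq _ _ _ _ (fun w => c w ^+ 2 * H w)); first by move=> w; exact: mulrC.
    apply: (@intg_mulbd _ _ _ _ _ _ C2) => //; first exact: measurable_funX.
    by move=> w; rewrite ger0_norm ?sqr_ge0//; exact: uC.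
  rewrite (brownian_square (t0 k) (tS k))//; last first.
    by apply: sM; [exact: smeas_sub (@pastF k) mH|apply: (@sM _ c c); exact: sc (@pastF k)].
  rewrite tD /modulated_rate.
  have iHv : intg P (fun w => H w * (chain_variance k (Y k w) / tau)).
    apply: (@intg_eq _ _ _ _ (fun w => (chain_variance k (Y k w) / tau) * H w)); first by move=> w; exact: mulrC.
    apply: (@intg_mulbd _ _ _ _ _ _ C1) => //; first exact: (@mY k (fun i => chain_variance k i / tau)).
    by move=> w; rewrite normrM normfV (gtr0_norm tau0) ler_pdivrMr.
  rewrite [in RHS](@Ex_eq _ _ _ _ _ (fun w => H w * (chain_variance k (Y k w) / tau) + H w * c w ^+ 2)); last first.
    by move=> w; rewrite mulrDr.
  rewrite ExD// mulrDr -(ExZ _ iHv); congr (_ + _); apply: Ex_eq => w.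
  by field; rewrite gt_eqF.
Qed.

End ModulatedIncrements.
End BrownianIncrements.

(** * Ito integrals along the chain *)

Section JointMeasurability.
Context {R : realType} d (T : measurableType d).
Implicit Types (c : R -> T -> R).

Definition joint_measurable c : Prop :=
  measurable_fun setT (fun z : measurableTypeR R * T => c z.1 z.2).

Definition right_continuous_paths c : Prop := forall w (t e : R), 0 <= t -> 0 < e ->
  exists2 r : R, 0 < r & forall s, t <= s -> s < t + r -> `|c s w - c t w| <= e.

Lemma cpath_right_continuous c : (forall w, cpath (c ^~ w)) -> right_continuous_paths c.
Proof.
move=> cc w t e t0 e0; have [r r0 h] := (cpathP (c ^~ w)).1 (cc w) t t0 e e0.
exists r => // s ts st; apply: h; first exact: le_trans ts.
by rewrite ger0_norm ?subr_ge0// ltrBlDl.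
Qed.

(** Time is rounded to the next multiple of [1 / (n+1)], strictly above it; each rounded process is
    a countable patchwork over product sets, and right continuity gives the limit. *)
Lemma right_continuous_joint c : (forall t : R, 0 <= t -> measurable_fun setT (c t)) ->
  right_continuous_paths c -> joint_measurable (fun s => c (Num.max s 0)).
Proof.
move=> mc rc.
pose q n (s : R) := Num.truncn (Num.max s 0 * n.+1%:R).
pose t n k : R := k.+1%:R / n.+1%:R.
apply: (@measurable_fun_cvg _ _ _ setT (fun n z => c (t n (q n z.1)) z.2)).
  move=> n _ E mE; rewrite setTI.
  have -> : (fun z : measurableTypeR R * T => c (t n (q n z.1)) z.2) @^-1` E =
      \bigcup_k ((q n @^-1` [set k]) `*` (c (t n k) @^-1` E)).
    apply/seteqP; split => [z /= Ez|z [k _ [/= <-]]]//.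
    by exists (q n z.1).
  apply: bigcupT_measurable => k; apply: measurableX; last first.
    rewrite -[X in measurable X]setTI; apply: mc => //.
    by rewrite divr_ge0.
  have -> : q n @^-1` [set k] = (fun s : R => Num.max s 0 * n.+1%:R) @^-1` `[k%:R, k.+1%:R[%classic.
    apply/seteqP; split => s /=; rewrite in_itv/=.
      by move=> <-; apply: truncn_itv; rewrite mulr_ge0// le_max lexx orbT.
    by move=> h; apply: truncn_def.
  rewrite -[X in measurable X]setTI.
  have : measurable_fun setT (fun s : R => Num.max s 0 * n.+1%:R).
    by apply: measurable_funM => //; exact: measurable_maxr.
  by apply => //; exact: measurable_itv.
move=> [s w] _ /=; set u := Num.max s 0.
have u0 : 0 <= u by rewrite le_max lexx orbT.
apply/cvgrPdist_le => e e0; have [r r0 h] := rc w u e u0 e0.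
exists (Num.truncn r^-1) => // n /= nr.
have n0 : 0 < n.+1%:R :> R by [].
have nr' : n.+1%:R^-1 < r.
  rewrite invf_plt ?posrE//; apply: lt_le_trans (truncnS_gt _) _.
  by rewrite ler_nat ltnS.
have /truncn_itv/andP[a b] : 0 <= u * n.+1%:R by rewrite mulr_ge0.
rewrite distrC; apply: h.
  by rewrite /t ler_pdivlMr// ltW.
rewrite /t -natr1 mulrDl mul1r; apply: ler_ltD nr'.
by rewrite ler_pdivrMr.
Qed.

Lemma joint_measurable_comp (psi : R -> R) c : measurable_fun setT psi ->
  joint_measurable c -> joint_measurable (fun s w => psi (c s w)).
Proof. by move=> mp mc; exact: (measurableT_comp mp mc). Qed.

Lemma joint_measurableB c c' : joint_measurable c -> joint_measurable c' ->
  joint_measurable (fun s w => c s w - c' s w).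
Proof. by move=> h h'; exact: measurable_funB. Qed.

Lemma joint_measurableM c c' : joint_measurable c -> joint_measurable c' ->
  joint_measurable (fun s w => c s w * c' s w).
Proof. by move=> h h'; exact: measurable_funM. Qed.

Lemma joint_measurable_time (f : R -> R) : measurable_fun setT f -> joint_measurable (fun s _ => f s).
Proof. by move=> mf; exact: (measurableT_comp mf measurable_fst). Qed.

Lemma joint_measurable_space (f : T -> R) : measurable_fun setT f -> joint_measurable (fun _ w => f w).
Proof. by move=> mf; exact: (measurableT_comp mf measurable_snd). Qed.

Lemma joint_measurable_sum (I : Type) (s : seq I) (F : I -> R -> T -> R) :
  (forall i, joint_measurable (F i)) -> joint_measurable (fun t w => \sum_(i <- s) F i t w).
Proof. by move=> h; apply: measurable_sum => i; exact: h. Qed.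

Lemma joint_section_time c w : joint_measurable c -> measurable_fun setT (c ^~ w).
Proof. by move=> mc; exact: (measurableT_comp mc (pair2_measurable w)). Qed.

Lemma joint_section_space c t : joint_measurable c -> measurable_fun setT (c t).
Proof. by move=> mc; exact: (measurableT_comp mc (pair1_measurable t)). Qed.

Local Notation mu := (@lebesgue_measure R).

Let restr (t : R) c (s : R) w : ((EFin \o (c ^~ w)) \_ `[0, t]%classic) s =
  ((s \in `[0, t])%:R * c s w)%:E.
Proof.
rewrite patchE mem_setE; case: (s \in `[0, t]) => /=; first by rewrite mul1r.
by rewrite mul0r.
Qed.

Let joint_restr (t : R) c : joint_measurable c ->
  joint_measurable (fun s w => (s \in `[0, t])%:R * c s w).
Proof.
move=> mc; apply: joint_measurableM => //; apply: joint_measurable_time.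
rewrite (_ : (fun s : R => _) = \1_(`[0, t]%classic)); first exact: measurable_indic.
by apply/funext => s; rewrite indicE mem_setE.
Qed.

Lemma measurable_time_integral c (t : R) : joint_measurable c -> (forall s w, 0 <= c s w) ->
  measurable_fun setT (fun w => \int[mu]_(s in `[0%R, t]) (c s w)%:E)%E.
Proof.
move=> mc c0.
rewrite (_ : (fun w => _) = (fun w => \int[mu]_s ((s \in `[0, t])%:R * c s w)%:E)%E); last first.
  by apply/funext => w; rewrite integral_mkcond; apply: eq_integral => s _; rewrite -restr.
apply: (@measurable_fun_fubini_tonelli_G _ _ (measurableTypeR R) T R mu (fun z => ((z.1 \in `[0, t])%:R * c z.1 z.2)%:E)).
  by apply/measurable_EFinP; exact: joint_restr.
by move=> z; rewrite lee_fin mulr_ge0.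
Qed.

Lemma measurable_time_Rintegral c (t : R) : joint_measurable c ->
  measurable_fun setT (fun w => \int[mu]_(s in `[0, t]) c s w).
Proof.
move=> mc; apply: (@measurableT_comp _ _ _ _ _ _ fine) => //.
have pos f : joint_measurable f -> measurable_fun setT
    (fun w => \int[mu]_(s in `[0%R, t]) (Num.max (f s w) 0)%:E)%E.
  move=> mf; apply: measurable_time_integral => [|s w]; last by rewrite le_max lexx orbT.
  by apply: (joint_measurable_comp (psi := fun x => Num.max x 0)) mf; exact: measurable_maxr.
rewrite (_ : (fun w => _) = (fun w => \int[mu]_(s in `[0%R, t]) (Num.max (c s w) 0)%:E -
    \int[mu]_(s in `[0%R, t]) (Num.max (- c s w) 0)%:E)%E); last first.
  by apply/funext => w; rewrite integralE; congr (_ - _)%E; apply: eq_integral => s _;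
     rewrite ?funeposE ?funenegE /= EFin_max// EFinN.
apply: emeasurable_funB; first exact: pos.
by apply: (pos (fun s w => - c s w)); exact: measurable_funN.
Qed.

Lemma time_integral_tonelli (P : probability T R) c (t : R) : joint_measurable c -> (forall s w, 0 <= c s w) ->
  (\int[P]_w \int[mu]_(s in `[0%R, t]) (c s w)%:E = \int[mu]_(s in `[0%R, t]) \int[P]_w (c s w)%:E)%E.
Proof.
move=> mc c0.
transitivity (\int[P]_w \int[mu]_s ((s \in `[0, t])%:R * c s w)%:E)%E.
  by apply: eq_integral => w _; rewrite integral_mkcond; apply: eq_integral => s _; rewrite -restr.
rewrite -(@fubini_tonelli _ _ (measurableTypeR R) T R mu P (fun z => ((z.1 \in `[0, t])%:R * c z.1 z.2)%:E)).
- rewrite [RHS]integral_mkcond; apply: eq_integral => s _ /=.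
  rewrite patchE mem_setE; case: (s \in `[0, t]) => /=.
    by under eq_integral do rewrite mul1r.
  by under eq_integral do rewrite mul0r; exact: integral0.
- by apply/measurable_EFinP; exact: joint_restr.
- by move=> z; rewrite lee_fin mulr_ge0.
Qed.

Lemma time_integral_le (P : probability T R) c (t K : R) : 0 <= t -> joint_measurable c ->
  (forall s w, 0 <= c s w) -> (forall s, 0 < s -> s <= t -> (\int[P]_w (c s w)%:E <= K%:E)%E) ->
  (\int[P]_w \int[mu]_(s in `[0%R, t]) (c s w)%:E <= (K * t)%:E)%E.
Proof.
move=> t0 mc c0 cK; rewrite time_integral_tonelli//.
have mi : measurable_fun setT (fun s : R => \int[P]_w (c s w)%:E)%E.
  apply: (@measurable_fun_fubini_tonelli_F _ _ (measurableTypeR R) T R P (fun z => (c z.1 z.2)%:E)).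
    exact/measurable_EFinP.
  by move=> z; rewrite lee_fin.
(* Time 0 is removed: elementary integrands live on intervals open at the left, so the bound is
   available for [s > 0] only. *)
rewrite -integral_itv_obnd_cbnd; last exact: measurable_funTS.
case: (eqVneq t 0) => [->|tn].
  by rewrite set_itvoc0 integral_set0 mulr0.
have tp : 0 < t by rewrite lt_neqAle eq_sym tn.
have K0 : 0 <= K.
  have := cK t tp (lexx t); rewrite -lee_fin; apply: le_trans.
  by apply: integral_ge0 => w _; rewrite lee_fin.
apply: (@le_trans _ _ (\int[mu]_(s in `]0%R, t]) (cst K%:E s))%E).
  apply: ge0_le_integral => //.
  - by move=> s _; apply: integral_ge0 => w _; rewrite lee_fin.
  - exact: measurable_funTS.
  - by move=> s; rewrite /= in_itv/= => /andP[s0 st]; exact: cK.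
have e : mu (`]0, t]%classic : set R) = t%:E.
  by rewrite lebesgue_measure_itv/= lte_fin tp oppr0 addr0.
rewrite integral_cst// EFinM le_eqVlt; apply/orP; left; apply/eqP; congr (_ * _)%E; exact: e.
Qed.

End JointMeasurability.

(** * The isometry for elementary integrands *)

Section ItoIsometry.
Context {R : realType} {dO : measure_display} {Om : measurableType dO}.
Variables (P : probability Om R) (F : R -> set (set Om)) (B : R -> Om -> R).
Hypothesis fF : filtration F.
Hypothesis bB : brownian_motion P F B.
Local Notation mu := (@lebesgue_measure R).
Local Notation inc s t := (fun w => B t w - B s w).

Let sM G (f h : Om -> R) : smeas G f -> smeas G h -> smeas G (fun w => f w * h w).
Proof. exact: (@measurable_funM _ (g_sigma_algebraType G)). Qed.

Let Fmeas (t : R) (f : Om -> R) : 0 <= t -> smeas (F t) f -> measurable_fun setT f.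
Proof. by move=> t0; exact: smeas_meas (filtration_measurable fF t0). Qed.

Let Fup (s t : R) (f : Om -> R) : 0 <= s -> s <= t -> smeas (F s) f -> smeas (F t) f.
Proof. by move=> s0 st; apply: smeas_sub; exact: (filtration_mono fF). Qed.

Let incL4 (s t : R) : 0 <= s -> s <= t -> L4 P (inc s t).
Proof.
move=> s0; rewrite le_eqVlt => /orP[/eqP <-|st]; last by have [] := brownian_moments fF bB s0 st.
by apply: L4_eq (L4_cst P 0) => w; rewrite subrr.
Qed.

Let incF (s t : R) : 0 <= s -> s <= t -> smeas (F t) (inc s t).
Proof.
move=> s0; rewrite le_eqVlt => /orP[/eqP <-|st]; last exact: (smeas_brownian_increment fF bB).
rewrite (_ : (fun _ => _) = fun=> 0); first exact: measurable_cst.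
by apply/funext => w; rewrite subrr.
Qed.

Let centered (s t : R) (H : Om -> R) : 0 <= s -> s <= t -> smeas (F s) H -> L4 P H ->
  Ex P (fun w => H w * inc s t w) = 0.
Proof.
move=> s0 st mH LH; have Li := incL4 s0 st; move: st; rewrite le_eqVlt => /orP[/eqP st|st].
  by rewrite -[RHS](Ex_cst P); apply: Ex_eq => w; rewrite st subrr mulr0.
apply: (brownian_centered fF bB) => //; [exact: L4_intg|exact: L4_prod2].
Qed.

Let square (s t K : R) (H : Om -> R) : 0 <= s -> s <= t -> smeas (F s) H -> (forall w, `|H w| <= K) ->
  Ex P (fun w => H w * inc s t w ^+ 2) = (t - s) * Ex P H.
Proof.
move=> s0 st mH HK; have Li := incL4 s0 st; move: st; rewrite le_eqVlt => /orP[/eqP st|st].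
  by rewrite st subrr mul0r -[RHS](Ex_cst P); apply: Ex_eq => w; rewrite subrr expr0n/= mulr0.
have mH' : measurable_fun setT H by exact: Fmeas s0 mH.
apply: (brownian_square fF bB) => //; first exact: intg_bd HK.
by apply: (intg_mulbd mH' HK); exact: L4_intg2.
Qed.

Definition overlap (a b a' b' : R) : R := Num.max (Num.min b b' - Num.max a a') 0.

Lemma overlapC a b a' b' : overlap a b a' b' = overlap a' b' a b.
Proof. by rewrite /overlap (minC b) (maxC a). Qed.

Lemma overlap_integral (T a b a' b' : R) : 0 <= a -> b <= T ->
  (\int[mu]_(s in `[0%R, T]) ((a < s <= b)%R%:R * (a' < s <= b')%R%:R)%:E = (overlap a b a' b')%:E)%E.
Proof.
move=> a0 bT; pose I : set R := `](Num.max a a'), (Num.min b b')]%classic.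
transitivity (\int[mu]_(s in `[0%R, T]) (\1_I s)%:E)%E.
  apply: eq_integral => s _; rewrite indicE mem_setE in_itv/= gt_max le_min.
  by case: (a < s); case: (s <= b); case: (a' < s); case: (s <= b'); rewrite /= ?(mulr1,mulr0,mul0r).
rewrite integral_indic//; last exact: measurable_itv.
have -> : I `&` `[0, T] = I.
  apply/setIidPl => s; rewrite /I /= !in_itv/= gt_max le_min => /andP[/andP[s1 _] /andP[s2 _]].
  by rewrite (le_trans a0 (ltW s1)) (le_trans s2 bT).
have e : (mu I = if (Num.max a a' < Num.min b b')%R then (Num.min b b' - Num.max a a')%R%:E else 0)%E.
  by rewrite /I lebesgue_measure_itv/= lte_fin EFinB.
apply: (eq_trans e) => {e}.
rewrite /overlap; case: ltP => h.
  by congr EFin; apply/esym/max_idPl; rewrite subr_ge0 ltW.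
by congr EFin; apply/esym/max_idPr; rewrite subr_le0.
Qed.

(** Cut the line at [a'] and at [m = min b b']. Products of increments over disjoint intervals have
    mean zero, so only the common stretch from [a'] to [m] contributes, by its length; of the two
    tails beyond [m] one is always 0. *)
Let gram_le (a b a' b' K K' : R) (xi xi' : Om -> R) : 0 <= a -> a <= b -> a' <= b' -> a <= a' ->
  smeas (F a) xi -> (forall w, `|xi w| <= K) -> smeas (F a') xi' -> (forall w, `|xi' w| <= K') ->
  Ex P (fun w => (xi w * inc a b w) * (xi' w * inc a' b' w)) =
  overlap a b a' b' * Ex P (fun w => xi w * xi' w).
Proof.
move=> a0 ab ab' aa' mx bx mx' bx'.
have a'0 : 0 <= a' by exact: le_trans aa'.
have b0 : 0 <= b by exact: le_trans ab.
pose eta w := xi w * xi' w.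
have me : smeas (F a') eta by apply: sM => //; exact: Fup a0 aa' mx.
have be w : `|eta w| <= K * K' by rewrite normrM ler_pM.
have me' : measurable_fun setT eta by exact: Fmeas a'0 me.
have Le f : L4 P f -> L4 P (fun w => eta w * f w) by exact: L4_mulbd.
have ie : intg P eta by exact: intg_bd be.
case: (leP b a') => ba'.
  have -> : overlap a b a' b' = 0.
    by rewrite /overlap; apply/max_idPr; rewrite subr_le0 ge_min !le_max ba' !orbT.
  rewrite mul0r (@Ex_eq _ _ _ _ _ (fun w => (eta w * inc a b w) * inc a' b' w)); last first.
    by move=> w; rewrite /eta; ring.
  apply: centered => //; last by apply: Le; exact: incL4.
  by apply: sM => //; apply: (Fup b0 ba'); exact: incF.
set m := Num.min b b'.
have am : a' <= m by rewrite le_min (ltW ba') ab'.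
have m0 : 0 <= m by exact: le_trans am.
have mb : m <= b by rewrite ge_min lexx.
have mb' : m <= b' by rewrite ge_min lexx orbT.
have -> : overlap a b a' b' = m - a'.
  by rewrite /overlap (max_idPr aa'); apply/max_idPl; rewrite subr_ge0.
have L1 := incL4 a0 aa'; have L2 := incL4 a'0 am; have L3 := incL4 m0 mb; have L4' := incL4 m0 mb'.
have z w : inc m b w * inc m b' w = 0.
  by rewrite /m; case: (leP b b') => _; rewrite subrr ?mul0r ?mulr0.
rewrite (@Ex_eq _ _ _ _ _ (fun w => ((eta w * inc a a' w) * inc a' m w + (eta w * inc a a' w) * inc m b' w) +
  ((eta w * inc a' m w) * inc m b' w + (eta w * inc a' m w) * inc m b w) + eta w * inc a' m w ^+ 2)); last first.
  move=> w; apply/eqP; rewrite -subr_eq0.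
  have -> : (0 : R) = eta w * (inc m b w * inc m b' w) by rewrite z mulr0.
  by apply/eqP; rewrite /eta; ring.
have Ea : L4 P (fun w => eta w * inc a a' w) by exact: Le.
have Em : L4 P (fun w => eta w * inc a' m w) by exact: Le.
have Fa : smeas (F a') (fun w => eta w * inc a a' w) by apply: sM => //; exact: incF.
have Fm : smeas (F m) (fun w => eta w * inc a' m w).
  by apply: sM; [exact: Fup a'0 am me|exact: incF].
have i1 := L4_prod2 Ea L2; have i2 := L4_prod2 Ea L4'; have i3 := L4_prod2 Em L4'; have i4 := L4_prod2 Em L3.
have i5 : intg P (fun w => eta w * inc a' m w ^+ 2).
  by apply: (intg_mulbd me' be); exact: L4_intg2.
have i12 := intgD i1 i2; have i34 := intgD i3 i4.
rewrite (ExD (intgD i12 i34) i5) (ExD i12 i34) (ExD i1 i2) (ExD i3 i4).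
rewrite !centered// ?addr0 ?add0r; last exact: Fup a'0 am Fa.
exact: square be.
Qed.

Lemma gram (a b a' b' K K' : R) (xi xi' : Om -> R) : 0 <= a -> a <= b -> 0 <= a' -> a' <= b' ->
  smeas (F a) xi -> (forall w, `|xi w| <= K) -> smeas (F a') xi' -> (forall w, `|xi' w| <= K') ->
  Ex P (fun w => (xi w * inc a b w) * (xi' w * inc a' b' w)) =
  overlap a b a' b' * Ex P (fun w => xi w * xi' w).
Proof.
move=> a0 ab a'0 ab' mx bx mx' bx'; case: (leP a a') => h; first exact: (gram_le a0 ab ab' h mx bx mx' bx').
rewrite overlapC (Ex_eq _ (g := fun w => (xi' w * inc a' b' w) * (xi w * inc a b w))); last by move=> w; exact: mulrC.
rewrite [in RHS](Ex_eq _ (g := fun w => xi' w * xi w)); last by move=> w; exact: mulrC.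
exact: (gram_le a'0 ab' ab (ltW h) mx' bx' mx bx).
Qed.

Section Elementary.
Variables (I : finType) (xi : I -> Om -> R) (a b : I -> R) (T : R).
Hypotheses (a0 : forall i, 0 <= a i) (ab : forall i, a i <= b i) (bT : forall i, b i <= T).
Hypothesis mxi : forall i, smeas (F (a i)) (xi i).
Hypothesis bxi : forall i, exists K : R, forall w, `|xi i w| <= K.

Definition elementary_value (s : R) (w : Om) : R := \sum_i xi i w * (a i < s <= b i)%R%:R.
Definition elementary_integral (w : Om) : R := \sum_i xi i w * (B (b i) w - B (a i) w).

Lemma joint_measurable_elementary : joint_measurable elementary_value.
Proof.
apply: joint_measurable_sum => i; apply: joint_measurableM.
  by apply: joint_measurable_space; exact: Fmeas (a0 i) (@mxi i).
apply: (joint_measurable_time (f := fun s => (a i < s <= b i)%R%:R)).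
rewrite (_ : (fun s : R => _) = \1_(`]a i, b i]%classic)); first exact: measurable_indic.
by apply/funext => s; rewrite indicE mem_setE in_itv.
Qed.

Lemma L4_elementary_integral : L4 P elementary_integral.
Proof.
apply: L4_sum => i; have [K hK] := bxi i.
by apply: (L4_mulbd _ hK); [exact: Fmeas (a0 i) (@mxi i)|exact: incL4].
Qed.

(** The index type is any finite type and the intervals may overlap, the Gram matrix of the
    increments accounting for it. Hence a difference of two elementary processes is again one, over
    the disjoint sum of the index types. *)
Lemma ito_isometry :
  (\int[P]_w \int[mu]_(s in `[0%R, T]) (elementary_value s w ^+ 2)%:E =
   \int[P]_w (elementary_integral w ^+ 2)%:E)%E.
Proof.
pose ov i j := overlap (a i) (b i) (a j) (b j).
have inner w : (\int[mu]_(s in `[0%R, T]) (elementary_value s w ^+ 2)%:E =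
    (\sum_i \sum_j ov i j * (xi i w * xi j w))%:E)%E.
  pose f i j s : \bar R := ((xi i w * xi j w) * ((a i < s <= b i)%R%:R * (a j < s <= b j)%R%:R))%:E.
  have meas1 i : measurable_fun setT (fun s : R => (a i < s <= b i)%R%:R : R).
    rewrite (_ : (fun s : R => _) = \1_(`]a i, b i]%classic)); first exact: measurable_indic.
    by apply/funext => s; rewrite indicE mem_setE in_itv.
  have int1 i j : mu.-integrable `[0, T] (fun s => ((a i < s <= b i)%R%:R * (a j < s <= b j)%R%:R)%:E).
    apply/integrableP; split.
      by apply/measurable_EFinP; apply: measurable_funTS; apply: measurable_funM; exact: meas1.
    rewrite [X in (X < _)%E](_ : _ = (overlap (a i) (b i) (a j) (b j))%:E) ?ltry//.
    rewrite -(@overlap_integral T)//; apply: eq_integral => s _ /=.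
    by rewrite ger0_norm ?mulr_ge0.
  have intf i j : mu.-integrable `[0, T] (f i j).
    exact: (integrableZl _ (xi i w * xi j w) (int1 i j)).
  transitivity (\int[mu]_(s in `[0%R, T]) (\sum_(k : I * I) f k.1 k.2 s))%E.
    apply: eq_integral => s _; rewrite /elementary_value expr2 mulr_suml -sumEFin.
    rewrite -(pair_bigA _ (fun i j => f i j s))/=; apply: eq_bigr => i _.
    rewrite mulr_sumr -sumEFin; apply: eq_bigr => j _; congr EFin; ring.
  rewrite integral_sum//.
  rewrite -(pair_bigA _ (fun i j => \int[mu]_(s in `[0%R, T]) f i j s)%E)/=.
  rewrite -sumEFin; apply: eq_bigr => i _; rewrite -sumEFin; apply: eq_bigr => j _.
  have mD : (@measurable _ (measurableTypeR R)) `[0, T]%classic by exact: measurable_itv.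
  have := integralZl mD (int1 i j) (xi i w * xi j w).
  rewrite overlap_integral// -EFinM => e.
  by rewrite [RHS](_ : _ = ((xi i w * xi j w) * ov i j)%:E)// mulrC.
have ixx i j : intg P (fun w => xi i w * xi j w).
  have [K hK] := bxi i; have [K' hK'] := bxi j.
  apply: (intg_mulbd _ hK); first exact: Fmeas (a0 i) (@mxi i).
  by apply: intg_bd hK'; exact: Fmeas (a0 j) (@mxi j).
have Li i : L4 P (fun w => xi i w * (B (b i) w - B (a i) w)).
  by have [K hK] := bxi i; apply: (L4_mulbd _ hK); [exact: Fmeas (a0 i) (@mxi i)|exact: incL4].
under eq_integral do rewrite inner.
rewrite -ExE; last by apply: intg_sum => i; apply: intg_sum => j; exact: intgZ.
rewrite -(ExE (L4_intg2 L4_elementary_integral)); congr EFin.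
rewrite Ex_sum; last by move=> i; apply: intg_sum => j; exact: intgZ.
rewrite [RHS](@Ex_eq _ _ _ _ _ (fun w => \sum_i \sum_j (xi i w * (B (b i) w - B (a i) w)) *
  (xi j w * (B (b j) w - B (a j) w)))); last first.
  by move=> w; rewrite /elementary_integral expr2 mulr_suml; apply: eq_bigr => i _; rewrite mulr_sumr.
rewrite Ex_sum; last by move=> i; apply: intg_sum => j; exact: L4_prod2.
apply: eq_bigr => i _; rewrite Ex_sum; last by move=> j; exact: intgZ.
rewrite Ex_sum; last by move=> j; exact: L4_prod2.
apply: eq_bigr => j _; rewrite ExZ//.
by have [K hK] := bxi i; have [K' hK'] := bxi j; rewrite (gram _ _ _ _ (@mxi i) hK (@mxi j) hK').
Qed.

End Elementary.
End ItoIsometry.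

(** * Ito integrals approximated by grid sums *)

Section ItoApproximation.
Context {R : realType} {dO : measure_display} {Om : measurableType dO}.
Variables (P : probability Om R) (F : R -> set (set Om)) (B : R -> Om -> R).
Hypothesis fF : filtration F.
Hypothesis bB : brownian_motion P F B.
Local Notation mu := (@lebesgue_measure R).

Lemma integral_itv_eq_off0 (f g : R -> R) (T : R) : measurable_fun setT g ->
  (forall s, 0 < s -> s <= T -> f s = g s) ->
  (\int[mu]_(s in `[0%R, T]) (f s)%:E = \int[mu]_(s in `[0%R, T]) (g s)%:E)%E.
Proof.
move=> mg fg.
have mg' : measurable_fun `]0, T] (EFin \o g) by apply/measurable_EFinP; exact: measurable_funTS.
have e : {in `]0, T], (EFin \o g) =1 (EFin \o f)}.
  by move=> s; rewrite in_itv/= => /andP[s0 sT]; rewrite fg.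
rewrite -!integral_itv_obnd_cbnd//.
  by apply: eq_integral => s; rewrite mem_setE => /e /= ->.
by apply: (eq_measurable_fun (EFin \o g)) => // s; rewrite mem_setE => /e.
Qed.

Lemma sqr_le_double (x y z : R) : (x - z) ^+ 2 <= 2 * (x - y) ^+ 2 + 2 * (y - z) ^+ 2.
Proof.
rewrite -subr_ge0 (_ : _ - _ = ((x - y) - (y - z)) ^+ 2); last by ring.
exact: sqr_ge0.
Qed.

Section TimeIntegralComparison.
Variable (T : R).
Implicit Types (f g h : R -> Om -> R).
Local Notation I2 f g := (\int[P]_w \int[mu]_(s in `[0%R, T]) ((f s w - g s w) ^+ 2)%:E)%E.

Let jsq f g : joint_measurable f -> joint_measurable g ->
  joint_measurable (fun s w => (f s w - g s w) ^+ 2).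
Proof.
move=> mf mg; apply: (joint_measurable_comp (psi := fun x => x ^+ 2)); first exact: measurable_funX.
exact: joint_measurableB.
Qed.

Lemma time_integral_sqr_triangle f g h : joint_measurable f -> joint_measurable g -> joint_measurable h ->
  (I2 f h <= 2%:E * I2 f g + 2%:E * I2 g h)%E.
Proof.
move=> mf mg mh.
have mfg := jsq mf mg; have mgh := jsq mg mh; have mfh := jsq mf mh.
have mI (u v : R -> Om -> R) : joint_measurable u -> joint_measurable v ->
    measurable_fun setT (fun w => \int[mu]_(s in `[0%R, T]) ((u s w - v s w) ^+ 2)%:E)%E.
  by move=> mu' mv; apply: measurable_time_integral (jsq mu' mv) _ => s w; exact: sqr_ge0.
have I0 (u v : R -> Om -> R) w : (0 <= \int[mu]_(s in `[0%R, T]) ((u s w - v s w) ^+ 2)%:E)%E.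
  by apply: integral_ge0 => s _; rewrite lee_fin sqr_ge0.
have mS (u v : R -> Om -> R) w : joint_measurable u -> joint_measurable v ->
    @measurable_fun _ _ (measurableTypeR R) _ `[0, T]%classic (fun s => ((u s w - v s w) ^+ 2)%:E).
  move=> mu' mv; apply/measurable_EFinP; apply: measurable_funTS.
  exact: (joint_section_time w (jsq mu' mv)).
have mD : (@measurable _ (measurableTypeR R)) `[0, T]%classic by exact: measurable_itv.
rewrite -!ge0_integralZl//; try exact: mI.
rewrite -ge0_integralD//; try (by move=> w _; rewrite mule_ge0);
  try (by apply: measurable_funeM; exact: mI).
apply: ge0_le_integral => //; first exact: mI.
  by apply: emeasurable_funD; apply: measurable_funeM; exact: mI.
move=> w _; rewrite -!ge0_integralZl//; try exact: mS; try (by move=> s _; rewrite lee_fin sqr_ge0).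
rewrite -ge0_integralD//; try (by move=> s _; rewrite mule_ge0// lee_fin sqr_ge0);
  try (by apply: measurable_funeM; exact: mS).
apply: ge0_le_integral => //.
- by move=> s _; rewrite lee_fin sqr_ge0.
- exact: mS.
- by apply: emeasurable_funD; apply: measurable_funeM; exact: mS.
by move=> s _; rewrite -!EFinM -EFinD lee_fin sqr_le_double.
Qed.

End TimeIntegralComparison.

Lemma integral_sqr_triangle (f g h : Om -> R) : measurable_fun setT f -> measurable_fun setT g -> measurable_fun setT h ->
  (\int[P]_w ((f w - h w) ^+ 2)%:E <= 2%:E * \int[P]_w ((f w - g w) ^+ 2)%:E + 2%:E * \int[P]_w ((g w - h w) ^+ 2)%:E)%E.
Proof.
move=> mf mg mh.
have mS (u v : Om -> R) : measurable_fun setT u -> measurable_fun setT v -> measurable_fun setT (fun w : Om => ((u w - v w) ^+ 2 : R)%:E).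
  by move=> mu' mv; apply/measurable_EFinP; apply: measurable_funX; exact: measurable_funB.
rewrite -!ge0_integralZl//; try exact: mS; try (by move=> s _; rewrite lee_fin sqr_ge0).
rewrite -ge0_integralD//; try (by move=> s _; rewrite mule_ge0// lee_fin sqr_ge0);
  try (by apply: measurable_funeM; exact: mS).
apply: ge0_le_integral => //.
- by move=> s _; rewrite lee_fin sqr_ge0.
- exact: mS.
- by apply: emeasurable_funD; apply: measurable_funeM; exact: mS.
by move=> s _; rewrite -!EFinM -EFinD lee_fin sqr_le_double.
Qed.

Lemma cvg0_small (u : nat -> \bar R) (e : R) : u @ \oo --> 0%E -> 0 < e ->
  exists n0 : nat, forall n, (n0 <= n)%N -> (u n <= e%:E)%E.
Proof.
move=> /fine_cvgP[[n1 _ fu] /cvgrPdist_le/(_ e)] + e0 => /(_ e0)[n2 _ h].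
exists (maxn n1 n2) => n; rewrite geq_max => /andP[h1 h2].
rewrite -(fineK (fu n h1)) lee_fin; have := h n h2.
by rewrite /= sub0r normrN; apply: le_trans; exact: ler_norm.
Qed.

Variables (c c' : R -> Om -> R) (T : R) (J : Om -> R).
Hypothesis iJ : ito_integral P F B c T J.
Hypothesis cc' : forall s w, 0 < s -> s <= T -> c s w = c' s w.
Hypothesis mc' : joint_measurable c'.

Section Elementary.
Variables (I : finType) (xi : I -> Om -> R) (a b : I -> R).
Hypotheses (a0 : forall i, 0 <= a i) (ab : forall i, a i <= b i) (bT : forall i, b i <= T).
Hypothesis mxi : forall i, smeas (F (a i)) (xi i).
Hypothesis bxi : forall i, exists K : R, forall w, `|xi i w| <= K.

(** The simple processes of the definition are compared with the given elementary one by the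
    isometry. [c'] is a jointly measurable version of [c], equal to it at positive times up to [T],
    with which time integrals depend measurably on the outcome. *)
Lemma ito_approximation :
  (\int[P]_w ((J w - elementary_integral B xi a b w) ^+ 2)%:E <=
   4%:E * \int[P]_w \int[mu]_(s in `[0%R, T]) ((c' s w - elementary_value xi a b s w) ^+ 2)%:E)%E.
Proof.
have [mJ [H [cH cI]]] := iJ.
have mK := joint_measurable_elementary fF b a0 mxi.
have LK := L4_elementary_integral fF bB a0 ab mxi bxi.
apply/lee_addgt0Pr => e e0.
have [n1 h1] := cvg0_small cH (divr_gt0 e0 (ltr0n _ 8)).
have [n2 h2] := cvg0_small cI (divr_gt0 e0 (ltr0n _ 4)).
pose n := maxn n1 n2; have {}h1 := h1 n (leq_maxl _ _); have {}h2 := h2 n (leq_maxr _ _).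
move: (H n) h1 h2 => {cH cI}{}H h1 h2.
pose S := sp_size H.
have tm k : (k <= S)%N -> 0 <= sp_time H k.
  elim: k => [_|k ih kS]; first exact: sp_time_ge0.
  by apply: le_trans (ih (ltnW kS)) _; exact: sp_time_homo.
have tT k : (k <= S)%N -> sp_time H k <= T.
  move=> kS; rewrite -(subKn kS); elim: (S - k)%N (leq_subr k S) => [_|m ih mS].
    by rewrite subn0; exact: sp_time_le.
  apply: le_trans (ih (ltnW mS)).
  have -> : (S - m)%N = (S - m.+1).+1 by rewrite subnSK.
  by apply: sp_time_homo; rewrite -subSn// subSS leq_subr.
pose xiH (i : 'I_S) : Om -> R := sp_coef H i.
pose aH (i : 'I_S) := sp_time H i; pose bH (i : 'I_S) := sp_time H i.+1.
have aH0 i : 0 <= aH i by apply: tm; exact: ltnW.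
have abH i : aH i <= bH i by exact: sp_time_homo.
have bHT i : bH i <= T by exact: tT.
have mxiH i : smeas (F (aH i)) (xiH i).
  apply/smeasP; first exact: (filtration_sigma fF).
  move=> E bE; apply: (sp_coef_measurable (ltn_ord i)).
  by exists E => //; rewrite setTI.
have bxiH i : exists K : R, forall w, `|xiH i w| <= K by exact: (sp_coef_bounded (ltn_ord i)).
have vH s w : sp_value H s w = elementary_value xiH aH bH s w by [].
have iH w : sp_integral H B w = elementary_integral B xiH aH bH w by [].
pose xi2 (i : 'I_S + I) : Om -> R := match i with inl i => xiH i | inr i => fun w => - xi i w end.
pose a2 (i : 'I_S + I) := match i with inl i => aH i | inr i => a i end.
pose b2 (i : 'I_S + I) := match i with inl i => bH i | inr i => b i end.
have v2 s w : elementary_value xi2 a2 b2 s w = elementary_value xiH aH bH s w - elementary_value xi a b s w.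
  rewrite /elementary_value big_sumType/=; congr (_ + _); rewrite -sumrN.
  by apply: eq_bigr => i _; rewrite mulNr.
have i2 w : elementary_integral B xi2 a2 b2 w = elementary_integral B xiH aH bH w - elementary_integral B xi a b w.
  rewrite /elementary_integral big_sumType/=; congr (_ + _); rewrite -sumrN.
  by apply: eq_bigr => i _; rewrite mulNr.
have iso : (\int[P]_w \int[mu]_(s in `[0%R, T]) (elementary_value xi2 a2 b2 s w ^+ 2)%:E =
   \int[P]_w (elementary_integral B xi2 a2 b2 w ^+ 2)%:E)%E.
  apply: (ito_isometry fF bB) => [[]|[]|[]|[] i|[] i]//=.
    by apply: measurable_funN; exact: mxi.
  by have [K hK] := bxi i; exists K => w; rewrite normrN.
have mH := joint_measurable_elementary fF bH aH0 mxiH.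
have [mIH _] := L4_elementary_integral fF bB aH0 abH mxiH bxiH.
have [mIK _] := LK.
have t1 := integral_sqr_triangle mJ mIH mIK.
have t2 := time_integral_sqr_triangle T mH mc' mK.
have e1 : (\int[P]_w ((elementary_integral B xiH aH bH w - elementary_integral B xi a b w) ^+ 2)%:E =
    \int[P]_w \int[mu]_(s in `[0%R, T]) ((elementary_value xiH aH bH s w - elementary_value xi a b s w) ^+ 2)%:E)%E.
  transitivity (\int[P]_w \int[mu]_(s in `[0%R, T]) (elementary_value xi2 a2 b2 s w ^+ 2)%:E)%E.
    by rewrite iso; apply: eq_integral => w _; rewrite i2.
  by apply: eq_integral => w _; apply: eq_integral => s _; rewrite v2.
have e2 : (\int[P]_w ((J w - elementary_integral B xiH aH bH w) ^+ 2)%:E <= (e / 4)%:E)%E.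
  apply: le_trans h2; rewrite le_eqVlt; apply/orP; left; apply/eqP; apply: eq_integral => w _.
  by rewrite iH; congr EFin; ring.
have e3 : (\int[P]_w \int[mu]_(s in `[0%R, T]) ((elementary_value xiH aH bH s w - c' s w) ^+ 2)%:E <= (e / 8)%:E)%E.
  apply: le_trans h1; rewrite le_eqVlt; apply/orP; left; apply/eqP; apply: eq_integral => w _.
  apply/esym; apply: (@integral_itv_eq_off0 (fun s => (sp_value H s w - c s w) ^+ 2) (fun s => (elementary_value xiH aH bH s w - c' s w) ^+ 2)).
    by apply: measurable_funX; exact: (joint_section_time w (joint_measurableB mH mc')).
  by move=> s s0 sT; rewrite vH cc'.
rewrite e1 in t1.
set Z := (\int[P]_w \int[mu]_(s in `[0%R, T]) ((c' s w - elementary_value xi a b s w) ^+ 2)%:E)%E in t2 *.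
apply: le_trans t1 _.
(* Two uses of [(x - z)^2 <= 2 (x - y)^2 + 2 (y - z)^2]: the total is [e/2 + e/2 + 4 Z], whence the
   factor 4. *)
apply: (@le_trans _ _ (2%:E * (e / 4)%:E + 2%:E * (2%:E * (e / 8)%:E + 2%:E * Z))%E).
  apply: leeD; first by rewrite lee_pmul2l.
  rewrite lee_pmul2l//; apply: le_trans t2 _; apply: leeD => //.
  by rewrite lee_pmul2l.
have Z0 : (0 <= Z)%E.
  by apply: integral_ge0 => w _; apply: integral_ge0 => s _; rewrite lee_fin sqr_ge0.
rewrite ge0_muleDr ?mule_ge0 ?lee_fin ?divr_ge0 ?(ltW e0)//.
rewrite addeA addeC muleA -!EFinM -EFinD.
rewrite (_ : 2 * 2 = 4 :> R); last by ring.
by apply: leeD => //; rewrite lee_fin; lra.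
Qed.

End Elementary.

Lemma elementary_value_grid (n : nat) (tau : R) (xi : nat -> Om -> R) (s : R) : 0 < tau -> 0 < s -> s <= n%:R * tau ->
  exists k, [/\ (k < n)%N, k%:R * tau < s, s <= k.+1%:R * tau & forall w,
    elementary_value (fun i : 'I_n => xi i) (fun i : 'I_n => i%:R * tau) (fun i : 'I_n => i.+1%:R * tau) s w = xi k w].
Proof.
move=> tau0 s0 sT.
have [k kn /andP[ks sk]] : exists2 k, (k < n)%N & k%:R * tau < s <= k.+1%:R * tau.
  have : exists k : nat, s <= k.+1%:R * tau.
    by exists n; apply: le_trans sT _; rewrite ler_wpM2r ?(ltW tau0)// ler_nat.
  move=> ek; case: (ex_minnP ek) => m sm mm; exists m; last first.
    apply/andP; split => //; case: m mm sm => [|m] mm sm; first by rewrite mul0r.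
    by rewrite ltNge; apply/negP => h; have := mm m h; rewrite ltnn.
  have n0 : (0 < n)%N.
    by rewrite lt0n; apply/eqP => n0; move: sT; rewrite n0 mul0r leNgt s0.
  by rewrite -(prednK n0) ltnS; apply: mm; rewrite prednK.
exists k; split => // w.
rewrite /elementary_value (bigD1 (Ordinal kn))//= big1 ?addr0 => [|i ik].
  by rewrite ks sk mulr1.
suff -> : (i%:R * tau < s <= i.+1%:R * tau) = false by rewrite mulr0.
apply/negbTE/negP => /andP[h1 h2]; move/negP: ik; apply; apply/eqP/val_inj => /=.
apply/eqP; rewrite eqn_leq; apply/andP; split; rewrite -ltnS -(ltr_nat R) -(ltr_pM2r tau0).
  exact: lt_le_trans sk.
exact: lt_le_trans h2.
Qed.

Lemma ito_grid_approximation (n : nat) (tau : R) (xi : nat -> Om -> R) (K delta : R) : 0 < tau -> n%:R * tau = T ->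
  (forall k, (k < n)%N -> smeas (F (k%:R * tau)) (xi k)) -> (forall k w, `|xi k w| <= K) ->
  (forall k s, (k < n)%N -> k%:R * tau < s -> s <= k.+1%:R * tau ->
    (\int[P]_w ((c' s w - xi k w) ^+ 2)%:E <= delta%:E)%E) ->
  (\int[P]_w ((J w - \sum_(k < n) xi k w * (B (k.+1%:R * tau) w - B (k%:R * tau) w)) ^+ 2)%:E <= (4 * delta * T)%:E)%E.
Proof.
move=> tau0 nT mxi bxi hd.
have T0 : 0 <= T by rewrite -nT mulr_ge0// ltW.
pose a (i : 'I_n) := i%:R * tau; pose b (i : 'I_n) := i.+1%:R * tau.
have a0 i : 0 <= a i by rewrite mulr_ge0// ltW.
have ab i : a i <= b i by rewrite ler_wpM2r ?(ltW tau0)// ler_nat.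
have bT i : b i <= T by rewrite -nT ler_wpM2r ?(ltW tau0)// ler_nat.
have mx (i : 'I_n) : smeas (F (a i)) (xi i) by exact: mxi.
have bx (i : 'I_n) : exists K : R, forall w, `|xi i w| <= K by exists K => w; exact: bxi.
apply: le_trans (ito_approximation a0 ab bT mx bx) _.
rewrite -mulrA EFinM lee_pmul2l//.
apply: (@time_integral_le _ _ _ P (fun s w => (c' s w - elementary_value (fun i : 'I_n => xi i) a b s w) ^+ 2)) => //.
- apply: (joint_measurable_comp (psi := fun x => x ^+ 2)); first exact: measurable_funX.
  by apply: joint_measurableB => //; exact: (joint_measurable_elementary fF b a0 mx).
- by move=> s w; exact: sqr_ge0.
move=> s s0 sT.
rewrite -nT in sT; have [k [kn ks sk ev]] := elementary_value_grid xi tau0 s0 sT.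
by under eq_integral do rewrite ev; exact: hd ks sk.
Qed.

End ItoApproximation.

(** * Averaging over the chain *)

Section GeneratorEstimates.
Context {R : realType} {d : nat}.
Variables (Q : 'M[R]_d) (p : 'cV[R]_d).
Hypotheses (gQ : is_generator Q) (up : unique_invariant_distribution Q p).
Implicit Types (f g h : 'I_d -> R).

Local Notation D := (deviation_matrix Q p).
Definition mxnorm1 (A : 'M[R]_d) : R := \sum_i \sum_j `|A i j|.

Lemma mxnorm1_ge0 A : 0 <= mxnorm1 A.
Proof. by apply: sumr_ge0 => i _; exact: sumr_ge0. Qed.

Lemma mop_bound A f (K : R) : (forall i, `|f i| <= K) -> forall i, `|mop A f i| <= mxnorm1 A * K.
Proof. by move=> h i; exact: mop_le. Qed.

Lemma mopB A f g i : mop A (fun j => f j - g j) i = mop A f i - mop A g i.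
Proof. by rewrite /mop -sumrB; apply: eq_bigr => j _; rewrite mulrBr. Qed.

Lemma pavB f g : pav p (fun j => f j - g j) = pav p f - pav p g.
Proof. by rewrite /pav -sumrB; apply: eq_bigr => j _; rewrite mulrBr. Qed.

Lemma pavD f g : pav p (fun j => f j + g j) = pav p f + pav p g.
Proof. by rewrite /pav -big_split/=; apply: eq_bigr => j _; rewrite mulrDr. Qed.

Lemma pavZ (k : R) f : pav p (fun j => k * f j) = k * pav p f.
Proof. by rewrite /pav mulr_sumr; apply: eq_bigr => j _; rewrite mulrCA. Qed.

Lemma pav_bound f (K : R) : (forall i, `|f i| <= K) -> `|pav p f| <= K.
Proof. exact: (pav_le up). Qed.

Lemma pav_dist f g (K : R) : (forall i, `|f i - g i| <= K) -> `|pav p f - pav p g| <= K.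
Proof. by move=> h; rewrite -pavB; exact: pav_bound. Qed.

Lemma mop_dist A f g (K : R) : (forall i, `|f i - g i| <= K) ->
  forall i, `|mop A f i - mop A g i| <= mxnorm1 A * K.
Proof. by move=> h i; rewrite -mopB; exact: mop_bound. Qed.

Lemma carre_du_champE g i :
  carre_du_champ Q g i = mop Q (fun j => g j ^+ 2) i - 2 * g i * mop Q g i.
Proof.
have [_ Q0] := gQ.
have z : \sum_j g i ^+ 2 * Q i j = 0 by rewrite -mulr_sumr Q0 mulr0.
rewrite -[RHS]addr0 -[X in _ = _ + X]z /carre_du_champ /mop mulr_sumr -sumrB -big_split/=.
by apply: eq_bigr => j _; ring.
Qed.

Lemma mxnorm1_coef (A : 'M[R]_d) i (e : 'I_d -> R) (K : R) : (forall j, `|e j| <= K) ->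
  `|\sum_j A i j * e j| <= mxnorm1 A * K.
Proof. by move=> h; exact: (mop_bound A h i). Qed.

Lemma carre_du_champ_bound g (G : R) i : (forall i, `|g i| <= G) ->
  `|carre_du_champ Q g i| <= 4 * mxnorm1 Q * G ^+ 2.
Proof.
move=> gG; rewrite [leRHS](_ : _ = mxnorm1 Q * (2 * G) ^+ 2); last by ring.
apply: mxnorm1_coef => j; rewrite normrX lerXn2r ?nnegrE//.
  by rewrite mulr_ge0//; exact: le_trans (gG i).
by apply: le_trans (ler_normB _ _) _; have := gG i; have := gG j; lra.
Qed.

Lemma carre_du_champ_dist g h (G e : R) i : (forall i, `|g i| <= G) -> (forall i, `|h i| <= G) ->
  (forall i, `|g i - h i| <= e) ->
  `|carre_du_champ Q g i - carre_du_champ Q h i| <= 8 * mxnorm1 Q * G * e.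
Proof.
move=> gG hG gh.
have -> : carre_du_champ Q g i - carre_du_champ Q h i =
    \sum_j Q i j * ((g j - g i) ^+ 2 - (h j - h i) ^+ 2).
  by rewrite /carre_du_champ -sumrB; apply: eq_bigr => j _; rewrite mulrBr.
rewrite [leRHS](_ : _ = mxnorm1 Q * (2 * e * (4 * G))); last by ring.
apply: mxnorm1_coef => j.
rewrite (_ : _ - _ = ((g j - h j) - (g i - h i)) * ((g j - g i) + (h j - h i))); last by ring.
rewrite normrM ler_pM//.
  by apply: le_trans (ler_normB _ _) _; have := gh i; have := gh j; lra.
apply: le_trans (ler_normD _ _) _.
have := ler_normB (g j) (g i); have := ler_normB (h j) (h i).
by have := gG i; have := gG j; have := hG i; have := hG j; lra.
Qed.

Section Semigroup.
Variables (nu : R) (C : R).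
Hypotheses (nu0 : 0 < nu) (C0 : 0 <= C).
Hypothesis taylor : forall t : R, 0 <= t -> t <= 1 -> forall i j,
  `|expmx (t *: (nu *: Q)) i j - ((i == j)%:R + t * (nu *: Q) i j)| <= C * t ^+ 2.
Variable (tau : R).
Hypotheses (tau0 : 0 <= tau) (tau1 : tau <= 1).
Local Notation pK := (expmx (tau *: (nu *: Q))).

Lemma semigroup_taylor h (M : R) i : (forall i, `|h i| <= M) ->
  `|mop pK h i - h i - tau * nu * mop Q h i| <= d%:R * C * M * tau ^+ 2.
Proof.
move=> hM; have M0 : 0 <= M by exact: le_trans (hM i).
have -> : mop pK h i - h i - tau * nu * mop Q h i =
    \sum_j (pK i j - ((i == j)%:R + tau * (nu *: Q) i j)) * h j.
  rewrite /mop mulr_sumr -[in LHS](mul1r (h i)).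
  have -> : 1 * h i = \sum_j (i == j)%:R * h j.
    by rewrite (bigD1 i)//= eqxx big1 ?addr0// => j ji; rewrite eq_sym (negbTE ji) mul0r.
  by rewrite -!sumrB; apply: eq_bigr => j _; rewrite [(nu *: Q) i j]mxE; ring.
apply: le_trans (ler_norm_sum _ _ _) _.
apply: (@le_trans _ _ (\sum_(j < d) C * tau ^+ 2 * M)).
  by apply: ler_sum => j _; rewrite normrM ler_pM// taylor.
by rewrite sumr_const card_ord -mulr_natl le_eqVlt; apply/orP; left; apply/eqP; ring.
Qed.

Lemma semigroup_dist h (M : R) i : (forall i, `|h i| <= M) ->
  `|mop pK h i - h i| <= (nu * mxnorm1 Q + d%:R * C) * M * tau.
Proof.
move=> hM; have M0 : 0 <= M by exact: le_trans (hM i).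
have h1 := semigroup_taylor i hM; have h2 := mop_bound Q hM i.
have -> : mop pK h i - h i = (mop pK h i - h i - tau * nu * mop Q h i) + tau * nu * mop Q h i by ring.
apply: le_trans (ler_normD _ _) _.
have h3 : `|tau * nu * mop Q h i| <= tau * nu * (mxnorm1 Q * M).
  by rewrite normrM ger0_norm ?mulr_ge0 ?(ltW nu0)// ler_wpM2l// mulr_ge0// ltW.
have h4 : d%:R * C * M * tau ^+ 2 <= d%:R * C * M * tau.
  by rewrite ler_wpM2l ?mulr_ge0// expr2 ler_piMl.
apply: le_trans (lerD (le_trans h1 h4) h3) _.
by rewrite le_eqVlt; apply/orP; left; apply/eqP; ring.
Qed.

Definition variance_const (G : R) : R :=
  3 * (d%:R * C) * G ^+ 2 + ((nu * mxnorm1 Q + d%:R * C) * G) ^+ 2.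

(** With [P g = g + r], the variance [P g^2 - (P g)^2] expands by [semigroup_taylor] to
    [tau nu (Q g^2 - 2 g Q g)], up to [r^2] and Taylor errors, all of order [tau^2]. *)
Lemma semigroup_variance g (G : R) i : (forall i, `|g i| <= G) ->
  `|mop pK (fun j => g j ^+ 2) i - mop pK g i ^+ 2 - tau * nu * carre_du_champ Q g i|
    <= variance_const G * tau ^+ 2.
Proof.
move=> gG; have G0 : 0 <= G by exact: le_trans (gG i).
have g2 j : `|g j ^+ 2| <= G ^+ 2 by rewrite normrX lerXn2r ?nnegrE.
have h1 := semigroup_taylor i g2; have h2 := semigroup_taylor i gG; have h3 := semigroup_dist i gG.
rewrite carre_du_champE.
set e1 := mop pK (fun j => g j ^+ 2) i - _ - _ in h1.
set e2 := mop pK g i - _ - _ in h2; set r := mop pK g i - g i in h3.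
have -> : mop pK (fun j => g j ^+ 2) i - mop pK g i ^+ 2 -
   tau * nu * (mop Q (fun j => g j ^+ 2) i - 2 * g i * mop Q g i) = e1 - 2 * g i * e2 - r ^+ 2.
  by rewrite /e1 /e2 /r; ring.
apply: le_trans (ler_normB _ _) _; apply: le_trans (lerD (ler_normB _ _) (lexx _)) _.
have k2 : `|2 * g i * e2| <= 2 * G * (d%:R * C * G * tau ^+ 2).
  by rewrite !normrM ger0_norm// !ler_pM// mulr_ge0.
have k3 : `|r ^+ 2| <= ((nu * mxnorm1 Q + d%:R * C) * G * tau) ^+ 2.
  by rewrite normrX lerXn2r ?nnegrE//; exact: le_trans h3.
apply: le_trans (lerD (lerD h1 k2) k3) _; rewrite /variance_const.
by rewrite le_eqVlt; apply/orP; left; apply/eqP; ring.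
Qed.

End Semigroup.

Section TimeDependent.
Variables (f : R -> 'I_d -> R) (u : 'I_d -> R) (Fb Lf : R).
Hypotheses (Fb0 : 0 <= Fb) (Lf0 : 0 <= Lf).
Hypothesis fB : forall t i, 0 <= t -> `|f t i| <= Fb.
Hypothesis fL : forall s t i, 0 <= s -> 0 <= t -> `|f t i - f s i| <= Lf * `|t - s|.

(** Solves [Q g = p.f_t - f_t]: compensating the integral of [f] along the chain by it leaves a
    martingale and boundary terms. *)
Definition corrector (t : R) : 'I_d -> R := mop D (f t).
Definition corrector_rate (t : R) (i : 'I_d) : R := carre_du_champ Q (corrector t) i.
Definition cG : R := mxnorm1 D * Fb.
Definition lG : R := mxnorm1 D * Lf.
Definition cV : R := 4 * mxnorm1 Q * cG ^+ 2.
Definition lV : R := 8 * mxnorm1 Q * cG * lG.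
Definition cU : R := \sum_i u i ^+ 2.

Lemma cG_ge0 : 0 <= cG. Proof. by rewrite mulr_ge0// mxnorm1_ge0. Qed.
Lemma lG_ge0 : 0 <= lG. Proof. by rewrite mulr_ge0// mxnorm1_ge0. Qed.
Lemma cV_ge0 : 0 <= cV. Proof. by rewrite !mulr_ge0 ?sqr_ge0 ?mxnorm1_ge0. Qed.
Lemma lV_ge0 : 0 <= lV. Proof. by rewrite !mulr_ge0 ?mxnorm1_ge0 ?cG_ge0 ?lG_ge0. Qed.
Lemma cU_ge0 : 0 <= cU. Proof. by apply: sumr_ge0 => i _; exact: sqr_ge0. Qed.

Lemma u_le_cU i : u i ^+ 2 <= cU.
Proof. by rewrite /cU (bigD1 i)//= lerDl; apply: sumr_ge0 => j _; exact: sqr_ge0. Qed.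

Lemma corrector_bound t i : 0 <= t -> `|corrector t i| <= cG.
Proof. by move=> t0; apply: mop_bound => j; exact: fB. Qed.

Lemma corrector_lip s t i : 0 <= s -> 0 <= t -> `|corrector t i - corrector s i| <= lG * `|t - s|.
Proof. by move=> s0 t0; rewrite /lG -mulrA; apply: mop_dist => j; exact: fL. Qed.

Lemma corrector_poisson t i : mop Q (corrector t) i = pav p (f t) - f t i.
Proof. exact: (poisson_equation gQ up). Qed.

Lemma corrector_rate_bound t i : 0 <= t -> `|corrector_rate t i| <= cV.
Proof. by move=> t0; apply: carre_du_champ_bound => j; exact: corrector_bound. Qed.

Lemma corrector_rate_ge0 t i : 0 <= corrector_rate t i.
Proof. exact: carre_du_champ_ge0. Qed.

Lemma corrector_rate_lip s t i : 0 <= s -> 0 <= t ->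
  `|corrector_rate t i - corrector_rate s i| <= lV * `|t - s|.
Proof.
move=> s0 t0; rewrite /lV -mulrA.
by apply: carre_du_champ_dist => j; [exact: corrector_bound|exact: corrector_bound|exact: corrector_lip].
Qed.

Section Rate.
Variables (A2 B2 : R).
Hypotheses (A20 : 0 <= A2) (B20 : 0 <= B2).

(** Variance rate of the noise while the chain is in state [i]. In use [A2] is [lam ^+ 2 * nu] and
    [B2] is the squared noise scale, or their limits. *)
Definition state_rate (t : R) (i : 'I_d) : R := A2 * corrector_rate t i + B2 * u i ^+ 2.
Definition mean_rate (t : R) : R := pav p (state_rate t).

Lemma state_rate_bound t i : 0 <= t -> `|state_rate t i| <= (cV + cU) * (A2 + B2).
Proof.
move=> t0; apply: le_trans (ler_normD _ _) _.
rewrite (normrM A2) (normrM B2) (ger0_norm A20) (ger0_norm B20) (ger0_norm (sqr_ge0 (u i))).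
have := ler_wpM2l A20 (corrector_rate_bound i t0); have := ler_wpM2l B20 (u_le_cU i).
have := mulr_ge0 cU_ge0 A20; have := mulr_ge0 cV_ge0 B20; lra.
Qed.

Lemma state_rate_ge0 t i : 0 <= state_rate t i.
Proof. by rewrite addr_ge0// mulr_ge0 ?sqr_ge0// corrector_rate_ge0. Qed.

Lemma state_rate_lip s t i : 0 <= s -> 0 <= t ->
  `|state_rate t i - state_rate s i| <= lV * (A2 + B2) * `|t - s|.
Proof.
move=> s0 t0; rewrite (_ : _ - _ = A2 * (corrector_rate t i - corrector_rate s i)); last by rewrite /state_rate; ring.
rewrite normrM (ger0_norm A20); apply: le_trans (ler_wpM2l A20 (corrector_rate_lip i s0 t0)) _.
have := mulr_ge0 (mulr_ge0 lV_ge0 B20) (normr_ge0 (t - s)); lra.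
Qed.

Lemma mean_rate_ge0 t : 0 <= mean_rate t.
Proof. by apply: (pav_ge0 up) => i; exact: state_rate_ge0. Qed.

Lemma mean_rate_bound t : 0 <= t -> `|mean_rate t| <= (cV + cU) * (A2 + B2).
Proof. by move=> t0; apply: pav_bound => i; exact: state_rate_bound. Qed.

Lemma mean_rate_lip s t : 0 <= s -> 0 <= t ->
  `|mean_rate t - mean_rate s| <= lV * (A2 + B2) * `|t - s|.
Proof. by move=> s0 t0; apply: pav_dist => i; exact: state_rate_lip. Qed.

Lemma mean_rateE t : mean_rate t = A2 * (2 * pav p (fun i => f t i * corrector t i)) +
  B2 * pav p (fun i => u i ^+ 2).
Proof. by rewrite /mean_rate /state_rate pavD !pavZ (pav_carre_du_champ gQ up). Qed.

Definition rate_corrector (t : R) : 'I_d -> R := mop D (state_rate t).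

Lemma rate_corrector_bound t i : 0 <= t -> `|rate_corrector t i| <= mxnorm1 D * ((cV + cU) * (A2 + B2)).
Proof. by move=> t0; apply: mop_bound => j; exact: state_rate_bound. Qed.

Lemma rate_corrector_lip s t i : 0 <= s -> 0 <= t ->
  `|rate_corrector t i - rate_corrector s i| <= mxnorm1 D * (lV * (A2 + B2)) * `|t - s|.
Proof. by move=> s0 t0; rewrite -mulrA; apply: mop_dist => j; exact: state_rate_lip. Qed.

Lemma rate_corrector_poisson t i : mop Q (rate_corrector t) i = mean_rate t - state_rate t i.
Proof. exact: (poisson_equation gQ up). Qed.

End Rate.
End TimeDependent.

End GeneratorEstimates.

Lemma dyadic_step_small (R : realType) (K : R) (n0 : nat) :
  exists n : nat, (n0 <= n)%N /\ K * 2 ^- n <= 1.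
Proof.
exists (maxn n0 (Num.truncn K).+1); split; first exact: leq_maxl.
set n := maxn _ _; have p0 : 0 < 2 ^+ n :> R by exact: exprn_gt0.
rewrite ler_pdivrMr// mul1r; apply: le_trans (ltW (truncnS_gt K)) _.
rewrite -natrX ler_nat; apply: leq_trans (leq_maxr n0 _) _; exact/ltnW/ltn_expl.
Qed.

Lemma mi_weaken {d} {T : measurableType d} {R : realType} {P : probability T R} A s q (tau C C' v v' : R) :
  0 <= tau -> C <= C' -> v <= v' -> martingale_increments P A s q tau C v -> martingale_increments P A s q tau C' v'.
Proof.
move=> t0 CC vv [? ? ? ? ? h4 ? ? hC ?]; split => //.
- by move=> k; apply: le_trans (h4 k) _; rewrite ler_wpM2r.
- by move=> k w; exact: le_trans (hC k w) CC.
Qed.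

(** * The discrete martingale of the sped-up chain and the averaging of its rate *)

Section DiscreteModel.
Context {R : realType} {d : nat} {dO : measure_display} {Om : measurableType dO}.
Variables (P : probability Om R) (F : R -> set (set Om)) (B : R -> Om -> R) (X : R -> Om -> 'I_d).
Variables (Q : 'M[R]_d) (p p0 : 'cV[R]_d) (nu : R).
Hypotheses (gQ : is_generator Q) (up : unique_invariant_distribution Q p).
Hypothesis fF : filtration F.
Hypothesis bB : brownian_motion P F B.
Hypothesis nu0 : 0 < nu.
Hypothesis cX : markov_chain P (nu *: Q) p0 X.
Hypothesis aX : adapted setT F X.
Hypothesis iXB : independent_processes P setT X borelR B.
Variable C : R.
Hypothesis C0 : 0 <= C.
Hypothesis taylor : forall t : R, 0 <= t -> t <= 1 -> forall i j,
  `|expmx (t *: (nu *: Q)) i j - ((i == j)%:R + t * (nu *: Q) i j)| <= C * t ^+ 2.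

Lemma measurable_chain (h : 'I_d -> R) (t : R) : 0 <= t -> measurable_fun setT (fun w => h (X t w)).
Proof.
move=> t0 _ E mE; rewrite setTI (_ : _ @^-1` E = X t @^-1` (h @^-1` E))//.
apply: measurable_comp_finite; first exact: sigma_algebra_measurable.
by move=> i; case: cX => h1 _ _ _; exact: h1.
Qed.

Definition jump_rate : R := nu * mxnorm1 Q + d%:R * (d%:R * C).

(** The two-time case of the Markov property, the Taylor expansion bounding each off-diagonal
    transition probability by [(t - s) (nu |Q i j| + C)]. *)
Lemma jump_probability (s t : R) : 0 <= s -> s <= t -> t - s <= 1 ->
  Ex P (fun w => (X s w != X t w)%:R) <= jump_rate * (t - s).
Proof.
move=> s0 st ts1; have t0 : 0 <= t by exact: le_trans st.
have ts0 : 0 <= t - s by rewrite subr_ge0.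
have [mX _ _ mk] := cX.
pose G i j := X s @^-1` [set i] `&` X t @^-1` [set j].
have mG i j : measurable (G i j) by apply: measurableI; exact: mX.
have iG i j : intg P (\1_(G i j) : Om -> R).
  by apply: (@intg_bd _ _ _ _ _ 1); [exact: measurable_indic|exact: indic_le1].
rewrite (@Ex_eq _ _ _ _ _ (fun w => \sum_(i < d) \sum_(j < d) (i != j)%:R * \1_(G i j) w)); last first.
  move=> w; rewrite (bigD1 (X s w))//= (bigD1 (X t w))//= !big1 ?addr0.
  - by rewrite indicE mem_set// mulr1.
  - move=> i iX; rewrite big1// => j _; rewrite indicE memNset ?mulr0//.
    by move=> [/= e _]; rewrite e eqxx in iX.
  - move=> j jX; rewrite indicE memNset ?mulr0//.
    by move=> [/= _ e]; rewrite e eqxx in jX.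
rewrite Ex_sum; last by move=> i; apply: intg_sum => j; exact: intgZ.
have one i j : i != j -> Ex P (\1_(G i j) : Om -> R) <= (t - s) * (nu * `|Q i j| + C).
  move=> ij; rewrite -lee_fin Ex_indic//.
  pose tt (n : nat) := if n == 0%N then s else t.
  pose x (n : nat) := if n == 0%N then i else j.
  have := mk 0%N tt x s0.
  have -> : [set w | forall k, (k <= 1)%N -> X (tt k) w = x k] = G i j.
    apply/seteqP; split => w /= h; first by split; [exact: (h 0%N)|exact: (h 1%N)].
    by move=> [|[|k]]//= _; [exact: h.1|exact: h.2].
  have -> : [set w | forall k, (k <= 0)%N -> X (tt k) w = x k] = X s @^-1` [set i].
    apply/seteqP; split => w /= h; first exact: (h 0%N).
    by move=> [|k]//= _.
  move=> -> => [|k]; last by rewrite leqn0 => /eqP ->.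
  have := taylor ts0 ts1 i j; rewrite (negbTE ij) add0r [(nu *: Q) i j]mxE /tt /x /= => h.
  set e := expmx _ i j in h *.
  have eb : e <= (t - s) * (nu * `|Q i j| + C).
    have h2 : (t - s) * (nu * Q i j) <= (t - s) * (nu * `|Q i j|).
      by rewrite ler_wpM2l// ler_wpM2l ?(ltW nu0)// ler_norm.
    have h3 : C * (t - s) ^+ 2 <= (t - s) * C.
      by rewrite [leRHS]mulrC ler_wpM2l// expr2 ler_piMl.
    by move: h; rewrite ler_norml => /andP[_ h]; lra.
  have P1 := probability_le1 P (mX s i s0).
  have Pf : P (X s @^-1` [set i]) = (fine (P (X s @^-1` [set i])))%:E.
    by rewrite fineK// fin_num_measure//; exact: mX.
  have b0 : 0 <= (t - s) * (nu * `|Q i j| + C).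
    by rewrite mulr_ge0// addr_ge0// mulr_ge0// ltW.
  have p1 : fine (P (X s @^-1` [set i])) <= 1 by rewrite -lee_fin -Pf.
  have p0' : 0 <= fine (P (X s @^-1` [set i])) by apply: fine_ge0; exact: measure_ge0.
  rewrite Pf -EFinM lee_fin; apply: le_trans (ler_wpM2l p0' eb) _.
  by rewrite ler_piMl.
apply: (@le_trans _ _ (\sum_(i < d) \sum_(j < d) (t - s) * (nu * `|Q i j| + C))).
  apply: ler_sum => i _; rewrite Ex_sum; last by move=> j; exact: intgZ.
  apply: ler_sum => j _; rewrite ExZ//; case: (eqVneq i j) => [->|ij]; last by rewrite mul1r one.
  by rewrite mul0r mulr_ge0// addr_ge0// mulr_ge0// ltW.
rewrite le_eqVlt; apply/orP; left; apply/eqP; rewrite /jump_rate /mxnorm1.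
under eq_bigr do rewrite -mulr_sumr big_split/= -mulr_sumr sumr_const card_ord -mulr_natl.
by rewrite -mulr_sumr big_split/= -mulr_sumr sumr_const card_ord -mulr_natl; ring.
Qed.

Variables (f : R -> 'I_d -> R) (u : 'I_d -> R) (Fb Lf : R).
Hypotheses (Fb0 : 0 <= Fb) (Lf0 : 0 <= Lf).
Hypothesis fB : forall t i, 0 <= t -> `|f t i| <= Fb.
Hypothesis fL : forall s t i, 0 <= s -> 0 <= t -> `|f t i - f s i| <= Lf * `|t - s|.
Variables (lam kap : R).
Hypothesis lam0 : 0 <= lam.
Variable tau : R.
Hypotheses (tau0 : 0 < tau) (tau1 : tau <= 1).

Local Notation A2 := (lam ^+ 2 * nu).
Local Notation B2 := (kap ^+ 2).
Local Notation cG := (cG Q p Fb).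
Local Notation lG := (lG Q p Lf).
Local Notation cV := (cV Q p Fb).
Local Notation lV := (lV Q p Fb Lf).
Local Notation cU := (cU u).
Local Notation vc := (variance_const Q nu C cG).
Local Notation Dn := (mxnorm1 (deviation_matrix Q p)).
Local Notation Y k := (X (k%:R * tau)).
Local Notation pK := (expmx (tau *: (nu *: Q))).
Local Notation gk := (fun k => corrector Q p f (k%:R * tau)).
Local Notation R_ := (state_rate Q p f u A2 B2).
Local Notation A_ := (past F B X tau).

Let t0 k : 0 <= k%:R * tau. Proof. by rewrite mulr_ge0// ltW. Qed.
Let A20 : 0 <= A2. Proof. by rewrite mulr_ge0 ?sqr_ge0// ltW. Qed.
Let B20 : 0 <= B2. Proof. exact: sqr_ge0. Qed.

Let gB k i : `|gk k i| <= cG. Proof. exact: corrector_bound. Qed.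

Let rC : 0 <= (nu * mxnorm1 Q + d%:R * C).
Proof. by rewrite addr_ge0// mulr_ge0// ?mxnorm1_ge0 ?(ltW nu0). Qed.

Hypothesis small1 : (nu * mxnorm1 Q + d%:R * C) * tau <= 1.
Hypothesis small2 : vc * tau <= nu.

Lemma chain_increment_bound k w : `|chain_increment X (nu *: Q) tau lam gk k w| <= 3 * lam * cG.
Proof.
have G0 : 0 <= cG by exact: cG_ge0.
rewrite normrM (ger0_norm lam0) -mulrA mulrCA ler_wpM2l//.
have h := semigroup_dist nu0 C0 taylor (ltW tau0) tau1 (Y k w) (gB k).
have h2 : (nu * mxnorm1 Q + d%:R * C) * cG * tau <= cG by rewrite mulrAC ler_piMl.
have -> : gk k (Y k.+1 w) - mop pK (gk k) (Y k w) =
  gk k (Y k.+1 w) - gk k (Y k w) - (mop pK (gk k) (Y k w) - gk k (Y k w)) by ring.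
apply: le_trans (ler_normB _ _) _; apply: le_trans (lerD (ler_normB _ _) (lexx _)) _.
have := gB k (Y k.+1 w); have := gB k (Y k w); have := le_trans h h2; lra.
Qed.

Lemma chain_variance_dist k i :
  `|chain_variance (nu *: Q) tau lam gk k i - tau * (A2 * corrector_rate Q p f (k%:R * tau) i)|
   <= lam ^+ 2 * (vc * tau ^+ 2).
Proof.
have h := semigroup_variance gQ nu0 C0 taylor (ltW tau0) tau1 i (gB k).
rewrite /chain_variance.
rewrite (_ : _ - _ = lam ^+ 2 * (mop pK (fun j => gk k j ^+ 2) i - mop pK (gk k) i ^+ 2 -
   tau * nu * carre_du_champ Q (gk k) i)); last by rewrite /corrector_rate; ring.
by rewrite normrM ger0_norm ?sqr_ge0// ler_wpM2l// sqr_ge0.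
Qed.

Lemma chain_variance_bound k i :
  `|chain_variance (nu *: Q) tau lam gk k i| <= (A2 * (cV + 1)) * tau.
Proof.
have h := chain_variance_dist k i.
have h1 : `|corrector_rate Q p f (k%:R * tau) i| <= cV by exact: corrector_rate_bound.
rewrite -[X in `|X|](subrK (tau * (A2 * corrector_rate Q p f (k%:R * tau) i))).
apply: le_trans (ler_normD _ _) _; apply: le_trans (lerD h (lexx _)) _.
have k1 : lam ^+ 2 * (vc * tau ^+ 2) <= A2 * tau.
  rewrite -[leRHS]mulrA ler_wpM2l ?sqr_ge0// expr2 mulrA ler_wpM2r//; exact: ltW.
have k2 : `|tau * (A2 * corrector_rate Q p f (k%:R * tau) i)| <= tau * (A2 * cV).
  by rewrite normrM (gtr0_norm tau0) ler_wpM2l ?(ltW tau0)// normrM (ger0_norm A20) ler_wpM2l.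
by apply: le_trans (lerD k1 k2) _; lra.
Qed.

Lemma kap_bound i : (kap * u i) ^+ 2 <= B2 * cU.
Proof. by rewrite exprMn ler_wpM2l// u_le_cU. Qed.

Definition model_increment (k : nat) (w : Om) : R :=
  chain_increment X (nu *: Q) tau lam gk k w + brownian_part B X tau kap u k w.
Definition model_rate : nat -> Om -> R := modulated_rate X (nu *: Q) tau lam kap gk u.

Lemma model_martingale : martingale_increments P A_ model_increment model_rate tau
  (A2 * (cV + 1) + B2 * cU) (8 * ((3 * lam * cG) ^+ 2 * (A2 * (cV + 1)) + 3 * (B2 * cU) ^+ 2 * tau)).
Proof.
exact: (modulated_martingale fF bB cX aX iXB tau0 chain_increment_bound chain_variance_bound kap_bound).
Qed.

Lemma model_rate_dist k w : `|model_rate k w - R_ (k%:R * tau) (Y k w)| <= lam ^+ 2 * vc * tau.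
Proof.
have h := chain_variance_dist k (Y k w).
rewrite /model_rate /modulated_rate /state_rate.
rewrite (_ : _ - _ = (chain_variance (nu *: Q) tau lam gk k (Y k w) -
   tau * (A2 * corrector_rate Q p f (k%:R * tau) (Y k w))) / tau); last by field; rewrite gt_eqF//.
rewrite normrM normfV (gtr0_norm tau0) ler_pdivrMr//; apply: le_trans h _.
by rewrite le_eqVlt; apply/orP; left; apply/eqP; ring.
Qed.

Let hk k := rate_corrector Q p f u A2 B2 (k%:R * tau).
Let cH := Dn * ((cV + cU) * (A2 + B2)).
Let lH := Dn * (lV * (A2 + B2)).

Let tauS k : `|k.+1%:R * tau - k%:R * tau| = tau.
Proof. by rewrite -natr1 mulrDl mul1r [X in `|X|](_ : _ = tau) ?gtr0_norm//; ring. Qed.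

(* Summation by parts against the solution of a second Poisson equation. *)
Lemma poisson_averaging a m (eta : Om -> R) (K : R) : smeas (A_ a) eta -> (forall w, `|eta w| <= K) ->
  `|tau * \sum_(a <= k < a + m) Ex P (fun w => eta w * (R_ (k%:R * tau) (Y k w) - mean_rate Q p f u A2 B2 (k%:R * tau)))|
    <= K * ((2 * cH + (m%:R * tau) * lH + (m%:R * tau) * (d%:R * C * cH * tau)) / nu).
Proof.
move=> me eK.
have pm k : A_ k `<=` measurable by exact: (past_measurable fF bB cX tau0).
have pmono k : (a <= k)%N -> A_ a `<=` A_ k.
  by move=> /subnK <-; elim: (k - a)%N => // n ih G /ih; exact: (past_mono fF tau0).
have me' : measurable_fun setT eta by exact: smeas_meas (pm a) me.
have ie : intg P eta by exact: intg_bd eK.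
have K0 : 0 <= K by exact: le_trans (eK point).
have mY (h : 'I_d -> R) n : measurable_fun setT (fun w => h (Y n w)) by exact: measurable_chain.
have iY (h : 'I_d -> R) n : intg P (fun w => eta w * h (Y n w)).
  have hb : forall w, `|h (Y n w)| <= \sum_i `|h i|.
    by move=> w; rewrite (bigD1 (Y n w))//= lerDl; exact: sumr_ge0.
  by apply: intg_eq (intg_mulbd (mY h n) hb ie) => w; exact: mulrC.
pose e k i := mop pK (hk k) i - hk k i - tau * nu * mop Q (hk k) i.
have hB k i : `|hk k i| <= cH by exact: rate_corrector_bound.
have H0 : 0 <= cH.
  apply: mulr_ge0; first exact: mxnorm1_ge0.
  by apply: mulr_ge0; apply: addr_ge0 => //; [exact: cV_ge0|exact: cU_ge0].
have eB k i : `|e k i| <= d%:R * C * cH * tau ^+ 2.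
  exact: (semigroup_taylor taylor (ltW tau0) tau1 i (hB k)).
(* The Poisson equation for the rate, read on the grid: [tau (R - r) = (h - P h + e) / nu] with [h]
   the rate corrector and [e] its Taylor error. The Markov step turns [P h] into the value at the
   next grid time. *)
have term k : (a <= k)%N -> tau * Ex P (fun w => eta w * (R_ (k%:R * tau) (Y k w) - mean_rate Q p f u A2 B2 (k%:R * tau))) =
   nu^-1 * (Ex P (fun w => eta w * hk k (Y k w)) - Ex P (fun w => eta w * hk k (Y k.+1 w)) + Ex P (fun w => eta w * e k (Y k w))).
  move=> ak; have rk : smeas <<s past_rectangles B X tau k >> eta.
    by apply: smeas_sub me => G /(pmono k ak) [].
  rewrite (chain_step fF bB cX aX iXB tau0 (hk k) rk ie) -ExB; [|exact: (iY (hk k))|exact: (iY (mop pK (hk k)))].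
  rewrite -ExD; [|by apply: intgB; [exact: (iY (hk k))|exact: (iY (mop pK (hk k)))]|exact: (iY (e k))].
  rewrite -[in RHS]ExZ; last first.
    by apply: intgD; [apply: intgB; [exact: (iY (hk k))|exact: (iY (mop pK (hk k)))]|exact: (iY (e k))].
  rewrite -ExZ; last exact: (iY (fun i => R_ (k%:R * tau) i - mean_rate Q p f u A2 B2 (k%:R * tau))).
  apply: Ex_eq => w; rewrite /e /hk (rate_corrector_poisson gQ up); field; rewrite gt_eqF//.
(* This would telescope if [hk] were the same function at all times; its Lipschitz constant [lH]
   bounds the deviation. *)
have tel : `|\sum_(a <= k < a + m) (Ex P (fun w => eta w * hk k (Y k w)) - Ex P (fun w => eta w * hk k (Y k.+1 w)))|
    <= K * (2 * cH + (m%:R * tau) * lH).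
  have -> : \sum_(a <= k < a + m) (Ex P (fun w => eta w * hk k (Y k w)) - Ex P (fun w => eta w * hk k (Y k.+1 w))) =
     Ex P (fun w => eta w * (hk a (Y a w) - hk (a + m)%N (Y (a + m)%N w) +
       \sum_(a <= k < a + m) (hk k.+1 (Y k.+1 w) - hk k (Y k.+1 w)))).
    rewrite (eq_bigr (fun k => Ex P (fun w => eta w * (hk k (Y k w) - hk k (Y k.+1 w))))); last first.
      move=> k _; rewrite -ExB; [|exact: (iY (hk k))|exact: (iY (hk k))].
      by apply: Ex_eq => w; rewrite mulrBr.
    rewrite -Ex_sum; last first.
      move=> k; apply: (@intg_eq _ _ _ _ (fun w => eta w * hk k (Y k w) - eta w * hk k (Y k.+1 w))).
        by move=> w; rewrite mulrBr.
      by apply: intgB; exact: (iY (hk k)).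
    apply: Ex_eq => w; rewrite -mulr_sumr; congr (_ * _); elim: m => [|m ih].
      by rewrite addn0 !big_geq// subrr addr0.
    by rewrite addnS !big_nat_recr ?leq_addr//= ih; ring.
  apply: Ex_bd.
    apply: (@intg_eq _ _ _ _ (fun w => eta w * hk a (Y a w) - eta w * hk (a + m)%N (Y (a + m)%N w) +
       \sum_(a <= k < a + m) (eta w * hk k.+1 (Y k.+1 w) - eta w * hk k (Y k.+1 w)))).
      by move=> w; rewrite mulrDr mulrBr; congr (_ + _); rewrite mulr_sumr; apply: eq_bigr => k _; rewrite mulrBr.
    apply: intgD; first by apply: intgB; [exact: (iY (hk a))|exact: (iY (hk (a + m)%N))].
    by apply: intg_sum => k; apply: intgB; [exact: (iY (hk k.+1))|exact: (iY (hk k))].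
  move=> w; rewrite normrM ler_pM//.
  apply: le_trans (ler_normD _ _) _; apply: lerD.
    by apply: le_trans (ler_normB _ _) _; have := hB a (Y a w); have := hB (a + m)%N (Y (a + m)%N w); lra.
  apply: le_trans (ler_norm_sum _ _ _) _.
  apply: (@le_trans _ _ (\sum_(a <= k < a + m) lH * tau)); last first.
    by rewrite sumr_const_nat addKn -mulr_natl le_eqVlt; apply/orP; left; apply/eqP; ring.
  apply: ler_sum => k _; rewrite -[in leRHS](tauS k); exact: rate_corrector_lip.
have err : `|\sum_(a <= k < a + m) Ex P (fun w => eta w * e k (Y k w))| <= K * ((m%:R * tau) * (d%:R * C * cH * tau)).
  apply: le_trans (ler_norm_sum _ _ _) _.
  apply: (@le_trans _ _ (\sum_(a <= k < a + m) K * (d%:R * C * cH * tau ^+ 2))); last first.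
    by rewrite sumr_const_nat addKn -mulr_natl le_eqVlt; apply/orP; left; apply/eqP; ring.
  apply: ler_sum => k _; apply: Ex_bd; first exact: (iY (e k)).
  by move=> w; rewrite normrM ler_pM.
rewrite mulr_sumr big_nat (eq_bigr (fun k => nu^-1 * (Ex P (fun w => eta w * hk k (Y k w)) -
  Ex P (fun w => eta w * hk k (Y k.+1 w)) + Ex P (fun w => eta w * e k (Y k w))))); last first.
  by move=> k /andP[ak _]; exact: term.
rewrite -big_nat -mulr_sumr big_split/= normrM (gtr0_norm (_ : 0 < nu^-1)) ?invr_gt0//.
rewrite mulrC mulrA ler_wpM2r ?invr_ge0 ?(ltW nu0)//.
by apply: le_trans (ler_normD _ _) _; apply: le_trans (lerD tel err) _; rewrite -mulrDr.
Qed.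

(** Three replacements: conditional variance per unit time by the state rate, state rate by its
    stationary mean, and that mean at running times by its value at the start of the block. The last
    one costs the square of the block length. *)
Lemma model_rate_average a m (eta : Om -> R) (K : R) : smeas (A_ a) eta -> (forall w, `|eta w| <= K) ->
  `|tau * (\sum_(a <= k < a + m) Ex P (fun w => eta w * model_rate k w)) -
     (m%:R * tau) * mean_rate Q p f u A2 B2 (a%:R * tau) * Ex P eta|
    <= K * ((2 * cH + (m%:R * tau) * lH + (m%:R * tau) * (d%:R * C * cH * tau)) / nu +
      (m%:R * tau) * (lam ^+ 2 * vc * tau) + lV * (A2 + B2) * (m%:R * tau) ^+ 2).
Proof.
move=> me eK; have h := poisson_averaging m me eK.
have pm k : A_ k `<=` measurable by exact: (past_measurable fF bB cX tau0).
have me' : measurable_fun setT eta by exact: smeas_meas (pm a) me.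
have ie : intg P eta by exact: intg_bd eK.
have K0 : 0 <= K by exact: le_trans (eK point).
have mi := model_martingale.
pose r k := mean_rate Q p f u A2 B2 (k%:R * tau).
have iq k : intg P (fun w => eta w * model_rate k w).
  apply: (@intg_mulbd _ _ _ _ eta _ K) => //.
  apply: intg_bd (mi_rate_le mi k); exact: smeas_meas (pm k) (mi_rate_smeas mi (k := k)).
have iR k : intg P (fun w => eta w * R_ (k%:R * tau) (Y k w)).
  apply: (@intg_mulbd _ _ _ _ eta _ K) => //.
  apply: (@intg_bd _ _ _ _ _ ((cV + cU) * (A2 + B2))); first exact: (measurable_chain (R_ (k%:R * tau))).
  by move=> w; exact: state_rate_bound.
have dec : tau * (\sum_(a <= k < a + m) Ex P (fun w => eta w * model_rate k w)) - (m%:R * tau) * r a * Ex P eta =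
  tau * (\sum_(a <= k < a + m) Ex P (fun w => eta w * (R_ (k%:R * tau) (Y k w) - r k))) +
  tau * (\sum_(a <= k < a + m) Ex P (fun w => eta w * (model_rate k w - R_ (k%:R * tau) (Y k w)))) +
  tau * (\sum_(a <= k < a + m) (r k - r a) * Ex P eta).
  have -> : (m%:R * tau) * r a * Ex P eta = tau * \sum_(a <= k < a + m) r a * Ex P eta.
    by rewrite sumr_const_nat addKn -mulr_natl; ring.
  rewrite -!mulrDr -!big_split/= -mulrBr -sumrB; congr (_ * _); apply: eq_bigr => k _.
  rewrite (@Ex_eq _ _ _ _ (fun w => eta w * (R_ (k%:R * tau) (Y k w) - r k))
    (fun w => eta w * R_ (k%:R * tau) (Y k w) - r k * eta w)); last by move=> w; ring.
  rewrite (@Ex_eq _ _ _ _ (fun w => eta w * (model_rate k w - R_ (k%:R * tau) (Y k w)))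
    (fun w => eta w * model_rate k w - eta w * R_ (k%:R * tau) (Y k w))); last by move=> w; ring.
  rewrite !ExB//; last exact: intgZ.
  by rewrite ExZ//; ring.
rewrite dec.
have e1 : `|tau * (\sum_(a <= k < a + m) Ex P (fun w => eta w * (model_rate k w - R_ (k%:R * tau) (Y k w))))| <=
   K * ((m%:R * tau) * (lam ^+ 2 * vc * tau)).
  rewrite normrM (gtr0_norm tau0).
  apply: (@le_trans _ _ (tau * \sum_(a <= k < a + m) K * (lam ^+ 2 * vc * tau))); last first.
    by rewrite sumr_const_nat addKn -mulr_natl le_eqVlt; apply/orP; left; apply/eqP; ring.
  rewrite ler_wpM2l ?(ltW tau0)//; apply: le_trans (ler_norm_sum _ _ _) _; apply: ler_sum => k _.
  apply: Ex_bd; last by move=> w; rewrite normrM ler_pM// model_rate_dist.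
  by apply: intg_eq (intgB (iq k) (iR k)) => w; rewrite mulrBr.
have e2 : `|tau * (\sum_(a <= k < a + m) (r k - r a) * Ex P eta)| <= K * (lV * (A2 + B2) * (m%:R * tau) ^+ 2).
  rewrite normrM (gtr0_norm tau0).
  apply: (@le_trans _ _ (tau * \sum_(a <= k < a + m) (lV * (A2 + B2) * (m%:R * tau)) * K)); last first.
    by rewrite sumr_const_nat addKn -mulr_natl le_eqVlt; apply/orP; left; apply/eqP; ring.
  rewrite ler_wpM2l ?(ltW tau0)//; apply: le_trans (ler_norm_sum _ _ _) _.
  rewrite big_nat [leRHS]big_nat; apply: ler_sum => k /andP[ak km].
  rewrite normrM ler_pM//; last exact: Ex_bd.
  apply: le_trans (mean_rate_lip up u Fb0 Lf0 fB fL A20 B20 (t0 a) (t0 k)) _ => //.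
  apply: ler_wpM2l.
    by rewrite mulr_ge0 ?addr_ge0// (lV_ge0 Q p Fb0 Lf0).
  rewrite -mulrBl normrM (gtr0_norm tau0) ler_wpM2r ?(ltW tau0)//.
  rewrite ger0_norm ?subr_ge0 ?ler_nat// lerBlDr -natrD ler_nat addnC; exact: ltnW.
apply: le_trans (ler_normD _ _) _; apply: le_trans (lerD (ler_normD _ _) (lexx _)) _.
by apply: le_trans (lerD (lerD h e1) e2) _; rewrite -!mulrDr.
Qed.

End DiscreteModel.

(** * Integrals over time intervals of bounded measurable functions *)

Section TimeIntegrals.
Context {R : realType}.
Implicit Types (f g : R -> R) (a b c k K T : R).
Local Notation mu := (@lebesgue_measure R).

Definition tint a b f : R := \int[mu]_(s in `[a, b]) f s.

Definition bmeas T f : Prop :=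
  measurable_fun setT f /\ exists K, forall s, 0 <= s <= T -> `|f s| <= K.

Let mD a b : (@measurable _ (measurableTypeR R)) `[a, b]%classic.
Proof. exact: measurable_itv. Qed.

Let mu_itv a b : a <= b -> mu `[a, b]%classic = (b - a)%:E.
Proof.
move=> ab; have h : mu (`[a, b]%classic : set R) = (if (a < b)%R then (b - a)%R%:E else 0)%E.
  by rewrite lebesgue_measure_itv/= lte_fin EFinB.
apply: (eq_trans h); move: ab; rewrite le_eqVlt => /orP[/eqP ->|->]//.
by rewrite ltxx subrr.
Qed.

Lemma bmeas_integrable T f a b : bmeas T f -> 0 <= a -> b <= T -> mu.-integrable `[a, b] (EFin \o f).
Proof.
move=> [mf [K hK]] a0 bT; case: (leP a b) => ab; last first.
  by rewrite set_itv_ge ?bnd_simp -?ltNge//; exact: integrable_set0.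
apply: measurable_bounded_integrable.
- exact: measurable_itv.
- by apply: (@le_lt_trans _ _ (b - a)%:E); [rewrite le_eqVlt; apply/orP; left; apply/eqP; exact: mu_itv|exact: ltry].
- exact: measurable_funTS.
exists K; split; first exact: num_real.
move=> M KM s; rewrite /= in_itv/= => /andP[h1 h2]; apply: le_trans (ltW KM); apply: hK.
by rewrite (le_trans a0 h1) (le_trans h2 bT).
Qed.

Lemma bmeas_cst T k : bmeas T (fun=> k).
Proof. by split; [exact: measurable_cst|exists `|k|]. Qed.

Lemma bmeasD T f g : bmeas T f -> bmeas T g -> bmeas T (fun s => f s + g s).
Proof.
move=> [mf [K hK]] [mg [L hL]]; split; first exact: measurable_funD.
exists (K + L) => s sT; apply: le_trans (ler_normD _ _) _.
by rewrite lerD ?hK ?hL.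
Qed.

Lemma bmeasM T f g : bmeas T f -> bmeas T g -> bmeas T (fun s => f s * g s).
Proof.
move=> [mf [K hK]] [mg [L hL]]; split; first exact: measurable_funM.
by exists (K * L) => s sT; rewrite normrM ler_pM ?hK ?hL.
Qed.

Lemma bmeasZ T k f : bmeas T f -> bmeas T (fun s => k * f s).
Proof. by apply: bmeasM; exact: bmeas_cst. Qed.

Lemma bmeasB T f g : bmeas T f -> bmeas T g -> bmeas T (fun s => f s - g s).
Proof.
move=> [mf [K hK]] [mg [L hL]]; split; first exact: measurable_funB.
exists (K + L) => s sT; apply: le_trans (ler_normB _ _) _.
by rewrite lerD ?hK ?hL.
Qed.

Lemma bmeas_abs T f : bmeas T f -> bmeas T (fun s => `|f s|).
Proof.
move=> [mf [K hK]]; split; first exact: measurableT_comp.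
by exists K => s sT; rewrite normr_id hK.
Qed.

Lemma bmeas_sum T (I : Type) (s : seq I) (F : I -> R -> R) :
  (forall i, bmeas T (F i)) -> bmeas T (fun t => \sum_(i <- s) F i t).
Proof.
move=> h; elim: s => [|i s ih].
  by under eq_fun do rewrite big_nil; exact: bmeas_cst.
by under eq_fun do rewrite big_cons; exact: bmeasD.
Qed.

Section Bounds.
Variables (T a b : R).
Hypotheses (a0 : 0 <= a) (bT : b <= T).

Lemma tintD f g : bmeas T f -> bmeas T g -> tint a b (fun s => f s + g s) = tint a b f + tint a b g.
Proof. by move=> hf hg; apply: RintegralD; [exact: mD|exact: (bmeas_integrable hf a0 bT)|exact: (bmeas_integrable hg a0 bT)]. Qed.

Lemma tintB f g : bmeas T f -> bmeas T g -> tint a b (fun s => f s - g s) = tint a b f - tint a b g.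
Proof. by move=> hf hg; apply: RintegralB; [exact: mD|exact: (bmeas_integrable hf a0 bT)|exact: (bmeas_integrable hg a0 bT)]. Qed.

Lemma tintZ k f : bmeas T f -> tint a b (fun s => k * f s) = k * tint a b f.
Proof. by move=> hf; apply: RintegralZl; [exact: mD|exact: (bmeas_integrable hf a0 bT)]. Qed.

Lemma tint_sum (I : Type) (s : seq I) (F : I -> R -> R) : (forall i, bmeas T (F i)) ->
  tint a b (fun t => \sum_(i <- s) F i t) = \sum_(i <- s) tint a b (F i).
Proof.
move=> h; elim: s => [|i s ih].
  under [in LHS]eq_fun do rewrite big_nil.
  by rewrite big_nil /tint Rintegral_cst ?mul0r//; exact: mD.
under [in LHS]eq_fun do rewrite big_cons.
by rewrite tintD ?ih ?big_cons//; exact: bmeas_sum.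
Qed.

Lemma tint_le f g : bmeas T f -> bmeas T g -> (forall s, a <= s <= b -> f s <= g s) ->
  tint a b f <= tint a b g.
Proof.
move=> hf hg fg; apply: le_Rintegral; [exact: mD|exact: (bmeas_integrable hf a0 bT)|exact: (bmeas_integrable hg a0 bT)|].
by move=> s; rewrite /= in_itv/=; exact: fg.
Qed.

Lemma tintE f : bmeas T f -> (\int[mu]_(s in `[a, b]) (f s)%:E)%E = (tint a b f)%:E.
Proof.
move=> hf; rewrite /tint /Rintegral fineK//.
exact: (integrable_fin_num (mD a b) (bmeas_integrable hf a0 bT)).
Qed.

Lemma tint_norm f : bmeas T f -> `|tint a b f| <= tint a b (fun s => `|f s|).
Proof. by move=> hf; apply: le_normr_Rintegral; [exact: mD|exact: (bmeas_integrable hf a0 bT)]. Qed.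

End Bounds.

Lemma tint_cst a b k : a <= b -> tint a b (fun=> k) = k * (b - a).
Proof.
move=> ab; rewrite /tint Rintegral_cst; last exact: mD.
by congr (_ * _); rewrite -[RHS]/(fine (b - a)%:E); congr fine; exact: mu_itv.
Qed.

Lemma tint_eq a b f g : (forall s, a <= s <= b -> f s = g s) -> tint a b f = tint a b g.
Proof. by move=> fg; apply: eq_Rintegral => s; rewrite mem_setE in_itv/=; exact: fg. Qed.

Lemma tint_bound T a b f K : 0 <= a -> a <= b -> b <= T -> bmeas T f -> (forall s, a <= s <= b -> `|f s| <= K) ->
  `|tint a b f| <= K * (b - a).
Proof.
move=> a0 ab bT hf fK; apply: le_trans (tint_norm a0 bT hf) _.
rewrite -(tint_cst K ab); apply: (tint_le a0 bT) => //; first exact: bmeas_abs.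
exact: bmeas_cst.
Qed.

Lemma tint_point a f : tint a a f = 0.
Proof. by rewrite /tint set_itv1 Rintegral_set1. Qed.

Lemma tint_split T a b c f : bmeas T f -> 0 <= a -> a <= b -> b <= c -> c <= T ->
  tint a c f = tint a b f + tint b c f.
Proof.
move=> hf a0 ab bc cT.
have b0 : 0 <= b by exact: le_trans ab.
have h := @Rintegral_itvB R f (BLeft a) (BRight c) b (bmeas_integrable hf a0 cT).
rewrite !bnd_simp in h; have {}h := h ab bc.
have -> : tint b c f = \int[mu]_(s in `]b, c]) f s.
  apply/esym/Rintegral_itv_obnd_cbnd.
  apply: (integrableS (mD b c) _ _ (bmeas_integrable hf b0 cT)); first exact: measurable_itv.
  by apply: subset_itvr; rewrite bnd_simp.
by rewrite -h addrC subrK.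
Qed.

(** Boundedness by walking from 0 to [s] in [n] steps, each shorter than the modulus [r] for
    oscillation 1; each step adds at most 1. *)
Lemma cpath_bmeas T f : cpath f -> bmeas T (fun s => f (Num.max s 0)).
Proof.
move=> cf; have cc := cpath_ext cf; split.
  exact: continuous_measurable_fun.
have [r r0 h] := cpath_unif (Num.max T 0) cf (ltr01 : 0 < (1 : R)).
have T0 : 0 <= Num.max T 0 by rewrite le_max lexx orbT.
pose n := (Num.truncn (Num.max T 0 / (r / 2))).+1.
exists (`|f 0| + n%:R) => s /andP[s0 sT].
rewrite (max_idPl s0).
have sT' : s <= Num.max T 0 by rewrite le_max sT.
pose tk (k : nat) : R := s * (k%:R / n%:R).
have n0 : 0 < n%:R :> R by [].
have step (k : nat) : (k <= n)%N -> `|f (tk k)| <= `|f 0| + k%:R.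
  elim: k => [_|k ih kn]; first by rewrite /tk mul0r mulr0 addr0.
  have b1 : 0 <= tk k <= Num.max T 0.
    rewrite mulr_ge0 ?divr_ge0//=; apply: le_trans sT'; rewrite ler_piMr// ler_pdivrMr// mul1r ler_nat.
    exact: ltnW.
  have b2 : 0 <= tk k.+1 <= Num.max T 0.
    by rewrite mulr_ge0 ?divr_ge0//=; apply: le_trans sT'; rewrite ler_piMr// ler_pdivrMr// mul1r ler_nat.
  have d : `|tk k.+1 - tk k| < r.
    have -> : tk k.+1 - tk k = s / n%:R by rewrite /tk -natr1; field; rewrite gt_eqF.
    rewrite ger0_norm ?divr_ge0//; apply: le_lt_trans (_ : _ <= Num.max T 0 / n%:R) _.
      by rewrite ler_wpM2r// invr_ge0.
    rewrite ltr_pdivrMr//.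
    have := truncnS_gt (Num.max T 0 / (r / 2)); rewrite -/n ltr_pdivrMr ?divr_gt0//.
    by move=> h'; apply: lt_le_trans h' _; rewrite mulrC ler_wpM2r//; lra.
  have := h _ _ b2 b1 d; have := ih (ltnW kn); rewrite -natr1.
  have : `|f (tk k.+1)| <= `|f (tk k.+1) - f (tk k)| + `|f (tk k)|.
    by rewrite -{1}(subrK (f (tk k)) (f (tk k.+1))); exact: ler_normD.
  lra.
by have := step n (leqnn n); rewrite /tk divff ?mulr1// gt_eqF.
Qed.

End TimeIntegrals.

Ltac nneg := lazymatch goal with
  | |- is_true (0 <= _ + _) => apply: addr_ge0; nneg
  | |- is_true (0 <= _ * _) => apply: mulr_ge0; nneg
  | |- is_true (0 <= _ ^+ 2) => exact: sqr_ge0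
  | |- is_true (0 <= _^-1) => rewrite invr_ge0; nneg
  | |- is_true (0 <= _%:R) => exact: ler0n
  | |- is_true (0 <= 1) => exact: ler01
  | |- is_true (0 <= _) => first [assumption | apply: ltW; assumption]
  end.

Lemma measurable_set_lt {d} {T : measurableType d} {R : realType} (f g : T -> R) :
  measurable_fun setT f -> measurable_fun setT g -> measurable [set w | (f w < g w)%R].
Proof.
move=> mf mg; rewrite (_ : [set w | (f w < g w)%R] = ~` [set w | (g w <= f w)%R]).
  by apply: measurableC; rewrite -[X in measurable X]setTI; exact: measurable_fun_le.
by apply/seteqP; split => w /=; rewrite ltNge => /negP.
Qed.

Lemma prob_markov {d} {T : measurableType d} {R : realType} (P : probability T R) (g : T -> \bar R) (G : set T) (delta K : R) :
  0 < delta -> measurable G -> measurable_fun setT g -> (forall w, 0 <= g w)%E ->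
  (forall w, G w -> (delta%:E <= g w)%E) -> (\int[P]_w g w <= K%:E)%E -> (P G <= (K / delta)%:E)%E.
Proof.
move=> d0 mG mg g0 Gg gK.
have h : (delta%:E * P G <= K%:E)%E.
  have -> : P G = (\int[P]_w (\1_G w)%:E)%E by rewrite integral_indic// setIT.
  apply: le_trans gK; rewrite -ge0_integralZl//.
  - apply: ge0_le_integral => //.
    + by move=> w _; rewrite mule_ge0// lee_fin// ltW.
    + by apply: measurable_funeM; apply/measurable_EFinP; exact: measurable_indic.
    move=> w _; rewrite indicE; case: (boolP (w \in G)) => wG; last by rewrite mule0.
    by rewrite mule1; apply: Gg; rewrite inE in wG.
  - by apply/measurable_EFinP; exact: measurable_indic.
  - by rewrite lee_fin ltW.
move: h; rewrite -(fineK (fin_num_measure P _ mG)) -EFinM !lee_fin => h.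
by rewrite ler_pdivlMr// mulrC.
Qed.

(* U is within b + delta of the block sums of martingale differences at the
   grid points of level n, outside events of probability delta; r is the variance
   rate seen on average over blocks. *)
Record discretization {d} {T : measurableType d} {R : realType} (P : probability T R) (U : R -> T -> R)
    (n H : nat) (A : nat -> set (set T)) (s q : nat -> T -> R) (Cq v4 : R) (r : R -> R) (e L b delta : R) : Prop := Discretization {
  dz_mi : martingale_increments P A s q (2 ^- n) Cq v4;
  dz_rate : forall a m (eta : T -> R) (K : R), (a + m <= H * 2 ^ n)%N -> smeas (A a) eta -> (forall w, `|eta w| <= K) ->
    `|2 ^- n * (\sum_(a <= k < a + m) Ex P (fun w => eta w * q k w)) - (m%:R * 2 ^- n) * r (a%:R * 2 ^- n) * Ex P eta|
      <= K * (e + L * (m%:R * 2 ^- n) ^+ 2);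
  dz_close : forall i, (i <= H * 2 ^ n)%N ->
    (P [set w | (b + delta < `|U (i%:R * 2 ^- n) w - block s 0 i w|)%R] <= delta%:E)%E }.

(** * Closeness of the noise to the discrete martingale at grid points *)

Section ModelApproximation.
Context {R : realType} {d : nat} {dO : measure_display} {Om : measurableType dO}.
Variables (P : probability Om R) (F : R -> set (set Om)) (B : R -> Om -> R) (X : R -> Om -> 'I_d).
Variables (Q : 'M[R]_d) (p p0 : 'cV[R]_d) (nu : R).
Hypotheses (gQ : is_generator Q) (up : unique_invariant_distribution Q p).
Hypothesis fF : filtration F.
Hypothesis bB : brownian_motion P F B.
Hypothesis nu0 : 0 < nu.
Hypothesis cX : markov_chain P (nu *: Q) p0 X.
Hypothesis aX : adapted setT F X.
Hypothesis iXB : independent_processes P setT X borelR B.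
Variables (f : R -> 'I_d -> R) (u : 'I_d -> R) (Fb Lf : R).
Hypotheses (Fb0 : 0 <= Fb) (Lf0 : 0 <= Lf).
Hypothesis fB : forall t i, 0 <= t -> `|f t i| <= Fb.
Hypothesis fL : forall s t i, 0 <= s -> 0 <= t -> `|f t i - f s i| <= Lf * `|t - s|.
Variables (lam kap0 q : R) (J U : R -> Om -> R).
Hypothesis lam0 : 0 <= lam.
Local Notation mu := (@lebesgue_measure R).
Local Notation ft := (fun s i => f s i - pav p (f s)).
Hypothesis hJ : forall t : R, 0 <= t -> ito_integral P F B (fun t w => q * u (X t w)) t (J t).
Hypothesis mU : forall t : R, 0 <= t -> measurable_fun setT (U t).
Hypothesis hU : forall t : R, 0 <= t -> {ae P, forall w,
  U t w = lam * nu * tint 0 t (fun s => ft s (X s w)) + kap0 * J t w}.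

Lemma chain_right_continuous (h : R -> 'I_d -> R) (L : R) : 0 <= L ->
  (forall s t i, 0 <= s -> 0 <= t -> `|h t i - h s i| <= L * `|t - s|) ->
  right_continuous_paths (fun s w => h s (X s w)).
Proof.
move=> L0 hL w t e t0 e0; have [_ cad _ _] := cX; have [/(_ t t0) + _] := cad w.
move=> [r /= r0 hr]; exists (Num.min r (e / (L + 1))).
  by rewrite lt_min r0 divr_gt0// ltr_wpDl.
move=> s ts; rewrite -ltrBlDl lt_min => /andP[s1 s2].
have -> : X s w = X t w.
  move: ts; rewrite le_eqVlt => /orP[/eqP ->//|ts]; apply: hr => //=.
  by rewrite distrC ger0_norm ?subr_ge0// ltW.
apply: le_trans (hL _ _ _ t0 (le_trans t0 ts)) _.
rewrite ger0_norm ?subr_ge0//; apply: (@le_trans _ _ ((L + 1) * (e / (L + 1)))).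
  by rewrite ler_pM ?subr_ge0 ?lerDl// ltW.
by rewrite mulrCA divff ?mulr1// gt_eqF// ltr_wpDl.
Qed.

Let ftL s t i : 0 <= s -> 0 <= t -> `|ft t i - ft s i| <= 2 * Lf * `|t - s|.
Proof.
move=> s0 t0; rewrite (_ : _ - _ = (f t i - f s i) - (pav p (f t) - pav p (f s))); last by ring.
apply: le_trans (ler_normB _ _) _.
have h1 := fL i s0 t0; have h2 : `|pav p (f t) - pav p (f s)| <= Lf * `|t - s|.
  by apply: (pav_dist up) => j; exact: fL.
lra.
Qed.

Let ftB t i : 0 <= t -> `|ft t i| <= 2 * Fb.
Proof.
move=> t0; apply: le_trans (ler_normB _ _) _.
have h1 := fB i t0; have h2 : `|pav p (f t)| <= Fb by apply: (pav_bound up) => j; exact: fB.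
lra.
Qed.

Let phi (s : R) w := ft (Num.max s 0) (X (Num.max s 0) w).

Let max0 (s : R) : 0 <= Num.max s 0. Proof. by rewrite le_max lexx orbT. Qed.

Lemma joint_measurable_chain (h : R -> 'I_d -> R) (L : R) : 0 <= L ->
  (forall s t i, 0 <= s -> 0 <= t -> `|h t i - h s i| <= L * `|t - s|) ->
  joint_measurable (fun s w => h (Num.max s 0) (X (Num.max s 0) w)).
Proof.
move=> L0 hL; apply: (right_continuous_joint (c := fun s w => h s (X s w))); last exact: chain_right_continuous hL.
by move=> t t0; exact: (measurable_chain cX (h t)).
Qed.

Let jphi : joint_measurable phi.
Proof. by apply: joint_measurable_chain (ftL); rewrite mulr_ge0. Qed.

Let phiB s w : `|phi s w| <= 2 * Fb. Proof. exact: ftB. Qed.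

Let bphi T w : bmeas T (phi ^~ w).
Proof. by split; [exact: joint_section_time|exists (2 * Fb) => s _; exact: phiB]. Qed.

Let tint_phi t w : tint 0 t (fun s => ft s (X s w)) = tint 0 t (phi ^~ w).
Proof. by apply: tint_eq => s /andP[s0 _]; rewrite /phi (max_idPl s0). Qed.

Section Step.
Variables (C tau : R).
Hypothesis C0 : 0 <= C.
Hypothesis taylor : forall t : R, 0 <= t -> t <= 1 -> forall i j,
  `|expmx (t *: (nu *: Q)) i j - ((i == j)%:R + t * (nu *: Q) i j)| <= C * t ^+ 2.
Hypotheses (tau0 : 0 < tau) (tau1 : tau <= 1).
Local Notation Y k := (X (k%:R * tau)).
Local Notation jr := (jump_rate Q nu C).

Let t0 k : 0 <= k%:R * tau. Proof. by rewrite mulr_ge0// ltW. Qed.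

Let jr0 : 0 <= jr.
Proof. by rewrite addr_ge0// ?mulr_ge0// ?mxnorm1_ge0 ?(ltW nu0). Qed.

Let jumpP (s : R) k : k%:R * tau < s -> s <= k.+1%:R * tau ->
  Ex P (fun w => (X s w != Y k w)%:R) <= jr * tau.
Proof.
move=> ks sk; have dt : s - k%:R * tau <= tau by move: sk; rewrite -natr1 mulrDl mul1r; lra.
rewrite (@Ex_eq _ _ _ _ _ (fun w => (Y k w != X s w)%:R)); last by move=> w; rewrite eq_sym.
apply: le_trans (jump_probability nu0 cX C0 taylor (t0 k) (ltW ks) (le_trans dt tau1)) _.
by rewrite ler_wpM2l.
Qed.

Let mne (s t : R) : 0 <= s -> 0 <= t -> measurable_fun setT (fun w => (X s w != X t w)%:R : R).
Proof.
move=> s0 t0'; rewrite (_ : (fun _ => _) = fun w => 1 - \sum_(i < d) ((X s w == i)%:R * (X t w == i)%:R)).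
  apply: measurable_funB => //; apply: measurable_sum => i; apply: measurable_funM.
    exact: (measurable_chain cX (fun j => (j == i)%:R)).
  exact: (measurable_chain cX (fun j => (j == i)%:R)).
apply/funext => w; rewrite (bigD1 (X s w))//= eqxx mul1r big1 ?addr0.
  by rewrite eq_sym; case: (_ == _); rewrite /= ?subrr ?subr0.
by move=> i /negbTE; rewrite eq_sym => ->; rewrite mul0r.
Qed.

(** True and frozen volatility differ only if the state at time [s] is not the one at the preceding
    grid time, which has probability at most [jr * tau]. *)
Lemma ito_chain_approximation (n : nat) :
  (\int[P]_w ((J (n%:R * tau) w - \sum_(k < n) q * u (Y k w) * (B (k.+1%:R * tau) w - B (k%:R * tau) w)) ^+ 2)%:E
    <= (4 * (4 * q ^+ 2 * cU u * (jr * tau)) * (n%:R * tau))%:E)%E.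
Proof.
have uL (s t : R) i : 0 <= s -> 0 <= t -> `|q * u i - q * u i| <= 0 * `|t - s|.
  by move=> _ _; rewrite subrr normr0 mul0r.
have jc := @joint_measurable_chain (fun _ i => q * u i) 0 (lexx 0) uL.
have qB i : (q * u i) ^+ 2 <= q ^+ 2 * cU u.
  by rewrite exprMn ler_wpM2l ?sqr_ge0// u_le_cU.
have qB' i : `|q * u i| <= q ^+ 2 * cU u + 1.
  have := sqr_ge0 (`|q * u i| - 1); rewrite sqrrB1 real_normK ?num_real// => h.
  by have := qB i; have := normr_ge0 (q * u i); lra.
have hcc (s : R) w : 0 < s -> s <= n%:R * tau -> q * u (X s w) = q * u (X (Num.max s 0) w).
  by move=> s0 _; rewrite (max_idPl (ltW s0)).
have hmx k : (k < n)%N -> smeas (F (k%:R * tau)) (fun w => q * u (Y k w)).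
  move=> _; apply: smeas_sub (_ : past F B X tau k `<=` _) _; first by move=> G [].
  exact: (chain_past fF aX tau0 (fun i => q * u i)).
have hbx k w : `|q * u (Y k w)| <= q ^+ 2 * cU u + 1 by exact: qB'.
apply: (ito_grid_approximation fF bB (hJ (t0 n)) hcc jc tau0 erefl hmx hbx).
move=> k s kn ks sk.
have s0 : 0 <= s by exact: le_trans (ltW ks).
have m1 : measurable_fun setT (fun w => q * u (X (Num.max s 0) w) - q * u (Y k w)).
  by apply: measurable_funB; exact: (measurable_chain cX (fun i => q * u i)).
rewrite (max_idPl s0) in m1 *.
have i1 : intg P (fun w => (q * u (X s w) - q * u (Y k w)) ^+ 2).
  apply: (@intg_bd _ _ _ _ _ ((2 * (q ^+ 2 * cU u + 1)) ^+ 2)); first exact: measurable_funX.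
  move=> w; rewrite normrX lerXn2r ?nnegrE//.
    by have := qB' (X s w); have := normr_ge0 (q * u (X s w)); lra.
  by apply: le_trans (ler_normB _ _) _; have := qB' (X s w); have := qB' (Y k w); lra.
have i2 : intg P (fun w => (X s w != Y k w)%:R).
  by apply: (@intg_bd _ _ _ _ _ 1); [exact: mne|move=> w; rewrite ger0_norm// lern1 leq_b1].
rewrite -(ExE i1) lee_fin.
apply: (@le_trans _ _ (Ex P (fun w => 4 * q ^+ 2 * cU u * (X s w != Y k w)%:R))); last first.
  have c0 : 0 <= 4 * q ^+ 2 * cU u by rewrite mulr_ge0 ?cU_ge0// mulr_ge0// sqr_ge0.
  by rewrite ExZ// ler_wpM2l//; exact: jumpP.
apply: Ex_le => //; first exact: intgZ.
move=> w; case: (eqVneq (X s w) (Y k w)) => [->|_]; first by rewrite subrr expr0n/= mulr0.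
rewrite mulr1; have := qB (X s w); have := qB (Y k w).
have := sqr_ge0 (q * u (X s w) + q * u (Y k w)); rewrite sqrrD sqrrB; lra.
Qed.

Lemma drift_approximation (n : nat) :
  (\int[P]_w (`|tint 0 (n%:R * tau) (phi ^~ w) - tau * \sum_(k < n) ft (k%:R * tau) (Y k w)|)%:E
    <= ((2 * Lf * tau + 4 * Fb * (jr * tau)) * (n%:R * tau))%:E)%E.
Proof.
set T := n%:R * tau.
pose xi k w := ft (k%:R * tau) (Y k w).
pose a (i : 'I_n) := i%:R * tau; pose b (i : 'I_n) := i.+1%:R * tau.
have mxi k : measurable_fun setT (xi k) by exact: (measurable_chain cX (ft (k%:R * tau))).
have xiB k w : `|xi k w| <= 2 * Fb by exact: ftB.
have ind_m (i : 'I_n) : measurable_fun setT (fun s : R => (a i < s <= b i)%R%:R : R).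
  rewrite (_ : (fun s : R => _) = \1_(`]a i, b i]%classic)); first exact: measurable_indic.
  by apply/funext => s; rewrite indicE mem_setE in_itv.
pose st s w := elementary_value (fun i : 'I_n => xi i) a b s w.
have bind w (i : 'I_n) : bmeas T (fun s => xi i w * (a i < s <= b i)%R%:R).
  apply: bmeasZ; split; first exact: ind_m.
  by exists 1 => s _; rewrite ger0_norm// lern1 leq_b1.
have bst w : bmeas T (st ^~ w) by apply: bmeas_sum => i; exact: bind.
have jst : joint_measurable st.
  apply: joint_measurable_sum => i; apply: joint_measurableM.
    exact: joint_measurable_space.
  by apply: (joint_measurable_time (f := fun s => (a i < s <= b i)%R%:R)); exact: ind_m.
have tst w : tint 0 T (st ^~ w) = tau * \sum_(k < n) xi k w.
  rewrite /st /elementary_value (tint_sum (lexx 0) (lexx T)); last exact: bind.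
  rewrite mulr_sumr; apply: eq_bigr => i _.
  rewrite (tintZ (lexx 0) (lexx T)); last first.
    by split; [exact: ind_m|exists 1 => s _; rewrite ger0_norm// lern1 leq_b1].
  rewrite mulrC; congr (_ * _).
  have bT : b i <= T by rewrite ler_wpM2r ?(ltW tau0)// ler_nat.
  have := overlap_integral (a i) (b i) (t0 i) bT.
  rewrite /tint /Rintegral => h; rewrite -[RHS]/(fine tau%:E); congr fine.
  have -> : tau = overlap (a i) (b i) (a i) (b i).
    rewrite /overlap minxx maxxx (_ : b i - a i = tau); last by rewrite /a /b -natr1; ring.
    by apply/esym/max_idPl/ltW.
  rewrite -h; apply: eq_integral => s _; congr EFin.
  by case: (a i < s <= b i); rewrite /= ?mulr1 ?mulr0.
have jd : joint_measurable (fun s w => `|phi s w - st s w|).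
  apply: (joint_measurable_comp (psi := fun x => `|x|)); first exact: normr_measurable.
  exact: joint_measurableB.
apply: (@le_trans _ _ (\int[P]_w \int[mu]_(s in `[0%R, T]) (`|phi s w - st s w|)%:E)%E).
  apply: ge0_le_integral => //.
  - apply/measurable_EFinP; apply: measurableT_comp => //; apply: measurable_funB.
      exact: (measurable_time_Rintegral T jphi).
    by apply: measurable_funM => //; apply: measurable_sum => k; exact: mxi.
  - by apply: measurable_time_integral.
  move=> w _; rewrite -/(xi _ _) -tst -(tintB (lexx 0) (lexx T) (bphi T w) (bst w)).
  have bd : bmeas T (fun s => phi s w - st s w) by exact: bmeasB.
  apply: (@le_trans _ _ (tint 0 T (fun s => `|phi s w - st s w|))%:E).
    by rewrite lee_fin (tint_norm (lexx 0) (lexx T)).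
  by rewrite (tintE (lexx 0) (lexx T))//; exact: bmeas_abs.
apply: (@time_integral_le _ _ _ P (fun s w => `|phi s w - st s w|)) => //.
  exact: t0.
move=> s s0 sT; have [k [kn ks sk ev]] := elementary_value_grid xi tau0 s0 sT.
under eq_integral do rewrite /st ev.
have i1 : intg P (fun w => `|phi s w - xi k w|).
  apply: (@intg_bd _ _ _ _ _ (4 * Fb)).
    by apply: measurableT_comp => //; apply: measurable_funB => //; exact: joint_section_space.
  move=> w; rewrite normr_id; apply: le_trans (ler_normB _ _) _.
  by have := phiB s w; have := xiB k w; lra.
have i2 : intg P (fun w => (X s w != Y k w)%:R).
  by apply: (@intg_bd _ _ _ _ _ 1); [apply: mne => //; exact: ltW|move=> w; rewrite ger0_norm// lern1 leq_b1].
rewrite -(ExE i1) lee_fin.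
apply: (@le_trans _ _ (Ex P (fun w => 2 * Lf * tau + 4 * Fb * (X s w != Y k w)%:R))); last first.
  rewrite ExD; [|exact: intg_cst|exact: intgZ].
  by rewrite Ex_cst ExZ// lerD2l ler_wpM2l ?mulr_ge0//; exact: jumpP.
apply: Ex_le => //; first by apply: intgD; [exact: intg_cst|exact: intgZ].
move=> w; rewrite /phi (max_idPl (ltW s0)) /xi.
have dt : `|s - k%:R * tau| <= tau.
  by rewrite ger0_norm ?subr_ge0 ?(ltW ks)//; move: sk; rewrite -natr1 mulrDl mul1r; lra.
case: (eqVneq (X s w) (Y k w)) => [->|_].
  rewrite mulr0 addr0; apply: le_trans (ftL _ (t0 k) (ltW s0)) _.
  by rewrite ler_wpM2l ?mulr_ge0.
rewrite mulr1; apply: le_trans (ler_normB _ _) _.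
have := ftB (X s w) (ltW s0); have := ftB (Y k w) (t0 k).
have : 0 <= 2 * Lf * tau by rewrite !mulr_ge0// ltW.
lra.
Qed.

(** Summation by parts with the Poisson equation. The boundary term and the Lipschitz term of the
    corrector do not shrink with [tau], only with [lam]: they become the permanent error [b] of the
    discretization. *)
Lemma chain_sum_approximation (n : nat) w :
  `|\sum_(k < n) chain_increment X (nu *: Q) tau lam (fun k => corrector Q p f (k%:R * tau)) k w
    - lam * nu * (tau * \sum_(k < n) ft (k%:R * tau) (Y k w))|
  <= lam * (2 * cG Q p Fb + lG Q p Lf * (n%:R * tau)) + lam * ((n%:R * tau) * (d%:R * C * cG Q p Fb * tau)).
Proof.
set g := fun k => corrector Q p f (k%:R * tau).
have gB k i : `|g k i| <= cG Q p Fb by exact: corrector_bound.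
pose e k i := mop (expmx (tau *: (nu *: Q))) (g k) i - g k i - tau * nu * mop Q (g k) i.
have eB k i : `|e k i| <= d%:R * C * cG Q p Fb * tau ^+ 2.
  exact: (semigroup_taylor taylor (ltW tau0) tau1 i (gB k)).
have -> : \sum_(k < n) chain_increment X (nu *: Q) tau lam g k w - lam * nu * (tau * \sum_(k < n) ft (k%:R * tau) (Y k w)) =
    lam * (g n (Y n w) - g 0%N (Y 0%N w) - \sum_(k < n) (g k.+1 (Y k.+1 w) - g k (Y k.+1 w))) - lam * \sum_(k < n) e k (Y k w).
  elim: n => [|n ih]; first by rewrite !big_ord0; ring.
  rewrite !big_ord_recr/= !(mulrDr tau) !(mulrDr (lam * nu)).
  rewrite [LHS](_ : _ = (\sum_(k < n) chain_increment X (nu *: Q) tau lam g k w - lam * nu * (tau * \sum_(k < n) ft (k%:R * tau) (Y k w))) +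
     (chain_increment X (nu *: Q) tau lam g n w - lam * nu * (tau * ft (n%:R * tau) (Y n w)))); last by ring.
  rewrite ih /e /chain_increment (corrector_poisson gQ up f (n%:R * tau)); ring.
apply: le_trans (ler_normB _ _) _; rewrite !normrM (ger0_norm lam0); apply: lerD; rewrite ler_wpM2l//.
  apply: le_trans (ler_normB _ _) _; apply: lerD.
    by apply: le_trans (ler_normB _ _) _; have := gB n (Y n w); have := gB 0%N (Y 0%N w); lra.
  apply: le_trans (ler_norm_sum _ _ _) _.
  apply: (@le_trans _ _ (\sum_(k < n) lG Q p Lf * tau)); last first.
    by rewrite sumr_const card_ord -mulr_natl le_eqVlt; apply/orP; left; apply/eqP; ring.
  apply: ler_sum => k _; apply: le_trans (corrector_lip Q p fL _ (t0 k) (t0 k.+1)) _.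
  rewrite (_ : _ - _ = tau) ?gtr0_norm//; last by rewrite -natr1; ring.
apply: le_trans (ler_norm_sum _ _ _) _.
apply: (@le_trans _ _ (\sum_(k < n) (d%:R * C * cG Q p Fb * tau ^+ 2))); last first.
  by rewrite sumr_const card_ord -mulr_natl le_eqVlt; apply/orP; left; apply/eqP; ring.
by apply: ler_sum => k _; exact: eB.
Qed.

(** [delta] is shared in three: the drift error by Markov's inequality, the Ito error by
    Chebyshev's, and the Taylor error deterministically. *)
Lemma grid_closeness (n : nat) (delta : R) (T := n%:R * tau) : 0 < delta ->
  lam * (T * (d%:R * C * cG Q p Fb * tau)) <= delta / 3 ->
  (P [set w | (lam * (2 * cG Q p Fb + lG Q p Lf * T) + delta <
      `|U T w - block (model_increment B X Q p nu f u lam (kap0 * q) tau) 0 n w|)%R] <=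
   (lam * nu * ((2 * Lf * tau + 4 * Fb * (jr * tau)) * T) / (delta / 3) +
    kap0 ^+ 2 * (4 * (4 * q ^+ 2 * cU u * (jr * tau)) * T) / (delta / 3) ^+ 2)%:E)%E.
Proof.
move=> d0 small.
have T0 : 0 <= T by exact: t0.
have d3 : 0 < delta / 3 by rewrite divr_gt0.
have ln0 : 0 <= lam * nu by rewrite mulr_ge0// ltW.
pose D1 w := tint 0 T (phi ^~ w) - tau * \sum_(k < n) ft (k%:R * tau) (Y k w).
pose D2 w := J T w - \sum_(k < n) q * u (Y k w) * (B (k.+1%:R * tau) w - B (k%:R * tau) w).
have mJ : measurable_fun setT (J T) by have [] := hJ T0.
have mD1 : measurable_fun setT D1.
  apply: measurable_funB; first exact: (measurable_time_Rintegral T jphi).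
  by apply: measurable_funM => //; apply: measurable_sum => k; exact: (measurable_chain cX (ft (k%:R * tau))).
have mD2 : measurable_fun setT D2.
  apply: measurable_funB => //; apply: measurable_sum => k; apply: measurable_funM.
    exact: (measurable_chain cX (fun i => q * u i)).
  by apply: measurable_funB; exact: (measurable_brownian fF bB).
have mb : measurable_fun setT (block (model_increment B X Q p nu f u lam (kap0 * q) tau) 0 n).
  apply: measurable_sum => k; apply: measurable_funD.
    apply: measurable_funM => //; apply: measurable_funB; first exact: (measurable_chain cX (corrector Q p f (k%:R * tau))).
    exact: (measurable_chain cX (mop (expmx (tau *: (nu *: Q))) (corrector Q p f (k%:R * tau)))).
  apply: measurable_funM; first exact: (measurable_chain cX (fun i => kap0 * q * u i)).
  by apply: measurable_funB; exact: (measurable_brownian fF bB).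
have [N [mN PN0 hN]] := hU T0.
pose G1 := [set w | (delta / 3 <= lam * nu * `|D1 w|)%R].
pose G2 := [set w | ((delta / 3) ^+ 2 <= kap0 ^+ 2 * D2 w ^+ 2)%R].
have mG1 : measurable G1.
  rewrite -[X in measurable X]setTI; apply: measurable_fun_le => //.
  by apply: measurable_funM => //; exact: measurableT_comp.
have mG2 : measurable G2.
  rewrite -[X in measurable X]setTI; apply: measurable_fun_le => //.
  by apply: measurable_funM => //; exact: measurable_funX.
have PG1 : (P G1 <= (lam * nu * ((2 * Lf * tau + 4 * Fb * (jr * tau)) * T) / (delta / 3))%:E)%E.
  apply: (@prob_markov _ _ _ P (fun w => (lam * nu * `|D1 w|)%:E)) => //.
  - by apply/measurable_EFinP; apply: measurable_funM => //; exact: measurableT_comp.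
  - by move=> w; rewrite lee_fin mulr_ge0.
  under eq_integral do rewrite EFinM.
  rewrite ge0_integralZl//; last by apply/measurable_EFinP; exact: measurableT_comp.
  rewrite [leRHS]EFinM; apply: lee_pmul => //; first exact: integral_ge0.
  exact: drift_approximation.
have PG2 : (P G2 <= (kap0 ^+ 2 * (4 * (4 * q ^+ 2 * cU u * (jr * tau)) * T) / (delta / 3) ^+ 2)%:E)%E.
  apply: (@prob_markov _ _ _ P (fun w => (kap0 ^+ 2 * D2 w ^+ 2)%:E)) => //.
  - exact: exprn_gt0.
  - by apply/measurable_EFinP; apply: measurable_funM => //; exact: measurable_funX.
  - by move=> w; rewrite lee_fin mulr_ge0 ?sqr_ge0.
  under eq_integral do rewrite EFinM.
  rewrite ge0_integralZl//; last 3 first.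
  - by apply/measurable_EFinP; exact: measurable_funX.
  - by move=> w _; rewrite lee_fin sqr_ge0.
  - by rewrite lee_fin sqr_ge0.
  rewrite [leRHS]EFinM; apply: lee_pmul => //.
  - by rewrite lee_fin sqr_ge0.
  - by apply: integral_ge0 => w _; rewrite lee_fin sqr_ge0.
  exact: ito_chain_approximation.
rewrite -[X in X%:E]add0r.
have mG12 : measurable (G1 `|` G2) by exact: measurableU.
have PN : (P N <= 0%:E)%E by rewrite PN0.
apply: prob_le (prob_setU_le mN mG12 PN (prob_setU_le mG1 mG2 PG1 PG2)).
- apply: measurable_set_lt => //.
  by apply: measurableT_comp => //; apply: measurable_funB => //; exact: mU.
- exact: measurableU.
move=> w /= hw; apply: contrapT => /not_orP[nN /not_orP[nG1 nG2]].
have eU : U T w = lam * nu * tint 0 T (phi ^~ w) + kap0 * J T w.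
  rewrite -tint_phi; apply: contrapT => h; apply: nN; exact: hN.
have b1 : lam * nu * `|D1 w| < delta / 3 by rewrite ltNge; apply/negP.
have b2 : `|kap0 * D2 w| < delta / 3.
  rewrite -(ltr_pXn2r (_ : 0 < 2)%N) ?nnegrE ?(ltW d3)// real_normK ?num_real// exprMn ltNge.
  exact/negP.
have b3 := chain_sum_approximation n w.
move: hw; apply/negP; rewrite -leNgt.
have -> : U T w - block (model_increment B X Q p nu f u lam (kap0 * q) tau) 0 n w =
   lam * nu * D1 w + kap0 * D2 w -
   (\sum_(k < n) chain_increment X (nu *: Q) tau lam (fun k => corrector Q p f (k%:R * tau)) k w
    - lam * nu * (tau * \sum_(k < n) ft (k%:R * tau) (Y k w))).
  rewrite eU /D1 /D2 /block big_mkord big_split/=.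
  have -> : \sum_(k < n) brownian_part B X tau (kap0 * q) u k w =
    kap0 * \sum_(k < n) q * u (Y k w) * (B (k.+1%:R * tau) w - B (k%:R * tau) w).
    by rewrite mulr_sumr; apply: eq_bigr => k _; rewrite /brownian_part; ring.
  ring.
apply: le_trans (ler_normB _ _) _; apply: le_trans (lerD (ler_normD _ _) b3) _.
rewrite normrM (ger0_norm ln0); have := ltW b1; have := ltW b2; have := small; rewrite -/T; lra.
Qed.

End Step.

(** One constant above every coefficient that remains once [tau] is small. It involves none of [nu],
    [lam], [kap0], [q], nor the Taylor constant, so the same value serves all [N]. *)
Definition model_const : R :=
  let G := cG Q p Fb in let V := cV Q p Fb in let Dn := mxnorm1 (deviation_matrix Q p) in
  1 + (V + 1 + cU u) + 72 * G ^+ 2 * (V + 1) + (2 * Dn * (V + cU u) + Dn * lV Q p Fb Lf + lV Q p Fb Lf) +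
  (2 * G + lG Q p Lf).

(** The Taylor constant of [nu *: Q] depends on [nu]; every error containing it also carries a
    factor [tau], and is absorbed into [delta] by the choice of the grid level, which comes last. *)
Lemma model_approximation (H n0 : nat) (delta : R) (kap := kap0 * q) (rho := lam ^+ 2 * nu + kap ^+ 2) : 0 < delta ->
  exists n A s q', (n0 <= n)%N /\
    discretization P U n H A s q' (model_const * rho) (model_const * lam ^+ 2 * rho + delta)
      (mean_rate Q p f u (lam ^+ 2 * nu) (kap ^+ 2)) (model_const * rho * (1 + H%:R) / nu + delta)
      (model_const * rho) (lam * model_const * (1 + H%:R)) delta.
Proof.
move=> d0.
have [C C0 taylor] := expmx_taylor (nu *: Q).
pose G := cG Q p Fb; pose V := cV Q p Fb; pose Dn := mxnorm1 (deviation_matrix Q p).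
pose LV := lV Q p Fb Lf; pose LG := lG Q p Lf; pose cu := cU u.
pose vc := variance_const Q nu C G; pose cH := Dn * ((V + cu) * rho).
have G0 : 0 <= G by exact: cG_ge0.
have V0 : 0 <= V by exact: cV_ge0.
have Dn0 : 0 <= Dn by exact: mxnorm1_ge0.
have LV0 : 0 <= LV by exact: lV_ge0.
have LG0 : 0 <= LG by exact: lG_ge0.
have cu0 : 0 <= cu by exact: cU_ge0.
have dC0 : 0 <= d%:R * C by rewrite mulr_ge0.
have A20 : 0 <= lam ^+ 2 * nu by rewrite mulr_ge0 ?sqr_ge0// ltW.
have B20 : 0 <= kap ^+ 2 by exact: sqr_ge0.
have rho0 : 0 <= rho by exact: addr_ge0.
have Q0 : 0 <= mxnorm1 Q by exact: mxnorm1_ge0.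
have nQ0 : 0 <= nu * mxnorm1 Q by rewrite mulr_ge0 ?mxnorm1_ge0 ?(ltW nu0).
have r0 : 0 <= nu * mxnorm1 Q + d%:R * C by nneg.
have vc0 : 0 <= vc by rewrite /vc /variance_const; nneg.
have cH0 : 0 <= cH by rewrite /cH; nneg.
have jr0 : 0 <= jump_rate Q nu C by rewrite /jump_rate; nneg.
have nV0 : 0 <= nu^-1 by nneg.
have dV0 : 0 <= delta^-1 by nneg.
pose h : R := H%:R; have h0 : 0 <= h by exact: ler0n.
(* Each condition [ki * tau <= 1] is one smallness requirement: [k2] and [k3] are those of the
   discrete model, [k4] concerns the fourth moment, [k5] the averaging error, [k6] and [k7] the
   closeness at grid points. *)
pose k2 := nu * mxnorm1 Q + d%:R * C.
pose k3 := vc / nu.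
pose k4 := 24 * (kap ^+ 2 * cu) ^+ 2 / delta.
pose k5 := (h * (d%:R * C * cH) / nu + h * (lam ^+ 2 * vc)) / delta.
pose k6 := 3 * lam * h * (d%:R * C * G) / delta.
pose k7 := (lam * nu * ((2 * Lf + 4 * Fb * jump_rate Q nu C) * h) / (delta / 3) +
   kap0 ^+ 2 * (4 * (4 * q ^+ 2 * cu * jump_rate Q nu C) * h) / (delta / 3) ^+ 2) / delta.
have k20 : 0 <= k2 by exact: r0.
have k30 : 0 <= k3 by rewrite /k3; nneg.
have k40 : 0 <= k4 by rewrite /k4; nneg.
have k50 : 0 <= k5 by rewrite /k5; nneg.
have k60 : 0 <= k6 by rewrite /k6; nneg.
have k70 : 0 <= k7 by rewrite /k7; nneg.
have [n [n0n hn]] := dyadic_step_small (1 + k2 + k3 + k4 + k5 + k6 + k7) n0.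
pose tau : R := 2 ^- n; rewrite -/tau in hn.
have tau0 : 0 < tau by rewrite invr_gt0 exprn_gt0.
have sm k : 0 <= k -> k <= 1 + k2 + k3 + k4 + k5 + k6 + k7 -> k * tau <= 1.
  by move=> _ kk; apply: le_trans hn; rewrite ler_wpM2r// ltW.
have tau1 : tau <= 1 by have := sm 1; rewrite mul1r; apply => //; lra.
have s2 : k2 * tau <= 1 by apply: sm => //; lra.
have s3 : k3 * tau <= 1 by apply: sm => //; lra.
have s4 : k4 * tau <= 1 by apply: sm => //; lra.
have s5 : k5 * tau <= 1 by apply: sm => //; lra.
have s6 : k6 * tau <= 1 by apply: sm => //; lra.
have s7 : k7 * tau <= 1 by apply: sm => //; lra.
have s3' : vc * tau <= nu.
  by move: s3; rewrite /k3 mulrAC ler_pdivrMr// mul1r.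
have cst0 : 0 <= model_const.
  rewrite /model_const -/G -/V -/Dn -/LV -/LG -/cu; nneg.
have hT m : (m <= H * 2 ^ n)%N -> m%:R * tau <= h.
  by move=> mH; rewrite ler_pdivrMr ?exprn_gt0// -natrX -natrM ler_nat.
have mi := model_martingale gQ fF bB nu0 cX aX iXB C0 taylor u Fb0 fB kap lam0 tau0 tau1 s2 s3'.
exists n, (past F B X tau), (model_increment B X Q p nu f u lam kap tau), (model_rate X Q p nu f u lam kap tau).
split => //; split.
- apply: mi_weaken mi; first exact: ltW.
    rewrite /model_const -/G -/V -/Dn -/LV -/LG -/cu /rho.
    rewrite -subr_ge0 (_ : _ - _ = kap ^+ 2 * (V + 1) + lam ^+ 2 * nu * cu + (1 + 72 * G ^+ 2 * (V + 1) +
      (2 * Dn * (V + cu) + Dn * LV + LV) + (2 * G + LG)) * (lam ^+ 2 * nu + kap ^+ 2)); last by ring.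
    by nneg.
  have e1 : 24 * (kap ^+ 2 * cu) ^+ 2 * tau <= delta.
    by move: s4; rewrite /k4 mulrAC ler_pdivrMr// mul1r.
  rewrite /model_const -/G -/V -/Dn -/LV -/LG -/cu /rho.
  rewrite [leLHS](_ : _ = 72 * G ^+ 2 * (V + 1) * lam ^+ 2 * (lam ^+ 2 * nu) + 24 * (kap ^+ 2 * cu) ^+ 2 * tau); last by ring.
  apply: lerD => //; rewrite -subr_ge0.
  rewrite (_ : _ - _ = lam ^+ 2 * ((72 * G ^+ 2 * (V + 1)) * kap ^+ 2 + (1 + (V + 1 + cu) +
      (2 * Dn * (V + cu) + Dn * LV + LV) + (2 * G + LG)) * (lam ^+ 2 * nu + kap ^+ 2))); last by ring.
  by nneg.
- move=> a m eta K am me eK.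
  have tm : m%:R * tau <= h by apply: hT; apply: leq_trans am; exact: leq_addl.
  have K0 : 0 <= K by exact: le_trans (eK point).
  have tm0 : 0 <= m%:R * tau by rewrite mulr_ge0// ltW.
  apply: le_trans (model_rate_average gQ up fF bB nu0 cX aX iXB C0 taylor u Fb0 Lf0 fB fL kap lam0 tau0 tau1 s2 s3' m me eK) _.
  rewrite -/G -/V -/Dn -/LV -/cu -/vc -/rho -/cH ler_wpM2l//.
  have e1 : m%:R * tau * (d%:R * C * cH * tau) / nu + m%:R * tau * (lam ^+ 2 * vc * tau) <= delta.
    have : m%:R * tau * ((d%:R * C * cH * tau) / nu + lam ^+ 2 * vc * tau) <= h * ((d%:R * C * cH * tau) / nu + lam ^+ 2 * vc * tau).
      rewrite ler_wpM2r//; by nneg.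
    move: s5; rewrite /k5 mulrAC ler_pdivrMr// mul1r; lra.
  have e2 : (2 * cH + m%:R * tau * (Dn * (LV * rho))) / nu <= model_const * rho * (1 + h) / nu.
    rewrite ler_wpM2r//.
    have : m%:R * tau * (Dn * (LV * rho)) <= h * (Dn * (LV * rho)) by rewrite ler_wpM2r// !mulr_ge0.
    move=> e; apply: le_trans (lerD (lexx _) e) _.
    rewrite /cH /model_const -/G -/V -/Dn -/LV -/LG -/cu -subr_ge0.
    rewrite (_ : _ - _ = rho * ((1 + (V + 1 + cu) + 72 * G ^+ 2 * (V + 1) + LV + (2 * G + LG)) * (1 + h) +
       2 * Dn * (V + cu) * h + Dn * LV)); last by ring.
    by nneg.
  have e3 : LV * rho * (m%:R * tau) ^+ 2 <= model_const * rho * (m%:R * tau) ^+ 2.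
    rewrite ler_wpM2r ?sqr_ge0// ler_wpM2r//.
    rewrite /model_const -/G -/V -/Dn -/LV -/LG -/cu -subr_ge0.
    rewrite (_ : _ - _ = 1 + (V + 1 + cu) + 72 * G ^+ 2 * (V + 1) + (2 * Dn * (V + cu) + Dn * LV) + (2 * G + LG)); last by ring.
    by nneg.
  rewrite mulrDl; apply: le_trans (_ : _ <= (delta + model_const * rho * (1 + h) / nu) + model_const * rho * (m%:R * tau) ^+ 2) _; last first.
    by rewrite [delta + _]addrC.
  apply: lerD => //; lra.
move=> i iH; have ti : i%:R * tau <= h by exact: hT.
have ti0 : 0 <= i%:R * tau by rewrite mulr_ge0// ltW.
have sml : lam * (i%:R * tau * (d%:R * C * G * tau)) <= delta / 3.
  have : lam * (i%:R * tau * (d%:R * C * G * tau)) <= lam * (h * (d%:R * C * G * tau)).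
    by rewrite ler_wpM2l// ler_wpM2r// !mulr_ge0// ltW.
  move: s6; rewrite /k6 mulrAC ler_pdivrMr// mul1r; lra.
have cl := grid_closeness C0 taylor tau0 tau1 d0 sml.
have mb : measurable_fun setT (block (model_increment B X Q p nu f u lam kap tau) 0 i).
  have [+ _] := L4_block mi 0 i; exact.
apply: le_trans (_ : _ <= (k7 * tau * delta)%:E)%E _; last by rewrite lee_fin ler_piMl// ltW.
have mS (c : R) : measurable [set w | (c < `|U (i%:R * tau) w - block (model_increment B X Q p nu f u lam kap tau) 0 i w|)%R].
  apply: measurable_set_lt => //.
  by apply: measurableT_comp => //; apply: measurable_funB => //; exact: mU.
apply: prob_le (le_trans cl _).
- exact: mS.
- exact: mS.
- move=> w /=; apply: le_lt_trans; rewrite lerD2r -mulrA ler_wpM2l//.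
  have : LG * (i%:R * tau) <= LG * h by rewrite ler_wpM2l.
  move=> e; apply: le_trans (lerD (lexx _) e) _.
  rewrite /model_const -/G -/V -/Dn -/LV -/LG -/cu -subr_ge0.
  rewrite (_ : _ - _ = (1 + (V + 1 + cu) + 72 * G ^+ 2 * (V + 1) + (2 * Dn * (V + cu) + Dn * LV + LV)) * (1 + h) +
    2 * G * h + LG); last by ring.
  by nneg.
rewrite lee_fin.
have -> : k7 * tau * delta = lam * nu * ((2 * Lf * tau + 4 * Fb * (jump_rate Q nu C * tau)) * h) / (delta / 3) +
   kap0 ^+ 2 * (4 * (4 * q ^+ 2 * cu * (jump_rate Q nu C * tau)) * h) / (delta / 3) ^+ 2.
  by rewrite /k7; field; rewrite gt_eqF.
apply: lerD; rewrite ler_wpM2r ?invr_ge0 ?exprn_ge0 ?divr_ge0 ?(ltW d0)//.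
  by rewrite ler_wpM2l ?mulr_ge0 ?(ltW nu0)// ler_wpM2l// addr_ge0// !mulr_ge0// ltW.
rewrite -/cu; apply: ler_wpM2l; first exact: sqr_ge0.
apply: ler_wpM2l => //; nneg.
Qed.

End ModelApproximation.

(** * Convergence of path laws *)

(** Constants come before the grid: [v], [e] and [b] hold what remains however fine the grid, and
    [delta] what a finer grid removes. *)
Definition approximable {d} {T : measurableType d} {R : realType} (P : probability T R) (U : R -> T -> R)
    (H : nat) (C v : R) (r : R -> R) (e L b : R) : Prop :=
  forall n0 (delta : R), 0 < delta -> exists n A s q, (n0 <= n)%N /\
    discretization P U n H A s q C (v + delta) r (e + delta) L b delta.

Lemma grid_refine (R : realType) (l n i : nat) : (l <= n)%N ->
  grid l i = (i * 2 ^ (n - l))%:R * 2 ^- n :> R.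
Proof.
move=> ln; rewrite /grid natrM natrX -mulrA; congr (_ * _).
by rewrite -{2}(subnKC ln) exprD invfM mulrCA divff ?mulr1// expf_neq0.
Qed.

(** * Tails of increments inherited from discretizations *)

Section DiscretizationTail.
Context d (T : measurableType d) (R : realType) (P : probability T R).
Variables (U : R -> T -> R) (H : nat) (C v : R) (r : R -> R) (e L b : R).
Hypotheses (C0 : 0 <= C) (v0 : 0 <= v).
Hypothesis mU : forall t : R, 0 <= t -> measurable_fun setT (U t).
Hypothesis apU : approximable P U H C v r e L b.

(** The fourth-moment bound of a block at threshold [c / 2], whence [64 = 16 * 4] and [48 = 16 * 3];
    the other half of [c] covers the two grid errors [b + delta], since [8 b <= c] and
    [delta <= c / 16]. *)
Lemma approximable_tail (k i : nat) (c : R) (t := 2 ^- k : R) : (i < H * 2 ^ k)%N -> 0 < c -> 8 * b <= c ->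
  (P [set w | (c <= `|U (grid k i.+1) w - U (grid k i) w|)%R] <=
   ((64 * C ^+ 2 * t ^+ 2 + 48 * v * t) / c ^+ 4)%:E)%E.
Proof.
move=> iH c0 bc.
have t0 : 0 < t by rewrite invr_gt0 exprn_gt0.
have g0 m : 0 <= grid k m :> R by rewrite divr_ge0// exprn_ge0.
have c40 : 0 < c ^+ 4 by exact: exprn_gt0.
have mS : measurable [set w | (c <= `|U (grid k i.+1) w - U (grid k i) w|)%R].
  rewrite -[X in measurable X]setTI; apply: measurable_fun_le => //.
  by apply: measurableT_comp => //; apply: measurable_funB; exact: mU.
rewrite -(fineK (fin_num_measure P _ mS)) lee_fin; apply/ler_addgt0Pr => eps eps0.
(* [Z] collects what multiplies [delta] in the final bound: the fourth-moment term, and 2 for the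
   two grid events. *)
pose Z := 48 * t / c ^+ 4 + 2.
have Z0 : 0 < Z by rewrite ltr_wpDl// divr_ge0 ?mulr_ge0// ltW.
pose delta := Num.min (c / 16) (eps / Z).
have d0 : 0 < delta by rewrite lt_min !divr_gt0.
have dc : delta <= c / 16 by rewrite ge_min lexx.
have de : delta * Z <= eps by rewrite -ler_pdivlMr// ge_min lexx orbT.
have [n [A [s [q [kn [mi _ cl]]]]]] := apU k d0.
pose m := (2 ^ (n - k))%N.
have mn : (2 ^ k * m = 2 ^ n)%N by rewrite /m -expnD subnKC.
have e1 j : grid k j = (j * m)%:R * 2 ^- n :> R by exact: grid_refine.
have inH j : (j <= H * 2 ^ k)%N -> (j * m <= H * 2 ^ n)%N.
  by move=> jH; rewrite -mn mulnA leq_mul2r jH orbT.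
have ta : 2 ^- n * m%:R = t.
  by rewrite mulrC -[m]mul1n -e1 /grid mul1r.
have mS' j : measurable [set w | (b + delta < `|U (grid k j) w - block s 0 (j * m) w|)%R].
  apply: measurable_set_lt => //.
  apply: measurableT_comp => //; apply: measurable_funB; first exact: mU.
  by have [] := L4_block mi 0 (j * m).
pose Bk := [set w | (c / 2 <= `|block s (i * m) (i * m + m) w|)%R].
have mB : measurable Bk.
  rewrite -[X in measurable X]setTI; apply: measurable_fun_le => //.
  by apply: measurableT_comp => //; have [] := L4_block mi (i * m) (i * m + m).
have PB : (P Bk <= ((c / 2) ^- 4 * (4 * C ^+ 2 * t ^+ 2 + 3 * (v + delta) * t))%:E)%E.
  have tau0 : 0 <= 2 ^- n :> R by rewrite invr_ge0 exprn_ge0.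
  have := block_tail mi tau0 (i * m) m (divr_gt0 c0 (ltr0n R 2)).
  by rewrite ta.
have PS1 : (P [set w | (b + delta < `|U (grid k i.+1) w - block s 0 (i.+1 * m) w|)%R] <= delta%:E)%E.
  by rewrite e1; apply: cl; exact: inH.
have PS0 : (P [set w | (b + delta < `|U (grid k i) w - block s 0 (i * m) w|)%R] <= delta%:E)%E.
  by rewrite e1; apply: cl; apply: inH; exact: ltnW.
have PU := prob_setU_le (mS' i.+1) (measurableU _ _ (mS' i) mB) PS1 (prob_setU_le (mS' i) mB PS0 PB).
have sub : [set w | (c <= `|U (grid k i.+1) w - U (grid k i) w|)%R] `<=`
  [set w | (b + delta < `|U (grid k i.+1) w - block s 0 (i.+1 * m) w|)%R] `|`
   ([set w | (b + delta < `|U (grid k i) w - block s 0 (i * m) w|)%R] `|` Bk).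
  move=> w /= cw; apply: contrapT => /not_orP[/negP n1 /not_orP[/negP n2 /negP n3]].
  move: n1 n2 n3 cw; rewrite -!leNgt -ltNge.
  have -> : block s (i * m) (i * m + m) w = block s 0 (i.+1 * m) w - block s 0 (i * m) w.
    by rewrite /block mulSnr [X in _ = X - _](@big_cat_nat _ _ _ (i * m))//= ?leq_addr// addrAC subrr add0r.
  rewrite !ler_norml !ltr_norml => /andP[a1 a2] /andP[b1 b2] /andP[c1 c2].
  move=> h; have : `|U (grid k i.+1) w - U (grid k i) w| < c.
    by rewrite ltr_norml; apply/andP; split; lra.
  by rewrite ltNge h.
have mU' := measurableU _ _ (mS' i.+1) (measurableU _ _ (mS' i) mB).
have := prob_le mS mU' sub PU.
rewrite -[X in (X <= _)%E](fineK (fin_num_measure P _ mS)) lee_fin => h; apply: le_trans h _.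
rewrite [leLHS](_ : _ = (64 * C ^+ 2 * t ^+ 2 + 48 * v * t) / c ^+ 4 + delta * Z).
  by rewrite lerD2l.
by rewrite /Z; field; rewrite gt_eqF.
Qed.

End DiscretizationTail.

(** * The law of a block against the Rademacher reference *)

Section BlockLaw.
Context d (T : measurableType d) (R : realType) (P : probability T R).
Variables (U : R -> T -> R) (n H : nat) (A : nat -> set (set T)) (s q : nat -> T -> R).
Variables (C v4 : R) (r r0 : R -> R) (e b delta om : R).
Hypothesis C1 : 1 <= C.
Hypothesis dz : discretization P U n H A s q C v4 r e C b delta.
Hypothesis v40 : 0 <= v4.
Hypothesis r00 : forall t, 0 <= t -> 0 <= r0 t <= C.
Hypothesis rr0 : forall t, 0 <= t -> `|r t - r0 t| <= om.
Variables (l p : nat).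
Hypothesis lpn : (l + p <= n)%N.
Local Notation t := (2 ^- (l + p) : R).
Hypotheses (v4t : v4 <= t) (eom : e + om * t <= t ^+ 2).

(** Mean of [f] at a sum of [2 ^ p] independent Rademacher steps with the variances that [r0] gives
    to the sub-blocks of block [j]; prelimit and limit are both compared with this number. *)
Definition reference_law (f : R -> R) (j : nat) : R :=
  rads f [seq t * r0 ((j * 2 ^ p + i)%:R * t) | i <- iota 0 (2 ^ p)] 0.

Let m := (2 ^ (n - l))%N.
Let m' := (2 ^ (n - (l + p)))%N.

Let mm : m = (2 ^ p * m')%N.
Proof. by rewrite /m /m' -expnD subnDA subnKC// leq_subRL// (leq_trans (leq_addr p l)). Qed.

Let tau0 : 0 <= 2 ^- n :> R. Proof. by rewrite invr_ge0 exprn_ge0. Qed.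

Let tE : 2 ^- n * m'%:R = t.
Proof. by rewrite mulrC -[m']mul1n -(grid_refine R 1 lpn) /grid mul1r. Qed.

(** Three scales: a block of length [2 ^- l] for the finite-dimensional laws, cut into [2 ^ p]
    sub-blocks of length [t] for Lindeberg's replacement, each made of steps of size [2 ^- n] over
    which the rate averages. A sub-block costs order [t sqrt t], hence all together order
    [sqrt t]. *)
Lemma block_law (M : R) f f1 f2 (j : nat) (eta : T -> R) (K : R) : (j < H * 2 ^ l)%N ->
  C21 M f f1 f2 -> smeas (A (j * m)%N) eta -> (forall w, `|eta w| <= K) ->
  `|Ex P (fun w => eta w * f (block s (j * m) (j.+1 * m) w)) - reference_law f j * Ex P eta|
    <= K * (3 * M * (4 * C ^+ 2 + 2 * C + 4) * Num.sqrt t).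
Proof.
move=> jH cf seta etaK.
have mi := dz_mi dz.
have t0 : 0 < t by rewrite invr_gt0 exprn_gt0.
have t1 : t <= 1 by rewrite invf_le1 ?exprn_gt0// exprn_ege1// ler1n.
have st0 : 0 <= Num.sqrt t by exact: sqrtr_ge0.
have st1 : Num.sqrt t <= 1 by rewrite -[leRHS]sqrtr1 ler_wsqrtr.
have tt : t ^+ 2 <= t * Num.sqrt t.
  by rewrite expr2 ler_wpM2l ?(ltW t0)// -{1}(sqr_sqrtr (ltW t0)) expr2 ler_piMl.
pose e' := (4 * C ^+ 2 + 2 * C + 4) * (t * Num.sqrt t).
pose a i := (j * m + i * m')%N.
have tt0 : 0 <= t * Num.sqrt t by rewrite mulr_ge0// ltW.
have bi i : (i < 2 ^ p)%N -> block_increment P (A (a i)) (block s (a i) (a i + m'))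
    (t * r0 ((j * 2 ^ p + i)%:R * t)) e'.
  move=> ip; have tt' : 0 <= (j * 2 ^ p + i)%:R * t by rewrite mulr_ge0// ltW.
  have /andP[r1 r2] := r00 tt'.
  have := @martingale_block_increment _ _ _ P A s q (2 ^- n) C v4 mi tau0 (a i) m'
    (t * r0 ((j * 2 ^ p + i)%:R * t)) e'.
  rewrite tE; apply => //.
  - by rewrite mulr_ge0// ltW.
  - by rewrite mulrC ler_wpM2r// ltW.
  - rewrite ler_wpM2r//; lra.
  move=> et K' se eK'.
  have ain : (a i + m' <= H * 2 ^ n)%N.
    have -> : (H * 2 ^ n = H * 2 ^ l * m)%N by rewrite /m -mulnA -expnD subnKC// (leq_trans (leq_addr p l)).
    apply: leq_trans (_ : j.+1 * m <= _)%N; last by rewrite leq_mul2r jH orbT.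
    by rewrite /a mulSn [in leqRHS]addnC -addnA leq_add2l mm -[X in (_ + X)%N]mul1n -mulnDl addn1 leq_mul2r ip orbT.
  have := dz_rate dz ain se eK'; rewrite [m'%:R * _]mulrC tE.
  have -> : (a i)%:R * 2 ^- n = (j * 2 ^ p + i)%:R * t.
    by rewrite -tE /a mm mulnA -mulnDl natrM; ring.
  set tt2 := (j * 2 ^ p + i)%:R * t in r1 r2 tt' *; move=> h.
  have K'0 : 0 <= K' by exact: le_trans (eK' point).
  have iet : intg P et by apply: intg_bd eK'; apply: smeas_meas se; exact: mi_meas mi _.
  have h2 : `|t * (r tt2 - r0 tt2) * Ex P et| <= om * t * K'.
    rewrite !normrM (gtr0_norm t0) [om * t]mulrC; apply: ler_pM; rewrite ?mulr_ge0// ?(ltW t0)//.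
      by rewrite ler_wpM2l ?(ltW t0)//; exact: rr0.
    exact: Ex_bd.
  apply: (@le_trans _ _ (K' * (e + C * t ^+ 2) + om * t * K')).
    rewrite (_ : _ - _ = (2 ^- n * (\sum_(a i <= k < a i + m') Ex P (fun w => et w * q k w)) - t * r tt2 * Ex P et) +
      t * (r tt2 - r0 tt2) * Ex P et); last by ring.
    exact: le_trans (ler_normD _ _) (lerD h h2).
  rewrite (_ : _ + _ = K' * (e + om * t + C * t ^+ 2)); last by ring.
  rewrite ler_wpM2l//; apply: le_trans (lerD eom (lexx _)) _.
  apply: (@le_trans _ _ ((1 + C) * (t * Num.sqrt t))).
    rewrite [leLHS](_ : _ = (1 + C) * t ^+ 2); last by ring.
    apply: ler_wpM2l; last exact: tt.
    lra.
  rewrite ler_wpM2r//; have := sqr_ge0 C; lra.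
have aS i : a i.+1 = (a i + m')%N by rewrite /a mulSn addnCA addnC.
have sumE w : 0 + \sum_(i < 2 ^ p) block s (a i) (a i + m') w = block s (j * m) (j.+1 * m) w.
  have -> : (j.+1 * m = j * m + 2 ^ p * m')%N by rewrite mulSn addnC mm.
  rewrite add0r; elim: (2 ^ p)%N => [|x ih]; first by rewrite big_ord0 mul0n addn0 block0.
  rewrite big_ord_recr/= ih /block -big_cat_nat/= ?leq_addr//; first by rewrite mulSn addnCA addnC.
have A0 : a 0%N = (j * m)%N by rewrite /a mul0n addn0.
rewrite -A0 in seta.
have hA i : A (a i) `<=` A (a i.+1) by apply: (mi_mono mi); rewrite aS leq_addr.
have hs i : (i < 2 ^ p)%N -> smeas (A (a i.+1)) (block s (a i) (a i + m')).
  by move=> _; rewrite aS; exact: (smeas_block mi (leq_addr _ _)).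
have hz : smeas (A (a 0%N)) (fun=> 0 : R) by exact: measurable_cst.
have := lindeberg (fun i => @mi_meas _ _ _ _ _ _ _ _ _ _ mi (a i)) hA bi hs cf seta etaK hz.
rewrite (Ex_eq P (fun w => congr1 (fun x => eta w * f x) (sumE w))) => h.
have ieta : intg P eta by apply: intg_bd etaK; apply: smeas_meas seta; exact: mi_meas mi _.
rewrite -ExZ//; rewrite (@Ex_eq _ _ _ P (fun w => reference_law f j * eta w)
   (fun w => eta w * reference_law f j)); last by move=> w; rewrite mulrC.
apply: le_trans h _; rewrite natrX /e'.
rewrite [leLHS](_ : _ = (2 ^+ p * t) * (K * (3 * M * (4 * C ^+ 2 + 2 * C + 4) * Num.sqrt t))); last by ring.
rewrite ler_piMl//; last by rewrite exprD invfM mulrCA divff ?expf_neq0// mulr1 invf_le1 ?exprn_gt0// exprn_ege1// ler1n.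
have M0 := C21_ge0 cf; have K0 : 0 <= K by exact: le_trans (etaK point).
have C40 : 0 <= 4 * C ^+ 2 + 2 * C + 4 by rewrite !addr_ge0// mulr_ge0// ?sqr_ge0// (le_trans ler01).
by apply: mulr_ge0 => //; apply: mulr_ge0 => //; apply: mulr_ge0 => //; exact: mulr_ge0.
Qed.

End BlockLaw.

Section Eventually.
Context {R : realType}.

Definition evt (A : nat -> Prop) : Prop := exists N0 : nat, forall N, (N0 <= N)%N -> A N.

Lemma evtI (A B : nat -> Prop) : evt A -> evt B -> evt (fun N => A N /\ B N).
Proof.
move=> [a ha] [b hb]; exists (maxn a b) => N; rewrite geq_max => /andP[h1 h2].
by split; [exact: ha|exact: hb].
Qed.

Lemma evt_ge (n : nat) : evt (fun N => (n <= N)%N). Proof. by exists n. Qed.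

Lemma evt_div (c e : R) : 0 < e -> evt (fun N => c / N%:R <= e).
Proof.
move=> e0; exists (Num.truncn (c / e)).+1 => N hN.
have N0 : 0 < N%:R :> R by rewrite ltr0n; exact: leq_trans hN.
rewrite ler_pdivrMr// mulrC -ler_pdivrMr//; apply: ltW; apply: lt_le_trans (truncnS_gt _) _.
by rewrite ler_nat.
Qed.

Lemma expr_small (q c e : R) : 0 <= q -> q < 1 -> 0 < e -> evt (fun l => c * q ^+ l <= e).
Proof.
move=> q0 q1 e0.
have h : (fun l => c * q ^+ l) @ \oo --> c * 0 by apply: cvgMr; apply: cvg_expr; rewrite ger0_norm.
have /cvgrPdist_le/(_ _ e0)[l0 _ hl] := h.
exists l0 => l /hl; rewrite /= mulr0 sub0r normrN; exact: le_trans (ler_norm _).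
Qed.

End Eventually.

Lemma C21_dist (R : realType) (M : R) f f1 f2 (x y e : R) : C21 M f f1 f2 -> e <= 1 -> `|x - y| <= e ->
  `|f x - f y| <= 3 * M * e.
Proof.
move=> cf e1; have M0 := C21_ge0 cf; have [_ _ _ bd ty] := cf.
set u := x - y => ue; have u0 : 0 <= `|u| by [].
have [_ b1 b2] := bd y; have := ty y u; rewrite (_ : y + u = x); last by rewrite /u addrC subrK.
move=> h.
have h1 : `|f1 y * u| <= M * `|u| by rewrite normrM ler_wpM2r.
have h2 : `|2^-1 * f2 y * u ^+ 2| <= M * `|u|.
  rewrite !normrM ger0_norm ?invr_ge0//.
  apply: (@le_trans _ _ (2^-1 * M * (`|u| * 1))).
    by rewrite ler_pM ?mulr_ge0// ?ler_wpM2l// (le_trans ue).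
  by rewrite mulr1 ler_wpM2r// ler_piMl// invf_le1// ler1n.
have h3 : M * `|u| ^+ 3 <= M * `|u|.
  by rewrite ler_wpM2l// exprS ler_piMr// exprn_ile1// (le_trans ue).
have h4 : M * `|u| <= M * e by rewrite ler_wpM2l.
rewrite (_ : f x - f y = (f x - f y - f1 y * u - 2^-1 * f2 y * u ^+ 2) + f1 y * u + 2^-1 * f2 y * u ^+ 2); last by ring.
apply: le_trans (ler_normD _ _) _; apply: le_trans (lerD (ler_normD _ _) (lexx _)) _; lra.
Qed.

(** * Path convergence from discretizations of prelimit and limit *)

Section PathConvergence.
Context {R : realType} (dO : nat -> measure_display) (Om : forall N, measurableType (dO N)).
Context (P : forall N, probability (Om N) R) (U W : forall N, R -> Om N -> R).
Context d' (Om' : measurableType d') (P' : probability Om' R) (F' : R -> set (set Om')) (U' : R -> Om' -> R).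
Variables (C : R) (lam : nat -> R) (r : nat -> R -> R) (r0 : R -> R).
Hypothesis C1 : 1 <= C.
Hypothesis lam0 : forall N, 0 <= lam N.
Hypothesis lam_cvg : forall e : R, 0 < e -> evt (fun N => lam N <= e).
Hypothesis r00 : forall t : R, 0 <= t -> 0 <= r0 t <= C.
Hypothesis r_cvg : forall e : R, 0 < e -> evt (fun N => forall t : R, 0 <= t -> `|r N t - r0 t| <= e).
Hypothesis apU : forall N H, (0 < N)%N ->
  approximable (P N) (@U N) H C (C * lam N ^+ 2) (r N) (C * (1 + H%:R) / N%:R) C (lam N * C * (1 + H%:R)).
Hypothesis cU : forall N (w : Om N), (0 < N)%N -> cpath (fun t => @U N t w).
Hypothesis mU : forall N (t : R), (0 < N)%N -> 0 <= t -> measurable_fun setT (@U N t).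
Hypothesis tailU : forall H : nat, exists2 K : R, 0 <= K & forall N k i (c : R), (0 < N)%N -> (i < H * 2 ^ k)%N -> 0 < c ->
  (P N [set w | (c <= `|@U N (grid k i.+1) w - @U N (grid k i) w|)%R] <= (K * 4 ^- k / c ^+ 4)%:E)%E.
Hypothesis cW : forall N (w : Om N), (0 < N)%N -> cpath (fun t => @W N t w).
Hypothesis mW : forall N (t : R), (0 < N)%N -> 0 <= t -> measurable_fun setT (@W N t).
Hypothesis WU : forall e T : R, 0 < e -> 0 <= T -> evt (fun N => exists B : set (Om N),
  [/\ measurable B, (P N B <= e%:E)%E & forall w, ~ B w -> forall t, 0 <= t <= T -> `|@W N t w - @U N t w| <= e]).
Hypothesis fF' : filtration F'.
Hypothesis aU' : forall t : R, 0 <= t -> smeas (F' t) (U' t).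
Hypothesis cU' : forall w, cpath (fun t => U' t w).
Hypothesis U'0 : {ae P', forall w, U' 0 w = 0}.
Hypothesis iU' : forall t : R, 0 <= t -> intg P' (fun w => U' t w ^+ 2).
Hypothesis apU' : forall H n0 (delta : R), 0 < delta -> exists n s q, (n0 <= n)%N /\
  discretization P' U' n H (fun k => F' (k%:R * 2 ^- n)) s q C delta r0 delta C 0 delta.

Let C0 : 0 <= C. Proof. exact: le_trans C1. Qed.

Let grid0 l i : 0 <= grid l i :> R.
Proof. by rewrite /grid divr_ge0// exprn_ge0. Qed.

Let mU' (t : R) : 0 <= t -> measurable_fun setT (U' t).
Proof. by move=> t0; apply: smeas_meas (aU' t0); exact: filtration_measurable. Qed.

(** Small enough that the error events at all [l * 2 ^ l + 1] grid points have total probability at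
    most [1 / N]. *)
Let dl (l N : nat) : R := (N%:R * (l * 2 ^ l).+2%:R)^-1.

Let dl0 l N : (0 < N)%N -> 0 < dl l N.
Proof. by move=> N0; rewrite invr_gt0 mulr_gt0 ?ltr0n. Qed.

Let dlN l N : (0 < N)%N -> dl l N <= 1 / N%:R.
Proof.
move=> N0; rewrite div1r lef_pV2 ?posrE ?mulr_gt0 ?ltr0n//.
by rewrite ler_peMr// ler1n.
Qed.

(** Prepares a choice of one discretization for each [l] and [N], of grid level at least [N + l];
    [N = 0] gets dummy data so that the choice is total. *)
Let exD l N : exists D : nat * (nat -> set (set (Om N))) * (nat -> Om N -> R) * (nat -> Om N -> R),
  (forall j, D.1.1.2 j `<=` measurable) /\ ((0 < N)%N -> (N + l <= D.1.1.1)%N /\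
   discretization (P N) (@U N) D.1.1.1 l D.1.1.2 D.1.2 D.2 C (C * lam N ^+ 2 + dl l N) (r N)
     (C * (1 + l%:R) / N%:R + dl l N) C (lam N * C * (1 + l%:R)) (dl l N)).
Proof.
have [N0|N0] := posnP N.
  by exists (0%N, fun=> set0, fun=> fun=> 0, fun=> fun=> 0); split => // j B; rewrite /=.
have [n [A [s [q [nl dz]]]]] := apU l N0 (N + l) (dl0 l N0).
by exists (n, A, s, q); split => // j; exact: mi_meas (dz_mi dz) j.
Qed.

Let D l N := projT1 (cid (exD l N)).
Let nn l N := (D l N).1.1.1.
Let AA l N := (D l N).1.1.2.
Let ss l N := (D l N).1.2.
Let mm l N := (2 ^ (nn l N - l))%N.
Let G N l i : Om N -> R := block (@ss l N) (i * mm l N) (i.+1 * mm l N).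

Let Am l N j : @AA l N j `<=` measurable.
Proof. by rewrite /AA /D; case: (cid _) => D' [h _] /=; exact: h. Qed.

Let nl l N : (0 < N)%N -> (N + l <= nn l N)%N.
Proof. by rewrite /nn /D; case: (cid _) => D' [_ h] /= /h[]. Qed.

Let dz l N : (0 < N)%N -> discretization (P N) (@U N) (nn l N) l (@AA l N) (@ss l N) (D l N).2
  C (C * lam N ^+ 2 + dl l N) (r N) (C * (1 + l%:R) / N%:R + dl l N) C (lam N * C * (1 + l%:R)) (dl l N).
Proof. by rewrite /nn /AA /ss /D; case: (cid _) => D' [_ h] /= /h[]. Qed.

Let tau0 n : 0 <= 2 ^- n :> R. Proof. by rewrite invr_ge0 exprn_ge0. Qed.

(** Prelimit and limit are both close to [reference_law], which is therefore the common constant.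
    The sub-block level [p] is fixed by [e], before [N] and before the discretization of the
    limit. *)
Let same_law l j : (j < l * 2 ^ l)%N ->
  same_increment P (fun N i => @G N l i) (fun N i => @AA l N (i * mm l N)%N) P'
   (fun i w => U' (grid l i.+1) w - U' (grid l i) w) (fun i => F' (grid l i)) j.
Proof.
move=> jl M f f1 f2 cf e e0; have M0 := C21_ge0 cf.
(* The error of [block_law] is at most [K * (e / 2)] as soon as [kk * sqrt t <= 1]; hence the square
   in the choice of the level. *)
pose kk := 6 * M * (4 * C ^+ 2 + 2 * C + 4) / e.
have [n [ln hn]] := dyadic_step_small (kk ^+ 2) l.
have [p np] : exists p, n = (l + p)%N by exists (n - l)%N; rewrite subnKC.
subst n.
set t : R := 2 ^- (l + p) in hn.
have t0 : 0 < t by rewrite invr_gt0 exprn_gt0.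
have small K : 0 <= K -> K * (3 * M * (4 * C ^+ 2 + 2 * C + 4) * Num.sqrt t) <= K * (e / 2).
  move=> K0; rewrite ler_wpM2l//.
  have h : kk * Num.sqrt t <= 1.
    apply: le_trans (ler_norm _) _; rewrite -(@ler_pXn2r _ 2) ?nnegrE// expr1n real_normK ?num_real//.
    by rewrite exprMn sqr_sqrtr// ltW.
  rewrite -subr_ge0 (_ : _ - _ = (e / 2) * (1 - kk * Num.sqrt t)).
    by rewrite mulr_ge0 ?divr_ge0 ?(ltW e0)// subr_ge0.
  by rewrite /kk; field; rewrite gt_eqF.
exists (reference_law r0 l p f j); split.
  have tC : 0 < t / (2 * C) by rewrite divr_gt0// mulr_gt0// (lt_le_trans _ C1).
  have t2 : 0 < t ^+ 2 / 2 by rewrite divr_gt0// exprn_gt0.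
  have [N0 hN0] := evtI (evtI (lam_cvg (ltr01 : 0 < 1 :> R)) (lam_cvg tC)) (evtI (evtI (evt_div 1 (divr_gt0 t0 (ltr0n R 2)))
    (evt_div (C * (1 + l%:R) + 1) t2)) (evtI (r_cvg (divr_gt0 t0 (ltr0n R 2))) (evt_ge (p + 1)))).
  exists N0 => N /hN0[[l1 l2] [[d1 d2] [rr pN]]] eta K seta etaK.
  have Ngt : (0 < N)%N by apply: leq_trans pN; rewrite addn1.
  have K0 : 0 <= K by exact: le_trans (etaK point).
  have dd := dlN l Ngt.
  have lpn : (l + p <= nn l N)%N.
    apply: leq_trans (nl l Ngt); rewrite addnC leq_add2r; apply: leq_trans pN; exact: leq_addr.
  have hv : C * lam N ^+ 2 + dl l N <= t.
    have : C * lam N ^+ 2 <= t / 2.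
      apply: (@le_trans _ _ (C * (t / (2 * C)))).
        rewrite ler_wpM2l// expr2; apply: le_trans l2; rewrite ler_piMl//.
      by rewrite le_eqVlt; apply/orP; left; apply/eqP; field; rewrite gt_eqF// (lt_le_trans _ C1).
    lra.
  have he : C * (1 + l%:R) / N%:R + dl l N + t / 2 * t <= t ^+ 2.
    move: d2; rewrite mulrDl mul1r; lra.
  have := block_law C1 (dz l Ngt) r00 rr lpn hv he jl cf seta etaK.
  move=> h; apply: le_trans h _; apply: le_trans (small _ K0) _.
  by rewrite ler_wpM2l//; lra.
move=> eta K seta etaK; have K0 : 0 <= K by exact: le_trans (etaK point).
(* Passing from the limit to its block sums costs [10 M delta]: [6 M delta] by continuity of [f],
   and [4 M delta] on the bad events. *)
pose delta := Num.min (Num.min (1 / 2) (t ^+ 2)) (e / (20 * (M + 1))).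
have t1 : t <= 1 by rewrite invf_le1 ?exprn_gt0// exprn_ege1// ler1n.
have M1 : 0 < 20 * (M + 1) by rewrite mulr_gt0// ltr_wpDl.
have d0 : 0 < delta by rewrite !lt_min !divr_gt0 ?exprn_gt0.
have d1 : delta <= 1 / 2 by rewrite !ge_min lexx.
have d2 : delta <= t ^+ 2 by rewrite !ge_min lexx orbT.
have d3 : delta * (20 * (M + 1)) <= e by rewrite -ler_pdivlMr// !ge_min lexx !orbT.
have [n [s [q [lpn dz']]]] := apU' l (l + p) d0.
have ln' : (l <= n)%N by apply: leq_trans lpn; exact: leq_addr.
pose m := (2 ^ (n - l))%N.
have gE i : grid l i = (i * m)%:R * 2 ^- n :> R by exact: grid_refine.
have hv : delta <= t by apply: le_trans d2 _; rewrite expr2 ler_piMl// ltW.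
have rr (x : R) : 0 <= x -> `|r0 x - r0 x| <= 0 by rewrite subrr normr0.
have he : delta + 0 * t <= t ^+ 2 by rewrite mul0r addr0.
rewrite gE in seta.
have hb := block_law C1 dz' r00 rr lpn hv he jl cf seta etaK.
rewrite -/m -/t in hb.
have mi := dz_mi dz'.
have [mf _ _ bd _] := cf.
have meta : measurable_fun setT eta by apply: smeas_meas seta; exact: (mi_meas mi (k := (j * m)%N)).
have mb i : measurable_fun setT (block s 0 (i * m)) by have [] := L4_block mi 0 (i * m).
have mb' : measurable_fun setT (block s (j * m) (j.+1 * m)) by have [] := L4_block mi (j * m) (j.+1 * m).
have mS i : measurable [set w | (0 + delta < `|U' (grid l i) w - block s 0 (i * m) w|)%R].
  by apply: measurable_set_lt => //; apply: measurableT_comp => //; apply: measurable_funB => //; exact: mU'.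
have PS i : (i <= l * 2 ^ l)%N -> (P' [set w | (0 + delta < `|U' (grid l i) w - block s 0 (i * m) w|)%R] <= delta%:E)%E.
  move=> il; rewrite gE; apply: (dz_close dz').
  have -> : (l * 2 ^ n = l * 2 ^ l * m)%N by rewrite /m -mulnA -expnD subnKC.
  by rewrite leq_mul2r il orbT.
have PB := prob_setU_le (mS j.+1) (mS j) (PS _ jl) (PS _ (ltnW jl)).
have ifg (g : Om' -> R) : measurable_fun setT g -> intg P' (fun w => eta w * f (g w)).
  move=> mg; apply: (@intg_bd _ _ _ _ _ (K * M)).
    by apply: measurable_funM => //; exact: measurableT_comp mf mg.
  by move=> w; rewrite normrM ler_pM//; have [] := bd (g w).
have cl : `|Ex P' (fun w => eta w * f (U' (grid l j.+1) w - U' (grid l j) w)) -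
    Ex P' (fun w => eta w * f (block s (j * m) (j.+1 * m) w))| <= K * (3 * M * (2 * delta)) + K * (2 * M) * (delta + delta).
  apply: (Ex_close _ _ (measurableU _ _ (mS j.+1) (mS j)) PB).
  - by rewrite !mulr_ge0// ltW.
  - by rewrite !mulr_ge0.
  - by apply: ifg; apply: measurable_funB; exact: mU'.
  - exact: ifg.
  - move=> w; rewrite -mulrBr normrM ler_pM//.
    have [bx _ _] := bd (U' (grid l j.+1) w - U' (grid l j) w).
    have [b_y _ _] := bd (block s (j * m) (j.+1 * m) w).
    apply: le_trans (ler_normB _ _) _; lra.
  move=> w /not_orP[/negP n1 /negP n2]; rewrite -mulrBr normrM ler_pM//.
  apply: (C21_dist cf); first by lra.
  move: n1 n2; rewrite -!leNgt.
  have -> : block s (j * m) (j.+1 * m) w = block s 0 (j.+1 * m) w - block s 0 (j * m) w.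
    by rewrite /block mulSnr [X in _ = X - _](@big_cat_nat _ _ _ (j * m))//= ?leq_addr// addrAC subrr add0r.
  rewrite !ler_norml => /andP[a1 a2] /andP[b1 b2]; apply/andP; split; lra.
have K10 : K * (3 * M * (2 * delta)) + K * (2 * M) * (delta + delta) <= K * (e / 2).
  rewrite [leLHS](_ : _ = K * (10 * M * delta)); last by ring.
  rewrite ler_wpM2l//; lra.
have := small K K0; move=> sm.
rewrite (_ : _ - _ = (Ex P' (fun w => eta w * f (U' (grid l j.+1) w - U' (grid l j) w)) -
    Ex P' (fun w => eta w * f (block s (j * m) (j.+1 * m) w))) + (Ex P' (fun w => eta w * f (block s (j * m) (j.+1 * m) w)) -
     reference_law r0 l p f j * Ex P' eta)); last by ring.
apply: le_trans (ler_normD _ _) _; apply: le_trans (lerD (le_trans cl K10) (le_trans hb sm)) _.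
by rewrite -mulrDr ler_wpM2l//; lra.
Qed.

Let psumG l N w i : psum (fun i => @G N l i w) i = block (@ss l N) 0 (i * mm l N) w.
Proof.
elim: i => [|i ih]; first by rewrite /psum big_ord0 mul0n block0.
have -> : psum (fun i => @G N l i w) i.+1 = psum (fun i => @G N l i w) i + @G N l i w by rewrite /psum big_ord_recr.
rewrite ih /G /block -big_cat_nat//=.
by rewrite leq_mul2r leqnSn orbT.
Qed.

Let mG l : evt (fun N => forall i, (i < l * 2 ^ l)%N -> measurable_fun setT (@G N l i)).
Proof. by exists 1%N => N N1 i _; have [] := L4_block (dz_mi (dz l N1)) (i * mm l N) (i.+1 * mm l N). Qed.

Let fdd l (phi : (nat -> R) -> R) (L M : R) : 0 <= L ->
  coord_lipschitz (l * 2 ^ l) L phi -> (forall x, `|phi x| <= M) ->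
  forall e : R, 0 < e -> evt (fun N =>
    `|Ex (P N) (fun w => phi (fun i => @G N l i w)) -
      Ex P' (fun w => phi (fun i => U' (grid l i.+1) w - U' (grid l i) w))| <= e).
Proof.
move=> L0 lphi bphi.
have gS i : grid l i <= grid l i.+1 :> R by rewrite /grid ler_wpM2r ?invr_ge0 ?exprn_ge0// ler_nat.
have gmono i j : (i <= j)%N -> grid l i <= grid l j :> R.
  by move=> ij; rewrite /grid ler_wpM2r ?invr_ge0 ?exprn_ge0// ler_nat.
have i2 i : intg P' (fun w => (U' (grid l i.+1) w - U' (grid l i) w) ^+ 2).
  apply: (intg_le (g := fun w => 2 * U' (grid l i.+1) w ^+ 2 + 2 * U' (grid l i) w ^+ 2)).
  - by apply: measurable_funX; apply: measurable_funB; exact: mU'.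
  - by apply: intgD; apply: intgZ; exact: iU'.
  move=> w; rewrite ger0_norm ?sqr_ge0//; have := sqr_ge0 (U' (grid l i.+1) w + U' (grid l i) w).
  rewrite sqrrD sqrrB; lra.
pose V := C + \sum_(i < l * 2 ^ l) Ex P' (fun w => (U' (grid l i.+1) w - U' (grid l i) w) ^+ 2).
apply: (@fdd_convergence _ _ _ _ _ (fun N i => @AA l N (i * mm l N)%N) _ _ _ _ (fun i => F' (grid l i)) _ _ _ V 1) lphi bphi => //.
- by move=> j; exact: filtration_measurable.
- move=> N i j N1 ij _; apply: (@smeas_sub _ _ _ (@AA l N (i.+1 * mm l N)%N)).
    by apply: (mi_mono (dz_mi (dz l N1))); rewrite leq_mul2r ij orbT.
  by apply: (smeas_block (dz_mi (dz l N1))); rewrite leq_mul2r leqnSn orbT.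
- move=> i j ij _; apply: measurable_funB.
    by apply: smeas_sub (aU' (grid0 l i.+1)); apply: filtration_mono => //; exact: gmono.
  by apply: smeas_sub (aU' (grid0 l i)); apply: filtration_mono => //; apply: gmono; exact: ltnW.
- move=> N j N1 jl; have mi := dz_mi (dz l N1); split; first exact: L4_intg2 (L4_block mi _ _).
  have := block_square_le mi (tau0 _) (j * mm l N) (mm l N); rewrite -mulSnr => h.
  apply: le_trans h _; rewrite /V -[leLHS]addr0; apply: lerD.
    rewrite ler_piMr//.
    have -> : 2 ^- nn l N * (mm l N)%:R = 2 ^- l :> R.
      have ln : (l <= nn l N)%N by apply: leq_trans (nl l N1); exact: leq_addl.
      by rewrite mulrC -[mm l N]mul1n -(grid_refine R 1 ln) /grid mul1r.
    by rewrite invf_le1 ?exprn_gt0// exprn_ege1// ler1n.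
  by apply: sumr_ge0 => i _; apply: Ex_ge0 => w; exact: sqr_ge0.
- move=> j jl; split => //; rewrite /V (bigD1 (Ordinal jl))//= addrCA lerDl addr_ge0//.
  by apply: sumr_ge0 => i _; apply: Ex_ge0 => w; exact: sqr_ge0.
- by move=> j jl; exact: same_law.
Qed.

(** Three distances: from [W] to [U], from [U] to its value at the last grid point (chaining), and
    from that value to the block sum (discretization, at all grid points at once). *)
Let close (e T : R) : 0 < e -> 0 <= T -> evt (fun l => evt (fun N => exists B : set (Om N),
  [/\ measurable B, (P N B <= e%:E)%E &
    forall w, ~ B w -> forall t, 0 <= t <= T ->
      `|@W N t w - stepv l (psum (fun i => @G N l i w)) t| <= e])).
Proof.
move=> e0 T0; pose H := (Num.truncn T).+1.
have TH : T <= H%:R by apply: ltW; exact: truncnS_gt.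
have [K K0 hK] := tailU H.
have e3 : 0 < e / 3 by rewrite divr_gt0.
have [q1 q2 q3 q4] : [/\ 0 <= 9 / 10 :> R, 9 / 10 < 1 :> R, 0 <= 4 / 5 :> R & 4 / 5 < 1 :> R] by split; lra.
have [l0 hl0] := evtI (evtI (expr_small 9 q1 q2 e3) (expr_small (5 * K * H%:R) q3 q4 e3)) (evt_ge H).
exists l0 => l /hl0[[s1 s2] Hl].
have lc : 0 < e / 6 / (C * (1 + l%:R)).
  by rewrite !divr_gt0// mulr_gt0 ?(lt_le_trans _ C1)// ltr_wpDr.
have [N0 hN0] := evtI (evtI (WU e3 T0) (lam_cvg lc)) (evtI (evt_div 1 (divr_gt0 e0 (ltr0n R 6))) (evt_ge 1)).
exists N0 => N /hN0[[[B1 [mB1 PB1 hB1]] l1] [d1 N1]].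
have [B2 [mB2 PB2 hB2]] := chaining K0 (fun w => @cU N w N1) (fun t => @mU N t N1) (fun k i c => hK N k i c N1) l ltr01.
have dd := dlN l N1.
have lnn : (l <= nn l N)%N by apply: leq_trans (nl l N1); exact: leq_addl.
have gE i : grid l i = (i * mm l N)%:R * 2 ^- nn l N :> R by exact: grid_refine.
pose S i := [set w | (lam N * C * (1 + l%:R) + dl l N < `|@U N (grid l i) w - block (@ss l N) 0 (i * mm l N) w|)%R].
have mS i : measurable (S i).
  apply: measurable_set_lt => //; apply: measurableT_comp => //; apply: measurable_funB.
    exact: mU.
  by have [] := L4_block (dz_mi (dz l N1)) 0 (i * mm l N).
have PS i : (i < (l * 2 ^ l).+1)%N -> (P N (S i) <= (dl l N)%:E)%E.
  rewrite ltnS => il; rewrite /S gE; apply: (dz_close (dz l N1)).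
  have -> : (l * 2 ^ nn l N = l * 2 ^ l * mm l N)%N by rewrite /mm -mulnA -expnD subnKC.
  by rewrite leq_mul2r il orbT.
have PS' : (P N (\bigcup_(i < (l * 2 ^ l).+1) S i) <= (e / 3)%:E)%E.
  apply: prob_bigcup_lt PS _ => //.
  apply: (@le_trans _ _ (1 / N%:R)); last by lra.
  rewrite /dl invfM mulrCA mulrC ler_wpM2r ?invr_ge0//.
  by rewrite ler_pdivrMr ?ltr0n// mul1r ler_nat.
have mS' : measurable (\bigcup_(i < (l * 2 ^ l).+1) S i) by apply: bigcup_measurable.
exists (B1 `|` (B2 `|` \bigcup_(i < (l * 2 ^ l).+1) S i)); split.
- by apply: measurableU => //; exact: measurableU.
- have := prob_setU_le mB1 (measurableU _ _ mB2 mS') PB1 (prob_setU_le mB2 mS' PB2 PS').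
  move=> h; apply: le_trans h _; rewrite lee_fin expr1n divr1; lra.
move=> w /not_orP[n1 /not_orP[n2 n3]] t /andP[t0 tT].
have [_ /(_ t t0 (le_trans tT TH))] := hB2 w n2; rewrite mulr1 => h2.
have h1 : `|@W N t w - @U N t w| <= e / 3 by apply: hB1 => //; rewrite t0.
have tl : (Num.truncn (t * 2 ^+ l) <= l * 2 ^ l)%N.
  have /andP[g1 _] := grid_trunc l t0; rewrite /grid ler_pdivrMr ?exprn_gt0// in g1.
  rewrite -(ler_nat R) natrM natrX; apply: le_trans g1 _; rewrite ler_wpM2r ?exprn_ge0//.
  by apply: le_trans tT (le_trans TH _); rewrite ler_nat.
rewrite /stepv (minn_idPl tl) psumG; set i := Num.truncn _ in h2 tl *.
have : ~ S i w by move=> Si; apply: n3; exists i.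
move/negP; rewrite -leNgt => h3.
have b1 : lam N * C * (1 + l%:R) <= e / 6.
  rewrite -mulrA -ler_pdivlMr// mulr_gt0 ?(lt_le_trans _ C1)// ltr_wpDr//.
rewrite (_ : _ - _ = (@W N t w - @U N t w) + ((@U N t w - @U N (grid l i) w) + (@U N (grid l i) w - block (@ss l N) 0 (i * mm l N) w))); last by ring.
apply: le_trans (ler_normD _ _) _; apply: le_trans (lerD (lexx _) (ler_normD _ _)) _; lra.
Qed.

Theorem path_convergence (Th : (R -> R) -> R) (K : R) : (forall x, cpath x -> `|Th x| <= K) -> uccont Th ->
  forall e : R, 0 < e -> evt (fun N =>
    `|Ex (P N) (fun w => Th (fun t => @W N t w)) - Ex P' (fun w => Th (fun t => U' t w))| <= e).
Proof.
move=> ThK uTh e e0.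
have mGl l : exists N1 : nat, forall N i, (N1 <= N)%N -> (i < l * 2 ^ l)%N -> measurable_fun setT (@G N l i).
  by have [N1 h] := mG l; exists N1 => N i /h; exact.
have NThK x : cpath x -> `|- Th x| <= K by rewrite normrN; exact: ThK.
have uNTh : uccont (fun x => - Th x).
  move=> x cx d d0; have [T [r1 [T0 r10 h]]] := uTh x cx d d0.
  by exists T, r1; split => // y cy xy; 
  rewrite (_ : _ - _ = - (Th x - Th y)); [rewrite normrN; exact: h|by ring].
have [N1 h1] := weak_lower ThK uTh cW mW cU' mU' U'0 mGl fdd close e0.
have [N2 h2] := weak_lower NThK uNTh cW mW cU' mU' U'0 mGl fdd close e0.
exists (maxn 1 (maxn N1 N2)) => N; rewrite !geq_max => /and3P[N0 /h1 a /h2].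
have [_ iN _] := Ex_infc_cvg ThK uTh (P N) (fun w => @cW N w N0) (fun t => @mW N t N0).
have [_ i' _] := Ex_infc_cvg ThK uTh P' cU' mU'.
rewrite !ExN// => b; rewrite ler_norml; apply/andP; split; lra.
Qed.

End PathConvergence.

(** * The Volterra equation *)

Section VolterraPaths.
Context {R : realType}.
Implicit Types (x y u v : R -> R).

Lemma cpath_continuous_bmeas T (f : R -> R) : continuous f -> bmeas T f.
Proof.
move=> cf; split; first exact: continuous_measurable_fun.
have cp : cpath f by exact: (@continuous_cpath _ f).
have [mf [K hK]] := cpath_bmeas T cp; exists K => s /andP[s0 sT].
by have := hK s; rewrite (max_idPl s0) s0 sT; exact.
Qed.

(** Extended linearly to negative times with slope [x 0], so that it has a derivative at every real
    time, 0 included, as [FTC_Rintegral] asks. *)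
Definition primitive x (t : R) : R :=
  if 0 <= t then tint 0 t (fun s => x (Num.max s 0)) else x 0 * t.

Lemma primitive_dist x (a b k e : R) : cpath x -> a <= b ->
  (forall s, a <= s <= b -> `|x (Num.max s 0) - k| <= e) ->
  `|primitive x b - primitive x a - k * (b - a)| <= e * (b - a).
Proof.
move=> cx; pose f (s : R) : R := x (Num.max s 0).
have pos (c d : R) : 0 <= c -> c <= d -> (forall s, c <= s <= d -> `|f s - k| <= e) ->
    `|primitive x d - primitive x c - k * (d - c)| <= e * (d - c).
  move=> c0 cd h; have bf := cpath_bmeas d cx; have d0 := le_trans c0 cd.
  have ts := @tint_split _ d 0 c d f bf (lexx 0) c0 cd (lexx d).
  rewrite /primitive c0 d0 -/f ts (addrAC _ _ (- tint 0 c f)) subrr add0r -(tint_cst k cd).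
  rewrite -(tintB c0 (lexx d) bf (bmeas_cst d k)).
  by apply: (tint_bound c0 cd (lexx d)) => //; apply: bmeasB => //; exact: bmeas_cst.
have neg (c d : R) : d <= 0 -> c <= d -> (forall s, c <= s <= d -> `|f s - k| <= e) ->
    `|x 0 * d - x 0 * c - k * (d - c)| <= e * (d - c).
  move=> d0 cd h; rewrite -mulrBr -mulrBl normrM (ger0_norm (_ : 0 <= d - c)) ?subr_ge0//.
  rewrite ler_wpM2r ?subr_ge0//; have := h d; rewrite cd lexx /f => /(_ isT).
  by rewrite (max_idPr d0).
have pr0 : primitive x 0 = 0 by rewrite /primitive lexx tint_point.
have prneg c : c <= 0 -> primitive x c = x 0 * c.
  rewrite le_eqVlt => /orP[/eqP ->|c0]; first by rewrite pr0 mulr0.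
  by rewrite /primitive leNgt c0.
move=> ab h; have [a0|/ltW a0] := leP 0 a; first exact: pos.
have [b0|/ltW b0] := leP 0 b; last by rewrite !prneg//; exact: neg.
have h1 := pos 0 b (lexx 0) b0 (fun s => _).
have {h1} := h1 _; rewrite pr0 !subr0 => h1.
have h2 := neg a 0 (lexx 0) a0 (fun s => _).
have {h2} := h2 _; rewrite mulr0 !sub0r => h2.
rewrite (prneg a)//.
rewrite (_ : _ - _ = (primitive x b - k * b) + (- (x 0 * a) - k * - a)); last by ring.
apply: le_trans (ler_normD _ _) _.
rewrite (_ : e * (b - a) = e * b + e * - a); last by ring.
apply: lerD; [apply: h1|apply: h2] => s /andP[s1 s2]; apply: h; apply/andP; split => //.
  exact: le_trans s1.
exact: le_trans b0.
Qed.

Lemma primitive_is_derive x (t : R) : cpath x -> is_derive t (1 : R) (primitive x) (x (Num.max t 0)).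
Proof.
move=> cx; have cf := cpath_ext cx.
have h : (h^-1 *: ((primitive x \o shift t) (h *: (1 : R)) - primitive x t)) @[h --> (0 : R)^'] --> x (Num.max t 0).
  apply/cvgrPdist_le => e e0.
  have /cvgrPdist_le/(_ _ e0)/nbhs_ballP[r /= r0 hr] := cf t.
  have {}hr s : `|t - s| < r -> `|x (Num.max s 0) - x (Num.max t 0)| <= e by move=> h; rewrite distrC; exact: (hr s h).
  apply/nbhs_ballP; exists r => //= s; rewrite /ball/= sub0r normrN => sr sn0.
  rewrite [s *: _]mulr1 [_ *: _]mulrC.
  rewrite (_ : _ - _ = - ((primitive x (s + t) - primitive x t - x (Num.max t 0) * s) / s)); last by field.
  rewrite normrN normrM normfV ler_pdivrMr ?normr_gt0//.
  have [s0|s0] := leP 0 s.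
    have := @primitive_dist x t (s + t) (x (Num.max t 0)) e cx; rewrite addrK (ger0_norm s0); apply.
      by rewrite lerDr.
    move=> z /andP[z1 z2]; apply: hr; rewrite distrC ger0_norm ?subr_ge0//.
    by rewrite (ger0_norm s0) in sr; lra.
  have := @primitive_dist x (s + t) t (x (Num.max t 0)) e cx.
  rewrite (ltr0_norm s0) (_ : t - (s + t) = - s); last by ring.
  rewrite (_ : primitive x (s + t) - primitive x t - x (Num.max t 0) * s =
    - (primitive x t - primitive x (s + t) - x (Num.max t 0) * - s)); last by ring.
  rewrite normrN; apply; first by rewrite gerDr ltW.
  move=> z /andP[z1 z2]; apply: hr; rewrite ger0_norm ?subr_ge0//.
  by rewrite (ltr0_norm s0) in sr; lra.
by apply: DeriveDef; [exact: cvgP h|exact: cvg_lim h].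
Qed.

(* In the norm weighted by exp(-2 k t) the integral operator has norm at most 1/2,
   whence the constant 2. *)
Lemma gronwall T a k y : 0 <= T -> 0 <= a -> 0 < k -> cpath y ->
  (forall t, 0 <= t <= T -> `|y t| <= a + k * tint 0 t (fun s => `|y (Num.max s 0)|)) ->
  forall t, 0 <= t <= T -> `|y t| <= 2 * a * expR (2 * k * t).
Proof.
move=> T0 a0 k0 cy h.
have by_ := cpath_bmeas T cy; have bay := bmeas_abs by_.
have [_ [K hK]] := by_.
pose S := [set `|y t| * expR (- (2 * k * t)) | t in `[0, T]%classic].
have e1 t : 0 <= t -> expR (- (2 * k * t)) <= 1.
  by move=> t0; rewrite -expR0 ler_expR oppr_le0 !mulr_ge0// ltW.
have hS : has_sup S.
  split; first by exists (`|y 0| * expR (- (2 * k * 0))), 0 => //=; rewrite in_itv/= lexx.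
  exists K => _ [t /= + <-]; rewrite in_itv/= => /andP[t0 tT].
  have := hK t; rewrite (max_idPl t0) t0 tT => /(_ isT) yK.
  by apply: le_trans yK; rewrite ler_piMr// e1.
pose m := sup S.
have ym t : 0 <= t <= T -> `|y t| <= m * expR (2 * k * t).
  move=> tT; have : `|y t| * expR (- (2 * k * t)) <= m.
    by apply: ub_le_sup; [case: hS|exists t => //=; rewrite in_itv].
  by rewrite expRN ler_pdivrMr ?expR_gt0.
have ce : continuous (fun s : R => m * expR (2 * k * s)).
  move=> s; apply: cvgM; first exact: cvg_cst.
  by apply: continuous_comp; [apply: cvgM => //; exact: cvg_cst|exact: continuous_expR].
have de (s : R) : is_derive s (1 : R) (fun s => m / (2 * k) * expR (2 * k * s)) (m * expR (2 * k * s)).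
  apply: is_derive_eq; rewrite /GRing.scale/=; field; rewrite gt_eqF//.
have bnd t : 0 <= t <= T -> `|y t| <= a + m / 2 * (expR (2 * k * t) - 1).
  move=> tT; have /andP[t0 tT'] := tT; apply: le_trans (h t tT) _; rewrite lerD2l.
  have -> : m / 2 * (expR (2 * k * t) - 1) = k * tint 0 t (fun s => m * expR (2 * k * s)).
    rewrite /tint (FTC_Rintegral t0 de ce) mulr0 expR0; by field; rewrite gt_eqF.
  rewrite ler_wpM2l ?(ltW k0)//; apply: (tint_le (lexx 0) tT' bay (cpath_continuous_bmeas T ce)).
  move=> s /andP[s0 st]; rewrite (max_idPl s0); apply: ym; rewrite s0; exact: le_trans st tT'.
have m0 : 0 <= m.
  apply: le_trans (_ : `|y 0| * expR (- (2 * k * 0)) <= _); first by rewrite mulr_ge0 ?expR_ge0.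
  by apply: ub_le_sup; [case: hS|exists 0 => //=; rewrite in_itv/= lexx].
have ma : m <= a + m / 2.
  apply: ge_sup; first by case: hS.
  move=> _ [t /= + <-]; rewrite in_itv/= => /andP[t0 tT].
  have tT' : 0 <= t <= T by rewrite t0.
  have E0 : 0 < expR (- (2 * k * t)) := expR_gt0 _.
  apply: le_trans (ler_wpM2r (ltW E0) (bnd t tT')) _.
  rewrite [leLHS](_ : _ = a * expR (- (2 * k * t)) + m / 2 * (expR (2 * k * t) * expR (- (2 * k * t)) - expR (- (2 * k * t)))); last by ring.
  rewrite -expRD subrr expR0; apply: lerD; first by rewrite ler_piMr// e1.
  by rewrite ler_piMr ?divr_ge0// gerBl ltW.
move=> t tT; apply: le_trans (ym t tT) _; rewrite ler_wpM2r ?expR_ge0//; lra.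
Qed.

Section Inverse.
Variable (g : R).
Hypothesis g0 : 0 < g.

Definition volterra y (t : R) : R := y t + g * tint 0 t (fun s => y (Num.max s 0)).
(* Variation of constants: the inverse of volterra on continuous paths. *)
Definition volterra_inv u (t : R) : R :=
  u t - g * (expR (- g * t) * primitive (fun s => expR (g * s) * u s) t).

Lemma cpath_exp u : cpath u -> cpath (fun s => expR (g * s) * u s).
Proof.
move=> cu; apply: (@continuous_cpath _ (fun s => expR (g * Num.max s 0) * u (Num.max s 0))).
  move=> s; apply: cvgM; last exact: cpath_ext.
  have ce : cpath (fun s => expR (g * s)).
    apply: (@continuous_cpath _ (fun s => expR (g * s))) => // z.
    by apply: continuous_comp; [apply: cvgM => //; exact: cvg_cst|exact: continuous_expR].
  exact: cpath_ext ce s.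
by move=> t t0; rewrite (max_idPl t0).
Qed.

Let pr_der u (s : R) : cpath u ->
  is_derive s (1 : R) (fun s => expR (- g * s) * primitive (fun s => expR (g * s) * u s) s)
   (expR (- g * s) * (expR (g * Num.max s 0) * u (Num.max s 0)) +
    - g * expR (- g * s) * primitive (fun s => expR (g * s) * u s) s).
Proof.
move=> cu; have dp := primitive_is_derive s (cpath_exp cu).
by apply: is_derive_eq; rewrite /GRing.scale/=; ring.
Qed.

Lemma cpath_volterra_inv u : cpath u -> cpath (volterra_inv u).
Proof.
move=> cu; apply: (@continuous_cpath _ (fun t => u (Num.max t 0) -
   g * (expR (- g * t) * primitive (fun s => expR (g * s) * u s) t))).
  move=> t; apply: cvgB; first exact: cpath_ext.
  apply: cvgM; first exact: cvg_cst.
  by apply: is_derive_continuous t => s; exact: pr_der.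
by move=> t t0; rewrite /volterra_inv (max_idPl t0).
Qed.

(** [Z t], the primitive multiplied by [exp (- g t)], satisfies [Z' = u - g Z] and [Z 0 = 0], and
    [u - g Z] is [volterra_inv u]; so [Z] is the integral of [volterra_inv u]. *)
Lemma volterra_invK u (t : R) : cpath u -> 0 <= t -> volterra (volterra_inv u) t = u t.
Proof.
move=> cu t0; rewrite /volterra.
pose Z (s : R) := expR (- g * s) * primitive (fun s => expR (g * s) * u s) s.
have pE (s : R) : s <= 0 -> primitive (fun s => expR (g * s) * u s) s = u 0 * s.
  rewrite /primitive mulr0 expR0 mul1r; rewrite le_eqVlt => /orP[/eqP ->|s0].
    by rewrite lexx tint_point mulr0.
  by rewrite leNgt s0.
have -> : tint 0 t (fun s => volterra_inv u (Num.max s 0)) = Z t.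
  pose z (s : R) := (expR (- g * s) * (expR (g * Num.max s 0) * u (Num.max s 0)) +
    - g * expR (- g * s) * primitive (fun s => expR (g * s) * u s) s).
  have dz (s : R) : is_derive s (1 : R) Z (z s) by exact: pr_der.
  have cz : continuous z.
    move=> s; apply: cvgD.
      apply: cvgM; first by apply: continuous_comp; [apply: cvgM => //; exact: cvg_cst|exact: continuous_expR].
      have := cpath_ext (cpath_exp cu); exact.
    have -> : (fun s => - g * expR (- g * s) * primitive (fun s => expR (g * s) * u s) s) = (fun s => - g * Z s).
      by apply/funext => r; rewrite /Z mulrA.
    by rewrite -mulrA -/(Z s); apply: cvgM; [exact: cvg_cst|exact: (is_derive_continuous dz)].
  transitivity (tint 0 t z).
    apply: tint_eq => s /andP[s0 st]; rewrite /volterra_inv /z (max_idPl s0).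
    have -> : expR (- g * s) * (expR (g * s) * u s) = u s by rewrite mulrA -expRD mulNr addNr expR0 mul1r.
    ring.
  by rewrite /tint (FTC_Rintegral t0 dz cz) /Z (pE 0)// !mulr0 subr0.
by rewrite /volterra_inv /Z subrK.
Qed.

(** Gronwall for the difference of the two paths. It yields both the injectivity of [volterra] (with
    [e = 0]) and the continuity of its inverse. *)
Lemma volterra_dist T y z e : 0 <= T -> 0 <= e -> cpath y -> cpath z ->
  (forall t, 0 <= t <= T -> `|volterra y t - volterra z t| <= e) ->
  forall t, 0 <= t <= T -> `|y t - z t| <= 2 * e * expR (2 * g * T).
Proof.
move=> T0 e0 cy cz h t tT.
have cyz : cpath (fun t => y t - z t).
  apply: (@continuous_cpath _ (fun t => y (Num.max t 0) - z (Num.max t 0))).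
    by move=> s; apply: cvgB; exact: cpath_ext.
  by move=> s s0; rewrite (max_idPl s0).
have hh s : 0 <= s <= T -> `|y s - z s| <= e + g * tint 0 s (fun r => `|y (Num.max r 0) - z (Num.max r 0)|).
  move=> sT; have /andP[s0 sT'] := sT.
  have b1 := cpath_bmeas T cy; have b2 := cpath_bmeas T cz.
  have := h s sT; rewrite /volterra => h1.
  have h2 := tint_norm (lexx 0) sT' (bmeasB b1 b2); rewrite (tintB (lexx 0) sT' b1 b2) in h2.
  rewrite (_ : y s - z s = (y s + g * tint 0 s (fun s => y (Num.max s 0)) - (z s + g * tint 0 s (fun s => z (Num.max s 0)))) -
     g * (tint 0 s (fun s => y (Num.max s 0)) - tint 0 s (fun s => z (Num.max s 0)))); last by ring.
  apply: le_trans (ler_normB _ _) (lerD h1 _); by rewrite normrM (gtr0_norm g0) ler_wpM2l// ltW.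
apply: le_trans (gronwall T0 e0 g0 cyz hh tT) _.
have /andP[t0 tT'] := tT.
by rewrite ler_wpM2l ?mulr_ge0// ler_expR ler_wpM2l// mulr_ge0// ltW.
Qed.

Lemma volterraK y (t : R) : cpath y -> cpath (volterra y) -> 0 <= t -> volterra_inv (volterra y) t = y t.
Proof.
move=> cy cv t0; apply/eqP; rewrite -subr_eq0 -normr_le0.
have h s : 0 <= s <= t -> `|volterra (volterra_inv (volterra y)) s - volterra y s| <= 0.
  by move=> /andP[s0 _]; rewrite volterra_invK// subrr normr0.
have := volterra_dist t0 (lexx 0) (cpath_volterra_inv cv) cy h (_ : 0 <= t <= t).
by rewrite t0 lexx mulr0 mul0r; exact.
Qed.

Lemma cpath_tint (f : R -> R) : (forall T, bmeas T f) -> cpath (fun t => tint 0 t f).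
Proof.
move=> bf; apply/cpathP => t t0 e e0.
have [mf [K hK]] := bf (t + 1).
have K0 : 0 <= K by apply: le_trans (hK 0 _) => //; rewrite lexx addr_ge0.
exists (Num.min 1 (e / (K + 1))); first by rewrite lt_min ltr01 divr_gt0// ltr_wpDl.
move=> s s0; rewrite lt_min => /andP[s1 s2].
have st1 : s <= t + 1 by move: s1; rewrite ltr_norml; lra.
have tt1 : t <= t + 1 by lra.
have key (a b : R) : 0 <= a -> a <= b -> b <= t + 1 -> `|tint 0 b f - tint 0 a f| <= K * (b - a).
  move=> a0 ab bt; rewrite (@tint_split _ (t + 1) 0 a b f (bf _))// addrAC subrr add0r.
  apply: (tint_bound a0 ab bt (bf _)) => r /andP[r1 r2]; apply: hK.
  by rewrite (le_trans a0 r1) (le_trans r2 bt).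
have fin (d : R) : 0 <= d -> d < e / (K + 1) -> K * d <= e.
  move=> d0; rewrite ltr_pdivlMr ?ltr_wpDl// => /ltW; apply: le_trans.
  by rewrite mulrDr mulr1 mulrC lerDl.
have [ts|st] := leP t s.
  apply: le_trans (key t s t0 ts st1) _; apply: fin; first by rewrite subr_ge0.
  by rewrite ger0_norm ?subr_ge0 in s2.
rewrite distrC; apply: le_trans (key s t s0 (ltW st) tt1) _; apply: fin; first by rewrite subr_ge0 ltW.
by rewrite distrC ger0_norm ?subr_ge0 ?(ltW st) in s2.
Qed.

Lemma cpathD x y : cpath x -> cpath y -> cpath (fun t => x t + y t).
Proof.
move=> cx cy; apply: (@continuous_cpath _ (fun t => x (Num.max t 0) + y (Num.max t 0))).
  by move=> s; apply: cvgD; exact: cpath_ext.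
by move=> s s0; rewrite (max_idPl s0).
Qed.

Lemma cpathZ (k : R) x : cpath x -> cpath (fun t => k * x t).
Proof.
move=> cx; apply: (@continuous_cpath _ (fun t => k * x (Num.max t 0))).
  by move=> s; apply: cvgM; [exact: cvg_cst|exact: cpath_ext].
by move=> s s0; rewrite (max_idPl s0).
Qed.

Lemma cpath_volterra y : cpath y -> cpath (volterra y).
Proof.
by move=> cy; apply: cpathD => //; apply: cpathZ; apply: cpath_tint => T; exact: cpath_bmeas.
Qed.

Lemma uccont_volterra_inv Th : uccont Th -> uccont (fun u => Th (volterra_inv u)).
Proof.
move=> uTh u cu e e0; have [T [r [T0 r0 h]]] := uTh _ (cpath_volterra_inv cu) e e0.
exists T, (r / (2 * expR (2 * g * T))); split => //; first by rewrite divr_gt0// mulr_gt0// expR_gt0.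
move=> v cv uv; apply: h (cpath_volterra_inv cv) _ => t tT.
apply: le_trans (volterra_dist (e := r / (2 * expR (2 * g * T))) T0 _ (cpath_volterra_inv cu) (cpath_volterra_inv cv) _ tT) _.
- by rewrite ltW// divr_gt0// mulr_gt0// expR_gt0.
- by move=> s sT; have /andP[s0 _] := sT; rewrite !volterra_invK//; exact: uv.
by rewrite le_eqVlt; apply/orP; left; apply/eqP; field; rewrite gt_eqF// expR_gt0.
Qed.

End Inverse.

(** These functionals do not see negative times; [volterra_inv] recovers a path for [t >= 0]
    only. *)
Lemma uccont_ext Th x y : uccont Th -> cpath x -> cpath y -> (forall t : R, 0 <= t -> x t = y t) -> Th x = Th y.
Proof.
move=> uTh cx cy xy; apply/eqP; rewrite -subr_eq0 -normr_le0; apply/ler_addgt0Pr => e e0.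
have [T [r [T0 r0 h]]] := uTh x cx e e0; rewrite add0r; apply: h => // t /andP[t0 _].
by rewrite xy// subrr normr0 ltW.
Qed.

End VolterraPaths.

(** * Scaled models *)

Lemma discretization_weaken {d} {T : measurableType d} {R : realType} (P : probability T R) (U : R -> T -> R)
    (n H : nat) A s q (C v e L b C' v' e' L' b' delta : R) (r : R -> R) :
  C <= C' -> v <= v' -> e <= e' -> L <= L' -> b <= b' ->
  (forall t : R, 0 <= t -> measurable_fun setT (U t)) ->
  discretization P U n H A s q C v r e L b delta -> discretization P U n H A s q C' v' r e' L' b' delta.
Proof.
move=> hC hv he hL hb mU [mi hr hc].
have t0 : 0 <= 2 ^- n :> R by rewrite invr_ge0 exprn_ge0.
split; first exact: mi_weaken mi.
  move=> a m eta K am se eK; have K0 : 0 <= K by exact: le_trans (eK point).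
  by apply: le_trans (hr a m eta K am se eK) _; rewrite ler_wpM2l// lerD// ler_wpM2r ?sqr_ge0.
move=> i iH; have mS (c : R) : measurable [set w | (c < `|U (i%:R * 2 ^- n) w - block s 0 i w|)%R].
  apply: measurable_set_lt => //; apply: measurableT_comp => //; apply: measurable_funB.
    by apply: mU; rewrite mulr_ge0.
  by have [] := L4_block mi 0 i.
apply: prob_le (mS _) (mS _) _ (hc i iH) => w /=; apply: le_lt_trans.
by rewrite lerD2r.
Qed.

(** * Estimates for one model with constants uniform in the speed *)

Section SingleModel.
Context {R : realType} {d : nat} {dO : measure_display} {Om : measurableType dO}.
Variables (P : probability Om R) (F : R -> set (set Om)) (B : R -> Om -> R) (X : R -> Om -> 'I_d).
Variables (Q : 'M[R]_d) (p p0 : 'cV[R]_d) (nu : R).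
Hypotheses (gQ : is_generator Q) (up : unique_invariant_distribution Q p).
Hypothesis fF : filtration F.
Hypothesis bB : brownian_motion P F B.
Hypothesis nu1 : 1 <= nu.
Hypothesis cX : markov_chain P (nu *: Q) p0 X.
Hypothesis aX : adapted setT F X.
Hypothesis iXB : independent_processes P setT X borelR B.
Variables (f : R -> 'I_d -> R) (u : 'I_d -> R) (Fb Lf : R).
Hypotheses (Fb0 : 0 <= Fb) (Lf0 : 0 <= Lf).
Hypothesis fB : forall (t : R) i, 0 <= t -> `|f t i| <= Fb.
Hypothesis fL : forall (s t : R) i, 0 <= s -> 0 <= t -> `|f t i - f s i| <= Lf * `|t - s|.
Variables (lam kap0 q : R) (J U : R -> Om -> R).
Hypothesis lam0 : 0 <= lam.
Hypothesis lam1 : lam ^+ 2 * nu <= 1.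
Hypothesis kap1 : (kap0 * q) ^+ 2 <= 1.
Hypothesis hJ : forall t : R, 0 <= t -> ito_integral P F B (fun t w => q * u (X t w)) t (J t).
Hypothesis mU : forall t : R, 0 <= t -> measurable_fun setT (U t).
Hypothesis hU : forall t : R, 0 <= t -> {ae P, forall w,
  U t w = lam * nu * tint 0 t (fun s => f s (X s w) - pav p (f s)) + kap0 * J t w}.

Let nu0 : 0 < nu. Proof. exact: lt_le_trans nu1. Qed.

Lemma model_const_ge1 F' L' : 0 <= F' -> 0 <= L' -> 1 <= model_const Q p u F' L'.
Proof.
move=> F'0 L'0; rewrite /model_const.
have G0 : 0 <= cG Q p F' by exact: cG_ge0.
have V0 : 0 <= cV Q p F' by exact: cV_ge0.
have D0 := mxnorm1_ge0 (deviation_matrix Q p).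
have LV0 : 0 <= lV Q p F' L' by exact: lV_ge0.
have LG0 : 0 <= lG Q p L' by exact: lG_ge0.
have cu0 : 0 <= cU u by exact: cU_ge0.
by rewrite -!addrA lerDl; nneg.
Qed.

(** The factor 2 bounds [lam ^+ 2 * nu + (kap0 * q) ^+ 2], both summands being at most 1. *)
Definition approx_const : R := 2 * model_const Q p u Fb Lf.
Local Notation C := approx_const.

Lemma approx_const_ge1 : 1 <= C.
Proof. by have := model_const_ge1 Fb0 Lf0; rewrite /C; lra. Qed.

Let model_const_le : model_const Q p u Fb Lf <= C.
Proof. by have := model_const_ge1 Fb0 Lf0; rewrite /C; lra. Qed.

Lemma model_approximable (H : nat) :
  approximable P U H C (C * lam ^+ 2) (mean_rate Q p f u (lam ^+ 2 * nu) ((kap0 * q) ^+ 2))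
    (C * (1 + H%:R) / nu) C (lam * C * (1 + H%:R)).
Proof.
move=> n0 delta d0; have m1 := model_const_ge1 Fb0 Lf0.
have [n [A [s [q' [nn dz]]]]] := model_approximation gQ up fF bB nu0 cX aX iXB Fb0 Lf0 fB fL lam0 hJ mU hU H n0 d0.
set rho := lam ^+ 2 * nu + (kap0 * q) ^+ 2 in dz.
have r2 : model_const Q p u Fb Lf * rho <= C.
  rewrite mulrC; apply: ler_wpM2r; first exact: le_trans ler01 m1.
  exact: lerD.
have H0 : 0 <= 1 + H%:R :> R by rewrite addr_ge0.
exists n, A, s, q'; split => //; apply: discretization_weaken dz => //.
- by rewrite lerD2r mulrAC ler_wpM2r// sqr_ge0.
- by rewrite lerD2r ler_wpM2r ?invr_ge0 ?(ltW nu0)// ler_wpM2r.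
- apply: ler_wpM2r => //; apply: ler_wpM2l => //; exact: model_const_le.
Qed.

Let mJ (s : R) : 0 <= s -> measurable_fun setT (fun w => kap0 * J s w).
Proof. by move=> s0; apply: measurable_funM => //; have [] := hJ s0. Qed.

(** The same approximation with [lam = 0]: the Ito part alone, free of boundary errors, for
    intervals too short for the Poisson equation to help. *)
Lemma noise_approximable (H : nat) :
  approximable P (fun s w => kap0 * J s w) H C 0 (mean_rate Q p f u (0 ^+ 2 * nu) ((kap0 * q) ^+ 2))
    (C * (1 + H%:R) / nu) C 0.
Proof.
have hU0 (s : R) : 0 <= s -> {ae P, forall w, kap0 * J s w = 0 * nu * tint 0 s (fun s => f s (X s w) - pav p (f s)) + kap0 * J s w}.
  by move=> s0; apply: aeW => w; rewrite !mul0r add0r.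
move=> n0 delta d0; have m1 := model_const_ge1 Fb0 Lf0.
have [n [A [s [q' [nn dz]]]]] := model_approximation gQ up fF bB nu0 cX aX iXB Fb0 Lf0 fB fL (lexx 0) hJ mJ hU0 H n0 d0.
set rho := 0 ^+ 2 * nu + (kap0 * q) ^+ 2 in dz.
have rE : rho = (kap0 * q) ^+ 2 by rewrite /rho expr2 !mul0r add0r.
have r2 : model_const Q p u Fb Lf * rho <= C.
  rewrite mulrC; apply: ler_wpM2r; first exact: le_trans ler01 m1.
  by rewrite rE (le_trans kap1)// ler1n.
have H0 : 0 <= 1 + H%:R :> R by rewrite addr_ge0.
exists n, A, s, q'; split => //; apply: discretization_weaken dz => //.
- by rewrite lerD2r expr2 mulr0 mulr0 mul0r.
- by rewrite lerD2r ler_wpM2r ?invr_ge0 ?(ltW nu0)// ler_wpM2r.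
- by rewrite !mul0r.
Qed.

(** For thresholds [c < b] the claimed bound exceeds 1, so it holds trivially. *)
Let small_case (c b K t : R) (G : set Om) : measurable G -> 0 < c -> c < b -> 0 <= t -> b ^+ 4 <= K * t ^+ 2 ->
  (P G <= (K * t ^+ 2 / c ^+ 4)%:E)%E.
Proof.
move=> mG c0 cb t0 bK; apply: (@le_trans _ _ 1%E); first exact: probability_le1.
rewrite lee_fin ler_pdivlMr ?exprn_gt0// mul1r; apply: le_trans bK.
by rewrite lerXn2r ?nnegrE ?(ltW c0)// ltW// (lt_trans c0).
Qed.

Lemma pow4_le (x y t : R) : 0 <= t -> 0 <= x -> x ^+ 2 <= t -> (y * x) ^+ 4 <= y ^+ 4 * t ^+ 2.
Proof.
move=> t0 x0 xt; rewrite exprMn (_ : 4 = 2 * 2)%N// !exprM ler_wpM2l ?sqr_ge0//.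
by rewrite lerXn2r ?nnegrE ?sqr_ge0.
Qed.

(** [1024 = 64 * 16] comes from the noise at the halved threshold and covers the coefficient 64 of
    long intervals as well; [48 * C] comes from their fourth moments; the two fourth powers come
    from the thresholds below which the bound is trivial. *)
Definition tail_const (H : nat) : R := 1024 * C ^+ 2 + 48 * C + (8 * (C * (1 + H%:R))) ^+ 4 + (4 * Fb) ^+ 4.

Lemma tail_const_ge0 H : 0 <= tail_const H.
Proof.
have C1 := approx_const_ge1; have C0 := le_trans ler01 C1.
have p4 (x : R) : 0 <= x ^+ 4 by rewrite (_ : 4 = 2 * 2)%N// exprM sqr_ge0.
rewrite /tail_const; move: approx_const C1 C0 => C C1 C0.
apply: addr_ge0; last exact: p4.
apply: addr_ge0; last exact: p4.
apply: addr_ge0; apply: mulr_ge0; [exact: ler0n|exact: sqr_ge0|exact: ler0n|exact: C0].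
Qed.

(* Over intervals longer than 1 / nu the martingale approximation bounds the fourth
   moment; over shorter ones the drift integral is bounded deterministically. *)
Lemma model_tail (H k i : nat) (c : R) : (i < H * 2 ^ k)%N -> 0 < c ->
  (P [set w | (c <= `|U (grid k i.+1) w - U (grid k i) w|)%R] <= (tail_const H * 4 ^- k / c ^+ 4)%:E)%E.
Proof.
move=> iH c0; have ap1 := model_approximable H; have ap := noise_approximable H.
have := approx_const_ge1; rewrite /tail_const.
move: approx_const ap1 ap => C ap1 ap C1; have C0 := le_trans ler01 C1.
pose t : R := 2 ^- k; have t0 : 0 < t by rewrite invr_gt0 exprn_gt0.
have -> : 4 ^- k = t ^+ 2 by rewrite /t -!exprVn -exprM mulnC exprM; congr (_ ^+ _); field.
set K := (X in (X * _ / _)%:E).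
have H10 : 0 <= C * (1 + H%:R) by rewrite mulr_ge0// addr_ge0.
have p4 (x : R) : 0 <= x ^+ 4 by rewrite (_ : 4 = 2 * 2)%N// exprM sqr_ge0.
have C20 := sqr_ge0 C.
have h1 := p4 (8 * (C * (1 + H%:R))); have h2 := p4 (4 * Fb).
have t20 : 0 <= t ^+ 2 by exact: sqr_ge0.
have c40 : 0 < c ^+ 4 by exact: exprn_gt0.
have g0 m : 0 <= grid k m :> R by rewrite divr_ge0// exprn_ge0.
have mS (V : R -> Om -> R) (e : R) : (forall s : R, 0 <= s -> measurable_fun setT (V s)) ->
    measurable [set w | (e <= `|V (grid k i.+1) w - V (grid k i) w|)%R].
  move=> mV; rewrite -[X in measurable X]setTI; apply: measurable_fun_le => //.
  by apply: measurableT_comp => //; apply: measurable_funB; exact: mV.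
have [nt|nt] := leP 1 (nu * t).
  (* Long interval: [lam^2 <= 1 / nu <= t], so boundary errors, of order [lam], do not exceed the
     scale [sqrt t] of the noise. *)
  have lt2 : lam ^+ 2 <= t.
    rewrite -(@ler_pM2r _ nu)// (le_trans lam1)// mulrC; exact: nt.
  have [bc|cb] := leP (8 * (lam * C * (1 + H%:R))) c; last first.
    apply: small_case (mS _ _ mU) c0 cb (ltW t0) _.
    rewrite (_ : 8 * _ = 8 * (C * (1 + H%:R)) * lam); last by ring.
    apply: le_trans (pow4_le _ (ltW t0) lam0 lt2) _.
    rewrite ler_wpM2r// /K; lra.
  have := approximable_tail mU ap1 iH c0 bc; rewrite -/t.
  move=> h; apply: le_trans h _; rewrite lee_fin ler_wpM2r ?invr_ge0 ?(ltW c40)//.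
  apply: (@le_trans _ _ (64 * C ^+ 2 * t ^+ 2 + 48 * C * t ^+ 2)).
    have : C * lam ^+ 2 * t <= C * t ^+ 2.
      by rewrite -mulrA; apply: ler_wpM2l => //; rewrite expr2; apply: ler_wpM2r => //; exact: ltW.
    by lra.
  rewrite -mulrDl ler_wpM2r// /K /tail_const; lra.
(* Short interval: the drift integral is at most a multiple of [gap], and
   [gap^2 = (lam^2 nu) (nu t) t <= t]. *)
pose gap := lam * nu * t.
have gap2 : gap ^+ 2 <= t.
  rewrite (_ : gap ^+ 2 = (lam ^+ 2 * nu) * ((nu * t) * t)); last by rewrite /gap; ring.
  apply: (@le_trans _ _ (1 * (1 * t))); last by rewrite !mul1r.
  by apply: ler_pM => //; rewrite ?mulr_ge0 ?sqr_ge0 ?(ltW nu0) ?(ltW t0)// ler_wpM2r// ltW.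
have gap0 : 0 <= gap by rewrite !mulr_ge0// ltW.
have [fc|cf] := leP (4 * Fb * gap) c; last first.
  apply: small_case (mS _ _ mU) c0 cf (ltW t0) _.
  apply: le_trans (pow4_le _ (ltW t0) gap0 gap2) _.
  rewrite ler_wpM2r// /K; lra.
have c2 : 0 < c / 2 by rewrite divr_gt0.
have := approximable_tail mJ ap iH c2 _; rewrite mulr0 => /(_ (ltW c2)); rewrite -/t => h.
have [N1 [mN1 PN1 hN1]] := hU (g0 i.+1); have [N0 [mN0 PN0 hN0]] := hU (g0 i).
have P1 : (P N1 <= 0%:E)%E by rewrite PN1.
have P0 : (P N0 <= 0%:E)%E by rewrite PN0.
have PU := prob_setU_le mN1 (measurableU _ _ mN0 (mS _ _ mJ)) P1 (prob_setU_le mN0 (mS _ _ mJ) P0 h).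
apply: le_trans (prob_le (mS _ _ mU) _ _ PU) _.
- by apply: measurableU => //; apply: measurableU => //; exact: (mS _ _ mJ).
- move=> w /= cw; apply: contrapT => /not_orP[n1 /not_orP[n0 /negP]]; rewrite -ltNge => n2.
  have e1 : U (grid k i.+1) w = lam * nu * tint 0 (grid k i.+1) (fun s => f s (X s w) - pav p (f s)) + kap0 * J (grid k i.+1) w.
    by apply: contrapT => nh; apply: n1; exact: hN1.
  have e0 : U (grid k i) w = lam * nu * tint 0 (grid k i) (fun s => f s (X s w) - pav p (f s)) + kap0 * J (grid k i) w.
    by apply: contrapT => nh; apply: n0; exact: hN0.
  have ftL (s s' : R) j : 0 <= s -> 0 <= s' -> `|(f s' j - pav p (f s')) - (f s j - pav p (f s))| <= (Lf + Lf) * `|s' - s|.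
    move=> s0 s0'; rewrite (_ : _ - _ = (f s' j - f s j) - (pav p (f s') - pav p (f s))); last by ring.
    apply: le_trans (ler_normB _ _) _; rewrite mulrDl lerD ?fL//.
    by apply: (pav_dist up) => j'; exact: fL.
  have ftB (s : R) j : 0 <= s -> `|f s j - pav p (f s)| <= 2 * Fb.
    move=> s0; apply: le_trans (ler_normB _ _) _; rewrite mulr2n mulrDl !mul1r lerD ?fB//.
    by apply: (pav_bound up) => j'; exact: fB.
  pose phi (s : R) := f (Num.max s 0) (X (Num.max s 0) w) - pav p (f (Num.max s 0)).
  have mx0 (s : R) : 0 <= Num.max s 0 by rewrite le_max lexx orbT.
  have bphi T : bmeas T phi.
    split; last by exists (2 * Fb) => s _; exact: ftB.
    have := joint_measurable_chain cX (addr_ge0 Lf0 Lf0) ftL; exact: joint_section_time.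
  have tE (a : R) : tint 0 a (fun s => f s (X s w) - pav p (f s)) = tint 0 a phi.
    by apply: tint_eq => s /andP[s0 _]; rewrite /phi (max_idPl s0).
  have gS : grid k i.+1 - grid k i = t :> R.
    by rewrite /grid /t -mulrBl -natr1 addrAC subrr add0r mul1r.
  have gle : grid k i <= grid k i.+1 :> R by rewrite -subr_ge0 gS ltW.
  have tb : `|tint (grid k i) (grid k i.+1) phi| <= 2 * Fb * t.
    by rewrite -gS; apply: (tint_bound (g0 i) gle (lexx _) (bphi _)) => s _; exact: ftB.
  move: cw; apply/negP; rewrite -ltNge e1 e0 !tE.
  rewrite (@tint_split _ (grid k i.+1) 0 (grid k i) (grid k i.+1) phi (bphi _))//.
  rewrite (_ : _ - _ = lam * nu * tint (grid k i) (grid k i.+1) phi + (kap0 * J (grid k i.+1) w - kap0 * J (grid k i) w)); last by ring.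
  apply: le_lt_trans (ler_normD _ _) _.
  have : `|lam * nu * tint (grid k i) (grid k i.+1) phi| <= c / 2.
    rewrite normrM ger0_norm ?mulr_ge0 ?(ltW nu0)//; apply: (@le_trans _ _ (lam * nu * (2 * Fb * t))).
      by rewrite ler_wpM2l ?mulr_ge0 ?(ltW nu0).
    by move: fc; rewrite /gap; lra.
  by lra.
rewrite lee_fin !add0r mulr0 mul0r addr0.
rewrite [leLHS](_ : _ = 1024 * C ^+ 2 * t ^+ 2 / c ^+ 4); last by field; rewrite gt_eqF.
rewrite ler_wpM2r ?invr_ge0 ?(ltW c40)// ler_wpM2r// /K /tail_const; lra.
Qed.

Section StateAverage.
Variables (gam : 'I_d -> R) (Gm : R).
Hypothesis Gm0 : 0 <= Gm.
Hypothesis gamB : forall i, `|gam i| <= Gm.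

Definition state_average (t : R) (w : Om) : R := tint 0 t (fun s => gam (X (Num.max s 0) w) - pav p gam).

Let hL (s t : R) i : 0 <= s -> 0 <= t -> `|(gam i - pav p gam) - (gam i - pav p gam)| <= 0 * `|t - s|.
Proof. by move=> _ _; rewrite subrr normr0 mul0r. Qed.

Lemma measurable_state_average (t : R) : measurable_fun setT (state_average t).
Proof.
apply: measurable_time_Rintegral.
exact: (joint_measurable_chain (h := fun _ i => gam i - pav p gam) cX (lexx 0) hL).
Qed.

(** The model with [f = gam] constant in time, [lam = 1 / nu] and [kap0 = 0], whose drift part is
    exactly the centred time integral of [gam]. Its variance rate and its boundary error are both of
    order [1 / nu]. *)
Lemma state_average_tail (H k i : nat) (c : R) (mc := model_const Q p u Gm 0) :
  (i < H * 2 ^ k)%N -> 0 < c -> 8 * (mc * (1 + H%:R)) / nu <= c ->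
  (P [set w | (c <= `|state_average (grid k i.+1) w - state_average (grid k i) w|)%R] <=
    ((64 * mc ^+ 2 + 48 * mc) / c ^+ 4 / nu)%:E)%E.
Proof.
move=> iH c0 bc; have m1 : 1 <= mc by exact: model_const_ge1.
have B' (t : R) j : 0 <= t -> `|gam j| <= Gm by move=> _; exact: gamB.
have L' (s t : R) j : 0 <= s -> 0 <= t -> `|gam j - gam j| <= 0 * `|t - s|.
  by move=> _ _; rewrite subrr normr0 mul0r.
have nV0 : 0 <= nu^-1 by rewrite invr_ge0 ltW.
have mA (t : R) : 0 <= t -> measurable_fun setT (state_average t).
  by move=> _; exact: measurable_state_average.
have hA (t : R) : 0 <= t -> {ae P, forall w, state_average t w =
   nu^-1 * nu * tint 0 t (fun s => gam (X s w) - pav p gam) + 0 * J t w}.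
  move=> t0; apply: aeW => w; rewrite mul0r addr0 mulVf ?gt_eqF// mul1r.
  by apply: tint_eq => s /andP[s0 _]; rewrite (max_idPl s0).
have ap : approximable P state_average H (mc * nu^-1) (mc * nu^-1) (mean_rate Q p (fun _ => gam) u (nu^-1 ^+ 2 * nu) ((0 * q) ^+ 2))
    (mc * nu^-1 * (1 + H%:R) / nu) (mc * nu^-1) (mc * (1 + H%:R) / nu).
  move=> n0 delta d0.
  have [n [A [s [q' [nn dz]]]]] := model_approximation gQ up fF bB nu0 cX aX iXB (f := fun _ => gam) Gm0 (lexx 0) B' L' nV0 hJ mA hA H n0 d0.
  set rho := nu^-1 ^+ 2 * nu + (0 * q) ^+ 2 in dz.
  have rE : rho = nu^-1 by rewrite /rho mul0r expr0n addr0 expr2 -mulrA mulVf ?mulr1// gt_eqF.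
  rewrite rE -/mc in dz.
  exists n, A, s, q'; split => //; apply: discretization_weaken dz => //.
    rewrite lerD2r; apply: ler_wpM2r => //; rewrite ler_piMr ?(le_trans ler01 m1)//.
    by rewrite expr_le1// invf_le1.
  by rewrite le_eqVlt; apply/orP; left; apply/eqP; ring.
have bc' : 8 * (mc * (1 + H%:R) / nu) <= c by rewrite mulrA.
have := approximable_tail mA ap iH c0 bc'.
set t : R := 2 ^- k.
have t0 : 0 <= t by rewrite invr_ge0 exprn_ge0.
have t1 : t <= 1 by rewrite invf_le1 ?exprn_gt0// exprn_ege1// ler1n.
have n1 : nu^-1 <= 1 by rewrite invf_le1.
move: (mc) m1 nV0 n1 => z z1 n0 n1 h; apply: le_trans h _; rewrite lee_fin [leRHS]mulrAC.
apply: ler_wpM2r; first by rewrite invr_ge0 exprn_ge0// ltW.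
have z0 : 0 <= z := le_trans ler01 z1.
have e1 : (z * nu^-1) ^+ 2 * t ^+ 2 <= z ^+ 2 * nu^-1.
  rewrite exprMn -mulrA; apply: ler_wpM2l; first exact: sqr_ge0.
  rewrite -[leRHS]mulr1; apply: ler_pM; rewrite ?sqr_ge0//; last by rewrite expr_le1.
  by rewrite expr2 ler_piMr.
have e2 : z * nu^-1 * t <= z * nu^-1 by rewrite ler_piMr// mulr_ge0.
lra.
Qed.

End StateAverage.

End SingleModel.

(** * Replacing the modulated reversion rate by its mean along one path *)

Section PathwiseAveraging.
Context {R : realType}.
Variables (y g : R -> R) (gi G c S eta : R) (H l : nat).
Hypothesis cy : cpath y.
Hypothesis mg : measurable_fun setT g.
Hypotheses (gi0 : 0 < gi) (giG : gi <= G).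
Hypothesis gG : forall s : R, `|g s| <= G.
Local Notation yy := (fun s => y (Num.max s 0)).
Definition driving (t : R) : R := y t - c + tint 0 t (fun s => g s * yy s).
Local Notation U := driving.
Hypothesis c1 : `|c| <= 1.
Hypothesis S0 : 0 <= S.
Hypothesis US : forall t : R, 0 <= t -> t <= H%:R -> `|U t| <= S.
Hypothesis Uinc : forall i, (i < H * 2 ^ l)%N -> `|U (grid l i.+1) - U (grid l i)| <= (9 / 10) ^+ l.
Hypothesis Utr : forall t : R, 0 <= t -> t <= H%:R -> `|U t - U (grid l (Num.truncn (t * 2 ^+ l)))| <= 9 * (9 / 10) ^+ l.
Hypothesis eta0 : 0 <= eta.
Hypothesis avg : forall i, (i < H * 2 ^ l)%N -> `|tint (grid l i) (grid l i.+1) (fun s => g s - gi)| <= eta.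

Let G0 : 0 < G. Proof. exact: lt_le_trans giG. Qed.

Let bg T : bmeas T g.
Proof. by split => //; exists G => s _; exact: gG. Qed.

Let by_ T : bmeas T yy. Proof. exact: cpath_bmeas. Qed.

Definition path_bound : R := 2 * (1 + S) * expR (2 * G * H%:R).
Local Notation Y := path_bound.

Lemma path_bound_ge0 : 0 <= Y.
Proof. by rewrite !mulr_ge0 ?expR_ge0// addr_ge0. Qed.

Lemma path_boundP (t : R) : 0 <= t -> t <= H%:R -> `|y t| <= Y.
Proof.
move=> t0 tH; have tT : 0 <= t <= H%:R by rewrite t0.
have S1 : 0 <= 1 + S by rewrite addr_ge0.
apply: le_trans (gronwall (ler0n R H) S1 G0 cy _ tT) _; last first.
  by rewrite /Y ler_wpM2l ?mulr_ge0// ler_expR ler_wpM2l// mulr_ge0// ltW.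
move=> s /andP[s0 sH].
have b1 := bmeasM (@bg H%:R) (@by_ H%:R).
rewrite (_ : y s = (c + U s) - tint 0 s (fun s => g s * yy s)); last by rewrite /U; ring.
apply: le_trans (ler_normB _ _) _; apply: lerD.
  by apply: le_trans (ler_normD _ _) _; rewrite lerD// US.
apply: le_trans (tint_norm (lexx 0) sH b1) _.
rewrite -(tintZ (lexx 0) sH _ (bmeas_abs (@by_ H%:R))).
apply: (tint_le (lexx 0) sH (bmeas_abs b1) (bmeasZ _ (bmeas_abs (@by_ H%:R)))) => z _.
by rewrite normrM ler_wpM2r.
Qed.

Local Notation Dl := (2 ^- l : R).
Local Notation om := (10 * (9 / 10) ^+ l + G * Y * Dl).

Let g0 i : 0 <= grid l i :> R. Proof. by rewrite divr_ge0// exprn_ge0. Qed.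
Let gS i : grid l i.+1 - grid l i = Dl :> R.
Proof. by rewrite /grid -mulrBl -natr1 addrAC subrr add0r mul1r. Qed.
Let D0 : 0 < Dl. Proof. by rewrite invr_gt0 exprn_gt0. Qed.
Let gH i : (i <= H * 2 ^ l)%N -> grid l i <= H%:R :> R.
Proof. by move=> iH; rewrite /grid ler_pdivrMr ?exprn_gt0// -natrX -natrM ler_nat. Qed.

Let osc i (s : R) : (i < H * 2 ^ l)%N -> grid l i <= s -> s <= grid l i.+1 -> `|y s - y (grid l i)| <= om.
Proof.
move=> iH s1 s2; have sH : s <= H%:R := le_trans s2 (gH iH).
have s0 : 0 <= s := le_trans (g0 i) s1.
have b1 := bmeasM (@bg H%:R) (@by_ H%:R).
have q0 : 0 <= (9 / 10) ^+ l :> R by rewrite exprn_ge0// divr_ge0.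
have h1 : `|U s - U (grid l i)| <= 10 * (9 / 10) ^+ l.
  move: s2; rewrite le_eqVlt => /orP[/eqP ->|s2]; first by have := Uinc iH; lra.
  have -> : i = Num.truncn (s * 2 ^+ l).
    have /andP[t1 t2] := grid_trunc l s0.
    have e0 : 0 < 2 ^+ l :> R by rewrite exprn_gt0.
    have := le_lt_trans s1 t2; have := le_lt_trans t1 s2; rewrite /grid !ltr_pM2r ?invr_gt0// !ltr_nat !ltnS => a b.
    by apply/eqP; rewrite eqn_leq b a.
  by have := Utr s0 sH; lra.
rewrite (_ : y s - y (grid l i) = (U s - U (grid l i)) - tint (grid l i) s (fun s => g s * yy s)); last first.
  by rewrite /U (@tint_split _ H%:R 0 (grid l i) s _ b1)//; ring.
apply: le_trans (ler_normB _ _) (lerD h1 _).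
apply: (@le_trans _ _ (G * Y * (s - grid l i))).
  apply: (tint_bound (g0 i) s1 sH b1) => z /andP[z1 z2].
  have z0 : 0 <= z := le_trans (g0 i) z1.
  by rewrite normrM ler_pM// (max_idPl z0) path_boundP// (le_trans z2).
by apply: ler_wpM2l; [rewrite mulr_ge0 ?path_bound_ge0 ?(ltW G0)|rewrite -(gS i) lerD2r].
Qed.

Let h s := g s - gi.
Let bh T : bmeas T h. Proof. by apply: bmeasB => //; exact: bmeas_cst. Qed.
Let hG s : `|h s| <= 2 * G.
Proof. by apply: le_trans (ler_normB _ _) _; have := gG s; have := giG; rewrite (gtr0_norm gi0); lra. Qed.

Let E (t : R) : R := tint 0 t (fun s => h s * yy s).

Let Egrid i : (i <= H * 2 ^ l)%N -> `|E (grid l i)| <= i%:R * (2 * G * om * Dl + Y * eta).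
Proof.
elim: i => [|i ih] iH; first by rewrite /E /grid mul0r tint_point normr0 mul0r.
have gle : grid l i <= grid l i.+1 :> R by rewrite -subr_ge0 gS ltW.
have bhy := bmeasM (@bh H%:R) (@by_ H%:R).
have yH := path_boundP (g0 i) (gH (ltnW iH)).
rewrite /E (@tint_split _ H%:R 0 (grid l i) (grid l i.+1) _ bhy)// ?gH// -/(E _).
rewrite -natr1 mulrDl mul1r; apply: le_trans (ler_normD _ _) (lerD (ih (ltnW iH)) _).
have -> : tint (grid l i) (grid l i.+1) (fun s => h s * yy s) =
  tint (grid l i) (grid l i.+1) (fun s => h s * (yy s - y (grid l i))) + y (grid l i) * tint (grid l i) (grid l i.+1) h.
  have b3 := bmeasM (@bh H%:R) (bmeasB (@by_ H%:R) (bmeas_cst H%:R (y (grid l i)))).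
  rewrite -(tintZ (g0 i) (gH iH) _ (@bh H%:R)) -(tintD (g0 i) (gH iH) b3 (bmeasZ _ (@bh H%:R))).
  by apply: tint_eq => s _; ring.
apply: le_trans (ler_normD _ _) (lerD _ _).
  rewrite -(gS i); apply: (tint_bound (g0 i) gle (gH iH)).
    exact: bmeasM (@bh H%:R) (bmeasB (@by_ H%:R) (bmeas_cst H%:R (y (grid l i)))).
  move=> s /andP[s1 s2]; have s0 : 0 <= s := le_trans (g0 i) s1.
  by rewrite normrM ler_pM// (max_idPl s0) gS osc.
by rewrite normrM ler_pM// avg.
Qed.

Lemma pathwise_averaging (t : R) : 0 <= t -> t <= H%:R ->
  `|volterra gi y t - U t| <= `|c| + (H%:R * (2 * G * om + 2 ^+ l * (Y * eta)) + 2 * G * Y * Dl).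
Proof.
move=> t0 tH.
have bhy := bmeasM (@bh H%:R) (@by_ H%:R).
have -> : volterra gi y t - U t = c - E t.
  rewrite /volterra /U /E -(tintZ (lexx 0) tH _ (@by_ H%:R)).
  rewrite (_ : tint 0 t (fun s => h s * yy s) = tint 0 t (fun s => g s * yy s) - tint 0 t (fun s => gi * yy s)); first by ring.
  rewrite -(tintB (lexx 0) tH (bmeasM (@bg H%:R) (@by_ H%:R)) (bmeasZ _ (@by_ H%:R))).
  by apply: tint_eq => s _; rewrite /h mulrBl.
apply: le_trans (ler_normB _ _) _; rewrite lerD2l.
set i := Num.truncn (t * 2 ^+ l).
have /andP[g1 g2] := grid_trunc l t0; rewrite -/i in g1 g2.
have iH : (i <= H * 2 ^ l)%N.
  by rewrite -(ler_nat R) natrM natrX -ler_pdivrMr ?exprn_gt0//; exact: le_trans g1 tH.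
rewrite /E (@tint_split _ H%:R 0 (grid l i) t _ bhy)// -/(E _).
have om0 : 0 <= om.
  apply: addr_ge0; first by apply: mulr_ge0 => //; apply: exprn_ge0; exact: divr_ge0.
  by apply: mulr_ge0; [apply: mulr_ge0; [exact: ltW|exact: path_bound_ge0]|exact: ltW].
apply: le_trans (ler_normD _ _) (lerD _ _).
  apply: le_trans (Egrid iH) _.
  apply: (@le_trans _ _ ((H * 2 ^ l)%:R * (2 * G * om * Dl + Y * eta))).
    apply: ler_wpM2r; last by rewrite ler_nat.
    have Y0 := path_bound_ge0; apply: addr_ge0; last exact: mulr_ge0.
    apply: mulr_ge0; last exact: ltW.
    by apply: mulr_ge0 => //; apply: mulr_ge0 => //; exact: ltW.
  rewrite natrM natrX -mulrA; apply: ler_wpM2l => //.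
  by rewrite mulrDr [2 ^+ l * (2 * G * om * Dl)]mulrC -[_ * Dl * _]mulrA mulVf ?mulr1// expf_neq0.
apply: (@le_trans _ _ (2 * G * Y * (t - grid l i))).
  apply: (tint_bound (g0 i) g1 tH bhy) => s /andP[s1 s2].
  have s0 : 0 <= s := le_trans (g0 i) s1.
  by rewrite normrM ler_pM// (max_idPl s0) path_boundP// (le_trans s2).
apply: ler_wpM2l; first by rewrite mulr_ge0 ?path_bound_ge0 ?mulr_ge0 ?(ltW G0).
by rewrite -(gS i) lerD2r ltW.
Qed.

End PathwiseAveraging.

Lemma cpath_cst (R : realType) (k : R) : cpath (fun=> k).
Proof. by apply: (@continuous_cpath _ (fun=> k)) => // t; exact: cvg_cst. Qed.

(** * The sequence of models: uniform tails and the Volterra approximation *)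

Section ScaledModels.
Context {R : realType} {d : nat} (dO : nat -> measure_display) (Om : forall N, measurableType (dO N)).
Variables (P : forall N, probability (Om N) R) (F : forall N, R -> set (set (Om N))).
Variables (B : forall N, R -> Om N -> R) (X : forall N, R -> Om N -> 'I_d).
Variables (Q : 'M[R]_d) (p p0 : 'cV[R]_d).
Hypotheses (gQ : is_generator Q) (up : unique_invariant_distribution Q p).
Hypothesis fF : forall N, (0 < N)%N -> filtration (@F N).
Hypothesis bB : forall N, (0 < N)%N -> brownian_motion (P N) (@F N) (@B N).
Hypothesis cX : forall N, (0 < N)%N -> markov_chain (P N) (N%:R *: Q) p0 (@X N).
Hypothesis aX : forall N, (0 < N)%N -> adapted setT (@F N) (@X N).
Hypothesis iXB : forall N, (0 < N)%N -> independent_processes (P N) setT (@X N) borelR (@B N).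
Variables (f : R -> 'I_d -> R) (u gam : 'I_d -> R) (Fb Lf Gm : R).
Hypotheses (Fb0 : 0 <= Fb) (Lf0 : 0 <= Lf).
Hypothesis fB : forall (t : R) i, 0 <= t -> `|f t i| <= Fb.
Hypothesis fL : forall (s t : R) i, 0 <= s -> 0 <= t -> `|f t i - f s i| <= Lf * `|t - s|.
Hypothesis gamB : forall i, `|gam i| <= Gm.
Local Notation gi := (pav p gam).
Hypotheses (gi0 : 0 < gi).
Variables (lam kap0 q c : nat -> R) (J y : forall N, R -> Om N -> R).
Hypothesis lam0 : forall N, 0 <= lam N.
Hypothesis lam1 : forall N, (0 < N)%N -> lam N ^+ 2 * N%:R <= 1.
Hypothesis kap1 : forall N, (0 < N)%N -> (kap0 N * q N) ^+ 2 <= 1.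
Hypothesis c_cvg : forall e : R, 0 < e -> evt (fun N => `|c N| <= e).
Hypothesis hJ : forall N (t : R), (0 < N)%N -> 0 <= t ->
  ito_integral (P N) (@F N) (@B N) (fun t w => q N * u (@X N t w)) t (@J N t).
Hypothesis cy : forall N (w : Om N), (0 < N)%N -> cpath (fun t => @y N t w).
Hypothesis my : forall N (t : R), (0 < N)%N -> 0 <= t -> measurable_fun setT (@y N t).
Hypothesis y0 : forall N, (0 < N)%N -> {ae P N, forall w, @y N 0 w = c N}.

Definition driving_process N (t : R) (w : Om N) : R :=
  driving (fun t => @y N t w) (fun s => gam (@X N (Num.max s 0) w)) (c N) t.
Local Notation U N := (@driving_process N).

Hypothesis hU : forall N (t : R), (0 < N)%N -> 0 <= t -> {ae P N, forall w,
  U N t w = lam N * N%:R * tint 0 t (fun s => f s (@X N s w) - pav p (f s)) + kap0 N * @J N t w}.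

Let giG : gi <= Gm. Proof. by apply: le_trans (ler_norm _) _; exact: (pav_bound up gamB). Qed.
Let Gm0 : 0 < Gm. Proof. exact: lt_le_trans giG. Qed.
Let N1 N : (0 < N)%N -> 1 <= N%:R :> R. Proof. by move=> N0; rewrite ler1n. Qed.

Let gL (s t : R) i : 0 <= s -> 0 <= t -> `|gam i - gam i| <= 0 * `|t - s|.
Proof. by move=> _ _; rewrite subrr normr0 mul0r. Qed.

Let jg N : (0 < N)%N -> joint_measurable (fun s (w : Om N) => gam (@X N (Num.max s 0) w)).
Proof. by move=> N0; exact: (joint_measurable_chain (h := fun _ i => gam i) (cX N0) (lexx 0) gL). Qed.

Let jy N : (0 < N)%N -> joint_measurable (fun s (w : Om N) => @y N (Num.max s 0) w).
Proof.
move=> N0; apply: right_continuous_joint; first by move=> t; exact: my.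
by apply: cpath_right_continuous => w; exact: cy.
Qed.

Let mg N (w : Om N) : (0 < N)%N -> measurable_fun setT (fun s : R => gam (@X N (Num.max s 0) w)).
Proof. by move=> N0; exact: (joint_section_time w (jg N0)). Qed.

Lemma cpath_driving N (w : Om N) : (0 < N)%N -> cpath (fun t => U N t w).
Proof.
move=> N0; apply: cpathD.
  by apply: cpathD; [exact: cy|exact: cpath_cst].
apply: cpath_tint => T; have b1 := cpath_bmeas T (@cy N w N0).
have b2 : bmeas T (fun s => gam (@X N (Num.max s 0) w)).
  by split; [exact: mg|exists Gm => s _; exact: gamB].
exact: bmeasM b2 b1.
Qed.

Lemma measurable_driving N (t : R) : (0 < N)%N -> 0 <= t -> measurable_fun setT (U N t).
Proof.
move=> N0 t0; apply: measurable_funD; first by apply: measurable_funB => //; exact: my.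
by apply: measurable_time_Rintegral; apply: joint_measurableM; [exact: jg|exact: jy].
Qed.

Lemma measurable_volterra N (t : R) : (0 < N)%N -> 0 <= t ->
  measurable_fun setT (fun w => volterra gi (fun t => @y N t w) t).
Proof.
move=> N0 t0; apply: measurable_funD; first exact: my.
by apply: measurable_funM => //; exact: measurable_time_Rintegral (jy N0).
Qed.

Lemma driving_approximable N (H : nat) (C := approx_const Q p u Fb Lf) : (0 < N)%N ->
  approximable (P N) (U N) H C (C * lam N ^+ 2) (mean_rate Q p f u (lam N ^+ 2 * N%:R) ((kap0 N * q N) ^+ 2))
    (C * (1 + H%:R) / N%:R) C (lam N * C * (1 + H%:R)).
Proof.
move=> N0; exact: (model_approximable gQ up (fF N0) (bB N0) (N1 N0) (cX N0) (aX N0) (iXB N0) Fb0 Lf0 fB fL (lam0 N)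
  (lam1 N0) (kap1 N0) (fun t => hJ N0) (fun t => @measurable_driving N t N0) (fun t => hU N0)).
Qed.

Lemma driving_tail N (H k i : nat) (x : R) : (0 < N)%N -> (i < H * 2 ^ k)%N -> 0 < x ->
  (P N [set w | (x <= `|U N (grid k i.+1) w - U N (grid k i) w|)%R] <=
    (tail_const Q p u Fb Lf H * 4 ^- k / x ^+ 4)%:E)%E.
Proof.
move=> N0; exact: (model_tail gQ up (fF N0) (bB N0) (N1 N0) (cX N0) (aX N0) (iXB N0) Fb0 Lf0 fB fL (lam0 N)
  (lam1 N0) (kap1 N0) (fun t => hJ N0) (fun t => @measurable_driving N t N0) (fun t => hU N0)).
Qed.

Let A N (t : R) (w : Om N) : R := state_average (@X N) p gam t w.

Let mc := model_const Q p u Gm 0.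

Let average_tail N (H k i : nat) (x : R) : (0 < N)%N -> (i < H * 2 ^ k)%N -> 0 < x ->
  8 * (mc * (1 + H%:R)) / N%:R <= x ->
  (P N [set w | (x <= `|@A N (grid k i.+1) w - @A N (grid k i) w|)%R] <=
    ((64 * mc ^+ 2 + 48 * mc) / x ^+ 4 / N%:R)%:E)%E.
Proof.
move=> N0; exact: (state_average_tail gQ up (fF N0) (bB N0) (N1 N0) (cX N0) (aX N0) (iXB N0) (fun t => hJ N0) (ltW Gm0) gamB).
Qed.

Let grid0 l i : 0 <= grid l i :> R. Proof. by rewrite divr_ge0// exprn_ge0. Qed.

Let sup_driving N (w : Om N) (H : nat) (r : R) : 0 <= r -> U N 0 w = 0 ->
  (forall i, (i < H * 2 ^ 0)%N -> `|U N (grid 0 i.+1) w - U N (grid 0 i) w| <= r * (9 / 10) ^+ 0) ->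
  (forall t : R, 0 <= t -> t <= H%:R -> `|U N t w - U N (grid 0 (Num.truncn (t * 2 ^+ 0))) w| <= 9 * r * (9 / 10) ^+ 0) ->
  forall t : R, 0 <= t -> t <= H%:R -> `|U N t w| <= (9 + H%:R) * r.
Proof.
move=> r0 U0 h1 h2 t t0 tH; have := h2 t t0 tH; rewrite !expr0 !mulr1.
set i := Num.truncn t => h3.
have iH : (i <= H)%N by rewrite -(ler_nat R); apply: le_trans tH; rewrite truncn_le.
have step j : (j <= H)%N -> `|U N (grid 0 j) w| <= j%:R * r.
  elim: j => [_|j ih jH]; first by rewrite /grid mul0r U0 normr0 mul0r.
  rewrite (_ : U N (grid 0 j.+1) w = U N (grid 0 j) w + (U N (grid 0 j.+1) w - U N (grid 0 j) w)); last by rewrite addrC subrK.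
  apply: le_trans (ler_normD _ _) _; rewrite -natr1 mulrDl mul1r; apply: lerD; first exact: ih (ltnW jH).
  by have := h1 j; rewrite expn0 muln1 expr0 mulr1; exact.
rewrite (_ : U N t w = (U N t w - U N (grid 0 i) w) + U N (grid 0 i) w); last by rewrite subrK.
apply: le_trans (ler_normD _ _) _; rewrite mulrDl; apply: lerD => //.
by apply: le_trans (step i iH) _; apply: ler_wpM2r => //; rewrite ler_nat.
Qed.

(** Constants are chosen in this order: [r], so that the noise stays below [S] with high
    probability; [Y], the resulting bound on the process; the level [l]; the tolerance [eta] for
    block averages; and [N] last. *)
Lemma volterra_driving_close (e T : R) : 0 < e -> 0 <= T -> evt (fun N => exists Bd : set (Om N),
  [/\ measurable Bd, (P N Bd <= e%:E)%E & forall w, ~ Bd w -> forall t, 0 <= t <= T ->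
    `|volterra gi (fun t => @y N t w) t - U N t w| <= e]).
Proof.
move=> e0 T0; pose H := (Num.truncn T).+1.
have TH : T <= H%:R by apply: ltW; exact: truncnS_gt.
set K := tail_const Q p u Fb Lf H.
have K0 : 0 <= K by exact: tail_const_ge0.
have tail N k i (x : R) (N0 : (0 < N)%N) := @driving_tail N H k i x N0.
rewrite -/K in tail.
have tailA N k i (x : R) (N0 : (0 < N)%N) := @average_tail N H k i x N0.
have m1 : 1 <= mc by apply: model_const_ge1 => //; exact: ltW.
move: K (mc) K0 tail tailA m1 => K z K0 tail tailA z1.
have e4 : 0 < e / 4 by rewrite divr_gt0.
have KH0 : 0 <= 5 * K * H%:R by apply: mulr_ge0 => //; exact: mulr_ge0.
(* As [r >= 1], also [r^4 >= r], so the chaining probability [5 K H / r^4] is at most [e / 4]. *)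
pose r : R := 1 + 5 * K * H%:R / (e / 4).
have r1 : 1 <= r by rewrite lerDl divr_ge0// ltW.
have r0 : 0 < r := lt_le_trans ltr01 r1.
have hr : 5 * K * H%:R / r ^+ 4 <= e / 4.
  rewrite ler_pdivrMr ?exprn_gt0//.
  have -> : 5 * K * H%:R = e / 4 * (r - 1) by rewrite /r; field; rewrite gt_eqF.
  apply: ler_wpM2l; first exact: ltW.
  by apply: (@le_trans _ _ r); [rewrite gerBl|rewrite exprS ler_peMr ?exprn_ege1// ltW].
pose S := (9 + H%:R) * r.
have S0 : 0 <= S by apply: mulr_ge0; [rewrite addr_ge0|exact: ltW].
have [Y YE] : exists Y, Y = path_bound Gm S H by exists (path_bound Gm S H).
have Y0 : 0 <= Y by rewrite YE; exact: path_bound_ge0.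
pose Z := H%:R * (2 * Gm * (10 + Gm * Y)) + 2 * Gm * Y.
have [q1 q2 q3 q4] : [/\ 0 <= 9 / 10 :> R, 9 / 10 < 1 :> R, 0 <= 4 / 5 :> R & 4 / 5 < 1 :> R] by split; lra.
have [l hl] := evtI (expr_small Z q1 q2 e4) (expr_small (5 * K * H%:R) q3 q4 e4).
have {hl} [s1 s2] := hl l (leqnn l).
have lpos : 0 < 2 ^+ l :> R by rewrite exprn_gt0.
have D1 : 2 ^- l <= (9 / 10) ^+ l :> R.
  by rewrite -exprVn lerXn2r ?nnegrE ?invr_ge0//; lra.
have D0 : 0 <= 2 ^- l :> R by rewrite invr_ge0 exprn_ge0.
have YH0 : 0 <= H%:R * 2 ^+ l * Y by apply: mulr_ge0 => //; apply: mulr_ge0 => //; exact: ltW.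
(* There are [H * 2 ^ l] blocks and the process is bounded by [Y], so the averaging errors add up to
   at most [e / 4]. *)
pose eta := e / 4 / (H%:R * 2 ^+ l * Y + 1).
have eta0 : 0 < eta by rewrite divr_gt0// ltr_wpDl.
have heta : H%:R * (2 ^+ l * (Y * eta)) <= e / 4.
  rewrite (_ : _ * _ = H%:R * 2 ^+ l * Y * eta); last by ring.
  rewrite /eta mulrA ler_pdivrMr ?ltr_wpDl// [leLHS]mulrC; apply: ler_wpM2l; first exact: ltW.
  by rewrite lerDl.
have cst : H%:R * (2 * Gm * (10 * (9 / 10) ^+ l + Gm * Y * 2 ^- l)) + 2 * Gm * Y * 2 ^- l <= e / 4.
  apply: le_trans s1; rewrite /Z [leRHS]mulrDl; apply: lerD.
    rewrite -!mulrA; apply: ler_wpM2l => //; apply: ler_wpM2l => //; apply: ler_wpM2l; first exact: ltW.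
    rewrite [leRHS]mulrDl lerD2l -!mulrA; apply: ler_wpM2l; first exact: ltW.
    exact: ler_wpM2l.
  by apply: ler_wpM2l => //; apply: mulr_ge0 => //; apply: mulr_ge0 => //; exact: ltW.
pose M : R := (H * 2 ^ l)%:R * ((64 * z ^+ 2 + 48 * z) / eta ^+ 4).
have [N0 hN0] := evtI (evtI (evt_ge 1) (evt_div (8 * (z * (1 + H%:R))) eta0)) (evtI (evt_div M e4)
  (evtI (c_cvg e4) (c_cvg ltr01))).
exists N0 => N /hN0[[N0' b8] [hM [ce ce1]]].
have [B0 [mB0 PB0 hB0]] := y0 N0'.
have ch := chaining K0 (fun w => @cpath_driving N w N0') (fun t => @measurable_driving N t N0')
  (fun k i x => @tail N k i x N0').
have [B1 [mB1 PB1 hB1]] := ch r 0%N r0.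
have [B2 [mB2 PB2 hB2]] := ch 1 l ltr01.
have g0 : 0 <= Gm := ltW Gm0.
pose S3 i := [set w | (eta <= `|@A N (grid l i.+1) w - @A N (grid l i) w|)%R].
have mA (t : R) : measurable_fun setT (@A N t) by exact: (measurable_state_average p (cX N0')).
have mS3 i : measurable (S3 i).
  rewrite -[X in measurable X]setTI; apply: measurable_fun_le => //.
  by apply: measurableT_comp => //; exact: measurable_funB.
have PB3 : (P N (\bigcup_(i < (H * 2 ^ l)%N) S3 i) <= (e / 4)%:E)%E.
  apply: (prob_bigcup_lt (a := (64 * z ^+ 2 + 48 * z) / eta ^+ 4 / N%:R)) => //.
    by move=> i iH; exact: tailA.
  by rewrite mulrA.
have mB3 : measurable (\bigcup_(i < (H * 2 ^ l)%N) S3 i) by apply: bigcup_measurable => i _.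
have PB0' : (P N B0 <= 0%:E)%E by rewrite PB0.
exists (B0 `|` (B1 `|` (B2 `|` \bigcup_(i < (H * 2 ^ l)%N) S3 i))); split.
- by apply: measurableU => //; apply: measurableU => //; exact: measurableU.
- have := prob_setU_le mB0 (measurableU _ _ mB1 (measurableU _ _ mB2 mB3)) PB0'
    (prob_setU_le mB1 (measurableU _ _ mB2 mB3) PB1 (prob_setU_le mB2 mB3 PB2 PB3)).
  move=> h; apply: le_trans h _; rewrite lee_fin expr0 mulr1 expr1n divr1; lra.
move=> w /not_orP[n0 /not_orP[n1 /not_orP[n2 n3]]] t /andP[t0 tT].
have U0 : U N 0 w = 0.
  have e1 : @y N 0 w = c N by apply: contrapT => h; apply: n0; exact: hB0.
  by rewrite /driving_process /driving e1 tint_point subrr addr0.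
have [a1 a2] := hB1 w n1; have [b1 b2] := hB2 w n2.
have supU := sup_driving (ltW r0) U0 a1 a2.
rewrite mul1r in b1; rewrite mulr1 in b2.
have avg i : (i < H * 2 ^ l)%N -> `|tint (grid l i) (grid l i.+1) (fun s => gam (@X N (Num.max s 0) w) - gi)| <= eta.
  move=> iH; rewrite leNgt; apply/negP => h; apply: n3; exists i => //; rewrite /S3/=.
  have bA T' : bmeas T' (fun s => gam (@X N (Num.max s 0) w) - gi).
    by apply: bmeasB; [split; [exact: mg|exists Gm => s _; exact: gamB]|exact: bmeas_cst].
  have gle : grid l i <= grid l i.+1 :> R by rewrite /grid ler_wpM2r ?invr_ge0 ?exprn_ge0// ler_nat.
  rewrite /A /state_average (@tint_split _ (grid l i.+1) 0 (grid l i) (grid l i.+1) _ (bA _))// addrAC subrr add0r.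
  exact: ltW.
have := pathwise_averaging (@cy N w N0') (@mg N w N0') gi0 giG (fun s => gamB _) ce1 S0 supU b1 b2 (ltW eta0) avg t0 (le_trans tT TH).
move=> h; apply: le_trans h _; rewrite -YE.
move: cst heta ce; rewrite !mulrDr; lra.
Qed.

End ScaledModels.

(** * The limit process *)

(** The rate may vanish, and there its square root is only Hoelder of exponent 1/2 in time; the
    squared difference is still linear, which is what the isometry asks for. *)
Lemma dist_sqrt_sqr (R : realType) (a b : R) : 0 <= a -> 0 <= b ->
  (Num.sqrt a - Num.sqrt b) ^+ 2 <= `|a - b|.
Proof.
move=> a0 b0; have x0 := sqrtr_ge0 a; have y0 := sqrtr_ge0 b.
rewrite -{2}(sqr_sqrtr a0) -{2}(sqr_sqrtr b0); move: (Num.sqrt a) (Num.sqrt b) x0 y0 => x y x0 y0.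
rewrite subr_sqr normrM (ger0_norm (addr_ge0 x0 y0)) -real_normK ?num_real// expr2.
apply: ler_wpM2l => //; apply: le_trans (ler_normB _ _) _.
by rewrite !ger0_norm.
Qed.

Section LimitProcess.
Context {R : realType} {dO : measure_display} {Om : measurableType dO}.
Variables (P : probability Om R) (F : R -> set (set Om)) (B : R -> Om -> R).
Hypothesis fF : filtration F.
Hypothesis bB : brownian_motion P F B.
Variables (c r : R -> R) (C g : R) (M : R -> Om -> R).
Hypothesis g0 : 0 < g.
Hypothesis C0 : 0 <= C.
Hypothesis cr : forall t : R, 0 < t -> c t = Num.sqrt (r t).
Hypothesis rC : forall t : R, 0 <= t -> 0 <= r t <= C.
Hypothesis rL : forall s t : R, 0 <= s -> 0 <= t -> `|r t - r s| <= C * `|t - s|.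
Hypothesis sM : sde_solution P F B (fun _ _ m => - g * m) (fun t _ => c t) 0 M.

Definition limit_noise (t : R) (w : Om) : R := volterra g (fun t => M t w) t.
Local Notation U := limit_noise.

Let cM w : cpath (fun t => M t w). Proof. by have [_ h _ _] := sM; exact: h. Qed.

Let r0 t : 0 <= t -> 0 <= r t. Proof. by move=> /rC/andP[]. Qed.

Lemma cpath_limit_noise w : cpath (fun t => U t w).
Proof. exact: cpath_volterra. Qed.

Let sM_t (t : R) : 0 <= t -> smeas (F t) (M t).
Proof. by move=> t0; have [aM _ _ _] := sM; exact: adapted_smeas. Qed.

(** The path is frozen after [t], which makes it a jointly measurable process over [F t], taken as
    the ambient sigma-algebra; the time integral is then measurable for [F t]. *)
Lemma smeas_limit_noise (t : R) : 0 <= t -> smeas (F t) (U t).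
Proof.
move=> t0; pose T' := g_sigma_algebraType (F t).
pose cc (s : R) (w : T') : R := M (Num.min s t) w.
have mcc (s : R) : 0 <= s -> measurable_fun setT (cc s).
  move=> s0; have m0 : 0 <= Num.min s t by rewrite le_min s0.
  apply: (smeas_sub _ (sM_t m0)).
  by apply: filtration_mono => //; rewrite ge_min lexx orbT.
have rcc : right_continuous_paths cc.
  apply: cpath_right_continuous => w; apply/cpathP => s s0 e e0.
  have m0 : 0 <= Num.min s t by rewrite le_min s0.
  have /cpathP/(_ _ m0 _ e0)[q q0 hq] := @cM w.
  exists q => // x x0 xs; apply: hq; first by rewrite le_min x0.
  apply: le_lt_trans xs; rewrite /Num.min.
  case: ltP => h1; case: ltP => h2; rewrite ?subrr ?normr0//.
    rewrite (ler0_norm (_ : x - t <= 0)) ?subr_le0 ?(ltW h1)//.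
    by rewrite (ler0_norm (_ : x - s <= 0)) ?subr_le0 ?(le_trans (ltW h1))//; lra.
  rewrite (ger0_norm (_ : 0 <= t - s)) ?subr_ge0 ?(ltW h2)//.
  by rewrite (ger0_norm (_ : 0 <= x - s)) ?subr_ge0 ?(le_trans (ltW h2))//; lra.
have jcc := right_continuous_joint mcc rcc.
apply: (measurable_funD (sM_t t0)); apply: measurable_funM; first exact: measurable_cst.
have := measurable_time_Rintegral t jcc.
rewrite (_ : (fun w => _) = (fun w : T' => tint 0 t (fun s => M (Num.max s 0) w))); first exact.
apply/funext => w; apply: tint_eq => s /andP[s0 st].
by rewrite /cc (max_idPl s0) (min_idPl st).
Qed.

Lemma measurable_limit_noise (t : R) : 0 <= t -> measurable_fun setT (U t).
Proof. by move=> t0; apply: smeas_meas (smeas_limit_noise t0); exact: filtration_measurable. Qed.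

Lemma limit_noise_ito (t : R) : 0 <= t ->
  exists2 J, ito_integral P F B (fun t _ => c t) t J & {ae P, forall w, U t w = J w}.
Proof.
move=> t0; have [_ _ _ /(_ t t0)[J iJ hJ]] := sM; exists J => //.
apply: filterS hJ => w; rewrite /limit_noise /volterra add0r => ->.
rewrite -/(tint 0 t (fun s => - g * M s w)) (@tint_eq _ 0 t _ (fun s => - g * M (Num.max s 0) w)).
  by rewrite (tintZ (lexx 0) (lexx t) _ (cpath_bmeas t (@cM w))); ring.
by move=> s /andP[s0 _]; rewrite (max_idPl s0).
Qed.

Lemma limit_noise0 : {ae P, forall w, U 0 w = 0}.
Proof.
have [_ _ h _] := sM; apply: filterS h => w; rewrite /limit_noise /volterra => ->.
by rewrite tint_point mulr0 addr0.
Qed.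

(** A continuous version of [c], with a value at time 0 as well; [cr] prescribes [c] at positive
    times only. *)
Let ct (s : R) : R := Num.sqrt (r (Num.max s 0)).

Let cct (s : R) : 0 < s -> c s = ct s.
Proof. by move=> s0; rewrite cr// /ct (max_idPl (ltW s0)). Qed.

Let mct : joint_measurable (fun s (_ : Om) => ct s).
Proof.
apply: joint_measurable_time; apply: continuous_measurable_fun.
have cr' : continuous (fun s : R => r (Num.max s 0)); last first.
  move=> s; rewrite (_ : ct = Num.sqrt \o (fun s => r (Num.max s 0)))//.
  by apply: continuous_comp; [exact: cr'|exact: sqrt_continuous].
apply: cpath_ext; apply/cpathP => t t0 e e0.
have C1 : 0 < C + 1 by rewrite ltr_wpDl.
exists (e / (C + 1)); first by rewrite divr_gt0.
move=> s s0 st; apply: le_trans (rL t0 s0) _.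
apply: (@le_trans _ _ ((C + 1) * (e / (C + 1)))); last by rewrite mulrCA divff ?mulr1// gt_eqF.
by apply: ler_pM => //; [rewrite lerDl|exact: ltW].
Qed.

Let ct_sqr (t : R) : 0 <= t -> ct t ^+ 2 = r t.
Proof. by move=> t0; rewrite /ct (max_idPl t0) sqr_sqrtr// r0. Qed.

Let ctC (t : R) : 0 <= t -> `|ct t| <= 1 + C.
Proof.
move=> t0; have /andP[_ h] := rC t0; rewrite ger0_norm ?sqrtr_ge0//.
have := sqr_ge0 (ct t - 1); rewrite sqrrB1 ct_sqr//; have := sqrtr_ge0 (r (Num.max t 0)); rewrite -/(ct t); lra.
Qed.

Let ct_dist (s t : R) : 0 <= s -> 0 <= t -> (ct s - ct t) ^+ 2 <= C * `|s - t|.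
Proof.
move=> s0 t0; rewrite /ct (max_idPl s0) (max_idPl t0); apply: le_trans (dist_sqrt_sqr _ _) _; rewrite ?r0//.
exact: rL.
Qed.

Let noise_sum (n : nat) (tau : R) w := \sum_(k < n) ct (k%:R * tau) * (B (k.+1%:R * tau) w - B (k%:R * tau) w).

Let noise_approx (n : nat) (tau t : R) : 0 < tau -> n%:R * tau = t ->
  (\int[P]_w ((U t w - noise_sum n tau w) ^+ 2)%:E <= (4 * (C * tau) * t)%:E)%E.
Proof.
move=> tau0 nt; have t0 : 0 <= t by rewrite -nt mulr_ge0// ltW.
have kt0 k : 0 <= k%:R * tau by rewrite mulr_ge0// ltW.
have [J iJ hJ] := limit_noise_ito t0.
have mJ : measurable_fun setT J by case: iJ.
have mS : measurable_fun setT (noise_sum n tau).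
  apply: measurable_sum => k; apply: measurable_funM => //.
  by apply: measurable_funB; exact: (measurable_brownian fF bB).
have -> : (\int[P]_w ((U t w - noise_sum n tau w) ^+ 2)%:E = \int[P]_w ((J w - noise_sum n tau w) ^+ 2)%:E)%E.
  apply: ae_eq_integral => //.
  - by apply/measurable_EFinP; apply: measurable_funX; apply: measurable_funB => //; exact: measurable_limit_noise.
  - by apply/measurable_EFinP; apply: measurable_funX; exact: measurable_funB.
  by apply: filterS hJ => w -> .
apply: (ito_grid_approximation fF bB iJ (c' := fun s _ => ct s) _ mct tau0 nt (xi := fun k _ => ct (k%:R * tau)) (K := 1 + C)).
- by move=> s w s0 _; exact: cct.
- by move=> k _; exact: measurable_cst.
- by move=> k w; exact: ctC.
move=> k s kn ks sk; rewrite integral_cst// [X in (_ * X)%E]probability_setT mule1 lee_fin.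
apply: le_trans (ct_dist (le_trans (kt0 k) (ltW ks)) (kt0 k)) _; apply: ler_wpM2l => //.
by rewrite ger0_norm ?subr_ge0 ?(ltW ks)//; move: sk; rewrite -natr1 mulrDl; lra.
Qed.

Let L4_noise_sum n (tau : R) : 0 < tau -> L4 P (noise_sum n tau).
Proof.
move=> tau0; apply: L4_sum => k; apply: L4Z.
have t0 : 0 <= k%:R * tau by rewrite mulr_ge0// ltW.
have st : k%:R * tau < k.+1%:R * tau by rewrite ltr_pM2r// ltr_nat.
by have [] := brownian_moments fF bB t0 st.
Qed.

Lemma limit_noise_square (t : R) : 0 <= t -> intg P (fun w => U t w ^+ 2).
Proof.
move=> t0.
have [n [tau [tau0 nt]]] : exists n (tau : R), 0 < tau /\ n%:R * tau = t.
  move: t0; rewrite le_eqVlt => /orP[/eqP <-|t0]; first by exists 0%N, 1; rewrite mul0r.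
  by exists 1%N, t; rewrite mul1r.
have h := noise_approx tau0 nt.
have mS := (L4_noise_sum n tau0).1.
have mU := measurable_limit_noise t0.
have mD : measurable_fun setT (fun w => (U t w - noise_sum n tau w) ^+ 2).
  by apply: measurable_funX; exact: measurable_funB.
have i1 : intg P (fun w => (U t w - noise_sum n tau w) ^+ 2).
  apply/integrableP; split; first exact/measurable_EFinP.
  rewrite (eq_integral (fun w => ((U t w - noise_sum n tau w) ^+ 2)%:E)).
    exact: le_lt_trans h (ltry _).
  by move=> w _; rewrite /= ger0_norm ?sqr_ge0.
have i2 := L4_intg2 (L4_noise_sum n tau0).
apply: (intg_le (g := fun w => 2 * (U t w - noise_sum n tau w) ^+ 2 + 2 * noise_sum n tau w ^+ 2)).
- exact: measurable_funX.
- by apply: intgD; exact: intgZ.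
move=> w; rewrite ger0_norm ?sqr_ge0//.
by have := sqr_le_double (U t w) (noise_sum n tau w) 0; rewrite !subr0.
Qed.

(** Grid sums of [ct] against Brownian increments are within [delta] of the noise by Chebyshev's
    inequality. The conditional variance is the rate itself, so averaging costs only its Lipschitz
    variation and no permanent error remains. *)
Lemma limit_noise_discretization (H n0 : nat) (delta : R) : 0 < delta -> exists n s q, (n0 <= n)%N /\
  discretization P U n H (fun k => F (k%:R * 2 ^- n)) s q C delta r delta C 0 delta.
Proof.
move=> d0.
pose k1 := 3 * C ^+ 2 / delta + 4 * C * H%:R / delta ^+ 3.
have a1 : 0 <= 3 * C ^+ 2 / delta by rewrite divr_ge0 ?mulr_ge0 ?sqr_ge0// ltW.
have a2 : 0 <= 4 * C * H%:R / delta ^+ 3 by rewrite divr_ge0 ?mulr_ge0 ?exprn_ge0// ltW.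
have [n [nn hn]] := dyadic_step_small k1 n0.
pose tau : R := 2 ^- n; rewrite -/tau in hn.
have tau0 : 0 < tau by rewrite invr_gt0 exprn_gt0.
have s1 : 3 * C ^+ 2 / delta * tau <= 1.
  by apply: le_trans hn; apply: ler_wpM2r; [exact: ltW|rewrite lerDl].
have s2 : 4 * C * H%:R / delta ^+ 3 * tau <= 1.
  by apply: le_trans hn; apply: ler_wpM2r; [exact: ltW|rewrite lerDr].
have kt0 k : 0 <= k%:R * tau by rewrite mulr_ge0// ltW.
have hC k : ct (k%:R * tau) ^+ 2 <= C by rewrite ct_sqr//; have /andP[] := rC (kt0 k).
have mi := deterministic_martingale fF bB tau0 hC.
exists n, (fun k w => ct (k%:R * tau) * (B (k.+1%:R * tau) w - B (k%:R * tau) w)), (fun k _ => ct (k%:R * tau) ^+ 2).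
split => //; split.
- apply: mi_weaken mi => //; first exact: ltW.
  by move: s1; rewrite mulrAC ler_pdivrMr// mul1r.
- move=> a m eta K am se eK.
  have K0 : 0 <= K by exact: le_trans (eK point).
  have ie : intg P eta by apply: intg_bd eK; apply: smeas_meas se; exact: filtration_measurable.
  rewrite -/tau.
  have -> : tau * \sum_(a <= k < a + m) Ex P (fun w => eta w * ct (k%:R * tau) ^+ 2) - m%:R * tau * r (a%:R * tau) * Ex P eta =
     tau * \sum_(a <= k < a + m) ((r (k%:R * tau) - r (a%:R * tau)) * Ex P eta).
    have -> : m%:R * tau * r (a%:R * tau) * Ex P eta = tau * \sum_(a <= k < a + m) r (a%:R * tau) * Ex P eta.
      by rewrite sumr_const_nat addKn -mulr_natl; ring.
    rewrite -mulrBr -sumrB; congr (_ * _); apply: eq_bigr => k _.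
    rewrite (@Ex_eq _ _ _ P _ (fun w => r (k%:R * tau) * eta w)) ?ExZ ?mulrBl//.
    by move=> w; rewrite ct_sqr// mulrC.
  rewrite normrM (gtr0_norm tau0).
  have b1 : `|\sum_(a <= k < a + m) ((r (k%:R * tau) - r (a%:R * tau)) * Ex P eta)| <= m%:R * (C * (m%:R * tau) * K).
    apply: le_trans (ler_norm_sum _ _ _) _.
    apply: (@le_trans _ _ (\sum_(a <= k < a + m) (C * (m%:R * tau) * K))).
      rewrite big_nat [leRHS]big_nat; apply: ler_sum => k /andP[ak km].
      rewrite normrM; apply: ler_pM => //; last exact: Ex_bd.
      apply: le_trans (rL (kt0 a) (kt0 k)) _; apply: ler_wpM2l => //.
      rewrite -mulrBl normrM (gtr0_norm tau0); apply: ler_wpM2r; first exact: ltW.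
      by rewrite -natrB// ger0_norm// ler_nat leq_subLR ltnW.
    by rewrite sumr_const_nat addKn -[leLHS]mulr_natl.
  apply: le_trans (ler_wpM2l (ltW tau0) b1) _.
  rewrite [leLHS](_ : _ = K * (C * (m%:R * tau) ^+ 2)); last by ring.
  by apply: ler_wpM2l => //; rewrite lerDr ltW.
move=> i iH; rewrite -/tau add0r.
have it0 := kt0 i.
have bE w : block (fun k w => ct (k%:R * tau) * (B (k.+1%:R * tau) w - B (k%:R * tau) w)) 0 i w = noise_sum i tau w.
  by rewrite /block big_mkord.
have mU := measurable_limit_noise it0.
have mS := (L4_noise_sum i tau0).1.
rewrite (_ : [set w | _] = [set w | (delta < `|U (i%:R * tau) w - noise_sum i tau w|)%R]); last first.
  by apply/seteqP; split => w /=; rewrite bE.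
have h := noise_approx tau0 (erefl (i%:R * tau)).
have d20 : 0 < delta ^+ 2 by exact: exprn_gt0.
apply: le_trans (prob_markov (g := fun w => ((U (i%:R * tau) w - noise_sum i tau w) ^+ 2)%:E) d20 _ _ _ _ h) _.
- apply: measurable_set_lt => //; apply: measurableT_comp => //; exact: measurable_funB.
- by apply/measurable_EFinP; apply: measurable_funX; exact: measurable_funB.
- by move=> w; rewrite lee_fin sqr_ge0.
- move=> w /= hw; rewrite lee_fin -[leRHS]real_normK ?num_real//.
  by rewrite lerXn2r ?nnegrE ?(ltW d0)// ltW.
rewrite lee_fin ler_pdivrMr//.
have iHH : i%:R * tau <= H%:R by rewrite /tau ler_pdivrMr ?exprn_gt0// -natrX -natrM ler_nat.
apply: (@le_trans _ _ (4 * (C * tau) * H%:R)).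
  by apply: ler_wpM2l => //; apply: mulr_ge0 => //; apply: mulr_ge0 => //; exact: ltW.
move: s2; rewrite mulrAC ler_pdivrMr ?exprn_gt0// mul1r => s2.
by rewrite -exprS; apply: le_trans s2; rewrite le_eqVlt; apply/orP; left; apply/eqP; ring.
Qed.

End LimitProcess.

(** * Scaling exponents and conclusion *)

Section ScalingLimit.
Context {R : realType}.

Lemma evt_powR (a e : R) : 0 < a -> 0 < e -> evt (fun N => N%:R `^ (- a) <= e).
Proof.
move=> a0 e0; exists (Num.truncn (e^-1 `^ a^-1)).+1 => N hN.
have N0 : 0 < N%:R :> R by rewrite ltr0n; exact: leq_trans hN.
rewrite powRN -[leRHS]invrK lef_pV2 ?posrE ?invr_gt0 ?powR_gt0//.
have -> : e^-1 = (e^-1 `^ a^-1) `^ a by rewrite -powRrM mulVf ?gt_eqF// powRr1// invr_ge0 ltW.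
apply: ge0_ler_powR; rewrite ?nnegrE ?powR_ge0 ?(ltW a0) ?(ltW N0)//.
by apply: ltW; apply: lt_le_trans (truncnS_gt _) _; rewrite ler_nat.
Qed.

(** The factor [lam] of the chain: [lam * N = N^(h - beta)] multiplies the drift integral, and
    [lam^2 * N] is the weight of [V'] in the variance rate. Likewise [noise_scale ^+ 2] is the
    weight of [sigma_infty^2]. *)
Definition drift_scale (h : R) (N : nat) : R := N%:R `^ (h - beta_exponent h - 1).
Definition noise_scale (h : R) (N : nat) : R := N%:R `^ (- beta_exponent h) * N%:R `^ (h / 2).

Variable h : R.
Hypothesis h0 : 0 < h.
Local Notation beta := (beta_exponent h).

Let Nne (N : nat) : (0 < N)%N -> N%:R != 0 :> R.
Proof. by rewrite pnatr_eq0 lt0n. Qed.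

Let powR_add (N : nat) (x y : R) : (0 < N)%N -> N%:R `^ x * N%:R `^ y = N%:R `^ (x + y) :> R.
Proof. by move=> N0; rewrite powRD// Nne// implybT. Qed.

Lemma beta_gt0 : 0 < beta.
Proof. by rewrite /beta_exponent lt_max divr_gt0. Qed.

Lemma drift_scaleM N : (0 < N)%N -> drift_scale h N * N%:R = N%:R `^ (- beta) * N%:R `^ h.
Proof.
move=> N0; rewrite /drift_scale -{2}(powRr1 (ler0n R N)) !powR_add//; congr (_ `^ _); ring.
Qed.

Lemma drift_scale_sqr N : (0 < N)%N -> drift_scale h N ^+ 2 * N%:R = N%:R `^ (2 * h - 2 * beta - 1).
Proof.
move=> N0; rewrite /drift_scale -powR_mulrn ?powR_ge0// -powRrM -{2}(powRr1 (ler0n R N)) powR_add//.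
by congr (_ `^ _); ring.
Qed.

Lemma noise_scale_sqr N : (0 < N)%N -> noise_scale h N ^+ 2 = N%:R `^ (h - 2 * beta).
Proof.
move=> N0; rewrite /noise_scale powR_add// -powR_mulrn ?powR_ge0// -powRrM; congr (_ `^ _); by field.
Qed.

Let beta_low : h <= 1 -> beta = h / 2.
Proof. by move=> h1; rewrite /beta_exponent; apply/max_idPl; lra. Qed.

Let beta_high : 1 <= h -> beta = h - 2^-1.
Proof. by move=> h1; rewrite /beta_exponent; apply/max_idPr; lra. Qed.

Lemma drift_scale_high N : (0 < N)%N -> 1 <= h -> drift_scale h N ^+ 2 * N%:R = 1.
Proof.
move=> N0 h1; rewrite drift_scale_sqr// beta_high// (_ : _ - _ = 0) ?powRr0//; by field.
Qed.

Lemma noise_scale_low N : (0 < N)%N -> h <= 1 -> noise_scale h N ^+ 2 = 1.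
Proof.
move=> N0 h1; rewrite noise_scale_sqr// beta_low// (_ : _ - _ = 0) ?powRr0//; by field.
Qed.

Let powR_le1 (N : nat) (x : R) : (0 < N)%N -> x <= 0 -> N%:R `^ x <= 1 :> R.
Proof.
move=> N0 x0; have n1 : 1 <= N%:R :> R by rewrite ler1n.
by have := ler_powR n1 x0; rewrite powRr0.
Qed.

Lemma drift_scale_le1 N : (0 < N)%N -> drift_scale h N ^+ 2 * N%:R <= 1.
Proof.
move=> N0; have [h1|/ltW h1] := leP 1 h; first by rewrite drift_scale_high.
by rewrite drift_scale_sqr//; apply: powR_le1 => //; rewrite beta_low//; lra.
Qed.

Lemma noise_scale_le1 N : (0 < N)%N -> noise_scale h N ^+ 2 <= 1.
Proof.
move=> N0; have [h1|/ltW h1] := leP h 1; first by rewrite noise_scale_low.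
by rewrite noise_scale_sqr//; apply: powR_le1 => //; rewrite beta_high//; lra.
Qed.

Lemma drift_scale_cvg0 (e : R) : h < 1 -> 0 < e -> evt (fun N => drift_scale h N ^+ 2 * N%:R <= e).
Proof.
move=> h1 e0; have a0 : 0 < 1 - h by lra.
have [N0 hN] := evtI (evt_ge 1) (evt_powR a0 e0).
exists N0 => N /hN[N1 hN']; rewrite drift_scale_sqr// beta_low ?(ltW h1)//.
by rewrite (_ : _ - 1 = - (1 - h))//; field.
Qed.

Lemma noise_scale_cvg0 (e : R) : 1 < h -> 0 < e -> evt (fun N => noise_scale h N ^+ 2 <= e).
Proof.
move=> h1 e0; have a0 : 0 < h - 1 by lra.
have [N0 hN] := evtI (evt_ge 1) (evt_powR a0 e0).
exists N0 => N /hN[N1 hN']; rewrite noise_scale_sqr// beta_high ?(ltW h1)//.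
by rewrite (_ : h - _ = - (h - 1))//; field.
Qed.

Lemma drift_scale_small (e : R) : 0 < e -> evt (fun N => drift_scale h N <= e).
Proof.
move=> e0; have [N0 hN] := evtI (evt_ge 1) (evt_div 1 (exprn_gt0 2 e0)).
exists N0 => N /hN[N1 hN']; rewrite -(@ler_pXn2r _ 2) ?nnegrE ?powR_ge0 ?(ltW e0)//.
by apply: le_trans hN'; rewrite ler_pdivlMr ?ltr0n//; exact: drift_scale_le1.
Qed.

End ScalingLimit.

(** * The drift around the averaged trajectory, its bounds, and the derivative of [Vfun] *)

Section CoupledParameters.
Context {R : realType} {d : nat}.
Variables (Q : 'M[R]_d) (p alpha gamma sigma : 'cV[R]_d).
Hypotheses (gQ : is_generator Q) (up : unique_invariant_distribution Q p).
Hypothesis gamma0 : forall i, 0 < gamma i 0.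

Lemma dotvE (a b : 'cV[R]_d) : dotv a b = pav a (fun i => b i 0).
Proof. by rewrite /dotv /pav mxE; apply: eq_bigr => i _; rewrite mxE. Qed.

Lemma dotv_indicator (a : 'cV[R]_d) i : dotv a (state_indicator i) = a i 0.
Proof.
rewrite dotvE /pav (bigD1 i)//= big1 ?addr0; first by rewrite mxE !eqxx mulr1.
by move=> j /negbTE ji; rewrite mxE ji mulr0.
Qed.

Local Notation gi := (dotv p gamma).
Local Notation rho := (varrho p alpha gamma).

Definition centred_drift (s : R) (i : 'I_d) : R := alpha i 0 - gamma i 0 * rho s.
Local Notation f := centred_drift.

Lemma gamma_infty_gt0 : 0 < gi.
Proof.
have [/invariant_distributionP[p0 p1 _] _] := up.
rewrite dotvE lt_neqAle; apply/andP; split; last first.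
  by apply: sumr_ge0 => i _; rewrite mulr_ge0// ltW.
apply/negP => /eqP/esym/eqP; rewrite psumr_eq0; last by move=> i _; rewrite mulr_ge0// ltW.
move=> /allP h; have : \sum_i p i 0 = 0.
  apply: big1 => i _; have := h i (mem_index_enum i); rewrite /= mulf_eq0 (gt_eqF (gamma0 i)) orbF.
  by move/eqP.
by rewrite p1 => /eqP; rewrite oner_eq0.
Qed.

Lemma pav_centred_drift s : pav p (f s) = dotv p alpha - gi * rho s.
Proof.
rewrite /f pavB -dotvE; congr (_ - _).
rewrite (_ : (fun j => _) = (fun j => rho s * gamma j 0)); last by apply/funext => j; rewrite mulrC.
by rewrite pavZ -dotvE mulrC.
Qed.

(** [varrho] solves the averaged equation, so the stationary mean of [centred_drift] integrates to
    [varrho] ([tint_pav_drift]): subtracting [N^h varrho] from the process is the same as centring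
    its drift. *)
Lemma varrho_is_derive (s : R) : is_derive s (1 : R) rho (dotv p alpha - gi * rho s).
Proof.
have g0 := gamma_infty_gt0; rewrite /varrho.
by apply: is_derive_eq; rewrite /GRing.scale/=; field; rewrite gt_eqF.
Qed.

Lemma varrho0 : rho 0 = 0.
Proof. by rewrite /varrho mulr0 expR0 subrr mulr0. Qed.

Lemma continuous_varrho : continuous rho.
Proof. exact: is_derive_continuous varrho_is_derive. Qed.

Lemma tint_pav_drift (t : R) : 0 <= t -> tint 0 t (fun s => pav p (f s)) = rho t.
Proof.
move=> t0; transitivity (tint 0 t (fun s => dotv p alpha - gi * rho s)).
  by apply: tint_eq => s _; exact: pav_centred_drift.
rewrite /tint (FTC_Rintegral t0 varrho_is_derive) ?varrho0 ?subr0//.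
move=> s; apply: cvgB; first exact: cvg_cst.
by apply: cvgM; [exact: cvg_cst|exact: continuous_varrho].
Qed.

Definition drift_lip : R := (\sum_i gamma i 0) * `|dotv p alpha|.
Definition drift_bound : R := \sum_i `|alpha i 0| + (\sum_i gamma i 0) * `|dotv p alpha / gi|.

Let G0 : 0 <= \sum_i gamma i 0.
Proof. by apply: sumr_ge0 => i _; exact: ltW. Qed.

Let gle i : gamma i 0 <= \sum_i gamma i 0.
Proof. by rewrite (bigD1 i)//= lerDl; apply: sumr_ge0 => j _; exact: ltW. Qed.

Lemma drift_lip_ge0 : 0 <= drift_lip. Proof. exact: mulr_ge0. Qed.

Lemma drift_bound_ge0 : 0 <= drift_bound.
Proof. by apply: addr_ge0; [exact: sumr_ge0|exact: mulr_ge0]. Qed.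

Lemma drift_boundP (t : R) i : 0 <= t -> `|f t i| <= drift_bound.
Proof.
move=> t0; have g0 := gamma_infty_gt0; apply: le_trans (ler_normB _ _) _; apply: lerD.
  by rewrite (bigD1 i)//= lerDl; exact: sumr_ge0.
rewrite normrM (gtr0_norm (gamma0 i)); apply: ler_pM => //; first exact: ltW.
rewrite /varrho normrM ler_piMr// ger0_norm; first by rewrite gerBl expR_ge0.
by rewrite subr_ge0 -expR0 ler_expR mulNr oppr_le0 mulr_ge0// ltW.
Qed.

Let rho_mono (s t : R) : 0 <= s -> s <= t -> `|rho t - rho s| <= `|dotv p alpha| * (t - s).
Proof.
move=> s0 st; have g0 := gamma_infty_gt0.
have -> : rho t - rho s = dotv p alpha * ((expR (- gi * s) - expR (- gi * t)) / gi).
  by rewrite /varrho; field; rewrite gt_eqF.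
rewrite normrM; apply: ler_wpM2l => //.
have e1 : expR (- gi * t) <= expR (- gi * s).
  by rewrite ler_expR !mulNr lerN2; apply: ler_wpM2l => //; exact: ltW.
rewrite ger0_norm ?divr_ge0 ?subr_ge0 ?(ltW g0)// ler_pdivrMr//.
have -> : expR (- gi * t) = expR (- gi * s) * expR (- (gi * (t - s))).
  by rewrite -expRD; congr expR; ring.
have e2 : expR (- gi * s) <= 1 by rewrite -expR0 ler_expR mulNr oppr_le0 mulr_ge0// ltW.
have e3 := expR_ge1Dx (- (gi * (t - s))).
have z0 : 0 <= gi * (t - s) by rewrite mulr_ge0 ?(ltW g0)// subr_ge0.
rewrite -{1}(mulr1 (expR (- gi * s))) -mulrBr.
apply: (@le_trans _ _ (1 * (gi * (t - s)))); last by rewrite mul1r mulrC.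
apply: ler_pM; rewrite ?expR_ge0//; last by lra.
by rewrite subr_ge0 -expR0 ler_expR oppr_le0.
Qed.

Lemma drift_lipP (s t : R) i : 0 <= s -> 0 <= t -> `|f t i - f s i| <= drift_lip * `|t - s|.
Proof.
move=> s0 t0; rewrite (_ : f t i - f s i = - (gamma i 0 * (rho t - rho s))); last by rewrite /f; ring.
rewrite normrN normrM (gtr0_norm (gamma0 i)) /drift_lip -mulrA; apply: ler_pM => //; first exact: ltW.
have [st|/ltW ts] := leP s t; first by rewrite (ger0_norm (_ : 0 <= t - s)) ?subr_ge0//; exact: rho_mono.
by rewrite distrC (distrC t) (ger0_norm (_ : 0 <= s - t)) ?subr_ge0//; exact: rho_mono.
Qed.

Definition volatility (i : 'I_d) : R := sigma i 0.
Local Notation u := volatility.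

Local Notation fB := drift_boundP.
Local Notation fL := drift_lipP.

Lemma sigma_infty_sqr : dotv p (map_mx (fun x => x ^+ 2) sigma) = pav p (fun i => u i ^+ 2).
Proof. by rewrite dotvE; congr pav; apply/funext => i; rewrite mxE. Qed.

Lemma sigma_inftyE : sigma_infty p sigma ^+ 2 = pav p (fun i => u i ^+ 2).
Proof.
rewrite /sigma_infty sigma_infty_sqr sqr_sqrtr//; have [/invariant_distributionP[p0 _ _] _] := up.
by apply: sumr_ge0 => i _; rewrite mulr_ge0// sqr_ge0.
Qed.

Definition averaged_rate (s : R) : R := mean_rate Q p f u 1 0 s.

Lemma averaged_rateE s : averaged_rate s = 2 * pav p (fun i => f s i * mop (deviation_matrix Q p) (f s) i).
Proof. by rewrite /averaged_rate (mean_rateE gQ up) mul1r mul0r addr0. Qed.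

Lemma mean_rate_split (A2 B2 s : R) :
  mean_rate Q p f u A2 B2 s = A2 * averaged_rate s + B2 * pav p (fun i => u i ^+ 2).
Proof. by rewrite averaged_rateE (mean_rateE gQ up). Qed.

(** Symmetrization doubles [p.(f D f)]: the transposed half is the same double sum with its indices
    exchanged. *)
Lemma Vfun_integrand (s : R) (D := deviation_matrix Q p) (v := alpha - rho s *: gamma) :
  dotv v ((diag_mx p^T *m D + D^T *m diag_mx p^T) *m v) = averaged_rate s.
Proof.
have vE i : v i 0 = f s i by rewrite !mxE mulrC.
rewrite averaged_rateE -/D dotvE mulmxDl /pav mulr_natl mulr2n.
have e1 i : (diag_mx p^T *m D *m v) i 0 = p i 0 * mop D (f s) i.
  rewrite -mulmxA mul_diag_mx mxE mxE; congr (_ * _); rewrite mxE /mop.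
  by apply: eq_bigr => j _; rewrite vE.
have e2 i : (D^T *m diag_mx p^T *m v) i 0 = \sum_j D j i * (p j 0 * f s j).
  rewrite -mulmxA mxE; apply: eq_bigr => j _; rewrite mul_diag_mx mxE.
  by rewrite vE ![_^T _ _]mxE.
have -> : \sum_i v i 0 * (diag_mx p^T *m D *m v + D^T *m diag_mx p^T *m v) i 0 =
  \sum_i f s i * (p i 0 * mop D (f s) i) + \sum_i f s i * \sum_j D j i * (p j 0 * f s j).
  by rewrite -big_split; apply: eq_bigr => i _; rewrite vE [X in _ * X]mxE e1 e2 mulrDr.
congr (_ + _); first by apply: eq_bigr => i _; rewrite mulrCA.
under eq_bigr do rewrite mulr_sumr.
rewrite exchange_big; apply: eq_bigr => j _; rewrite /mop !mulr_sumr; apply: eq_bigr => i _; ring.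
Qed.

Let B0 := drift_bound_ge0.
Let L0 := drift_lip_ge0.

Lemma averaged_rate_lip (s t : R) : 0 <= s -> 0 <= t ->
  `|averaged_rate t - averaged_rate s| <= lV Q p drift_bound drift_lip * `|t - s|.
Proof.
move=> s0 t0; have := mean_rate_lip up u B0 L0 fB fL ler01 (lexx 0) s0 t0.
by rewrite addr0 mulr1.
Qed.

Lemma cpath_averaged_rate : cpath averaged_rate.
Proof.
apply/cpathP => t t0 e e0; set K := lV Q p drift_bound drift_lip.
have K0 : 0 <= K by exact: lV_ge0.
have K1 : 0 < K + 1 by rewrite ltr_wpDl.
exists (e / (K + 1)); first by rewrite divr_gt0.
move=> s s0 st; apply: le_trans (averaged_rate_lip t0 s0) _; rewrite -/K.
apply: (@le_trans _ _ ((K + 1) * (e / (K + 1)))); last by rewrite mulrCA divff ?mulr1// gt_eqF.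
by apply: ler_pM => //; [rewrite lerDl|exact: ltW].
Qed.

(** Near a positive time [Vfun] coincides with [primitive averaged_rate], which is differentiable
    everywhere. *)
Lemma Vfun_derive1 (t : R) : 0 < t -> derive1 (Vfun Q p alpha gamma) t = averaged_rate t.
Proof.
move=> t0; rewrite derive1E.
have dp := primitive_is_derive t cpath_averaged_rate.
rewrite (@near_eq_derive _ _ _ _ (primitive averaged_rate)).
  by rewrite derive_val (max_idPl (ltW t0)).
apply/nbhs_ballP; exists t => //= x; rewrite /ball/= => tx.
have x0 : 0 <= x by move: tx; rewrite ltr_norml; lra.
rewrite /primitive x0 /Vfun; apply: tint_eq => s /andP[s0 _].
by rewrite (max_idPl s0) -Vfun_integrand.
Qed.

Lemma averaged_rate_bound t : 0 <= t -> `|averaged_rate t| <= cV Q p drift_bound + cU u.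
Proof.
by move=> t0; have := mean_rate_bound up u B0 fB ler01 (lexx 0) t0; rewrite addr0 mulr1.
Qed.

End CoupledParameters.

(** * The scaled process in all three regimes, for limiting weights [a] and [b] *)

Section CoreConvergence.
Context {R : realType} {d : nat}.
Variables (Q : 'M[R]_d) (p p0 alpha gamma sigma : 'cV[R]_d) (h m0 : R).
Context {dO : nat -> measure_display} {Om : forall N, measurableType (dO N)}.
Variables (P : forall N, probability (Om N) R) (F : forall N, R -> set (set (Om N))).
Variables (B : forall N, R -> Om N -> R) (X : forall N, R -> Om N -> 'I_d) (M : forall N, R -> Om N -> R).
Context {dO' : measure_display} {Om' : measurableType dO'}.
Variables (P' : probability Om' R) (F' : R -> set (set Om')) (B' : R -> Om' -> R) (M2 : R -> Om' -> R).
Hypotheses (gQ : is_generator Q) (up : unique_invariant_distribution Q p).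
Hypothesis gamma0 : forall i, 0 < gamma i 0.
Hypothesis h0 : 0 < h.
Hypothesis hyp : forall N, (0 < N)%N ->
  filtration (@F N) /\
  brownian_motion (P N) (@F N) (@B N) /\
  markov_chain (P N) (N%:R *: Q) p0 (@X N) /\
  adapted setT (@F N) (@X N) /\
  independent_processes (P N) setT (@X N) borelR (@B N) /\
  mmou (P N) (@F N) (@B N) (@X N) ((N%:R `^ h) *: alpha) gamma ((N%:R `^ (h / 2)) *: sigma) m0 (@M N).
Hypothesis fF' : filtration F'.
Hypothesis bB' : brownian_motion P' F' B'.

Local Notation gi := (dotv p gamma).
Local Notation rho := (varrho p alpha gamma).
Local Notation f := (centred_drift p alpha gamma).
Local Notation u := (volatility sigma).
Local Notation beta := (beta_exponent h).
Local Notation Fb := (drift_bound p alpha gamma).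
Local Notation Lf := (drift_lip p alpha gamma).

Definition scaled_process N (t : R) (w : Om N) : R := N%:R `^ (- beta) * (@M N t w - N%:R `^ h * rho t).
Local Notation y := scaled_process.
Let cN (N : nat) : R := N%:R `^ (- beta) * m0.
Let gam (i : 'I_d) : R := gamma i 0.

Let gi0 : 0 < gi. Proof. exact: gamma_infty_gt0 up gamma0. Qed.
Let giE : pav p gam = gi. Proof. by rewrite dotvE. Qed.

Let cM N (w : Om N) : (0 < N)%N -> cpath (fun t => @M N t w).
Proof. by move=> /hyp[_ [_ [_ [_ [_ [_ h' _ _]]]]]]; exact: h'. Qed.

Let crho : cpath rho.
Proof. by apply: (@continuous_cpath _ rho) => //; exact: continuous_varrho up gamma0. Qed.

Lemma cpath_scaled N (w : Om N) : (0 < N)%N -> cpath (fun t => @y N t w).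
Proof.
move=> N0; apply: cpathZ; apply: cpathD; first exact: cM.
rewrite (_ : (fun t => _) = (fun t => - N%:R `^ h * rho t)); first exact: cpathZ.
by apply/funext => t; rewrite mulNr.
Qed.

Lemma measurable_scaled N (t : R) : (0 < N)%N -> 0 <= t -> measurable_fun setT (@y N t).
Proof.
move=> N0 t0; have [fF [_ [_ [_ [_ [aM _ _ _]]]]]] := hyp N0.
apply: measurable_funM => //; apply: measurable_funB => //.
by apply: smeas_meas (adapted_smeas fF aM t0); exact: filtration_measurable.
Qed.

Let noise N (t : R) : (0 < N)%N -> 0 <= t -> exists J,
  ito_integral (P N) (@F N) (@B N) (fun t w => N%:R `^ (h / 2) * u (@X N t w)) t J /\
  {ae P N, forall w, @M N t w = m0 +
     tint 0 t (fun s => N%:R `^ h * alpha (@X N s w) 0 - gam (@X N s w) * @M N s w) + J w}.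
Proof.
move=> N0 t0; have [_ [_ [_ [_ [_ [_ _ _ /(_ t t0)[J iJ hJ]]]]]]] := hyp N0; exists J; split.
  rewrite (_ : (fun t w => _) = mmou_diffusion (@X N) (N%:R `^ (h / 2) *: sigma))//.
  by apply/funext => s; apply/funext => w; rewrite /mmou_diffusion dotv_indicator mxE.
apply: filterS hJ => w ->; congr (_ + _ + _); apply: tint_eq => s _.
by rewrite /mmou_drift dotv_indicator !mxE /gam mulrC [_ * gamma _ _]mulrC [alpha _ _ * _]mulrC.
Qed.

(** One version of the Ito integral for each [N] and [t], chosen separately; the versions are used
    at fixed times only. *)
Let J N (t : R) : Om N -> R :=
  if pselect ((0 < N)%N /\ 0 <= t) is left e then projT1 (cid (@noise N t e.1 e.2)) else fun=> 0.

Let JP N (t : R) : (0 < N)%N -> 0 <= t ->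
  ito_integral (P N) (@F N) (@B N) (fun t w => N%:R `^ (h / 2) * u (@X N t w)) t (@J N t) /\
  {ae P N, forall w, @M N t w = m0 +
     tint 0 t (fun s => N%:R `^ h * alpha (@X N s w) 0 - gam (@X N s w) * @M N s w) + @J N t w}.
Proof.
move=> N0 t0; rewrite /J; case: pselect => [e|]; last by case.
by case: (cid _).
Qed.

Let y0 N : (0 < N)%N -> {ae P N, forall w, @y N 0 w = cN N}.
Proof.
move=> N0; have [_ [_ [_ [_ [_ [_ _ h' _]]]]]] := hyp N0.
by apply: filterS h' => w e; rewrite /scaled_process e varrho0 mulr0 subr0.
Qed.

Let bX (v : 'I_d -> R) N (w : Om N) T : (0 < N)%N -> bmeas T (fun s => v (@X N (Num.max s 0) w)).
Proof.
move=> N0; have [_ [_ [cX _]]] := hyp N0; split.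
  have vL (s t : R) i : 0 <= s -> 0 <= t -> `|v i - v i| <= 0 * `|t - s|.
    by move=> _ _; rewrite subrr normr0 mul0r.
  exact: (joint_section_time w (joint_measurable_chain (h := fun _ i => v i) cX (lexx 0) vL)).
exists (\sum_i `|v i|) => s _; set i := X _ w.
by rewrite (bigD1 i)//= lerDl; exact: sumr_ge0.
Qed.

Let drivingE N (t : R) : (0 < N)%N -> 0 <= t -> {ae P N, forall w,
  @driving_process _ _ _ Om (@X) gam cN (@y) N t w =
  drift_scale h N * N%:R * tint 0 t (fun s => f s (@X N s w) - pav p (f s)) + N%:R `^ (- beta) * @J N t w}.
Proof.
move=> N0 t0; have [_ hJ] := JP N0 t0; apply: filterS hJ => w hM.
pose Xw (s : R) := @X N (Num.max s 0) w.
have bM := cpath_bmeas t (@cM N w N0); have br := cpath_bmeas t crho.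
have ba := @bX (fun i => alpha i 0) N w t N0; have bg := @bX gam N w t N0.
have bf (k : R) : bmeas t (fun=> k) := bmeas_cst t k.
pose nh : R := N%:R `^ h.
have eM : tint 0 t (fun s => nh * alpha (@X N s w) 0 - gam (@X N s w) * @M N s w) =
    nh * tint 0 t (fun s => alpha (Xw s) 0) - tint 0 t (fun s => gam (Xw s) * @M N (Num.max s 0) w).
  rewrite -(tintZ (lexx 0) (lexx t) _ ba) -(tintB (lexx 0) (lexx t) (bmeasZ _ ba) (bmeasM bg bM)).
  by apply: tint_eq => s /andP[s0 _]; rewrite /Xw (max_idPl s0).
have ey : tint 0 t (fun s => gam (Xw s) * @y N (Num.max s 0) w) =
    N%:R `^ (- beta) * (tint 0 t (fun s => gam (Xw s) * @M N (Num.max s 0) w) -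
       nh * tint 0 t (fun s => gam (Xw s) * rho (Num.max s 0))).
  rewrite -(tintZ (lexx 0) (lexx t) nh (bmeasM bg br)).
  rewrite -(tintB (lexx 0) (lexx t) (bmeasM bg bM) (bmeasZ _ (bmeasM bg br))).
  rewrite -(tintZ (lexx 0) (lexx t) _ (bmeasB (bmeasM bg bM) (bmeasZ _ (bmeasM bg br)))).
  by apply: tint_eq => s _; rewrite /scaled_process -/nh; ring.
have bpav : bmeas t (fun s => pav p (f (Num.max s 0))).
  rewrite (_ : (fun s => _) = (fun s => dotv p alpha - gi * rho (Num.max s 0))).
    by apply: bmeasB => //; exact: bmeasZ.
  by apply/funext => s; rewrite pav_centred_drift.
have ef : tint 0 t (fun s => f s (@X N s w) - pav p (f s)) =
    tint 0 t (fun s => alpha (Xw s) 0) - tint 0 t (fun s => gam (Xw s) * rho (Num.max s 0)) - rho t.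
  rewrite -(tintB (lexx 0) (lexx t) ba (bmeasM bg br)) -(tint_pav_drift alpha up gamma0 t0).
  rewrite (@tint_eq _ 0 t (fun s => pav p (f s)) (fun s => pav p (f (Num.max s 0)))); last first.
    by move=> s /andP[s0 _]; rewrite (max_idPl s0).
  rewrite -(tintB (lexx 0) (lexx t) (bmeasB ba (bmeasM bg br)) bpav).
  by apply: tint_eq => s /andP[s0 _]; rewrite /Xw (max_idPl s0).
rewrite /driving_process /driving ey ef drift_scaleM// -/nh /scaled_process hM eM -/nh /cN.
ring.
Qed.

Variables (a b : R) (c : R -> R).
Hypotheses (a0 : 0 <= a) (a1 : a <= 1) (b0 : 0 <= b) (b1 : b <= 1).
Hypothesis a_cvg : forall e : R, 0 < e -> evt (fun N => `|drift_scale h N ^+ 2 * N%:R - a| <= e).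
Hypothesis b_cvg : forall e : R, 0 < e -> evt (fun N => `|noise_scale h N ^+ 2 - b| <= e).
Local Notation r := (mean_rate Q p f u a b).
Hypothesis cr : forall t : R, 0 < t -> c t = Num.sqrt (r t).
Hypothesis sM2 : sde_solution P' F' B' (fun _ _ m => - gi * m) (fun t _ => c t) 0 M2.

Local Notation C := (approx_const Q p u Fb Lf).

Let B0 : 0 <= Fb. Proof. exact: drift_bound_ge0. Qed.
Let L0 : 0 <= Lf. Proof. exact: drift_lip_ge0. Qed.
Let fB (t : R) i := @drift_boundP _ _ _ _ alpha _ up gamma0 t i.
Let fL (s t : R) i := @drift_lipP _ _ _ _ alpha _ up gamma0 s t i.

Let const_le : cV Q p Fb + cU u <= C / 2 /\ lV Q p Fb Lf <= C / 2.
Proof.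
rewrite /approx_const mulrAC divff// mul1r /model_const.
have G0 : 0 <= cG Q p Fb by exact: cG_ge0.
have V0 : 0 <= cV Q p Fb by exact: cV_ge0.
have D0 := mxnorm1_ge0 (deviation_matrix Q p).
have LV0 : 0 <= lV Q p Fb Lf by exact: lV_ge0.
have LG0 : 0 <= lG Q p Lf by exact: lG_ge0.
have cu0 : 0 <= cU u by exact: cU_ge0.
move: (cG Q p Fb) (cV Q p Fb) (mxnorm1 _) (lV Q p Fb Lf) (lG Q p Lf) (cU u) G0 V0 D0 LV0 LG0 cu0.
move=> G V D LV LG cu G0 V0 D0 LV0 LG0 cu0; split; rewrite -subr_ge0.
  rewrite [leRHS](_ : _ = 1 + 1 + 72 * G ^+ 2 * (V + 1) + (2 * D * (V + cu) + D * LV + LV) + (2 * G + LG)); last by ring.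
  by nneg.
rewrite [leRHS](_ : _ = 1 + (V + 1 + cu) + 72 * G ^+ 2 * (V + 1) + (2 * D * (V + cu) + D * LV) + (2 * G + LG)); last by ring.
by nneg.
Qed.

Let C1 : 1 <= C. Proof. exact: approx_const_ge1. Qed.

Let rC (t : R) : 0 <= t -> 0 <= r t <= C.
Proof.
move=> t0; rewrite mean_rate_ge0//=; apply: le_trans (ler_norm _) _.
apply: le_trans (mean_rate_bound up u B0 fB a0 b0 t0) _.
have [h1 _] := const_le; have z0 : 0 <= cV Q p Fb + cU u by rewrite addr_ge0 ?cV_ge0 ?cU_ge0.
apply: (@le_trans _ _ (C / 2 * 2)); last by rewrite divfK.
by apply: ler_pM => //; [exact: addr_ge0|exact: (lerD a1 b1)].
Qed.

Let rL (s t : R) : 0 <= s -> 0 <= t -> `|r t - r s| <= C * `|t - s|.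
Proof.
move=> s0 t0; apply: le_trans (mean_rate_lip up u B0 L0 fB fL a0 b0 s0 t0) _.
have [_ h1] := const_le; have z0 : 0 <= lV Q p Fb Lf by exact: lV_ge0.
apply: ler_wpM2r => //; apply: (@le_trans _ _ (C / 2 * 2)); last by rewrite divfK.
by apply: ler_pM => //; [exact: addr_ge0|exact: (lerD a1 b1)].
Qed.

Let r_cvg (e : R) : 0 < e -> evt (fun N => forall t : R, 0 <= t ->
  `|mean_rate Q p f u (drift_scale h N ^+ 2 * N%:R) (noise_scale h N ^+ 2) t - r t| <= e).
Proof.
move=> e0; have C0 : 0 < C := lt_le_trans ltr01 C1.
have e1 : 0 < e / C by rewrite divr_gt0.
have [N0 hN] := evtI (a_cvg e1) (b_cvg e1); exists N0 => N /hN[ha hb] t t0.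
rewrite !(mean_rate_split _ _ _ gQ up).
set v := averaged_rate _ _ _ _ _ _; set s2 := pav _ _.
rewrite (_ : _ - _ = (drift_scale h N ^+ 2 * N%:R - a) * v + (noise_scale h N ^+ 2 - b) * s2); last by ring.
have [h1 _] := const_le.
have hv : `|v| <= C / 2 by apply: le_trans h1; exact: averaged_rate_bound.
have hs : `|s2| <= C / 2.
  apply: le_trans h1; have := mean_rate_bound up u B0 fB (lexx 0) ler01 t0.
  by rewrite (mean_rateE gQ up) mul0r add0r mul1r add0r mulr1.
apply: le_trans (ler_normD _ _) _; rewrite !normrM.
apply: (@le_trans _ _ (e / C * (C / 2) + e / C * (C / 2))); first by apply: lerD; apply: ler_pM.
by rewrite le_eqVlt; apply/orP; left; apply/eqP; field; rewrite gt_eqF.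
Qed.

Let c_cvg (e : R) : 0 < e -> evt (fun N => `|cN N| <= e).
Proof.
move=> e0; have m1 : 0 < `|m0| + 1 by rewrite ltr_wpDl.
have [N0 hN] := evt_powR (beta_gt0 h0) (divr_gt0 e0 m1); exists N0 => N /hN hh.
rewrite /cN normrM ger0_norm ?powR_ge0//.
apply: (@le_trans _ _ (e / (`|m0| + 1) * (`|m0| + 1))); last by rewrite divfK// gt_eqF.
by apply: ler_pM => //; rewrite ?powR_ge0 ?lerDl.
Qed.

Let gamB i : `|gam i| <= \sum_i `|gam i|.
Proof. by rewrite (bigD1 i)//= lerDl; exact: sumr_ge0. Qed.

(** [path_convergence] is applied to [Phi] composed with [volterra_inv]: there [W] is [volterra] of
    the scaled process and the limit is the noise of [M2], so the composition undoes itself on both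
    sides. *)
Lemma scaled_functional_cvg (Phi : (R -> R) -> R) (K : R) : (forall x, cpath x -> `|Phi x| <= K) -> uccont Phi ->
  forall e : R, 0 < e -> evt (fun N =>
    `|Ex (P N) (fun w => Phi (fun t => @y N t w)) - Ex P' (fun w => Phi (fun t => M2 t w))| <= e).
Proof.
move=> bPhi uPhi e e0.
have fF N : (0 < N)%N -> filtration (@F N) by move=> /hyp[].
have bB N : (0 < N)%N -> brownian_motion (P N) (@F N) (@B N) by move=> /hyp[_ []].
have cX N : (0 < N)%N -> markov_chain (P N) (N%:R *: Q) p0 (@X N) by move=> /hyp[_ [_ []]].
have aX N : (0 < N)%N -> adapted setT (@F N) (@X N) by move=> /hyp[_ [_ [_ []]]].
have iXB N : (0 < N)%N -> independent_processes (P N) setT (@X N) borelR (@B N) by move=> /hyp[_ [_ [_ [_ []]]]].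
have gi1 : 0 < pav p gam by rewrite giE.
have lam0 N : 0 <= drift_scale h N by exact: powR_ge0.
have hJ N (t : R) (N0 : (0 < N)%N) (t0 : 0 <= t) := (JP N0 t0).1.
pose U := @driving_process _ _ _ Om (@X) gam cN (@y).
pose W N (t : R) (w : Om N) : R := volterra (pav p gam) (fun t => @y N t w) t.
pose Th (x : R -> R) := Phi (volterra_inv (pav p gam) x).
have ThK x : cpath x -> `|Th x| <= K by move=> cx; apply: bPhi; exact: cpath_volterra_inv.
have uTh : uccont Th := uccont_volterra_inv gi1 uPhi.
have cW N (w : Om N) : (0 < N)%N -> cpath (fun t => @W N t w).
  by move=> N0; apply: cpath_volterra; exact: cpath_scaled.
have mW N (t : R) : (0 < N)%N -> 0 <= t -> measurable_fun setT (@W N t).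
  by move=> N0 t0; exact: (measurable_volterra p gam (@cpath_scaled) (@measurable_scaled) N0 t0).
have apU N H (N0 : (0 < N)%N) := driving_approximable gQ up fF bB cX aX iXB B0 L0 fB fL
  lam0 (@drift_scale_le1 _ h) (@noise_scale_le1 _ h) hJ (@cpath_scaled) (@measurable_scaled) drivingE H N0.
have mU N (t : R) (N0 : (0 < N)%N) (t0 : 0 <= t) := measurable_driving cX gam cN (@cpath_scaled) (@measurable_scaled) N0 t0.
have cU N (w : Om N) (N0 : (0 < N)%N) := @cpath_driving _ _ _ _ _ _ _ _ cX _ _ gamB cN _ (@cpath_scaled) N w N0.
have tailU (H : nat) : exists2 K : R, 0 <= K & forall N k i (x : R), (0 < N)%N -> (i < H * 2 ^ k)%N -> 0 < x ->
   (P N [set w | (x <= `|@U N (grid k i.+1) w - @U N (grid k i) w|)%R] <= (K * 4 ^- k / x ^+ 4)%:E)%E.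
  exists (tail_const Q p u Fb Lf H); first exact: tail_const_ge0.
  move=> N k i x N0 iH x0.
  exact: (driving_tail gQ up fF bB cX aX iXB B0 L0 fB fL
    lam0 (@drift_scale_le1 _ h) (@noise_scale_le1 _ h) hJ (@cpath_scaled) (@measurable_scaled) drivingE N0 iH x0).
have WU (x T : R) (x0 : 0 < x) (T0 : 0 <= T) := volterra_driving_close gQ up fF bB cX aX iXB B0 L0 fB fL gamB gi1
  lam0 (@drift_scale_le1 _ h) (@noise_scale_le1 _ h) c_cvg hJ (@cpath_scaled) (@measurable_scaled) y0 drivingE x0 T0.
have C0 : 0 <= C := le_trans ler01 C1.
have sM2' : sde_solution P' F' B' (fun _ _ m => - pav p gam * m) (fun t _ => c t) 0 M2 by rewrite giE.
have [N0 hN] := path_convergence C1 lam0 (drift_scale_small h) rC r_cvg apU cU mU tailU cW mW WU fF'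
  (smeas_limit_noise fF' sM2') (cpath_limit_noise sM2') (limit_noise0 sM2') (limit_noise_square fF' bB' C0 cr rC rL sM2')
  (limit_noise_discretization fF' bB' C0 cr rC rL sM2') ThK uTh e0.
exists (maxn 1 N0) => N; rewrite geq_max => /andP[N1 /hN].
have e1 w : Th (fun t => @W N t w) = Phi (fun t => @y N t w).
  have cyw := @cpath_scaled N w N1.
  apply: (uccont_ext uPhi (cpath_volterra_inv (cW N w N1)) cyw) => t t0.
  exact: (volterraK gi1 cyw (cW N w N1) t0).
have e2 w : Th (fun t => limit_noise (pav p gam) M2 t w) = Phi (fun t => M2 t w).
  have cyw : cpath (fun t => M2 t w) by have [_ cc _ _] := sM2; exact: cc.
  apply: (uccont_ext uPhi (cpath_volterra_inv (cpath_volterra cyw)) cyw) => t t0.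
  by apply: volterraK => //; exact: cpath_volterra.
by rewrite (Ex_eq (P N) e1) (Ex_eq P' e2).
Qed.

Lemma scaled_cvg_in_law : cvg_in_law_paths P (@y) P' M2.
Proof.
move=> Phi cPhi [K hK].
have uPhi := continuous_uccont cPhi.
have bPhi x : cpath x -> `|Phi x| <= K by exact: hK.
have iN N : (0 < N)%N -> ('E_(P N)[fun w => Phi (fun t => @y N t w)])%E = (Ex (P N) (fun w => Phi (fun t => @y N t w)))%:E.
  move=> N0; have [_ i1 _] := Ex_infc_cvg bPhi uPhi (P N) (fun w => @cpath_scaled N w N0) (fun t => @measurable_scaled N t N0).
  by rewrite (ExE i1) unlock.
have i' : ('E_P'[fun w => Phi (fun t => M2 t w)])%E = (Ex P' (fun w => Phi (fun t => M2 t w)))%:E.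
  have [aM cc _ _] := sM2.
  have mM (t : R) : 0 <= t -> measurable_fun setT (M2 t).
    by move=> t0; apply: smeas_meas (adapted_smeas fF' aM t0); exact: filtration_measurable.
  by have [_ i1 _] := Ex_infc_cvg bPhi uPhi P' cc mM; rewrite (ExE i1) unlock.
(* At [N = 0] the data are unconstrained, so finiteness of the expectation is claimed from [N = 1]
   on. *)
rewrite i'; apply/fine_cvgP; split.
  by exists 1%N => // N N1; rewrite (iN N N1).
apply/cvgrPdist_le => e e0.
have [N0 hN] := scaled_functional_cvg bPhi uPhi e0.
exists (maxn 1 N0) => // N /=; rewrite geq_max => /andP[N1 /hN].
by rewrite /= (iN N N1) distrC.
Qed.

End CoreConvergence.

Theorem corollary5p3 (R : realType) (d : nat)
  (Q : 'M[R]_d) (p p0 alpha gamma sigma : 'cV[R]_d) (h m0 : R)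
  (dO : nat -> measure_display) (Om : forall N, measurableType (dO N))
  (P : forall N, probability (Om N) R)
  (F : forall N, R -> set (set (Om N)))
  (B : forall N, R -> Om N -> R)
  (X : forall N, R -> Om N -> 'I_d)
  (M : forall N, R -> Om N -> R)
  (dO' : measure_display) (Om' : measurableType dO')
  (P' : probability Om' R) (F' : R -> set (set Om'))
  (B' : R -> Om' -> R) (M2 : R -> Om' -> R) :
  is_generator Q ->
  unique_invariant_distribution Q p ->
  (forall i, 0 < gamma i 0) ->
  0 < h ->
  (forall N, (0 < N)%N ->
    filtration (F N) /\
    brownian_motion (P N) (F N) (B N) /\
    markov_chain (P N) (N%:R *: Q) p0 (X N) /\
    adapted setT (F N) (X N) /\
    independent_processes (P N) setT (X N) borelR (B N) /\
    mmou (P N) (F N) (B N) (X N)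
      ((N%:R `^ h) *: alpha) gamma ((N%:R `^ (h / 2)) *: sigma) m0 (M N)) ->
  filtration F' ->
  brownian_motion P' F' B' ->
  let gamma_infty := dotv p gamma in
  let Mhat := fun N t w =>
    N%:R `^ (- beta_exponent h) *
    (M N t w - N%:R `^ h * varrho p alpha gamma t) in
  let V' := derive1 (Vfun Q p alpha gamma) in
  let solves_limit_sde := fun c : R -> R =>
    sde_solution P' F' B' (fun _ _ m => - gamma_infty * m) (fun t _ => c t)
      0 M2 in
  [/\ h < 1 ->
        solves_limit_sde (fun=> sigma_infty p sigma) ->
        cvg_in_law_paths P Mhat P' M2,
      h = 1 ->
        solves_limit_sde
          (fun t => Num.sqrt (sigma_infty p sigma ^+ 2 + V' t)) ->
        cvg_in_law_paths P Mhat P' M2 &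
      1 < h ->
        solves_limit_sde (fun t => Num.sqrt (V' t)) ->
        cvg_in_law_paths P Mhat P' M2].
Proof.
move=> gQ up g0 h0 hyp fF' bB' gamma_infty Mhat V' solves.
have core (a b : R) (c : R -> R) :=
  @scaled_cvg_in_law _ _ _ _ _ _ _ _ _ _ _ _ _ _ _ _ _ _ _ _ _ _ M2 gQ up g0 h0 hyp fF' bB' a b c.
have cvg_const (s : nat -> R) (l : R) : (forall N, (0 < N)%N -> s N = l) -> forall e : R, 0 < e -> evt (fun N => `|s N - l| <= e).
  by move=> sl e e0; exists 1%N => N N0; rewrite sl// subrr normr0 ltW.
have cvg_zero (s : nat -> R) : (forall N, 0 <= s N) -> (forall e : R, 0 < e -> evt (fun N => s N <= e)) ->
    forall e : R, 0 < e -> evt (fun N => `|s N - 0| <= e).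
  by move=> s0 sl e e0; have [N0 hN] := sl e e0; exists N0 => N /hN; rewrite subr0 ger0_norm.
have s0 N : 0 <= drift_scale h N ^+ 2 * N%:R by rewrite mulr_ge0 ?sqr_ge0.
have rateE (a b t : R) : mean_rate Q p (centred_drift p alpha gamma) (volatility sigma) a b t =
    a * averaged_rate Q p alpha gamma sigma t + b * sigma_infty p sigma ^+ 2.
  by rewrite (mean_rate_split _ _ _ gQ up) (sigma_inftyE _ up).
have VE (t : R) : 0 < t -> V' t = averaged_rate Q p alpha gamma sigma t by exact: Vfun_derive1.
have sig0 : 0 <= sigma_infty p sigma by exact: sqrtr_ge0.
split => [h1|h1|h1] sde.
- apply: (core 0 1 _ _ _ _ _ _ _ _ sde) => //.
  + by apply: cvg_zero => // e e0; exact: drift_scale_cvg0.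
  + by apply: cvg_const => N N0; apply: noise_scale_low => //; exact: ltW.
  by move=> t t0; rewrite rateE mul0r add0r mul1r sqrtr_sqr ger0_norm.
- apply: (core 1 1 _ _ _ _ _ _ _ _ sde) => //.
  + by apply: cvg_const => N N0; apply: drift_scale_high => //; rewrite h1.
  + by apply: cvg_const => N N0; apply: noise_scale_low => //; rewrite h1.
  by move=> t t0; rewrite rateE !mul1r VE// addrC.
apply: (core 1 0 _ _ _ _ _ _ _ _ sde) => //.
- by apply: cvg_const => N N0; apply: drift_scale_high => //; exact: ltW.
- by apply: cvg_zero => // [N|e e0]; [exact: sqr_ge0|exact: noise_scale_cvg0].
by move=> t t0; rewrite rateE mul0r addr0 mul1r VE.
Qed.
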